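(* Let $n\ge 2$, let $r_1,\dots,r_n\in\mathbb{R}^3$ be constant known inertial vectors at least two of which are not collinear, and assume the vector measurements $b_i=\mathcal{R}(Q)^Tr_i$, $i=1,\dots,n$, are available. Consider the rigid body system $$\dot Q=\tfrac12 Q\odot\bar\omega,\qquad J\dot\omega=\tau-S(\omega)J\omega,$$ under the control law $\tau=z_\gamma+z_\rho$, together with the auxiliary system $\dot{\hat Q}=\tfrac12\hat Q\odot\bar\beta$, $\hat Q(0)\in\mathbb{S}^3$ arbitrary, with input $\beta=-z_\gamma$, where $z_\gamma=\sum_{i=1}^n\gamma_iS(\hat b_i)b_i$, $z_\rho=\sum_{i=1}^n\rho_iS(r_i)b_i$, $\hat b_i=\mathcal{R}(\hat Q)^Tr_i$, and $\gamma_i>0$, $\rho_i>0$. Let $W_\gamma=-\sum_{i=1}^n\gamma_iS(r_i)^2$ and $W_\rho=-\sum_{i=1}^n\rho_iS(r_i)^2$. Let $\tilde Q=(\tilde q_0,\tilde q^T)^T=Q\odot\hat Q^{-1}$, and let $\chi=(\tilde q,q,\omega)$ be the state of the resulting closed-loop system $$\dot{\tilde q}=\tfrac12(\tilde q_0I_3+S(\tilde q))\hat R(\omega+z_\gamma),\qquad \dot q=\tfrac12(q_0I_3+S(q))\omega,\qquad J\dot\omega=-S(\omega)J\omega+z_\gamma+z_\rho,$$ where $\hat R=\mathcal{R}(\hat Q)=\mathcal{R}(\tilde Q)^T\mathcal{R}(Q)$, on the state space $\Upsilon=D\times D\times\mathbb{R}^3$, $D=\{x\in\mathbb{R}^3:\|x\|\le1\}$.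 Then: 1) The equilibria of the closed-loop system are given by $\Omega_1=(0,0,0)$, $\Omega_2=(v_\gamma,0,0)$, $\Omega_3=(v_\gamma,v_\rho,0)$ and $\Omega_4=(0,v_\rho,0)$, where $v_\gamma$ and $v_\rho$ denote, respectively, the unit eigenvectors of $W_\gamma$ and of $W_\rho$ (so $\Omega_2,\Omega_3,\Omega_4$ each stand for the set of all points obtained as $v_\gamma$, $v_\rho$ range over all such eigenvectors). 2) The equilibrium point $\Omega_1$ is asymptotically stable, with domain of attraction containing the domain $$\Phi_1=\{\chi\in\Upsilon:\chi^TP\chi\le c\},$$ where $P=\mathrm{diag}(2W_\gamma,2W_\rho,\tfrac12J)$ (block diagonal), $c<2\min\{\lambda_{\min}(W_\gamma),\lambda_{\min}(W_\rho)\}$, and $\lambda_{\min}(\cdot)$ denotes the minimum eigenvalue. 3) There exist $k_\rho>0$ and $k_\gamma>0$ such that if $\lambda_{\min}(W_\rho)>k_\rho$ and $\lambda_{\min}(W_\gamma)>k_\gamma$, then $\Omega_2$, $\Omega_3$ and $\Omega_4$ are unstable, and $\Omega_1$ is almost globally asymptotically stable.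
   Context: $I_3$ is the $3\times3$ identity matrix. For $x\in\mathbb{R}^3$, $S(x)$ is the skew-symmetric matrix with $S(x)y=x\times y$ for all $y\in\mathbb{R}^3$. $\mathbb{S}^3$ is the set of unit quaternions $Q=(q_0,q^T)^T$, $q_0\in\mathbb{R}$, $q\in\mathbb{R}^3$, $q_0^2+q^Tq=1$. Quaternion multiplication is $P\odot Q=(p_0q_0-p^Tq,\ (p_0q+q_0p+p\times q)^T)^T$, with inverse $Q^{-1}=(q_0,-q^T)^T$ for unit quaternions; for $x\in\mathbb{R}^3$, $\bar x=(0,x^T)^T$. The map $\mathcal{R}:\mathbb{S}^3\to SO(3)$ is $\mathcal{R}(Q)=I_3+2q_0S(q)+2S(q)^2$. $Q=(q_0,q^T)^T\in\mathbb{S}^3$ represents the attitude of the rigid body (rotation matrix $R=\mathcal{R}(Q)$), $\omega\in\mathbb{R}^3$ is its angular velocity in the body frame, $\tau\in\mathbb{R}^3$ the control torque, and $J\in\mathbb{R}^{3\times3}$ the constant symmetric positive definite inertia matrix. In terms of the closed-loop variables, $z_\gamma=-2\mathcal{R}(Q)^T\mathcal{R}(\tilde Q)(\tilde q_0I_3-S(\tilde q))W_\gamma\tilde q$ and $z_\rho=-2(q_0I_3-S(q))W_\rho q$, so the closed-loop system is autonomous. Equilibria and states are described by the vector parts $\tilde q,q$ of the unit quaternions $\tilde Q,Q$ (and $\omega$); the scalar parts are related to the vector parts by $\tilde q_0^2=1-\tilde q^T\tilde q$ and $q_0^2=1-q^Tq$ (so a zero vector part corresponds to scalar part $\pm1$,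 both representing the same rotation $I_3$, and a unit vector part corresponds to scalar part $0$). Definition: an equilibrium point $x^*$ of a dynamical system is almost globally asymptotically stable if it is stable and all trajectories starting in some open dense subset of the state space converge to $x^*$. *)

(* Defs.v *)
From HB Require Import structures.
From mathcomp Require Import all_boot all_order all_algebra.
From mathcomp Require Import all_classical all_reals all_analysis.

Set Implicit Arguments.
Unset Strict Implicit.
Unset Printing Implicit Defensive.

Import Order.TTheory GRing.Theory Num.Theory.
Import numFieldNormedType.Exports.

Local Open Scope classical_set_scope.
Local Open Scope ring_scope.

(* Vectors of R^3 are columns 'cV[R]_3 and a quaternion (q_0, q^T)^T is a
   column 'cV[R]_(1 + 3) split by usubmx / dsubmx.  The library norm and
   topology on 'M[R]_(m, n) are those of the max norm, equivalent to the
   Euclidean ones; the Euclidean length is always written through dotv. *)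

Definition dotv (R : realType) (m : nat) (x y : 'cV[R]_m) : R :=
  (x^T *m y) 0 0.

Definition crossmx (R : realType) (x : 'cV[R]_3) : 'M[R]_3 :=
  let x1 := x 0 0 in let x2 := x 1 0 in let x3 := x 2%:R 0 in
  \matrix_(i < 3, j < 3)
    nth 0 (nth [::] [:: [::   0; - x3;   x2];
                        [::  x3;    0; - x1];
                        [:: - x2;  x1;    0]] i) j.

(* linear dependence: the zero vector is collinear with every vector *)
Definition collinear (R : realType) (x y : 'cV[R]_3) : Prop :=
  exists a b : R, (a != 0 \/ b != 0) /\ a *: x + b *: y = 0.

Definition sym_posdef (R : realType) (A : 'M[R]_3) : Prop :=
  A^T = A /\ forall x : 'cV[R]_3, x != 0 -> 0 < dotv x (A *m x).

(* For a symmetric matrix the set of (real) eigenvalues is finite and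
   nonempty, so this infimum is a minimum. *)
Definition lambda_min (R : realType) (A : 'M[R]_3) : R :=
  inf [set a : R | eigenvalue A a].

Definition unit_eigenvectors (R : realType) (A : 'M[R]_3) : set 'cV[R]_3 :=
  [set v | dotv v v = 1 /\ exists a : R, A *m v = a *: v].

Definition quat (R : realType) := 'cV[R]_(1 + 3).

Definition mkquat (R : realType) (a : R) (v : 'cV[R]_3) : quat R :=
  col_mx (a%:M : 'cV[R]_1) v.

Definition qscal (R : realType) (Q : quat R) : R := usubmx Q 0 0.
Definition qvec (R : realType) (Q : quat R) : 'cV[R]_3 := dsubmx Q.

Definition qmul (R : realType) (P Q : quat R) : quat R :=
  mkquat (qscal P * qscal Q - dotv (qvec P) (qvec Q))
         (qscal P *: qvec Q + qscal Q *: qvec P + crossmx (qvec P) *m qvec Q).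

(* the inverse for unit quaternions *)
Definition qinv (R : realType) (Q : quat R) : quat R :=
  mkquat (qscal Q) (- qvec Q).

Definition qbar (R : realType) (x : 'cV[R]_3) : quat R := mkquat 0 x.

Definition unit_quat (R : realType) : set (quat R) :=
  [set Q | qscal Q ^+ 2 + dotv (qvec Q) (qvec Q) = 1].

Definition rotmx (R : realType) (Q : quat R) : 'M[R]_3 :=
  1%:M + (2%:R * qscal Q) *: crossmx (qvec Q)
       + 2%:R *: (crossmx (qvec Q) *m crossmx (qvec Q)).

Definition Wmx (R : realType) (n : nat) (r : 'I_n -> 'cV[R]_3)
    (g : 'I_n -> R) : 'M[R]_3 :=
  - \sum_(i < n) g i *: (crossmx (r i) *m crossmx (r i)).

Section Systems.
Variable R : realType.

Definition body_meas (n : nat) (r : 'I_n -> 'cV[R]_3) (Q : quat R) (i : 'I_n) :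
    'cV[R]_3 :=
  (rotmx Q)^T *m r i.

Definition z_gamma (n : nat) (r : 'I_n -> 'cV[R]_3) (gamma : 'I_n -> R)
    (Q Qhat : quat R) : 'cV[R]_3 :=
  \sum_(i < n) gamma i *: (crossmx (body_meas r Qhat i) *m body_meas r Q i).

Definition z_rho (n : nat) (r : 'I_n -> 'cV[R]_3) (rho : 'I_n -> R)
    (Q : quat R) : 'cV[R]_3 :=
  \sum_(i < n) rho i *: (crossmx (r i) *m body_meas r Q i).

(* Solutions on [0, +oo[ are functions on R constrained at t >= 0 only.
   Two-sided differentiability at 0 costs nothing: a solution that is only
   right-differentiable at 0 extends linearly to t < 0. *)

(* rigid body, auxiliary system and feedback
   tau = z_gamma + z_rho, beta = - z_gamma *)
Definition attitude_system (n : nat) (r : 'I_n -> 'cV[R]_3) (J : 'M[R]_3)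
    (gamma rho : 'I_n -> R) (Q Qhat : R -> quat R) (omega : R -> 'cV[R]_3) :
    Prop :=
  forall t : R, 0 <= t ->
    let zg := z_gamma r gamma (Q t) (Qhat t) in
    let zr := z_rho r rho (Q t) in
    let tau := zg + zr in
    let beta := - zg in
    [/\ unit_quat (Q t) /\ unit_quat (Qhat t),
        is_derive t 1 Q (2%:R^-1 *: qmul (Q t) (qbar (omega t))),
        is_derive t 1 Qhat (2%:R^-1 *: qmul (Qhat t) (qbar beta)) &
        exists2 domega : 'cV[R]_3, is_derive t 1 omega domega &
          J *m domega = tau - crossmx (omega t) *m (J *m omega t)].

(* The closed-loop state, with the scalar parts kept: (Qtilde, Q, omega). *)
Definition cl_state := (quat R * quat R * 'cV[R]_3)%type.

Definition admissible : set cl_state :=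
  [set s | unit_quat s.1.1 /\ unit_quat s.1.2].

Definition chi (s : cl_state) : 'cV[R]_(3 + 3 + 3) :=
  col_mx (col_mx (qvec s.1.1) (qvec s.1.2)) s.2.

(* The vector parts alone do not determine the signs of the scalar parts, so
   the closed loop is posed on (Qtilde, Q, omega), i.e. the equations for
   (qtilde, q, omega) are completed by the scalar rows of the quaternion
   kinematics.  Without the latter, q_0 = 0 with omega parallel to q would be
   a spurious rest point of the q-equation. *)
Definition closed_loop (J Wg Wr : 'M[R]_3) : set (R -> cl_state) :=
  [set s | forall t : R, 0 <= t ->
    let q0t := qscal (s t).1.1 in let qt := qvec (s t).1.1 in
    let q0 := qscal (s t).1.2 in let q := qvec (s t).1.2 in
    let om := (s t).2 in
    let Rhat := (rotmx (s t).1.1)^T *m rotmx (s t).1.2 in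
    let zg := - (2%:R *: ((rotmx (s t).1.2)^T *m rotmx (s t).1.1
                            *m (q0t%:M - crossmx qt) *m Wg *m qt)) in
    let zr := - (2%:R *: ((q0%:M - crossmx q) *m Wr *m q)) in
    [/\ admissible (s t),
        is_derive t 1 (fun u => qvec (s u).1.1)
          (2%:R^-1 *: ((q0t%:M + crossmx qt) *m (Rhat *m (om + zg)))) /\
        is_derive t 1 (fun u => qscal (s u).1.1)
          (- (2%:R^-1 * dotv qt (Rhat *m (om + zg)))),
        is_derive t 1 (fun u => qvec (s u).1.2)
          (2%:R^-1 *: ((q0%:M + crossmx q) *m om)) /\
        is_derive t 1 (fun u => qscal (s u).1.2)
          (- (2%:R^-1 * dotv q om)) &
        exists2 dom : 'cV[R]_3, is_derive t 1 (fun u => (s u).2) dom &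
          J *m dom = - (crossmx om *m (J *m om)) + zg + zr]].

(* rest point: the constant trajectory is a solution *)
Definition equilibrium (traj : set (R -> cl_state)) (s : cl_state) : Prop :=
  traj (fun=> s).

Definition Omega1 : 'cV[R]_(3 + 3 + 3) := 0.

Definition Omega2 (Wg : 'M[R]_3) : set 'cV[R]_(3 + 3 + 3) :=
  [set col_mx (col_mx vg 0) 0 | vg in unit_eigenvectors Wg].

Definition Omega3 (Wg Wr : 'M[R]_3) : set 'cV[R]_(3 + 3 + 3) :=
  [set x | exists vg vr, [/\ unit_eigenvectors Wg vg,
     unit_eigenvectors Wr vr & x = col_mx (col_mx vg vr) 0]].

Definition Omega4 (Wr : 'M[R]_3) : set 'cV[R]_(3 + 3 + 3) :=
  [set col_mx (col_mx 0 vr) 0 | vr in unit_eigenvectors Wr].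

Definition unit_ball3 : set 'cV[R]_3 := [set x | dotv x x <= 1].

Definition Upsilon : set 'cV[R]_(3 + 3 + 3) :=
  [set x | unit_ball3 (usubmx (usubmx x)) /\ unit_ball3 (dsubmx (usubmx x))].

Definition Pmx (J Wg Wr : 'M[R]_3) : 'M[R]_(3 + 3 + 3) :=
  block_mx (block_mx (2%:R *: Wg) 0 0 (2%:R *: Wr)) 0 0 (2%:R^-1 *: J).

Definition Phi1 (J Wg Wr : 'M[R]_3) (c : R) : set 'cV[R]_(3 + 3 + 3) :=
  [set x | Upsilon x /\ dotv x (Pmx J Wg Wr *m x) <= c].

Definition lyapunov_stable (traj : set (R -> cl_state)) (xe : 'cV[R]_(3 + 3 + 3)) :
    Prop :=
  forall eps : R, 0 < eps -> exists2 delta : R, 0 < delta &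
    forall s, traj s -> `|chi (s 0) - xe| < delta ->
    forall t : R, 0 <= t -> `|chi (s t) - xe| < eps.

Definition lyapunov_unstable (traj : set (R -> cl_state)) (xe : 'cV[R]_(3 + 3 + 3)) :
    Prop :=
  ~ lyapunov_stable traj xe.

(* Whatever the signs of the scalar parts, trajectories from x0 exist for all
   t >= 0 and converge to xe. *)
Definition attraction_domain (traj : set (R -> cl_state))
    (xe : 'cV[R]_(3 + 3 + 3)) : set 'cV[R]_(3 + 3 + 3) :=
  [set x0 | Upsilon x0 /\ forall s0, admissible s0 -> chi s0 = x0 ->
     (exists2 s, traj s & s 0 = s0) /\
     (forall s, traj s -> s 0 = s0 -> chi (s t) @[t --> +oo] --> xe)].

Definition asymptotically_stable (traj : set (R -> cl_state))
    (xe : 'cV[R]_(3 + 3 + 3)) : Prop :=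
  lyapunov_stable traj xe /\
  exists2 delta : R, 0 < delta & forall x0, Upsilon x0 -> `|x0 - xe| < delta ->
    attraction_domain traj xe x0.

Definition open_dense_in_Upsilon (U : set 'cV[R]_(3 + 3 + 3)) : Prop :=
  (exists2 V : set 'cV[R]_(3 + 3 + 3), open V & U = Upsilon `&` V) /\
  Upsilon `<=` closure U.

Definition almost_globally_asymptotically_stable
    (traj : set (R -> cl_state)) (xe : 'cV[R]_(3 + 3 + 3)) : Prop :=
  lyapunov_stable traj xe /\
  exists2 U, open_dense_in_Upsilon U & U `<=` attraction_domain traj xe.

End Systems.

(* Main.v *)
Require Import Defs.
From HB Require Import structures.
From mathcomp Require Import all_boot all_order all_algebra.
From mathcomp Require Import all_classical all_reals all_analysis.
From mathcomp Require Import ring lra zify.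
Set Implicit Arguments.
Unset Strict Implicit.
Unset Printing Implicit Defensive.

Import Order.TTheory GRing.Theory Num.Theory.
Import numFieldNormedType.Exports.
Local Open Scope classical_set_scope.
Local Open Scope ring_scope.

(** Write T for the error quaternion and Q for the attitude, and let B and A be
    the quadratic forms diag (0, W_gamma) and diag (0, W_rho) on quaternions. The
    torques are gradients: the closed loop is a rigid body in the potential
    2 T . B T + 2 Q . A Q, in which T is carried along by the rotation of the body
    and moreover descends the gradient of its potential on the sphere
    (closed_loopP). The energy is the quadratic form of the matrix P, and it is
    lost at the rate |z_gamma|^2 (energy_derivative). A constant solution has no
    rotation, and each of the two quaternions is critical for its potential, hence
    a pole or an eigenvector (equilibrium_classes).

    Energy converges along every motion, so z_gamma tends to 0 by Barbalat, and T
    approaches one eigenspace of B (error_eigenspace_limit). If it is a line then T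
    converges, whence the angular velocity tends to 0, whence z_rho tends to 0, and
    Q approaches an eigenspace of A (simple_limit). The eigenvalue 0 is simple for
    both forms and stands for the origin. The others are at least the smallest
    eigenvalue of W_gamma or W_rho, so below the corresponding energy the only
    possible limit is the origin (low_energy_good); with the energy as a Lyapunov
    function this gives the second part.

    The third part follows once the set of states attracted by the origin is open
    and dense: arbitrarily close to any other equilibrium there are motions that
    leave it for the origin (other_unstable). Openness is continuous dependence.
    For density, a motion that does not converge to the origin eventually stays
    either near the eigenspace of a repeated eigenvalue of B, or near rest points
    whose error is an isolated eigenvector, finitely many closed conditions in all
    (bad_classes). By the Baire theorem it is enough that no open set of motions
    stays there for all times (good_dense).

    Near rest points with an isolated error the attitude may still lie on a
    continuum of rest points, so that hyperbolicity is not available. Instead, two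
    motions are compared: a quadratic form in their difference, minus the energy of
    the difference corrected by small cross terms, grows exponentially where it is
    positive, as long as both motions stay near the rest points (persistent_pair).
    It is bounded, hence it cannot be positive; but moving the initial attitude or
    error a little towards the pole makes it positive (no_persistent_near).

    Near the eigenspace of a repeated eigenvalue of B the argument is recurrence.
    W_gamma is a matrix of inertia type, so by the triangle inequality of its
    eigenvalues a repeated one is at least a quarter c of the trace of B. Replace T
    by rho T with rho' = (c - T . B T) rho: the extended system is divergence free
    (frame_field_shear, extended_orbit), and near the eigenspace the growth of rho
    is dominated by the dissipation, whose integral is finite (compression_le). So
    an open set of motions that stay there would form a bounded volume-preserving
    flow, and some motion would return close to its initial state, which the loss
    of energy excludes (no_persistent_repeated). Recurrence is proved without
    measure theory: in suitable coordinates no component of the field depends on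
    its own coordinate, so coordinatewise Euler steps rounded to a lattice permute
    the lattice, and the pigeonhole principle applies (lattice_recurrence). *)

(** * Calculus along curves and Euclidean geometry *)

Section Calculus.
Variable R : realType.
Implicit Types (f g df dg : R -> R) (t u a b : R).

Lemma is_derive_mxP m n (F : R -> 'M[R]_(m, n)) t (dF : 'M[R]_(m, n)) :
  is_derive t 1 F dF <->
  forall i j, is_derive t 1 (fun u => F u i j) (dF i j).
Proof.
split=> [[dvF eF] i j|dF_].
  split; first by move/derivable_mxP : dvF; exact.
  by move: eF; rewrite derive_mx// => <-; rewrite mxE.
have dvF : derivable F t 1.
  by apply/derivable_mxP => i j; have [] := dF_ i j.
split=> //; rewrite derive_mx//; apply/matrixP => i j; rewrite mxE.
by have [] := dF_ i j.
Qed.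

Lemma is_derive_continuous (V : normedModType R) (F : R -> V) t dF :
  is_derive t 1 F dF -> {for t, continuous F}.
Proof. by case=> dv _; apply: differentiable_continuous; exact/derivable1_diffP. Qed.

Lemma is_derive_ext (V : normedModType R) (F G : R -> V) t dF :
  F =1 G -> is_derive t 1 F dF -> is_derive t 1 G dF.
Proof. by move=> /funext ->. Qed.

(** Time reversal, for running orbits backwards. *)
Lemma is_derive_comp_opp (V : normedModType R) (F : R -> V) t dF :
  is_derive (- t) 1 F dF -> is_derive t 1 (fun u => F (- u)) (- dF).
Proof.
move=> [dv ev].
have dN : is_derive t (1 : R) (-%R : R -> R) (- 1) by exact: is_deriveNid.
have [df1 df2] : derivable (F \o -%R) t 1 /\ 'D_1 (F \o -%R) t = - dF.
  have dvd : differentiable F (- t) by exact/derivable1_diffP.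
  have dNd : differentiable (-%R : R -> R) t by apply/derivable1_diffP; case: dN.
  have dc : differentiable (F \o -%R) t by exact: differentiable_comp.
  split; first exact/derivable1_diffP.
  rewrite deriveE// diff_comp//=.
  have -> : 'd (-%R : R -> R) t 1 = - 1 by rewrite -deriveE//; case: dN.
  by rewrite linearN -deriveE// ev.
by split.
Qed.

Lemma mean_value f df a b : a <= b ->
  (forall x, a <= x <= b -> is_derive x 1 f (df x)) ->
  exists2 c, a <= c <= b & f b - f a = df c * (b - a).
Proof.
move=> ab dfx.
have [||c cab e] := @MVT_segment R f df a b ab.
- by move=> x; rewrite in_itv/= => /andP[ax xb]; apply: dfx; rewrite !ltW.
- apply: continuous_in_subspaceT => x; rewrite inE/= in_itv/= => xab.
  exact: is_derive_continuous (dfx _ xab).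
by exists c => //; move: cab; rewrite in_itv.
Qed.

Lemma deriv_le0_nincr f df a b : a <= b ->
  (forall x, a <= x <= b -> is_derive x 1 f (df x)) ->
  (forall x, a <= x <= b -> df x <= 0) -> f b <= f a.
Proof.
move=> ab d1 d2; have [c cab e] := mean_value ab d1.
by rewrite -subr_le0 e mulr_le0_ge0 ?subr_ge0 ?d2.
Qed.

Lemma deriv_eq0_cst f a b : a <= b ->
  (forall x, a <= x <= b -> is_derive x 1 f 0) -> f b = f a.
Proof.
move=> ab d1; have [c cab e] := @mean_value f (fun=> 0) a b ab d1.
by apply/eqP; rewrite -subr_eq0 e mul0r.
Qed.

(** The sum, product and scaling rules are restated for functions written pointwise,
    so that they apply to composite expressions without unfolding the operations on
    functions. *)
Lemma derD (V : normedModType R) (F G : R -> V) t dF dG :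
  is_derive t 1 F dF -> is_derive t 1 G dG ->
  is_derive t 1 (fun u => F u + G u) (dF + dG).
Proof. by move=> ? ?; exact: is_deriveD. Qed.

Lemma derB (V : normedModType R) (F G : R -> V) t dF dG :
  is_derive t 1 F dF -> is_derive t 1 G dG ->
  is_derive t 1 (fun u => F u - G u) (dF - dG).
Proof. by move=> ? ?; exact: is_deriveB. Qed.

Lemma derN (V : normedModType R) (F : R -> V) t dF :
  is_derive t 1 F dF -> is_derive t 1 (fun u => - F u) (- dF).
Proof. by move=> ?; exact: is_deriveN. Qed.

Lemma derZ (V : normedModType R) (F : R -> V) t dF (k : R) :
  is_derive t 1 F dF -> is_derive t 1 (fun u => k *: F u) (k *: dF).
Proof. by move=> ?; exact: is_deriveZ. Qed.

Lemma derM f g t (df dg : R) :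
  is_derive t 1 f df -> is_derive t 1 g dg ->
  is_derive t 1 (fun u => f u * g u) (df * g t + f t * dg).
Proof.
move=> h1 h2.
have -> : df * g t + f t * dg = f t *: dg + g t *: df.
  by rewrite /GRing.scale/= addrC [df * _]mulrC.
exact: is_deriveM.
Qed.

Lemma der_cst (V : normedModType R) t (c : V) : is_derive t 1 (fun=> c) 0.
Proof. exact: is_derive_cst. Qed.

Lemma der_eq (V : normedModType R) (F : R -> V) t dF dF' :
  dF = dF' -> is_derive t 1 F dF -> is_derive t 1 F dF'.
Proof. by move=> ->. Qed.

Lemma der_sum (I : Type) (s : seq I) (F : I -> R -> R) t (dF : I -> R) :
  (forall i, is_derive t 1 (F i) (dF i)) ->
  is_derive t 1 (fun u => \sum_(i <- s) F i u) (\sum_(i <- s) dF i).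
Proof.
move=> dF_; elim: s => [|i s IH].
  rewrite big_nil; apply: is_derive_ext (der_cst t 0) => u; by rewrite big_nil.
rewrite big_cons; apply: is_derive_ext (derD (dF_ i) IH) => u.
by rewrite big_cons.
Qed.

Lemma der_mulmx m n p (F : R -> 'M[R]_(m, n)) (G : R -> 'M[R]_(n, p)) t dF dG :
  is_derive t 1 F dF -> is_derive t 1 G dG ->
  is_derive t 1 (fun u => F u *m G u) (dF *m G t + F t *m dG).
Proof.
move=> /is_derive_mxP dF_ /is_derive_mxP dG_; apply/is_derive_mxP => i j.
have h k : is_derive t 1 (fun u => F u i k * G u k j)
    (dF i k * G t k j + F t i k * dG k j) by exact: derM.
rewrite !mxE -big_split/=; apply: is_derive_ext (der_sum _ h) => u.
by rewrite mxE.
Qed.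

Lemma der_mulmxl m n p (A : 'M[R]_(m, n)) (G : R -> 'M[R]_(n, p)) t dG :
  is_derive t 1 G dG -> is_derive t 1 (fun u => A *m G u) (A *m dG).
Proof.
move=> h; apply: der_eq (der_mulmx (der_cst t A) h).
by rewrite mul0mx add0r.
Qed.

Lemma der_trmx m n (F : R -> 'M[R]_(m, n)) t dF :
  is_derive t 1 F dF -> is_derive t 1 (fun u => (F u)^T) (dF^T).
Proof.
move=> /is_derive_mxP dF_; apply/is_derive_mxP => i j; rewrite mxE.
by apply: is_derive_ext (dF_ j i) => u; rewrite mxE.
Qed.

Lemma der_scale m n f (F : R -> 'M[R]_(m, n)) t (df : R) dF :
  is_derive t 1 f df -> is_derive t 1 F dF ->
  is_derive t 1 (fun u => f u *: F u) (df *: F t + f t *: dF).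
Proof.
move=> hf /is_derive_mxP dF_; apply/is_derive_mxP => i j; rewrite !mxE.
by apply: is_derive_ext (derM hf (dF_ i j)) => u; rewrite !mxE.
Qed.

Lemma der_usubmx m1 m2 n (F : R -> 'M[R]_(m1 + m2, n)) t dF :
  is_derive t 1 F dF -> is_derive t 1 (fun u => usubmx (F u)) (usubmx dF).
Proof.
move=> /is_derive_mxP dF_; apply/is_derive_mxP => i j; rewrite mxE.
by apply: is_derive_ext (dF_ _ j) => u; rewrite mxE.
Qed.

Lemma der_dsubmx m1 m2 n (F : R -> 'M[R]_(m1 + m2, n)) t dF :
  is_derive t 1 F dF -> is_derive t 1 (fun u => dsubmx (F u)) (dsubmx dF).
Proof.
move=> /is_derive_mxP dF_; apply/is_derive_mxP => i j; rewrite mxE.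
by apply: is_derive_ext (dF_ _ j) => u; rewrite mxE.
Qed.

Lemma der_col_mx m1 m2 n (F : R -> 'M[R]_(m1, n)) (G : R -> 'M[R]_(m2, n)) t dF dG :
  is_derive t 1 F dF -> is_derive t 1 G dG ->
  is_derive t 1 (fun u => col_mx (F u) (G u)) (col_mx dF dG).
Proof.
move=> /is_derive_mxP dF_ /is_derive_mxP dG_; apply/is_derive_mxP => i j.
rewrite mxE; case: (split_ordP i) => k ik.
  apply: is_derive_ext (dF_ k j) => u.
  by rewrite ik col_mxEu.
by apply: is_derive_ext (dG_ k j) => u; rewrite ik col_mxEd.
Qed.

Lemma dotvE m (x y : 'cV[R]_m) : dotv x y = \sum_i x i 0 * y i 0.
Proof. by rewrite /dotv mxE; apply: eq_bigr => i _; rewrite mxE. Qed.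

Lemma der_dotv m (F G : R -> 'cV[R]_m) t dF dG :
  is_derive t 1 F dF -> is_derive t 1 G dG ->
  is_derive t 1 (fun u => dotv (F u) (G u)) (dotv dF (G t) + dotv (F t) dG).
Proof.
move=> hF hG; have /is_derive_mxP/(_ 0 0) h := der_mulmx (der_trmx hF) hG.
by move: h; rewrite mxE.
Qed.

End Calculus.

Section Euclid.
Variable R : realType.
Implicit Types (m : nat).

Lemma dotvC m (x y : 'cV[R]_m) : dotv x y = dotv y x.
Proof. by rewrite !dotvE; apply: eq_bigr => i _; rewrite mulrC. Qed.

Lemma dotvDl m (x y z : 'cV[R]_m) : dotv (x + y) z = dotv x z + dotv y z.
Proof. by rewrite /dotv raddfD/= mulmxDl mxE. Qed.

Lemma dotvDr m (x y z : 'cV[R]_m) : dotv z (x + y) = dotv z x + dotv z y.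
Proof. by rewrite /dotv mulmxDr mxE. Qed.

Lemma dotvNl m (x z : 'cV[R]_m) : dotv (- x) z = - dotv x z.
Proof. by rewrite /dotv raddfN/= mulNmx mxE. Qed.

Lemma dotvNr m (x z : 'cV[R]_m) : dotv z (- x) = - dotv z x.
Proof. by rewrite /dotv mulmxN mxE. Qed.

Lemma dotvBl m (x y z : 'cV[R]_m) : dotv (x - y) z = dotv x z - dotv y z.
Proof. by rewrite dotvDl dotvNl. Qed.

Lemma dotvBr m (x y z : 'cV[R]_m) : dotv z (x - y) = dotv z x - dotv z y.
Proof. by rewrite dotvDr dotvNr. Qed.

Lemma dotvZl m k (x z : 'cV[R]_m) : dotv (k *: x) z = k * dotv x z.
Proof. by rewrite /dotv linearZ/= -scalemxAl mxE. Qed.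

Lemma dotvZr m k (x z : 'cV[R]_m) : dotv z (k *: x) = k * dotv z x.
Proof. by rewrite /dotv -scalemxAr mxE. Qed.

Lemma dotv0l m (x : 'cV[R]_m) : dotv 0 x = 0.
Proof. by rewrite /dotv trmx0 mul0mx mxE. Qed.

Lemma dotv0r m (x : 'cV[R]_m) : dotv x 0 = 0.
Proof. by rewrite /dotv mulmx0 mxE. Qed.

Lemma dotv_mulr m n (A : 'M[R]_(m, n)) x y : dotv x (A *m y) = dotv (A^T *m x) y.
Proof. by rewrite /dotv trmx_mul trmxK mulmxA. Qed.

Lemma dotv_mull m n (A : 'M[R]_(m, n)) x y : dotv (A *m y) x = dotv y (A^T *m x).
Proof. by rewrite dotvC dotv_mulr dotvC. Qed.

Lemma dotv_suml m (I : Type) (s : seq I) (F : I -> 'cV[R]_m) y :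
  dotv (\sum_(i <- s) F i) y = \sum_(i <- s) dotv (F i) y.
Proof.
by elim: s => [|i s IH]; rewrite ?big_nil ?dotv0l// !big_cons dotvDl IH.
Qed.

Lemma dotv_sumr m (I : Type) (s : seq I) (F : I -> 'cV[R]_m) y :
  dotv y (\sum_(i <- s) F i) = \sum_(i <- s) dotv y (F i).
Proof. by rewrite dotvC dotv_suml; apply: eq_bigr => i _; rewrite dotvC. Qed.

Lemma dotv_ge0 m (x : 'cV[R]_m) : 0 <= dotv x x.
Proof. by rewrite dotvE sumr_ge0// => i _; rewrite -expr2 sqr_ge0. Qed.

Lemma dotv_eq0 m (x : 'cV[R]_m) : (dotv x x == 0) = (x == 0).
Proof.
apply/idP/idP => [|/eqP ->]; last by rewrite dotv0l.
rewrite dotvE psumr_eq0 => [|i _]; last by rewrite -expr2 sqr_ge0.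
move=> /allP h; apply/eqP/matrixP => i j; rewrite ord1 mxE.
have := h i; rewrite mem_index_enum => /(_ isT)/=.
by rewrite mulf_eq0 orbb => /eqP.
Qed.

Lemma dotv_gt0 m (x : 'cV[R]_m) : (0 < dotv x x) = (x != 0).
Proof. by rewrite lt_neqAle dotv_ge0 andbT eq_sym dotv_eq0. Qed.

Lemma dotv_CS m (x y : 'cV[R]_m) : dotv x y ^+ 2 <= dotv x x * dotv y y.
Proof.
have [->|y0] := eqVneq y 0; first by rewrite !dotv0r mulr0 expr0n.
have y1 : 0 < dotv y y by rewrite dotv_gt0.
have := dotv_ge0 (dotv y y *: x - dotv x y *: y).
rewrite !(dotvBl, dotvBr, dotvZl, dotvZr) (dotvC y x) => h.
rewrite -subr_ge0 -(pmulr_rge0 _ y1).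
by apply: le_trans h _; rewrite le_eqVlt; apply/orP; left; apply/eqP; ring.
Qed.

Lemma dotv_young m (u v : 'cV[R]_m) : 2 * `|dotv u v| <= dotv u u + dotv v v.
Proof.
have := dotv_ge0 (u - v); have := dotv_ge0 (u + v).
rewrite !(dotvDl, dotvDr, dotvNl, dotvNr) opprK [dotv v u]dotvC => h1 h2.
by have [_|_] := ger0P (dotv u v); lra.
Qed.

Definition enorm m (x : 'cV[R]_m) : R := Num.sqrt (dotv x x).

Lemma enorm_ge0 m (x : 'cV[R]_m) : 0 <= enorm x.
Proof. exact: sqrtr_ge0. Qed.

Lemma enorm_sqr m (x : 'cV[R]_m) : enorm x ^+ 2 = dotv x x.
Proof. by rewrite sqr_sqrtr// dotv_ge0. Qed.

Lemma enorm0 m : enorm (0 : 'cV[R]_m) = 0.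
Proof. by rewrite /enorm dotv0l sqrtr0. Qed.

Lemma enorm_eq0 m (x : 'cV[R]_m) : (enorm x == 0) = (x == 0).
Proof. by rewrite -dotv_eq0 -enorm_sqr sqrf_eq0. Qed.

Lemma dotv_enorm m (x y : 'cV[R]_m) : `|dotv x y| <= enorm x * enorm y.
Proof.
rewrite -ler_sqr ?nnegrE ?mulr_ge0 ?enorm_ge0//.
by rewrite exprMn !enorm_sqr real_normK ?num_real// dotv_CS.
Qed.

Lemma enormN m (x : 'cV[R]_m) : enorm (- x) = enorm x.
Proof. by rewrite /enorm dotvNl dotvNr opprK. Qed.

Lemma enormZ m k (x : 'cV[R]_m) : enorm (k *: x) = `|k| * enorm x.
Proof.
by rewrite /enorm dotvZl dotvZr mulrA -expr2 sqrtrM ?sqr_ge0// sqrtr_sqr.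
Qed.

Lemma ler_enormD m (x y : 'cV[R]_m) : enorm (x + y) <= enorm x + enorm y.
Proof.
rewrite -ler_sqr ?nnegrE ?addr_ge0 ?enorm_ge0//.
rewrite sqrrD !enorm_sqr dotvDl !dotvDr (dotvC y x).
have := le_trans (ler_norm _) (dotv_enorm x y); lra.
Qed.

Lemma ler_enormB m (x y : 'cV[R]_m) : enorm (x - y) <= enorm x + enorm y.
Proof. by rewrite -(enormN y) ler_enormD. Qed.

(** The norm of a matrix is the largest absolute value of an entry, so bounds are
    checked entry by entry. *)
Lemma mx_norm_le m n (x : 'M[R]_(m, n)) (r : R) : 0 <= r ->
  (forall i j, `|x i j| <= r) -> `|x| <= r.
Proof.
move=> r0 h; rewrite [leLHS]/Num.Def.normr/= mx_normrE.
by apply: bigmax_le => // -[i j] _; exact: h.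
Qed.

Lemma mx_norm_ge m n (x : 'M[R]_(m, n)) i j : `|x i j| <= `|x|.
Proof.
rewrite [leRHS]/Num.Def.normr/= mx_normrE.
exact: (le_bigmax _ (fun ij => `|x ij.1 ij.2|) (i, j)).
Qed.

Lemma enorm_le_mxnorm m (x : 'cV[R]_m) : dotv x x <= m%:R * `|x| ^+ 2.
Proof.
have -> : m%:R * `|x| ^+ 2 = \sum_(i < m) `|x| ^+ 2.
  by rewrite sumr_const card_ord mulr_natl.
rewrite dotvE; apply: ler_sum => i _.
rewrite -expr2 -(real_normK (num_real (x i 0))) ler_sqr ?nnegrE//.
exact: mx_norm_ge.
Qed.

Lemma mxnorm_le_enorm m (x : 'cV[R]_m) : `|x| <= enorm x.
Proof.
apply: mx_norm_le (enorm_ge0 _) _ => i j; rewrite ord1.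
rewrite -ler_sqr ?nnegrE ?enorm_ge0// enorm_sqr real_normK ?num_real// dotvE.
rewrite (bigD1 i)//= -expr2 lerDl sumr_ge0// => k _.
by rewrite -expr2 sqr_ge0.
Qed.

End Euclid.


(** * Global solutions of Lipschitz differential equations *)

(* joins the complete uniform structure of matrices with the normed one *)
HB.instance Definition _ (R : realType) m n :=
  Complete.copy 'M[R]_(m, n) 'M[R]_(m, n).

Lemma near_dist_lt (R : realType) (V : normedModType R) (x : V) (e : R) :
  0 < e -> \forall y \near x, `|x - y| < e.
Proof. by move=> e0; apply/nbhs_normP; exists e. Qed.

Lemma continuous_dist (R : realType) (V W : normedModType R) (f : V -> W) (x : V) :
  (forall e : R, 0 < e ->
     exists2 d : R, 0 < d & forall y, `|x - y| < d -> `|f x - f y| < e) ->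
  {for x, continuous f}.
Proof.
move=> h; apply/cvgrPdist_lt => e e0; have [d d0 hd] := h e e0.
exact: filterS hd (near_dist_lt x d0).
Qed.

Lemma continuous_distP (R : realType) (V W : normedModType R) (f : V -> W) (x : V)
  (e : R) : {for x, continuous f} -> 0 < e ->
  exists2 d : R, 0 < d & forall y, `|x - y| < d -> `|f x - f y| < e.
Proof.
move=> /cvgrPdist_lt h e0; have /nbhs_normP[d d0 hd] := h e e0.
by exists d.
Qed.

Section Antiderivative.
Variable R : realType.

Lemma is_derive_near (V : normedModType R) (F G : R -> V) t dF (e : R) : 0 < e ->
  (forall u, `|u - t| < e -> F u = G u) -> is_derive t 1 F dF -> is_derive t 1 G dF.
Proof.
move=> e0 FG; have FGn : \forall u \near t, F u = G u.
  apply: filterS (near_dist_lt (t : R) e0) => u tu; apply: FG.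
  by rewrite distrC.
by move=> h; apply: near_eq_is_derive h; rewrite ?oner_neq0.
Qed.

Let prim (g : R -> R) (N u : R) :=
  (\int[lebesgue_measure]_(s in [set` `[(- N), u]]) g s)%R.

Lemma prim_derive (g : R -> R) (N t : R) : continuous g -> `|t| < N ->
  is_derive t 1 (prim g N) (g t).
Proof.
move=> cg; rewrite ltr_norml => /andP[Nt tN].
have [|d1 d2] := @continuous_FTC1_closed R g (- N) t N tN _ Nt (cg t).
  apply: continuous_compact_integrable; first exact: segment_compact.
  exact: continuous_subspaceT.
by split; [exact: d1|rewrite -derive1E; exact: d2].
Qed.

(** The fundamental theorem of calculus differentiates integrals from a fixed left
    end, at points to its right. Here the left end recedes with t, and the increments
    agree because their difference has derivative 0. *)
Lemma antiderivative_exists (g : R -> R) : continuous g ->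
  exists2 G : R -> R, G 0 = 0 & forall t : R, is_derive t 1 G (g t).
Proof.
move=> cg.
pose G (t : R) := prim g (`|t| + 2) t - prim g (`|t| + 2) 0.
have indep (N M t : R) : `|t| < N -> `|t| < M ->
    prim g N t - prim g N 0 = prim g M t - prim g M 0.
  move=> tN tM; pose h u := prim g N u - prim g M u.
  have hd (u : R) : `|u| <= `|t| -> is_derive u 1 h 0.
    move=> ut; apply: der_eq (derB (prim_derive cg _) (prim_derive cg _)).
    - by rewrite subrr.
    - exact: le_lt_trans tN.
    - exact: le_lt_trans tM.
  suff : h t = h 0.
    by rewrite /h => /eqP; rewrite subr_eq addrAC -subr_eq addrC; move/eqP => e; lra.
  case: (leP 0 t) => t0.
    apply: (@deriv_eq0_cst _ h) => // x /andP[x0 xt]; apply: hd.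
    by rewrite !ger0_norm.
  symmetry; apply: (@deriv_eq0_cst _ h); first exact: ltW.
  by move=> x /andP[x0 xt]; apply: hd; rewrite !ler0_norm// ?lerN2// ltW.
exists G; first by rewrite /G subrr.
move=> t; pose N := `|t| + 3.
apply: (@is_derive_near _ (fun u => prim g N u - prim g N 0) _ _ _ 1) => //.
  move=> u ut; apply: indep.
    have := ler_normD (u - t) t; rewrite subrK /N; lra.
  by lra.
apply: der_eq (derB (prim_derive cg _) (der_cst t _)).
  by rewrite subr0.
by rewrite /N; lra.
Qed.

Lemma antiderivative_mx m (g : R -> 'cV[R]_m) : continuous g ->
  exists2 G : R -> 'cV[R]_m, G 0 = 0 & forall t : R, is_derive t 1 G (g t).
Proof.
move=> cg.
have cgi i : continuous (fun u => g u i 0).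
  move=> u; apply: (@continuous_comp _ _ _ g (fun M : 'cV[R]_m => M i 0)); first exact: cg.
  exact: coord_continuous.
have /choice[G hG] : forall i, exists G : R -> R, G 0 = 0 /\
    forall t : R, is_derive t 1 G (g t i 0).
  by move=> i; have [G G0 dG] := antiderivative_exists (cgi i); exists G.
exists (fun u => \col_i G i u).
  by apply/matrixP => i j; rewrite !mxE; have [] := hG i.
move=> t; apply/is_derive_mxP => i j; rewrite ord1.
by apply: is_derive_ext (proj2 (hG i) t) => u; rewrite mxE.
Qed.

End Antiderivative.

Section Gronwall.
Variable R : realType.

Lemma der_expR (c t : R) :
  is_derive t 1 (fun u => expR (c * u)) (c * expR (c * t)).
Proof.
have d1 : is_derive t 1 (fun u : R => c * u) c.
  by apply: der_eq (derZ c (is_derive_id t 1)); exact: mulr1.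
by have := @is_derive1_comp R expR (fun u => c * u) t _ _ (is_derive_expR _) d1; apply: der_eq; rewrite mulrC.
Qed.

Lemma exp_growth (E dE : R -> R) (c a b : R) : a <= b ->
  (forall t, a <= t <= b -> is_derive t 1 E (dE t)) ->
  (forall t, a <= t <= b -> dE t <= c * E t) ->
  E b <= E a * expR (c * (b - a)).
Proof.
move=> ab dE_ le.
pose h t := E t * expR (- c * t).
pose dh t := (dE t - c * E t) * expR (- c * t).
have : h b <= h a.
  apply: (@deriv_le0_nincr _ h dh) => // t tab.
    apply: der_eq (derM (dE_ t tab) (der_expR (- c) t)).
    by rewrite /dh; ring.
  by rewrite /dh mulr_le0_ge0 ?expR_ge0// subr_le0 le.
rewrite /h => H.
have -> : expR (c * (b - a)) = expR (- c * a) * expR (c * b).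
  by rewrite -expRD; congr expR; ring.
rewrite mulrA; apply: le_trans (_ : E b * expR (- c * b) * expR (c * b) <= _).
  by rewrite -mulrA -expRD mulNr addNr expR0 mulr1.
by rewrite ler_wpM2r// expR_ge0.
Qed.

Lemma exp_growth_lower (E dE : R -> R) (c a b : R) : a <= b ->
  (forall t, a <= t <= b -> is_derive t 1 E (dE t)) ->
  (forall t, a <= t <= b -> c * E t <= dE t) ->
  E a * expR (c * (b - a)) <= E b.
Proof.
move=> ab dE_ le.
have := @exp_growth (fun t => - E t) (fun t => - dE t) c a b ab _ _.
rewrite mulNr lerN2; apply.
  by move=> t tab; exact: derN (dE_ t tab).
by move=> t tab; rewrite mulrN lerN2 le.
Qed.

(** The squared distance of two solutions has logarithmic derivative at most c in
    absolute value, which bounds its growth in both directions of time. The factor m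
    compares the max norm, in which the Lipschitz condition is stated, with the
    Euclidean one. *)
Lemma gronwall_dotv m (x y dx dy : R -> 'cV[R]_m) (L a b : R) : a <= b ->
  (forall t, a <= t <= b -> is_derive t 1 x (dx t)) ->
  (forall t, a <= t <= b -> is_derive t 1 y (dy t)) ->
  (forall t, a <= t <= b -> `|dx t - dy t| <= L * `|x t - y t|) ->
  let E t := dotv (x t - y t) (x t - y t) in
  let c := 1 + m%:R * L ^+ 2 in
  E b <= E a * expR (c * (b - a)) /\ E a <= E b * expR (c * (b - a)).
Proof.
move=> ab hx hy hL E c.
pose dE t := 2 * dotv (x t - y t) (dx t - dy t).
have dE_ t : a <= t <= b -> is_derive t 1 E (dE t).
  move=> tab; have d := derB (hx t tab) (hy t tab).
  by apply: der_eq (der_dotv d d); rewrite /dE (dotvC (dx t - dy t)) mulr_natl mulr2n.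
have dEc t : a <= t <= b -> `|dE t| <= c * E t.
  move=> tab; pose u : 'cV[R]_m := x t - y t; pose v : 'cV[R]_m := dx t - dy t.
  have h1 := dotv_young u v.
  have h3 : dotv v v <= m%:R * L ^+ 2 * dotv u u.
    apply: le_trans (enorm_le_mxnorm _) _.
    rewrite -mulrA ler_wpM2l// -enorm_sqr -exprMn.
    have := hL t tab; rewrite -/u -/v => hLt.
    have [u0|u0] := eqVneq u 0.
      have : `|v| <= 0 by rewrite (le_trans hLt)// u0 normr0 mulr0.
      rewrite normr_le0 => /eqP ->; rewrite normr0 expr0n/= sqr_ge0//.
    have L0 : 0 <= L.
      by rewrite -(pmulr_lge0 _ (_ : 0 < `|u|)) ?normr_gt0// (le_trans _ hLt).
    rewrite ler_sqr ?nnegrE ?mulr_ge0 ?enorm_ge0//.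
    by rewrite (le_trans hLt)// ler_wpM2l// mxnorm_le_enorm.
  rewrite /dE /E /c -/u -/v normrM ger0_norm//; lra.
split.
  apply: (@exp_growth E dE) => // t tab.
  exact: le_trans (ler_norm _) (dEc t tab).
have := @exp_growth_lower E dE (- c) a b ab dE_ _.
have -> : expR (c * (b - a)) = (expR (- c * (b - a)))^-1.
  by rewrite -expRN; congr expR; ring.
rewrite ler_pdivlMr ?expR_gt0//; apply => t tab.
by have := dEc t tab; rewrite ler_norml mulNr => /andP[].
Qed.

End Gronwall.

Section Picard.
Variables (R : realType) (m : nat).

(** The functions of growth exp (c |t|) are reproduced by integration, with a gain of
    1/c. With c twice the Lipschitz constant this makes each Picard step a contraction
    by 1/2 on the whole line. *)
Lemma exp_bound_from_derivative (u du : R -> 'cV[R]_m) (K c : R) :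
  0 <= K -> 0 < c -> u 0 = 0 ->
  (forall t : R, is_derive t 1 u (du t)) ->
  (forall t, `|du t| <= K * (c * expR (c * `|t|))) ->
  forall t, `|u t| <= K * expR (c * `|t|).
Proof.
move=> K0 c0.
have half (w dw : R -> R) : w 0 = 0 ->
    (forall t : R, is_derive t 1 w (dw t)) ->
    (forall t, dw t <= K * (c * expR (c * `|t|))) ->
    forall t, 0 <= t -> w t <= K * expR (c * t).
  move=> w0 dw_ le t t0.
  pose h s := w s - K * expR (c * s).
  have : h t <= h 0.
    apply: (@deriv_le0_nincr _ h (fun s => dw s - K * (c * expR (c * s)))) => // s.
      move=> _; apply: derB => //.
      exact: derZ (der_expR c s).
    by move=> /andP[s0 _]; rewrite subr_le0 (le_trans (le s))// ger0_norm.
  by rewrite /h w0 mulr0 expR0; lra.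
move=> u0 du_ le.
have key (v dv : R -> 'cV[R]_m) : v 0 = 0 ->
   (forall t : R, is_derive t 1 v (dv t)) ->
   (forall t, `|dv t| <= K * (c * expR (c * `|t|))) ->
   forall t, 0 <= t -> `|v t| <= K * expR (c * t).
  move=> v0 dv_ lev t t0; apply: mx_norm_le; first by rewrite mulr_ge0// expR_ge0.
  move=> i j; rewrite ler_norml; apply/andP; split.
    rewrite lerNl; apply: (half (fun s => - v s i j) (fun s => - dv s i j)) => //.
    - by rewrite v0 mxE oppr0.
    - by move=> s; apply: derN; move/is_derive_mxP: (dv_ s).
    - by move=> s; apply: le_trans (lev s); rewrite (le_trans (ler_norm _))// normrN mx_norm_ge.
  apply: (half (fun s => v s i j) (fun s => dv s i j)) => //.
  - by rewrite v0 mxE.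
  - by move=> s; move/is_derive_mxP: (dv_ s).
  - by move=> s; apply: le_trans (lev s); rewrite (le_trans (ler_norm _))// mx_norm_ge.
move=> t; have [t0|t0] := leP 0 t; first by rewrite ger0_norm//; exact: key le _ _.
have := key (fun s => u (- s)) (fun s => - du (- s)) _ _ _ (- t) _.
rewrite opprK ltr0_norm//; apply; rewrite ?oppr0//.
- by move=> s; exact: is_derive_comp_opp.
- by move=> s; rewrite normrN (le_trans (le _))// normrN.
- by rewrite oppr_ge0 ltW.
Qed.

Lemma geometric_small (C e : R) : 0 < e -> exists n, C * 2^-1 ^+ n < e.
Proof.
move=> e0.
have h2 : `|2^-1 : R| < 1 by rewrite ger0_norm; lra.
have : (fun n => C * 2^-1 ^+ n) @ \oo --> C * 0.
  by apply: cvgM; [exact: cvg_cst|exact: cvg_expr].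
rewrite mulr0 => /cvgrPdist_lt /(_ e e0) [N _ hN]; exists N.
have := hN N (leqnn N); rewrite /= sub0r normrN; apply: le_lt_trans.
exact: ler_norm.
Qed.

Lemma geometric_limit (u : nat -> 'cV[R]_m) (C : R) : 0 <= C ->
  (forall n, `|u n.+1 - u n| <= C * 2^-1 ^+ n) ->
  exists l, forall n, `|l - u n| <= 2 * C * 2^-1 ^+ n.
Proof.
move=> C0 hu.
have tele n k : `|u (n + k)%N - u n| <= 2 * C * 2^-1 ^+ n.
  suff : `|u (n + k)%N - u n| <= 2 * C * 2^-1 ^+ n * (1 - 2^-1 ^+ k).
    by move/le_trans; apply; rewrite ler_piMr ?mulr_ge0 ?exprn_ge0.
  elim: k => [|k IH]; first by rewrite addn0 subrr normr0 expr0 subrr mulr0.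
  rewrite addnS; have -> : u (n + k).+1 - u n = (u (n + k).+1 - u (n + k)%N) +
     (u (n + k)%N - u n) by rewrite addrA subrK.
  apply: le_trans (ler_normD _ _) _.
  apply: le_trans (lerD (hu _) IH) _.
  by rewrite exprD exprS le_eqVlt; apply/orP; left; apply/eqP; field.
have small (e : R) : 0 < e -> exists n, 2 * C * 2^-1 ^+ n < e.
  move=> e0.
  exact: geometric_small.
have cu : cvg (u @ \oo).
  apply/cauchy_cvgP; apply: cauchy_exP => e e0.
  have [n hn] := small e e0; exists (u n); exists n => // k /= nk.
  rewrite -ball_normE/=; rewrite -(subnKC nk) distrC.
  exact: le_lt_trans (tele _ _) hn.
exists (lim (u @ \oo)) => n.
have h : `|u k - u n| @[k --> \oo] --> `|lim (u @ \oo) - u n|.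
  by apply: cvg_norm; apply: cvgB => //; exact: cvg_cst.
have -> : `|lim (u @ \oo) - u n| = lim (`|u k - u n| @[k --> \oo]).
  by symmetry; apply/cvg_lim.
apply: limr_le; first by apply/cvg_ex; exists `|lim (u @ \oo) - u n|.
by exists n => // k /= nk; rewrite -(subnKC nk).
Qed.

(** Picard iteration. In the norm weighted by exp (2 L |t|) it contracts by 1/2, so
    that no subdivision of the time axis is needed. *)
Theorem ode_global (f : 'cV[R]_m -> 'cV[R]_m) (L : R) : 0 < L ->
  (forall x y, `|f x - f y| <= L * `|x - y|) ->
  forall x0, exists2 x : R -> 'cV[R]_m, x 0 = x0 &
    forall t : R, is_derive t 1 x (f (x t)).
Proof.
move=> L0 fL x0.
have cf : continuous f.
  move=> x; apply: continuous_dist => e e0; exists (e / L); first exact: divr_gt0.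
  by move=> y xy; apply: le_lt_trans (fL _ _) _; rewrite mulrC -ltr_pdivlMr.
have /choice[AD hAD] : forall g : R -> 'cV[R]_m, exists G : R -> 'cV[R]_m,
    continuous g -> G 0 = 0 /\ forall t : R, is_derive t 1 G (g t).
  move=> g; case: (pselect (continuous g)) => [cg|ncg]; last by exists g.
  by have [G G0 dG] := antiderivative_mx cg; exists G.
pose X := fix X (n : nat) : R -> 'cV[R]_m :=
  if n is n'.+1 then fun t => x0 + AD (f \o X n') t else fun=> x0.
have dX n : continuous (X n) ->
    X n.+1 0 = x0 /\ forall t : R, is_derive t 1 (X n.+1) (f (X n t)).
  move=> cX; have [A0 dA] := hAD (f \o X n) (fun t => continuous_comp (cX t) (cf _)).
  split; first by rewrite /= A0 addr0.
  move=> t; apply: der_eq (derD (der_cst t x0) (dA t)); by rewrite add0r.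
have cX n : continuous (X n).
  elim: n => [|n IH]; first by move=> t; exact: cvg_cst.
  by move=> t; apply: is_derive_continuous (proj2 (dX n IH) t).
pose K := `|f x0| / (2 * L).
have K0 : 0 <= K by rewrite divr_ge0// mulr_ge0// ltW.
have L20 : 0 < 2 * L by rewrite mulr_gt0.
have step n (t : R) : `|X n.+1 t - X n t| <= K * 2^-1 ^+ n * expR (2 * L * `|t|).
  elim: n t => [|n IH] t.
    rewrite expr0 mulr1; have [X1 dX1] := dX 0%N (cX 0%N).
    apply: (@exp_bound_from_derivative (fun t => X 1%N t - X 0%N t)
       (fun t => f (X 0%N t) - 0)) => //.
    - by rewrite X1 subrr.
    - move=> s; rewrite /= subr0 mulrA /K divfK ?gt_eqF// ler_peMr//.
      by rewrite -[leLHS]expR0 ler_expR mulr_ge0// ltW.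
  have [Xn0 dXn] := dX n (cX n); have [XSn0 dXSn] := dX n.+1 (cX n.+1).
  apply: (@exp_bound_from_derivative (fun t => X n.+2 t - X n.+1 t)
     (fun t => f (X n.+1 t) - f (X n t))) => //.
  - by rewrite mulr_ge0// exprn_ge0.
  - by rewrite XSn0 Xn0 subrr.
  - move=> s; apply: le_trans (fL _ _) _.
    apply: le_trans (ler_wpM2l (ltW L0) (IH s)) _.
    by rewrite exprS le_eqVlt; apply/orP; left; apply/eqP; field.
have Ke0 (t : R) : 0 <= K * expR (2 * L * `|t|) by rewrite mulr_ge0// expR_ge0.
have /choice[x hx] : forall t, exists l, forall n,
    `|l - X n t| <= 2 * (K * expR (2 * L * `|t|)) * 2^-1 ^+ n.
  move=> t; apply: geometric_limit => // n.
  by apply: le_trans (step n t) _; rewrite le_eqVlt; apply/orP; left; apply/eqP; ring.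
have small := @geometric_small.
have cx : continuous x.
  move=> t; apply: continuous_dist => e e0.
  pose C := 2 * (K * expR (2 * L * (`|t| + 1))).
  have [n hn] := small C (e / 3) (divr_gt0 e0 (ltr0Sn R 2)).
  have hC (s : R) : `|s| <= `|t| + 1 -> `|x s - X n s| < e / 3.
    move=> st; apply: le_lt_trans (hx s n) _; apply: le_lt_trans hn.
    rewrite ler_wpM2r ?exprn_ge0// /C ler_wpM2l// ler_wpM2l// ler_expR.
    by rewrite ler_wpM2l// ltW.
  have [d d0 hd] := continuous_distP (cX n t) (divr_gt0 e0 (ltr0Sn R 2)).
  exists (Num.min 1 d); first by rewrite lt_min ltr01.
  move=> s; rewrite lt_min => /andP[ts tsd].
  have s1 : `|s| <= `|t| + 1.
    have := ler_normD t (s - t); rewrite addrC subrK distrC; lra.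
  have -> : x t - x s = (x t - X n t) + (X n t - X n s) - (x s - X n s).
    by rewrite subrKA opprB subrKA.
  have h2 : `|X n t - X n s| < e / 3.
    exact: hd.
  have h1 : `|x t - X n t| < e / 3 by apply: hC; lra.
  have h3 := hC s s1.
  apply: le_lt_trans (ler_normB _ _) _.
  apply: le_lt_trans (lerD (ler_normD _ _) (lexx _)) _; lra.
have [A0 dA] := hAD (f \o x) (fun t => continuous_comp (cx t) (cf _)).
pose y (t : R) : 'cV[R]_m := x0 + AD (f \o x) t.
have dy (t : R) : is_derive t 1 y (f (x t)).
  apply: der_eq (derD (der_cst t x0) (dA t)); by rewrite add0r.
have yX n (t : R) : `|y t - X n.+1 t| <= (K * 2^-1 ^+ n) * expR (2 * L * `|t|).
  have [Xn0 dXn] := dX n (cX n).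
  apply: (@exp_bound_from_derivative (fun t => y t - X n.+1 t)
     (fun t => f (x t) - f (X n t))) => //.
  - by rewrite mulr_ge0// exprn_ge0.
  - by rewrite /y A0 Xn0 addr0 subrr.
  - move=> s; apply: le_trans (fL _ _) _.
    apply: le_trans (ler_wpM2l (ltW L0) (hx s n)) _.
    by rewrite le_eqVlt; apply/orP; left; apply/eqP; ring.
have xy : x =1 y.
  move=> t; apply/eqP; rewrite -subr_eq0 -normr_le0 leNgt; apply/negP => h.
  have [n hn] := small (2 * (K * expR (2 * L * `|t|))) _ h.
  have h1 := hx t n.+1; have h2 := yX n t.
  have : `|x t - y t| <= `|x t - X n.+1 t| + `|y t - X n.+1 t|.
    have -> : x t - y t = (x t - X n.+1 t) - (y t - X n.+1 t) by rewrite opprB addrA subrK.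
    exact: ler_normB.
  move: h1 h2 hn; rewrite exprS; set P := 2^-1 ^+ n; set W := expR _.
  have -> : 2 * (K * W) * (2^-1 * P) = K * W * P by field.
  have -> : K * P * W = K * W * P by ring.
  lra.
exists x; first by rewrite xy /y A0 addr0.
move=> t; apply: is_derive_ext (dy t) => s; by rewrite xy.
Qed.

End Picard.


(** * Cross products, quaternions and rotations *)

Section Cross.
Variable R : realType.
Implicit Types x y z : 'cV[R]_3.

Lemma sum3 (F : 'I_3 -> R) : \sum_(i < 3) F i = F 0 + F 1 + F 2%:R.
Proof.
rewrite 3!big_ord_recl big_ord0 addr0 addrA.
by congr (_ + _ + _); congr F; apply: val_inj.
Qed.

Lemma ord3P (P : 'I_3 -> Prop) : P 0 -> P 1 -> P 2%:R -> forall i, P i.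
Proof.
move=> p0 p1 p2 [[|[|[|//]]] hi].
- by rewrite (_ : Ordinal hi = 0)//; apply: val_inj.
- by rewrite (_ : Ordinal hi = 1)//; apply: val_inj.
- by rewrite (_ : Ordinal hi = 2%:R)//; apply: val_inj.
Qed.

Lemma ord1P (P : 'I_1 -> Prop) : P 0 -> forall i, P i.
Proof. by move=> p0 i; rewrite (ord1 i). Qed.

Lemma crossE x :
  (crossmx x 0 0 = 0) * (crossmx x 0 1 = - x 2%:R 0) * (crossmx x 0 2%:R = x 1 0) *
  (crossmx x 1 0 = x 2%:R 0) * (crossmx x 1 1 = 0) * (crossmx x 1 2%:R = - x 0 0) *
  (crossmx x 2%:R 0 = - x 1 0) * (crossmx x 2%:R 1 = x 0 0) *
  (crossmx x 2%:R 2%:R = 0).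
Proof. by rewrite /crossmx !mxE. Qed.

Lemma dotv3 x y : dotv x y = x 0 0 * y 0 0 + x 1 0 * y 1 0 + x 2%:R 0 * y 2%:R 0.
Proof. by rewrite dotvE sum3. Qed.

Lemma mulmx3E m n (A : 'M[R]_(m, 3)) (B : 'M[R]_(3, n)) i j :
  (A *m B) i j = A i 0 * B 0 j + A i 1 * B 1 j + A i 2%:R * B 2%:R j.
Proof. by rewrite mxE sum3. Qed.

Lemma mulmx1E m n (A : 'M[R]_(m, 1)) (B : 'M[R]_(1, n)) i j :
  (A *m B) i j = A i 0 * B 0 j.
Proof. by rewrite mxE big_ord1. Qed.

Lemma scal3E (a : R) (i j : 'I_3) : (a%:M : 'M[R]_3) i j = if i == j then a else 0.
Proof. by rewrite mxE; case: eqP. Qed.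

End Cross.

(** Entrywise verification of identities between 3 x 3 matrices or columns. *)
Ltac mx3 :=
  apply/matrixP;
  first [ elim/ord3P; elim/ord3P | elim/ord3P; elim/ord1P ];
  rewrite ?(crossE, mulmx3E, mulmx1E, scal3E, dotv3, mxE, mulr1n, mulr0n, eqxx)/=;
  rewrite ?(crossE, mulmx3E, mulmx1E, scal3E, dotv3, mxE, mulr1n, mulr0n, eqxx)/=; try ring.

Section CrossTheory.
Variable R : realType.
Implicit Types x y z : 'cV[R]_3.

Lemma cross_tr x : (crossmx x)^T = - crossmx x.
Proof. mx3. Qed.

Lemma crossC x y : crossmx x *m y = - (crossmx y *m x).
Proof. mx3. Qed.

Lemma crossxx x : crossmx x *m x = 0.
Proof. mx3. Qed.

Lemma crossD x y : crossmx (x + y) = crossmx x + crossmx y.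
Proof. mx3. Qed.

Lemma crossZ a x : crossmx (a *: x) = a *: crossmx x.
Proof. mx3. Qed.

Lemma crossN x : crossmx (- x) = - crossmx x.
Proof. mx3. Qed.

Lemma cross0 : crossmx (0 : 'cV[R]_3) = 0.
Proof. mx3. Qed.

End CrossTheory.

Section Quaternion.
Variable R : realType.
Implicit Types (P Q T : quat R) (x y : 'cV[R]_3).

Lemma qscal_mk a x : qscal (mkquat a x) = a.
Proof. by rewrite /qscal /mkquat col_mxKu mxE mulr1n. Qed.

Lemma qvec_mk a x : qvec (mkquat a x) = x.
Proof. by rewrite /qvec /mkquat col_mxKd. Qed.

Lemma quatP P Q : qscal P = qscal Q -> qvec P = qvec Q -> P = Q.
Proof.
rewrite /qscal /qvec => h1 h2; rewrite -[P]vsubmxK -[Q]vsubmxK h2.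
by congr col_mx; apply/matrixP => i j; rewrite !ord1.
Qed.

Lemma mkquat_eta Q : mkquat (qscal Q) (qvec Q) = Q.
Proof. by apply: quatP; rewrite ?qscal_mk ?qvec_mk. Qed.

Lemma qscalD P Q : qscal (P + Q) = qscal P + qscal Q.
Proof. by rewrite /qscal !mxE. Qed.

Lemma qscalN P : qscal (- P) = - qscal P.
Proof. by rewrite /qscal !mxE. Qed.

Lemma qscalZ a P : qscal (a *: P) = a * qscal P.
Proof. by rewrite /qscal !mxE. Qed.

Lemma qvecD P Q : qvec (P + Q) = qvec P + qvec Q.
Proof. by rewrite /qvec raddfD. Qed.

Lemma qvecN P : qvec (- P) = - qvec P.
Proof. by rewrite /qvec raddfN. Qed.

Lemma qvecZ a P : qvec (a *: P) = a *: qvec P.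
Proof. by rewrite /qvec linearZ. Qed.

Lemma qscal0 : qscal (0 : quat R) = 0.
Proof. by rewrite /qscal !mxE. Qed.

Lemma qvec0 : qvec (0 : quat R) = 0.
Proof. by rewrite /qvec raddf0. Qed.

Definition qE := (qscal_mk, qvec_mk, qscalD, qscalN, qscalZ, qvecD, qvecN, qvecZ).

Lemma dotv_quat P Q : dotv P Q = qscal P * qscal Q + dotv (qvec P) (qvec Q).
Proof.
rewrite -{1}[P]vsubmxK -{1}[Q]vsubmxK /dotv tr_col_mx mul_row_col [LHS]mxE.
by congr (_ + _); rewrite mulmx1E mxE.
Qed.

Lemma unit_quatE Q : unit_quat Q <-> dotv Q Q = 1.
Proof. by rewrite dotv_quat -expr2. Qed.

(** The map x |-> Q (0, x); for unit Q its image is the tangent space of the sphere at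
    Q. *)
Definition Lq Q : 'M[R]_(1 + 3, 3) :=
  col_mx (- (qvec Q)^T) ((qscal Q)%:M + crossmx (qvec Q)).
(** The same for multiplication on the other side, x |-> (0, x) Q. The two are related
    by the rotation of Q, which changes body coordinates into inertial ones. *)
Definition Nq Q : 'M[R]_(1 + 3, 3) :=
  col_mx (- (qvec Q)^T) ((qscal Q)%:M - crossmx (qvec Q)).

(** On quaternions q^T W q becomes the quadratic form of diag (0, W), a function on
    the sphere of which the poles and the eigenvectors of W are the critical points. *)
Definition Bq (W : 'M[R]_3) : 'M[R]_(1 + 3) := block_mx 0 0 0 W.

Lemma Lq_mul Q x :
  Lq Q *m x = mkquat (- dotv (qvec Q) x) (qscal Q *: x + crossmx (qvec Q) *m x).
Proof.
rewrite /Lq mul_col_mx /mkquat mulmxDl mul_scalar_mx; congr col_mx.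
by rewrite mulNmx /dotv; apply/matrixP => i j; rewrite !ord1 [LHS]mxE [RHS]mxE mulr1n.
Qed.

Lemma Nq_mul Q x :
  Nq Q *m x = mkquat (- dotv (qvec Q) x) (qscal Q *: x - crossmx (qvec Q) *m x).
Proof.
rewrite /Nq mul_col_mx /mkquat mulmxBl mul_scalar_mx; congr col_mx.
by rewrite mulNmx /dotv; apply/matrixP => i j; rewrite !ord1 [LHS]mxE [RHS]mxE mulr1n.
Qed.

Lemma mul_trN_usub q P : (- (q : 'cV[R]_3)^T)^T *m usubmx P = - (qscal P *: q).
Proof.
rewrite linearN/= trmxK mulNmx; congr (- _); apply/matrixP => i j.
by rewrite (ord1 j) mulmx1E [RHS]mxE mulrC.
Qed.

Lemma LqT_mul Q P :
  (Lq Q)^T *m P = - (qscal P *: qvec Q) + qscal Q *: qvec P - crossmx (qvec Q) *m qvec P.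
Proof.
rewrite -{1}[P]vsubmxK /Lq tr_col_mx mul_row_col mul_trN_usub -addrA; congr (_ + _).
by rewrite linearD/= tr_scalar_mx cross_tr mulmxBl mul_scalar_mx.
Qed.

Lemma NqT_mul Q P :
  (Nq Q)^T *m P = - (qscal P *: qvec Q) + qscal Q *: qvec P + crossmx (qvec Q) *m qvec P.
Proof.
rewrite -{1}[P]vsubmxK /Nq tr_col_mx mul_row_col mul_trN_usub -addrA; congr (_ + _).
by rewrite linearB/= tr_scalar_mx cross_tr opprK mulmxDl mul_scalar_mx.
Qed.

Lemma Bq_mul W Q : Bq W *m Q = mkquat 0 (W *m qvec Q).
Proof.
rewrite -{1}[Q]vsubmxK /Bq mul_block_col !mul0mx !add0r /mkquat.
by rewrite raddf0.
Qed.

Lemma Bq_tr W : W^T = W -> (Bq W)^T = Bq W.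
Proof. by move=> h; rewrite /Bq tr_block_mx !trmx0 h. Qed.

Lemma qmul_bar Q x : qmul Q (qbar x) = Lq Q *m x.
Proof.
rewrite Lq_mul /qmul /qbar qscal_mk qvec_mk mulr0 sub0r scale0r addr0.
by [].
Qed.

Lemma bar_qmul Q x : qmul (qbar x) Q = Nq Q *m x.
Proof.
rewrite Nq_mul /qmul /qbar qscal_mk qvec_mk mul0r sub0r scale0r add0r dotvC.
by rewrite [crossmx x *m _]crossC.
Qed.

Ltac qring :=
  first [apply: quatP | idtac];
  rewrite ?(qscal_mk, qvec_mk, qscalD, qvecD, qscalN, qvecN, qscalZ, qvecZ);
  repeat match goal with
  | |- context [qvec ?Q] => is_var Q; let q := fresh "q" in move: (qvec Q) => q
  | |- context [qscal ?Q] => is_var Q; let q := fresh "q" in move: (qscal Q) => q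
  end; [ try (rewrite !dotv3;
   rewrite ?(crossE, mulmx3E, mulmx1E, scal3E, dotv3, mxE, mulr1n, mulr0n, eqxx)/=; ring)
  | try mx3 ].

Lemma LqLq Q x : (Lq Q)^T *m (Lq Q *m x) = dotv Q Q *: x.
Proof.
rewrite LqT_mul Lq_mul qscal_mk qvec_mk dotv_quat.
by move: (qvec Q) (qscal Q) => q q0; mx3.
Qed.

Lemma NqNq Q x : (Nq Q)^T *m (Nq Q *m x) = dotv Q Q *: x.
Proof.
rewrite NqT_mul Nq_mul qscal_mk qvec_mk dotv_quat.
by move: (qvec Q) (qscal Q) => q q0; mx3.
Qed.

Lemma LqTQ Q : (Lq Q)^T *m Q = 0.
Proof. by rewrite LqT_mul crossxx subr0 addrC subrr. Qed.

Lemma NqTQ Q : (Nq Q)^T *m Q = 0.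
Proof. by rewrite NqT_mul crossxx addr0 addrC subrr. Qed.

Lemma NqNqT Q P : Nq Q *m ((Nq Q)^T *m P) = dotv Q Q *: P - dotv Q P *: Q.
Proof.
rewrite NqT_mul Nq_mul !dotv_quat.
by qring.
Qed.

(** On unit quaternions this is the projection to the tangent space; hence the
    tangential part of a gradient vanishes exactly at the eigenvectors of the form. *)
Lemma LqLqT Q P : Lq Q *m ((Lq Q)^T *m P) = dotv Q Q *: P - dotv Q P *: Q.
Proof.
rewrite LqT_mul Lq_mul !dotv_quat.
by qring.
Qed.

(** R(Q) x is the vector part of Q (0, x) Q^-1. *)
Lemma rot_NL Q : unit_quat Q -> rotmx Q = (Nq Q)^T *m Lq Q.
Proof.
rewrite unit_quatE dotv_quat /rotmx /Nq /Lq tr_col_mx mul_row_col.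
rewrite [((qscal Q)%:M - _)^T]raddfB [(- _)^T]raddfN/= trmxK tr_scalar_mx cross_tr opprK mulNmx mulmxN opprK.
move: (qvec Q) (qscal Q) => q q0; rewrite dotv3 => h.
have h0 : q0 * q0 = 1 - (q 0 0 * q 0 0 + q 1 0 * q 1 0 + q 2%:R 0 * q 2%:R 0) by lra.
mx3; rewrite ?mulrDl ?mulrDr ?h0; try ring; try (rewrite ?mulrDl ?mulrDr ?h0; ring).
Qed.

Lemma LqNrot Q : unit_quat Q -> Lq Q = Nq Q *m rotmx Q.
Proof.
move=> uQ; rewrite (rot_NL uQ); apply/matrixP => i j.
have : col j (Lq Q) = col j (Nq Q *m ((Nq Q)^T *m Lq Q)).
  rewrite !colE -!mulmxA NqNqT (unit_quatE Q).1// scale1r.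
  by rewrite dotv_mulr LqTQ dotv0l scale0r subr0.
by move=> /matrixP/(_ i 0); rewrite [LHS]mxE [RHS]mxE.
Qed.

Lemma rot_trmul Q : unit_quat Q -> (rotmx Q)^T *m rotmx Q = 1%:M.
Proof.
move=> uQ; rewrite {2}(rot_NL uQ) mulmxA -trmx_mul -(LqNrot uQ).
apply/matrixP => i j.
have : col j ((Lq Q)^T *m Lq Q) = col j 1%:M.
  by rewrite !colE -mulmxA LqLq (unit_quatE Q).1// scale1r mul1mx.
by move=> /matrixP/(_ i 0); rewrite [LHS]mxE [RHS]mxE.
Qed.

Lemma rot_multr Q : unit_quat Q -> rotmx Q *m (rotmx Q)^T = 1%:M.
Proof. by move=> uQ; apply: mulmx1C; exact: rot_trmul. Qed.

Lemma rot_LqT Q : unit_quat Q -> rotmx Q *m (Lq Q)^T = (Nq Q)^T.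
Proof.
by move=> uQ; rewrite (LqNrot uQ) trmx_mul mulmxA rot_multr// mul1mx.
Qed.

Lemma qmulA P Q T : qmul P (qmul Q T) = qmul (qmul P Q) T.
Proof. by rewrite /qmul; qring. Qed.

Lemma qmulVq Q : unit_quat Q -> qmul (qinv Q) Q = mkquat 1 0.
Proof.
rewrite unit_quatE dotv_quat => h; rewrite /qmul /qinv !qE dotvNl opprK h.
by rewrite scalerN crossN mulNmx crossxx oppr0 addr0 subrr.
Qed.

Lemma qmulqV Q : unit_quat Q -> qmul Q (qinv Q) = mkquat 1 0.
Proof.
rewrite unit_quatE dotv_quat => h; rewrite /qmul /qinv !qE dotvNr opprK h.
by rewrite scalerN mulmxN crossxx oppr0 addr0 addrC subrr.
Qed.

Lemma qmul1q Q : qmul (mkquat 1 0) Q = Q.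
Proof.
by rewrite /qmul !qE dotv0l mul1r subr0 scale1r scaler0 cross0 mul0mx !addr0 mkquat_eta.
Qed.

Lemma qmulq1 Q : qmul Q (mkquat 1 0) = Q.
Proof.
by rewrite /qmul !qE dotv0r mulr1 subr0 scale1r scaler0 mulmx0 addr0 add0r mkquat_eta.
Qed.

Lemma qinvK Q : qinv (qinv Q) = Q.
Proof. by rewrite /qinv !qE opprK mkquat_eta. Qed.

Lemma qinv_mul P Q : qinv (qmul P Q) = qmul (qinv Q) (qinv P).
Proof. by rewrite /qinv /qmul !qE; qring. Qed.

Lemma qmul_norm P Q : dotv (qmul P Q) (qmul P Q) = dotv P P * dotv Q Q.
Proof.
rewrite /qmul !dotv_quat !qE; move: (qvec P) (qvec Q) (qscal P) (qscal Q) => p q p0 q0.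
rewrite !dotv3 ?(crossE, mulmx3E, mulmx1E, scal3E, dotv3, mxE, mulr1n, mulr0n, eqxx)/=.
ring.
Qed.

Lemma unit_qmul P Q : unit_quat P -> unit_quat Q -> unit_quat (qmul P Q).
Proof. by rewrite !unit_quatE qmul_norm => -> ->; rewrite mulr1. Qed.

Lemma unit_qinv Q : unit_quat Q -> unit_quat (qinv Q).
Proof. by rewrite !unit_quatE !dotv_quat /qinv !qE dotvNl dotvNr opprK. Qed.

(** Conjugation by Q is the rotation R(Q). *)
Lemma rot_bar Q x : unit_quat Q -> qmul (qbar (rotmx Q *m x)) Q = qmul Q (qbar x).
Proof. by move=> uQ; rewrite bar_qmul qmul_bar (LqNrot uQ) mulmxA. Qed.

Lemma qmulDl P Q T : qmul (P + Q) T = qmul P T + qmul Q T.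
Proof. by rewrite /qmul !qE; qring. Qed.

Lemma qmulDr P Q T : qmul T (P + Q) = qmul T P + qmul T Q.
Proof. by rewrite /qmul !qE; qring. Qed.

Lemma qmulZl a P T : qmul (a *: P) T = a *: qmul P T.
Proof. by rewrite /qmul !qE; qring. Qed.

Lemma qmulZr a P T : qmul T (a *: P) = a *: qmul T P.
Proof. by rewrite /qmul !qE; qring. Qed.

Lemma rot_conj Q x : unit_quat Q ->
  qbar (rotmx Q *m x) = qmul (qmul Q (qbar x)) (qinv Q).
Proof.
by move=> uQ; rewrite -(rot_bar x uQ) -qmulA qmulqV// qmulq1.
Qed.

(** Conjugation is an automorphism of the quaternions, and the cross product is half
    the commutator of pure quaternions. *)
Lemma rot_cross Q x y : unit_quat Q ->
  rotmx Q *m (crossmx x *m y) = crossmx (rotmx Q *m x) *m (rotmx Q *m y).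
Proof.
move=> uQ.
have barbar (a b : 'cV[R]_3) :
    qmul (qbar a) (qbar b) = - dotv a b *: mkquat 1 0 + qbar (crossmx a *m b).
  rewrite /qmul /qbar !qE; apply: quatP; rewrite !qE.
    by rewrite mul0r sub0r mulr1 addr0.
  by rewrite !scale0r !add0r scaler0 add0r.
have : qmul (qbar (rotmx Q *m x)) (qbar (rotmx Q *m y)) =
       qmul (qmul Q (qmul (qbar x) (qbar y))) (qinv Q).
  rewrite (rot_conj x uQ) (rot_conj y uQ); move: (qbar x) (qbar y) => X Y.
  rewrite -(qmulA (qmul Q X)) (qmulA (qinv Q) (qmul Q Y)) (qmulA (qinv Q) Q Y).
  by rewrite (qmulVq uQ) qmul1q (qmulA (qmul Q X) Y) -(qmulA Q X Y).
rewrite (barbar x) (barbar (rotmx Q *m x)) qmulDr qmulDl -(rot_conj _ uQ).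
rewrite qmulZr qmulq1 qmulZl (qmulqV uQ).
by move=> /(congr1 (@qvec R)); rewrite !qE !scaler0 !add0r => ->.
Qed.

End Quaternion.


(** * The closed loop in quaternion form and its energy *)

Section QuatDerivative.
Variable R : realType.
Implicit Types (F G : R -> quat R) (t : R).

Lemma der_qscal F t dF : is_derive t 1 F dF ->
  is_derive t 1 (fun u => qscal (F u)) (qscal dF).
Proof.
by move=> /der_usubmx /is_derive_mxP /(_ 0 0).
Qed.

Lemma der_qvec F t dF : is_derive t 1 F dF ->
  is_derive t 1 (fun u => qvec (F u)) (qvec dF).
Proof. exact: der_dsubmx. Qed.

Lemma der_mkquat (a : R -> R) (v : R -> 'cV[R]_3) t (da : R) dv :
  is_derive t 1 a da -> is_derive t 1 v dv ->
  is_derive t 1 (fun u => mkquat (a u) (v u)) (mkquat da dv).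
Proof.
move=> ha hv; apply: der_col_mx => //; apply/is_derive_mxP => i j.
rewrite !ord1 mxE mulr1n; apply: is_derive_ext ha => u.
by rewrite mxE mulr1n.
Qed.

Lemma der_quat F t a v :
  is_derive t 1 (fun u => qscal (F u)) a ->
  is_derive t 1 (fun u => qvec (F u)) v -> is_derive t 1 F (mkquat a v).
Proof.
move=> ha hv; apply: is_derive_ext (der_mkquat ha hv) => u.
exact: mkquat_eta.
Qed.

Lemma der_cross (f : R -> 'cV[R]_3) t df : is_derive t 1 f df ->
  is_derive t 1 (fun u => crossmx (f u)) (crossmx df).
Proof.
move=> /is_derive_mxP h; apply/is_derive_mxP.
have h0 := h 0 0; have h1 := h 1 0; have h2 := h 2%:R 0.
elim/ord3P; elim/ord3P; rewrite crossE;
  [ have d := der_cst t (0 : R) | have d := derN h2 | have d := h1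
  | have d := h2 | have d := der_cst t (0 : R) | have d := derN h0
  | have d := derN h1 | have d := h0 | have d := der_cst t (0 : R) ];
  by apply: is_derive_ext d => u; rewrite crossE.
Qed.

Lemma der_qmul F G t dF dG : is_derive t 1 F dF -> is_derive t 1 G dG ->
  is_derive t 1 (fun u => qmul (F u) (G u)) (qmul dF (G t) + qmul (F t) dG).
Proof.
move=> hF hG; have sF := der_qscal hF; have sG := der_qscal hG.
have vF := der_qvec hF; have vG := der_qvec hG.
apply: der_eq (der_mkquat (derB (derM sF sG) (der_dotv vF vG))
  (derD (derD (der_scale sF vG) (der_scale sG vF)) (der_mulmx (der_cross vF) vG))).
apply: quatP; rewrite /qmul !qE; first by ring.
move: (qscal dF *: _) (qscal dG *: _) (crossmx (qvec dF) *m _) => a b c.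
move: (qscal (F t) *: _) (qscal (G t) *: _) (crossmx (qvec (F t)) *m _) => d e f.
by apply/matrixP => i j; rewrite !mxE; ring.
Qed.

Lemma der_qinv F t dF : is_derive t 1 F dF ->
  is_derive t 1 (fun u => qinv (F u)) (qinv dF).
Proof.
by move=> h; apply: der_mkquat; [exact: der_qscal|exact/derN/der_qvec].
Qed.

Lemma der_Lq F t dF : is_derive t 1 F dF ->
  is_derive t 1 (fun u => Lq (F u)) (Lq dF).
Proof.
move=> h; apply: der_col_mx; first exact/derN/der_trmx/der_qvec.
apply: derD; last exact/der_cross/der_qvec.
apply/is_derive_mxP => i j; rewrite mxE; have hs := der_qscal h.
case: (eqVneq i j) => ij; last first.
  rewrite mulr0n; apply: is_derive_ext (der_cst t 0) => u.
  by rewrite mxE (negbTE ij).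
by rewrite mulr1n; apply: is_derive_ext hs => u; rewrite mxE ij eqxx mulr1n.
Qed.

Lemma der_Nq F t dF : is_derive t 1 F dF ->
  is_derive t 1 (fun u => Nq (F u)) (Nq dF).
Proof.
move=> h; apply: der_col_mx; first exact/derN/der_trmx/der_qvec.
apply: derB; last exact/der_cross/der_qvec.
apply/is_derive_mxP => i j; rewrite mxE; have hs := der_qscal h.
case: (eqVneq i j) => ij; last first.
  rewrite mulr0n; apply: is_derive_ext (der_cst t 0) => u.
  by rewrite mxE (negbTE ij).
by rewrite mulr1n; apply: is_derive_ext hs => u; rewrite mxE ij eqxx mulr1n.
Qed.

End QuatDerivative.

Section SymPosdef.
Variable R : realType.

Lemma posdef_unitmx (J : 'M[R]_3) : sym_posdef J -> J \in unitmx.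
Proof.
move=> [_ h]; rewrite -row_free_unit -kermx_eq0; apply/negPn/negP => /rowV0Pn[v].
move=> /sub_kermxP vJ v0.
have tv0 : v^T != 0 by apply: contra_neq v0 => e; rewrite -[v]trmxK e trmx0.
by have := h _ tv0; rewrite /dotv trmxK mulmxA vJ mul0mx mxE ltxx.
Qed.

End SymPosdef.

Section NormalForm.
Variables (R : realType) (J Wg Wr : 'M[R]_3).

(** Half the gradients of the two potentials along the sphere, for the estimation
    error in inertial coordinates and for the attitude in body coordinates. *)
Definition Gg (T : quat R) : 'cV[R]_3 := (Nq T)^T *m (Bq Wg *m T).
Definition Gr (Q : quat R) : 'cV[R]_3 := (Lq Q)^T *m (Bq Wr *m Q).

Definition zg (T Q : quat R) : 'cV[R]_3 := - (2 *: ((rotmx Q)^T *m Gg T)).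
Definition zr (Q : quat R) : 'cV[R]_3 := - (2 *: Gr Q).

(** The velocity of the error quaternion: it is carried by the rotation of the body
    and at the same time descends the gradient of its potential. *)
Definition vT (T Q : quat R) (w : 'cV[R]_3) : quat R :=
  Nq T *m (2^-1 *: (rotmx Q *m w) - Gg T).
Definition vQ (Q : quat R) (w : 'cV[R]_3) : quat R := 2^-1 *: (Lq Q *m w).
Definition vw (T Q : quat R) (w : 'cV[R]_3) : 'cV[R]_3 :=
  invmx J *m (- (crossmx w *m (J *m w)) + zg T Q + zr Q).

Hypothesis J_spd : sym_posdef J.

Lemma mulJ_vw T Q w :
  J *m vw T Q w = - (crossmx w *m (J *m w)) + zg T Q + zr Q.
Proof. by rewrite /vw [LHS]mulmxA mulmxV ?posdef_unitmx// mul1mx. Qed.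

(** R(T) times the transpose of the left multiplication is the transpose of the right
    multiplication; this turns z_gamma into a gradient in inertial coordinates. *)
Lemma zg_cl T Q : unit_quat T ->
  - (2 *: ((rotmx Q)^T *m rotmx T *m ((qscal T)%:M - crossmx (qvec T)) *m Wg *m qvec T))
  = zg T Q.
Proof.
move=> uT; congr (- (_ *: _)); rewrite -!mulmxA; congr (_ *m _).
rewrite /Gg -(rot_LqT uT) -mulmxA; congr (_ *m _).
by rewrite Bq_mul LqT_mul !qE scale0r oppr0 add0r mulmxBl mul_scalar_mx.
Qed.

Lemma zr_cl Q :
  - (2 *: (((qscal Q)%:M - crossmx (qvec Q)) *m Wr *m qvec Q)) = zr Q.
Proof.
congr (- (_ *: _)); rewrite /Gr -!mulmxA.
by rewrite Bq_mul LqT_mul !qE scale0r oppr0 add0r mulmxBl mul_scalar_mx.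
Qed.

Lemma vT_cl T Q w : unit_quat T -> unit_quat Q ->
  2^-1 *: (Lq T *m ((rotmx T)^T *m rotmx Q *m (w + zg T Q))) = vT T Q w.
Proof.
move=> uT uQ; rewrite (LqNrot uT) -!mulmxA [rotmx T *m _]mulmxA rot_multr// mul1mx.
rewrite mulmxDr scalemxAr /vT; congr (_ *m _).
rewrite /zg mulmxN -scalemxAr mulmxA rot_multr// mul1mx scalerBr scalerA.
by rewrite mulVf ?pnatr_eq0// scale1r.
Qed.

Definition solution (s : R -> cl_state R) (t : R) : Prop :=
  [/\ admissible (s t),
      is_derive t 1 (fun u => (s u).1.1) (vT (s t).1.1 (s t).1.2 (s t).2),
      is_derive t 1 (fun u => (s u).1.2) (vQ (s t).1.2 (s t).2) &
      is_derive t 1 (fun u => (s u).2) (vw (s t).1.1 (s t).1.2 (s t).2)].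

(** The vector and scalar rows of the kinematics are the two parts of one quaternion
    equation. *)
Lemma closed_loopP s :
  closed_loop J Wg Wr s <-> forall t : R, 0 <= t -> solution s t.
Proof.
have split_der (F : R -> quat R) (t : R) (Q : quat R) (x : 'cV[R]_3) :
    (is_derive t 1 (fun u => qvec (F u))
       (2^-1 *: (((qscal Q)%:M + crossmx (qvec Q)) *m x)) /\
     is_derive t 1 (fun u => qscal (F u)) (- (2^-1 * dotv (qvec Q) x))) <->
    is_derive t 1 F (2^-1 *: (Lq Q *m x)).
  have e : 2^-1 *: (Lq Q *m x) = mkquat (- (2^-1 * dotv (qvec Q) x))
      (2^-1 *: (((qscal Q)%:M + crossmx (qvec Q)) *m x)).
    apply: quatP; rewrite Lq_mul !qE; first by rewrite mulrN.
    by rewrite mulmxDl mul_scalar_mx.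
  rewrite e; split=> [[h1 h2]|h]; first exact: der_quat.
  by split; [have := der_qvec h|have := der_qscal h]; rewrite qE.
split=> h t t0.
  have [adm hT hQ [dom hw hJ]] := h t t0; have [uT uQ] := adm.
  move: hT; rewrite zg_cl// split_der vT_cl// => hT.
  move: hQ; rewrite split_der => hQ.
  split=> //; apply: der_eq hw.
  move: hJ; rewrite zg_cl// zr_cl => hJ.
  by rewrite /vw -hJ mulmxA mulVmx ?posdef_unitmx// mul1mx.
have [adm hT hQ hw] := h t t0; have [uT uQ] := adm.
split=> //.
- by rewrite zg_cl// split_der vT_cl.
- by rewrite split_der.
- by exists (vw (s t).1.1 (s t).1.2 (s t).2) => //; rewrite mulJ_vw zg_cl// zr_cl.
Qed.

(** The quadratic form of P, written on the quaternions. *)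
Definition energy (T Q : quat R) (w : 'cV[R]_3) : R :=
  2 * dotv T (Bq Wg *m T) + 2 * dotv Q (Bq Wr *m Q) + 2^-1 * dotv w (J *m w).

Hypotheses (Wg_sym : Wg^T = Wg) (Wr_sym : Wr^T = Wr).

Lemma der_quadform m (A : 'M[R]_m) (F : R -> 'cV[R]_m) (t : R) dF : A^T = A ->
  is_derive t 1 F dF ->
  is_derive t 1 (fun u => dotv (F u) (A *m F u)) (2 * dotv dF (A *m F t)).
Proof.
move=> sA h; apply: der_eq (der_dotv h (der_mulmxl A h)).
by rewrite dotv_mulr sA [dotv (A *m _) _]dotvC mulr_natl mulr2n.
Qed.

(** The torques are the gradients of the potentials, so that their work cancels the
    change of potential energy due to rotation; what remains is the gradient descent
    of the error. *)
Lemma energy_derivative s t : solution s t ->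
  is_derive t 1 (fun u => energy (s u).1.1 (s u).1.2 (s u).2)
    (- (4 * dotv (Gg (s t).1.1) (Gg (s t).1.1))).
Proof.
move=> [[uT uQ] hT hQ hw].
have [symJ _] := J_spd.
have symBg := Bq_tr Wg_sym; have symBr := Bq_tr Wr_sym.
apply: der_eq (derD (derD (derZ 2 (der_quadform symBg hT))
  (derZ 2 (der_quadform symBr hQ))) (derZ 2^-1 (der_quadform symJ hw))).
move: (s t).1.1 (s t).1.2 (s t).2 uT uQ {hT hQ hw} => T Q w uT uQ.
rewrite /GRing.scale/= /vT /vQ dotv_mull -/(Gg T) dotvZl dotv_mull -/(Gr Q).
rewrite -[in dotv (vw _ _ _) _]symJ -dotv_mull mulJ_vw !(dotvDl, dotvNl).
have -> : dotv (crossmx w *m (J *m w)) w = 0.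
  by rewrite dotv_mull cross_tr mulNmx crossxx oppr0 dotv0r.
rewrite /zg /zr !(dotvNl, dotvZl) (dotv_mull _ w) trmxK (dotvC (Gr Q) w) (dotvC (Gg T) (rotmx Q *m w)).
by field.
Qed.

End NormalForm.

Section AttitudeSystem.
(* keeps failed matches on products of quaternions cheap *)
#[local] Opaque qmul.
Variables (R : realType) (n : nat) (r : 'I_n -> 'cV[R]_3).

Lemma Wmx_mul (g : 'I_n -> R) x :
  Wmx r g *m x = \sum_i g i *: (crossmx (r i) *m (crossmx x *m r i)).
Proof.
rewrite /Wmx mulNmx mulmx_suml -sumrN; apply: eq_bigr => i _.
rewrite -scalemxAl -mulmxA -scalerN; congr (_ *: _).
by rewrite [crossmx x *m _]crossC mulmxN.
Qed.

Lemma Wmx_sym (g : 'I_n -> R) : (Wmx r g)^T = Wmx r g.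
Proof.
rewrite /Wmx linearN/= linear_sum/=; congr (- _); apply: eq_bigr => i _.
by rewrite linearZ/= trmx_mul cross_tr mulNmx mulmxN opprK.
Qed.

(** The Jacobi identity with two equal arguments. *)
Lemma cross_jacobi (x q : 'cV[R]_3) :
  crossmx x *m (crossmx q *m (crossmx q *m x)) =
  crossmx q *m (crossmx x *m (crossmx q *m x)).
Proof. by mx3. Qed.

(** Expanding the rotation in x = r_i, with q the vector part of T, the term linear in
    S(q) produces W q and the quadratic one produces S(q) W q by the Jacobi identity;
    together they are the gradient of the potential of the error. *)
Lemma sum_cross_rot (g : 'I_n -> R) (T : quat R) :
  \sum_i g i *: (crossmx (r i) *m (rotmx T *m r i)) =
  2 *: ((Nq T)^T *m (Bq (Wmx r g) *m T)).
Proof.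
rewrite Bq_mul NqT_mul !qE scale0r oppr0 add0r Wmx_mul.
rewrite scalerDr scalerA mulmx_sumr !scaler_sumr -big_split/=.
apply: eq_bigr => i _.
rewrite /rotmx !mulmxDl mul1mx !mulmxDr crossxx add0r -!scalemxAl -!scalemxAr.
rewrite -mulmxA cross_jacobi scalerDr !scalerA.
by congr (_ *: _ + _ *: _); ring.
Qed.

Lemma sum_cross_rotT (g : 'I_n -> R) (Q : quat R) :
  \sum_i g i *: (crossmx (r i) *m ((rotmx Q)^T *m r i)) =
  - (2 *: ((Lq Q)^T *m (Bq (Wmx r g) *m Q))).
Proof.
have -> : (rotmx Q)^T = rotmx (qinv Q).
  rewrite /rotmx /qinv !qE crossN mulNmx mulmxN opprK !linearD/= !linearZ/= trmx1.
  by rewrite trmx_mul cross_tr mulNmx mulmxN opprK scalerN.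
rewrite sum_cross_rot -scalerN; congr (_ *: _).
rewrite !Bq_mul NqT_mul LqT_mul /qinv !qE [Wmx r g *m - _]mulmxN.
move: (Wmx r g *m qvec Q) => y; rewrite !scale0r !oppr0 !add0r crossN mulNmx !mulmxN opprK.
by rewrite opprB addrC scalerN.
Qed.

(** Both measured vectors are turned into inertial coordinates by R(Q), which
    preserves cross products and then only the rotation of the error remains. *)
Lemma z_gammaE (g : 'I_n -> R) (Q Qh : quat R) : unit_quat Q -> unit_quat Qh ->
  z_gamma r g Q Qh = zg (Wmx r g) (qmul Q (qinv Qh)) Q.
Proof.
move=> uQ uQh; have uT := unit_qmul uQ (unit_qinv uQh).
have inj (x y : 'cV[R]_3) : rotmx Q *m x = rotmx Q *m y -> x = y.
  by move=> /(congr1 (mulmx (rotmx Q)^T)); rewrite !mulmxA rot_trmul// !mul1mx.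
apply: inj; rewrite /zg mulmxN -scalemxAr mulmxA rot_multr// mul1mx /Gg.
rewrite -sum_cross_rot /z_gamma mulmx_sumr -sumrN; apply: eq_bigr => i _.
rewrite -scalemxAr -scalerN; congr (_ *: _).
have eQ : rotmx Q *m body_meas r Q i = r i by rewrite /body_meas mulmxA rot_multr// mul1mx.
rewrite rot_cross// eQ crossC /body_meas (mulmxA (rotmx Q)); congr (- (_ *m (_ *m _))).
have -> : rotmx Q *m (rotmx Qh)^T = rotmx (qmul Q (qinv Qh)) => //.
have : forall x : 'cV[R]_3, rotmx (qmul Q (qinv Qh)) *m (rotmx Qh *m x) = rotmx Q *m x.
  move=> x; have h1 := rot_conj (rotmx Qh *m x) uT.
  suff e : qbar (rotmx (qmul Q (qinv Qh)) *m (rotmx Qh *m x)) = qbar (rotmx Q *m x).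
    by move: e => /(congr1 (@qvec R)); rewrite !qvec_mk.
  rewrite h1 (rot_conj x uQh) (rot_conj x uQ) qinv_mul qinvK; move: (qbar x) => X.
  rewrite -!qmulA (qmulA (qinv Qh) Qh (qmul X _)) (qmulVq uQh) qmul1q.
  by rewrite (qmulA (qinv Qh) Qh) (qmulVq uQh) qmul1q.
move=> h; apply/trmx_inj/matrixP => i' j; rewrite -[in RHS](mulmx1 (rotmx (qmul _ _))).
rewrite -(rot_multr uQh) mulmxA.
have -> : rotmx (qmul Q (qinv Qh)) *m rotmx Qh = rotmx Q.
  apply/matrixP => a b; have /matrixP/(_ a 0) := h (delta_mx b 0).
  by rewrite mulmxA -!colE mxE [RHS]mxE.
by [].
Qed.

Lemma z_rhoE (g : 'I_n -> R) (Q : quat R) : z_rho r g Q = zr (Wmx r g) Q.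
Proof. exact: sum_cross_rotT. Qed.

Variable J : 'M[R]_3.
Hypothesis J_spd : sym_posdef J.
Variables (gamma rho : 'I_n -> R).

Lemma attitude_to_closed_loop (Q Qhat : R -> quat R) (omega : R -> 'cV[R]_3) :
  attitude_system r J gamma rho Q Qhat omega ->
  closed_loop J (Wmx r gamma) (Wmx r rho)
    (fun t => (qmul (Q t) (qinv (Qhat t)), Q t, omega t)).
Proof.
move=> sys; apply/(closed_loopP _ _ J_spd) => t t0.
have [[uQ uQh] hQ hQh [dw hw hJ]] := sys t t0.
have uT := unit_qmul uQ (unit_qinv uQh).
move: hQ hQh hJ; rewrite z_gammaE// z_rhoE => hQ hQh hJ.
split=> //=.
- apply: der_eq (der_qmul hQ (der_qinv hQh)).
  have -> : qinv (2^-1 *: qmul (Qhat t) (qbar (- zg (Wmx r gamma)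
       (qmul (Q t) (qinv (Qhat t))) (Q t)))) =
       2^-1 *: qmul (qbar (zg (Wmx r gamma) (qmul (Q t) (qinv (Qhat t))) (Q t)))
                 (qinv (Qhat t)).
    have -> (a : R) (P : quat R) : qinv (a *: P) = a *: qinv P.
      by apply: quatP; rewrite /qinv !qE// scalerN.
    rewrite qinv_mul.
    have -> // (x : 'cV[R]_3) : qinv (qbar (- x)) = qbar x.
    by rewrite /qinv /qbar !qE opprK.
  rewrite qmulZl qmulZr -scalerDr -qmulA.
  rewrite -vT_cl//= (LqNrot uT) -!mulmxA [rotmx (qmul _ _) *m _]mulmxA rot_multr// mul1mx.
  rewrite -bar_qmul rot_conj// -!qmulA (qmulA (qinv _)) qmulVq// qmul1q.
  rewrite -qmulDr -qmulDl.
  have -> // (x y : 'cV[R]_3) : qbar x + qbar y = qbar (x + y).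
  by apply: quatP; rewrite /qbar !qE ?addr0.
- by apply: der_eq hQ; rewrite qmul_bar.
- apply: der_eq hw.
  rewrite /vw -[_ + _ + _]addrA addrC -hJ mulmxA mulVmx ?posdef_unitmx// mul1mx //.
Qed.

Lemma closed_loop_to_attitude (s : R -> cl_state R) :
  closed_loop J (Wmx r gamma) (Wmx r rho) s ->
  attitude_system r J gamma rho (fun t => (s t).1.2)
    (fun t => qmul (qinv (s t).1.1) (s t).1.2) (fun t => (s t).2).
Proof.
move=> /(closed_loopP _ _ J_spd) cl t t0.
have [[uT uQ] hT hQ hw] := cl t t0.
have uQh := unit_qmul (unit_qinv uT) uQ.
rewrite z_gammaE// z_rhoE qinv_mul qinvK qmulA qmulqV// qmul1q.
split=> //.
- by rewrite qmul_bar.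
- apply: der_eq (der_qmul (der_qinv hT) hQ).
  rewrite -vT_cl// (LqNrot uT) -!mulmxA [rotmx (s t).1.1 *m _]mulmxA rot_multr// mul1mx.
  rewrite -bar_qmul.
  have -> (a : R) (P : quat R) : qinv (a *: P) = a *: qinv P.
    by apply: quatP; rewrite /qinv !qE// scalerN.
  rewrite qinv_mul qmulZl -!qmulA.
  have -> (x : 'cV[R]_3) : qinv (qbar x) = qbar (- x).
    by rewrite /qinv /qbar !qE.
  rewrite -mulmxN rot_bar// /vQ -qmul_bar qmulZr -scalerDr; congr (_ *: _).
  rewrite -!qmulDr.
  have -> // (x y : 'cV[R]_3) : qbar (- (x + y)) + qbar x = qbar (- y).
  by apply: quatP; rewrite /qbar !qE ?addr0// opprD addrAC addNr add0r.
- exists (vw J (Wmx r gamma) (Wmx r rho) (s t).1.1 (s t).1.2 (s t).2) => //.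
  by rewrite mulJ_vw// -addrA addrC.
Qed.

End AttitudeSystem.


(** * Calculus of locally Lipschitz functions *)

Section LocallyLipschitz.
Variables (R : realType) (V : normedModType R).
Implicit Types (g h : V -> R).

(** Lipschitz on bounded sets: closed under products, unlike the global condition, and
    enough for polynomial fields after truncation to a box. *)
Definition lipB g := forall r : R, exists2 L : R, 0 <= L &
  forall x y, `|x| <= r -> `|y| <= r -> `|g x - g y| <= L * `|x - y|.

Definition lipM m n (G : V -> 'M[R]_(m, n)) := forall i j, lipB (fun x => G x i j).

Lemma lipB_bounded g : lipB g -> forall r : R, exists2 M : R, 0 <= M &
  forall x, `|x| <= r -> `|g x| <= M.
Proof.
move=> lg r; have [L L0 hL] := lg `|r|.
exists (L * `|r| + `|g 0|); first by rewrite addr_ge0// mulr_ge0.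
move=> x xr; have xr' : `|x| <= `|r| by rewrite (le_trans xr)// ler_norm.
rewrite -[g x](subrK (g 0)); apply: le_trans (ler_normD _ _) _; rewrite lerD2r.
apply: le_trans (hL x 0 xr' _) _; first by rewrite normr0.
by rewrite subr0 ler_wpM2l.
Qed.

Lemma lipB_ext g h : g =1 h -> lipB g -> lipB h.
Proof. by move=> /funext ->. Qed.

Lemma lipB_cst a : lipB (fun=> a).
Proof. by move=> r; exists 0 => // x y _ _; rewrite subrr normr0 mul0r. Qed.

Lemma lipB_add g h : lipB g -> lipB h -> lipB (fun x => g x + h x).
Proof.
move=> lg lh r; have [L L0 hL] := lg r; have [M M0 hM] := lh r.
exists (L + M) => [|x y xr yr]; first exact: addr_ge0.
rewrite opprD addrACA mulrDl; apply: le_trans (ler_normD _ _) _.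
by rewrite lerD ?hL ?hM.
Qed.

Lemma lipB_opp g : lipB g -> lipB (fun x => - g x).
Proof.
move=> lg r; have [L L0 hL] := lg r; exists L => // x y xr yr.
by rewrite -opprD normrN hL.
Qed.

Lemma lipB_sub g h : lipB g -> lipB h -> lipB (fun x => g x - h x).
Proof. by move=> lg lh; apply: lipB_add => //; exact: lipB_opp. Qed.

Lemma lipB_mul g h : lipB g -> lipB h -> lipB (fun x => g x * h x).
Proof.
move=> lg lh r; have [L L0 hL] := lg r; have [M M0 hM] := lh r.
have [A A0 hA] := lipB_bounded lg r; have [B B0 hB] := lipB_bounded lh r.
exists (A * M + B * L) => [|x y xr yr]; first by rewrite addr_ge0// mulr_ge0.
have -> : g x * h x - g y * h y = g x * (h x - h y) + h y * (g x - g y) by ring.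
apply: le_trans (ler_normD _ _) _; rewrite mulrDl !normrM -!mulrA.
by rewrite lerD// ler_pM ?hA ?hB ?hL ?hM.
Qed.

Lemma lipB_sum (I : Type) (s : seq I) (G : I -> V -> R) :
  (forall i, lipB (G i)) -> lipB (fun x => \sum_(i <- s) G i x).
Proof.
move=> lG; elim: s => [|i s IH].
  by apply: lipB_ext (lipB_cst 0) => x; rewrite big_nil.
by apply: lipB_ext (lipB_add (lG i) IH) => x; rewrite big_cons.
Qed.

Lemma lipB_inv g (k : R) : 0 < k -> (forall x, k <= g x) -> lipB g ->
  lipB (fun x => (g x)^-1).
Proof.
move=> k0 gk lg r; have [L L0 hL] := lg r.
exists (L / k ^+ 2) => [|x y xr yr]; first by rewrite divr_ge0// exprn_ge0// ltW.
have gx0 : 0 < g x by exact: lt_le_trans (gk x).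
have gy0 : 0 < g y by exact: lt_le_trans (gk y).
have -> : (g x)^-1 - (g y)^-1 = (g y - g x) / (g x * g y).
  by field; rewrite !gt_eqF.
have -> : `|(g y - g x) / (g x * g y)| = `|g x - g y| * (g x * g y)^-1.
  by rewrite normrM distrC [X in _ * X]ger0_norm// invr_ge0 mulr_ge0// ltW.
rewrite mulrAC; apply: ler_pM => //; first by rewrite invr_ge0 mulr_ge0// ltW.
  exact: hL.
rewrite lef_pV2 ?posrE ?mulr_gt0 ?exprn_gt0// expr2.
by apply: ler_pM; rewrite ?gk// ltW.
Qed.

(** With a positive k this makes denominators harmless. *)
Lemma lipB_max g (k : R) : lipB g -> lipB (fun x => Num.max (g x) k).
Proof.
move=> lg r; have [L L0 hL] := lg r; exists L => // x y xr yr.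
apply: le_trans (hL x y xr yr).
rewrite !maxEle; case: ifP => h1; case: ifP => h2.
- by rewrite subrr normr0.
- move/negbT: h2; rewrite -ltNge => h2.
  rewrite distrC (distrC (g x)) !ger0_norm; lra.
- move/negbT: h1; rewrite -ltNge => h1.
  rewrite !ger0_norm; lra.
- by [].
Qed.

Lemma lipB_continuous g : lipB g -> continuous g.
Proof.
move=> lg x; apply: continuous_dist => e e0.
have [L L0 hL] := lg (`|x| + 1).
exists (Num.min 1 (e / (L + 1))).
  by rewrite lt_min ltr01 divr_gt0// ltr_wpDl.
move=> y; rewrite lt_min => /andP[y1 ye].
have hx : `|x| <= `|x| + 1 by rewrite lerDl.
have hy : `|y| <= `|x| + 1.
  have := ler_normB x (x - y); rewrite opprB addrCA subrr addr0; lra.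
apply: le_lt_trans (hL x y hx hy) _.
have L1 : 0 < L + 1 by rewrite ltr_wpDl.
have : `|x - y| * (L + 1) < e by rewrite -ltr_pdivlMr.
have : 0 <= `|x - y| by []; nra.
Qed.

Lemma lipM_ext m n (G H : V -> 'M[R]_(m, n)) : G =1 H -> lipM G -> lipM H.
Proof. by move=> /funext ->. Qed.

Lemma lipM_cst m n (A : 'M[R]_(m, n)) : lipM (fun=> A).
Proof. by move=> i j; exact: lipB_cst. Qed.

Lemma lipM_add m n (G H : V -> 'M[R]_(m, n)) :
  lipM G -> lipM H -> lipM (fun x => G x + H x).
Proof.
by move=> lG lH i j; apply: lipB_ext (lipB_add (lG i j) (lH i j)) => x; rewrite mxE.
Qed.

Lemma lipM_opp m n (G : V -> 'M[R]_(m, n)) : lipM G -> lipM (fun x => - G x).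
Proof.
by move=> lG i j; apply: lipB_ext (lipB_opp (lG i j)) => x; rewrite mxE.
Qed.

Lemma lipM_sub m n (G H : V -> 'M[R]_(m, n)) :
  lipM G -> lipM H -> lipM (fun x => G x - H x).
Proof. by move=> lG lH; apply: lipM_add => //; exact: lipM_opp. Qed.

Lemma lipM_scale m n g (G : V -> 'M[R]_(m, n)) :
  lipB g -> lipM G -> lipM (fun x => g x *: G x).
Proof.
by move=> lg lG i j; apply: lipB_ext (lipB_mul lg (lG i j)) => x; rewrite mxE.
Qed.

Lemma lipM_mul m n p (G : V -> 'M[R]_(m, n)) (H : V -> 'M[R]_(n, p)) :
  lipM G -> lipM H -> lipM (fun x => G x *m H x).
Proof.
move=> lG lH i j.
apply: lipB_ext (lipB_sum _ (fun k => lipB_mul (lG i k) (lH k j))) => x.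
by rewrite mxE.
Qed.

Lemma lipM_tr m n (G : V -> 'M[R]_(m, n)) : lipM G -> lipM (fun x => (G x)^T).
Proof. by move=> lG i j; apply: lipB_ext (lG j i) => x; rewrite mxE. Qed.

Lemma lipM_col_mx m1 m2 n (G : V -> 'M[R]_(m1, n)) (H : V -> 'M[R]_(m2, n)) :
  lipM G -> lipM H -> lipM (fun x => col_mx (G x) (H x)).
Proof.
move=> lG lH i j; case: (split_ordP i) => k ->.
  by apply: lipB_ext (lG k j) => x; rewrite col_mxEu.
by apply: lipB_ext (lH k j) => x; rewrite col_mxEd.
Qed.

Lemma lipM_usub m1 m2 n (G : V -> 'M[R]_(m1 + m2, n)) :
  lipM G -> lipM (fun x => usubmx (G x)).
Proof. by move=> lG i j; apply: lipB_ext (lG _ j) => x; rewrite mxE. Qed.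

Lemma lipM_dsub m1 m2 n (G : V -> 'M[R]_(m1 + m2, n)) :
  lipM G -> lipM (fun x => dsubmx (G x)).
Proof. by move=> lG i j; apply: lipB_ext (lG _ j) => x; rewrite mxE. Qed.

Lemma lipM_scalar n g : lipB g -> lipM (fun x => (g x)%:M : 'M[R]_n).
Proof.
move=> lg i j; case: (eqVneq i j) => ij.
  by apply: lipB_ext lg => x; rewrite mxE ij eqxx mulr1n.
by apply: lipB_ext (lipB_cst 0) => x; rewrite mxE (negbTE ij).
Qed.

Lemma lipM_cross (G : V -> 'cV[R]_3) : lipM G -> lipM (fun x => crossmx (G x)).
Proof.
move=> lG; have l0 := lG 0 0; have l1 := lG 1 0; have l2 := lG 2%:R 0.
have z : lipB (fun=> 0) by exact: lipB_cst.
elim/ord3P; elim/ord3P; [have d := z|have d := lipB_opp l2|have d := l1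
  |have d := l2|have d := z|have d := lipB_opp l0
  |have d := lipB_opp l1|have d := l0|have d := z];
  by apply: lipB_ext d => x; rewrite crossE.
Qed.

Lemma lipM_qvec (G : V -> quat R) : lipM G -> lipM (fun x => qvec (G x)).
Proof. exact: lipM_dsub. Qed.

Lemma lipB_qscal (G : V -> quat R) : lipM G -> lipB (fun x => qscal (G x)).
Proof. by move=> lG; exact: (lipM_usub lG 0 0). Qed.

Lemma lipB_dotv m (G H : V -> 'cV[R]_m) : lipM G -> lipM H ->
  lipB (fun x => dotv (G x) (H x)).
Proof. by move=> lG lH; exact: (lipM_mul (lipM_tr lG) lH 0 0). Qed.

Lemma lipM_mkquat g (G : V -> 'cV[R]_3) : lipB g -> lipM G ->
  lipM (fun x => mkquat (g x) (G x)).
Proof. by move=> lg lG; apply: lipM_col_mx => //; exact: lipM_scalar. Qed.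

Lemma lipM_Lq (G : V -> quat R) : lipM G -> lipM (fun x => Lq (G x)).
Proof.
move=> lG; apply: lipM_col_mx; first exact/lipM_opp/lipM_tr/lipM_qvec.
by apply: lipM_add; [exact/lipM_scalar/lipB_qscal|exact/lipM_cross/lipM_qvec].
Qed.

Lemma lipM_Nq (G : V -> quat R) : lipM G -> lipM (fun x => Nq (G x)).
Proof.
move=> lG; apply: lipM_col_mx; first exact/lipM_opp/lipM_tr/lipM_qvec.
by apply: lipM_sub; [exact/lipM_scalar/lipB_qscal|exact/lipM_cross/lipM_qvec].
Qed.

Lemma lipM_rotmx (G : V -> quat R) : lipM G -> lipM (fun x => rotmx (G x)).
Proof.
move=> lG; have lS := lipM_cross (lipM_qvec lG).
apply: lipM_add; first apply: lipM_add; first exact: lipM_cst.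
  apply: lipM_scale => //; apply: lipB_mul; first exact: lipB_cst.
  exact: lipB_qscal.
by apply: lipM_scale; [exact: lipB_cst|exact: lipM_mul].
Qed.

Lemma lipM_norm m n (G : V -> 'M[R]_(m, n)) : lipM G ->
  forall r : R, exists2 L : R, 0 < L &
  forall x y, `|x| <= r -> `|y| <= r -> `|G x - G y| <= L * `|x - y|.
Proof.
move=> lG r.
have /choice[L hL] : forall ij : 'I_m * 'I_n, exists L : R, 0 <= L /\
    forall x y, `|x| <= r -> `|y| <= r -> `|G x ij.1 ij.2 - G y ij.1 ij.2| <= L * `|x - y|.
  by move=> ij; have [L L0 h] := lG ij.1 ij.2 r; exists L.
have S0 : 0 <= \sum_ij L ij by apply: sumr_ge0 => ij _; have [] := hL ij.
exists (\sum_ij L ij + 1); first by rewrite ltr_wpDl.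
move=> x y xr yr; apply: mx_norm_le; first by rewrite mulr_ge0// addr_ge0.
move=> i j; rewrite !mxE; have [L0 h] := hL (i, j).
apply: le_trans (h x y xr yr) _; rewrite ler_wpM2r//.
rewrite (bigD1 (i, j))//= -addrA lerDl addr_ge0//.
by apply: sumr_ge0 => ij _; have [] := hL ij.
Qed.

Lemma lipM_bounded m n (G : V -> 'M[R]_(m, n)) : lipM G ->
  forall r : R, exists2 M : R, 0 < M & forall x, `|x| <= r -> `|G x| <= M.
Proof.
move=> lG r; have [L L0 hL] := lipM_norm lG `|r|.
have M0 : 0 < L * `|r| + `|G 0| + 1.
  by rewrite ltr_wpDl// addr_ge0// mulr_ge0// ltW.
exists (L * `|r| + `|G 0| + 1) => // x xr.
have xr' : `|x| <= `|r| by rewrite (le_trans xr)// ler_norm.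
have := hL x 0 xr'; rewrite normr0 subr0 => /(_ (normr_ge0 _)) h.
have := ler_normD (G x - G 0) (G 0); rewrite subrK.
have : L * `|x| <= L * `|r| by rewrite ler_wpM2l// ltW.
lra.
Qed.

Lemma lipM_continuous m n (G : V -> 'M[R]_(m, n)) : lipM G -> continuous G.
Proof.
move=> lG x; apply: continuous_dist => e e0.
have [L L0 hL] := lipM_norm lG (`|x| + 1).
exists (Num.min 1 (e / L)); first by rewrite lt_min ltr01 divr_gt0.
move=> y; rewrite lt_min => /andP[y1 ye].
have hx : `|x| <= `|x| + 1 by rewrite lerDl.
have hy : `|y| <= `|x| + 1.
  have := ler_normB x (x - y); rewrite opprB addrCA subrr addr0; lra.
apply: le_lt_trans (hL x y hx hy) _.
by rewrite mulrC -ltr_pdivlMr.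
Qed.

End LocallyLipschitz.

Lemma lipM_id (R : realType) m n : lipM (fun x : 'M[R]_(m, n) => x).
Proof.
move=> i j r; exists 1 => // x y _ _; rewrite mul1r.
by have := mx_norm_ge (x - y) i j; rewrite !mxE.
Qed.

Section Clip.
Variables (R : realType) (m : nat).

(** Truncation to a box makes a polynomial field globally Lipschitz without changing
    it inside. *)
Definition clip (r : R) (x : 'cV[R]_m) : 'cV[R]_m :=
  \col_i Num.max (- r) (Num.min r (x i 0)).

Lemma clip_norm r x : 0 <= r -> `|clip r x| <= r.
Proof.
move=> r0; apply: mx_norm_le => // i j; rewrite mxE ler_norml le_max lexx/=.
by rewrite ge_max ge_min lexx/= andbT (le_trans _ r0)// oppr_le0.
Qed.

Lemma clip_id r x : `|x| <= r -> clip r x = x.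
Proof.
move=> xr; apply/matrixP => i j; rewrite mxE (ord1 j).
have := le_trans (mx_norm_ge x i 0) xr; rewrite ler_norml => /andP[h1 h2].
by rewrite (min_idPr h2) (max_idPr h1).
Qed.

Lemma clip_lip r x y : `|clip r x - clip r y| <= `|x - y|.
Proof.
apply: mx_norm_le => // i j; rewrite !mxE.
have := mx_norm_ge (x - y) i 0; rewrite !mxE; apply: le_trans.
move: (x i 0) (y i 0) => a b.
rewrite !maxEle !minEle.
case: (leP r a) => h1; case: (leP r b) => h2; case: (leP (- r) _) => h3; try (case: (leP (- r) _) => h4);
  rewrite ler_norml; apply/andP; split;
  have := ler_norm (a - b); have := ler_norm (b - a); rewrite (distrC b); lra.
Qed.

Lemma clip_field (F : 'cV[R]_m -> 'cV[R]_m) r : lipM F -> 0 <= r ->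
  exists2 L : R, 0 < L & forall x y, `|F (clip r x) - F (clip r y)| <= L * `|x - y|.
Proof.
move=> lF r0; have [L L0 hL] := lipM_norm lF r.
exists L => // x y; apply: le_trans (hL _ _ (clip_norm _ r0) (clip_norm _ r0)) _.
by rewrite ler_wpM2l ?clip_lip// ltW.
Qed.

End Clip.


(** * Symmetric matrices and the weighted matrices of the vectors r *)

Section Orthonormal.
Variables (R : realType) (n : nat).
Implicit Types (v : 'I_n -> 'cV[R]_n) (x y : 'cV[R]_n).

Definition orthonormal v := forall i j, dotv (v i) (v j) = (i == j)%:R.

Lemma orthonormal_expand v x : orthonormal v ->
  x = \sum_i dotv (v i) x *: v i.
Proof.
move=> ov; pose P : 'M[R]_n := \matrix_(i, j) v j i 0.
have PP : P^T *m P = 1%:M.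
  apply/matrixP => i j; rewrite !mxE -(ov i j) dotvE.
  by apply: eq_bigr => k _; rewrite !mxE.
have PP' := mulmx1C PP.
rewrite -{1}[x]mul1mx -PP' -mulmxA; apply/matrixP => i j.
rewrite mxE summxE; apply: eq_bigr => k _; rewrite (ord1 j) !mxE mulrC; congr (_ * _).
by rewrite dotvE; apply: eq_bigr => l _; rewrite !mxE.
Qed.

Lemma orthonormal_dotv v x y : orthonormal v ->
  dotv x y = \sum_i dotv (v i) x * dotv (v i) y.
Proof.
move=> ov; rewrite {1}(orthonormal_expand x ov) dotv_suml.
by apply: eq_bigr => i _; rewrite dotvZl.
Qed.

Lemma eigen_coord (A : 'M[R]_n) v (l : 'I_n -> R) x i : A^T = A ->
  A *m v i = l i *: v i -> dotv (v i) (A *m x) = l i * dotv (v i) x.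
Proof. by move=> sA e; rewrite dotv_mulr sA e dotvZl. Qed.

End Orthonormal.

Section Spectral.
Variables (R : realType) (n : nat).
Implicit Types (x y : 'cV[R]_n).

(** Maximise the quadratic form on the compact set of unit vectors orthogonal to the
    known eigenvectors. At a maximum v the residual A v - m v is again admissible, and
    moving v in its direction would increase the form to first order. *)
Lemma rayleigh_eigenvector (A : 'M[R]_n) (L : seq 'cV[R]_n) : A^T = A ->
  (forall l, l \in L -> exists m : R, A *m l = m *: l) ->
  (exists2 u : 'cV[R]_n, u != 0 & forall l, l \in L -> dotv l u = 0) ->
  exists v : 'cV[R]_n, [/\ dotv v v = 1, (forall l, l \in L -> dotv l v = 0) &
    exists m : R, A *m v = m *: v].
Proof.
move=> sA eL [u0 u00 u0L].
pose S := [set x : 'rV[R]_n | dotv x^T x^T = 1 /\ forall l, l \in L -> dotv l x^T = 0].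
have lid : lipM (fun x : 'rV[R]_n => x^T) by apply: lipM_tr; exact: lipM_id.
have nS : S !=set0.
  exists ((enorm u0)^-1 *: u0)^T; split; rewrite !trmxK; last first.
    by move=> l lL; rewrite dotvZr u0L// mulr0.
  rewrite dotvZl dotvZr mulrA -expr2 exprVn enorm_sqr mulVf// gt_eqF//.
  by rewrite dotv_gt0.
have cS : compact S.
  apply: bounded_closed_compact.
    exists 1; split; first exact: num_real.
    move=> M M1 x [x1 _] /=; apply: le_trans (ltW M1).
    have := mxnorm_le_enorm x^T; rewrite /enorm x1 sqrtr1; apply: le_trans.
    apply: mx_norm_le => // i j; by have := mx_norm_ge x^T j i; rewrite mxE.
  have -> : S = [set x | dotv x^T x^T = 1] `&`
      \bigcap_(l in [set l | l \in L]) [set x | dotv l x^T = 0].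
    by apply/seteqP; split=> x /= [h1 h2]; split=> // l; exact: h2.
  apply: closedI.
    apply: (@preimage_closed _ _ (fun x : 'rV[R]_n => dotv x^T x^T) [set 1]).
      by move=> x _; apply: lipB_continuous; exact: lipB_dotv.
    exact: (@closed_eq R).
  apply: closed_bigI => l _.
  apply: (@preimage_closed _ _ (fun x : 'rV[R]_n => dotv l x^T) [set 0]).
    by move=> x _; apply: lipB_continuous; apply: lipB_dotv => //; exact: lipM_cst.
  exact: (@closed_eq R).
have cf : continuous (fun x : 'rV[R]_n => dotv x^T (A *m x^T)).
  by apply: lipB_continuous; apply: lipB_dotv => //; apply: lipM_mul => //; exact: lipM_cst.
have [w wS wmax] := compact_EVT_max nS cS (continuous_subspaceT cf).
move: wS; rewrite inE => -[w1 wL].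
pose v := w^T; pose m := dotv v (A *m v).
exists v; split=> //; exists m.
have [u ue] : exists u : 'cV[R]_n, u = A *m v - m *: v by exists (A *m v - m *: v).
have uL l : l \in L -> dotv l u = 0.
  move=> lL; have [a la] := eL l lL.
  by rewrite ue dotvBr dotvZr dotv_mulr sA la dotvZl wL// !mulr0 subrr.
have uv : dotv u v = 0.
  by rewrite ue dotvBl dotvZl -/v w1 mulr1 dotvC -/m subrr.
have uAv : dotv u (A *m v) = dotv u u.
  by rewrite -[in LHS](subrK (m *: v) (A *m v)) -ue dotvDr dotvZr uv mulr0 addr0.
apply/eqP; rewrite -subr_eq0 -ue -dotv_eq0; apply/eqP.
have ineq (s : R) : 2 * s * dotv u u <= s ^+ 2 * (m * dotv u u - dotv u (A *m u)).
  pose y := v + s *: u.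
  have yy : dotv y y = 1 + s ^+ 2 * dotv u u.
    rewrite /y !(dotvDl, dotvDr, dotvZl, dotvZr) [dotv v u]dotvC uv -/v w1; ring.
  have y0 : 0 < dotv y y by rewrite yy ltr_wpDr// mulr_ge0 ?sqr_ge0 ?dotv_ge0.
  have yS : ((enorm y)^-1 *: y)^T \in S.
    rewrite inE; split; rewrite !trmxK.
      by rewrite dotvZl dotvZr mulrA -expr2 exprVn enorm_sqr mulVf// gt_eqF.
    by move=> l lL; rewrite dotvZr /y dotvDr dotvZr wL// uL// mulr0 addr0 mulr0.
  have := wmax _ yS; rewrite !trmxK -/v -/m -scalemxAr dotvZl dotvZr mulrA -expr2.
  rewrite exprVn enorm_sqr mulrC ler_pdivrMr// yy.
  rewrite /y !(mulmxDr, dotvDl, dotvDr, dotvZl, dotvZr) -!scalemxAr !dotvZr -/m uAv.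
  have -> : dotv v (A *m u) = dotv u u by rewrite dotv_mulr sA dotvC uAv.
  lra.
have d0 := dotv_ge0 u.
set d := dotv u u in d0 ineq *; set k := m * d - _ in ineq.
case: (leP d 0) => [dl|dg]; first by apply/eqP; rewrite eq_le dl.
have k0 : 0 < k by have := ineq 1; rewrite mulr1 expr1n mul1r; lra.
have := ineq (d / k); rewrite expr2.
have -> : d / k * (d / k) * k = d / k * d by field; rewrite gt_eqF.
have : 0 < d / k * d by rewrite mulr_gt0// divr_gt0.
lra.
Qed.

Lemma orthogonal_nonzero (L : seq 'cV[R]_n) : (size L < n)%N ->
  exists2 u : 'cV[R]_n, u != 0 & forall l, l \in L -> dotv l u = 0.
Proof.
move=> sL; pose M : 'M[R]_(n, size L) := \matrix_(i, j) (nth 0 L j) i 0.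
have : kermx M != 0.
  rewrite -mxrank_eq0 mxrank_ker -lt0n subn_gt0.
  exact: leq_ltn_trans (rank_leq_col M) sL.
move=> /rowV0Pn[u /sub_kermxP uM u0]; exists u^T.
  by apply: contra_neq u0 => e; rewrite -[u]trmxK e trmx0.
move=> l lL; have il : (index l L < size L)%N by rewrite index_mem.
have /matrixP/(_ 0 (Ordinal il)) := uM; rewrite !mxE => <-.
by rewrite dotvE; apply: eq_bigr => i _; rewrite !mxE /= nth_index// mulrC.
Qed.

Theorem spectral_symmetric (A : 'M[R]_n) : A^T = A ->
  exists v : 'I_n -> 'cV[R]_n, exists l : 'I_n -> R,
    orthonormal v /\ forall i, A *m v i = l i *: v i.
Proof.
move=> sA.
have step k : (k <= n)%N -> exists L : seq 'cV[R]_n, [/\ size L = k,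
    (forall i j, (i < k)%N -> (j < k)%N -> dotv (nth 0 L i) (nth 0 L j) = (i == j)%:R) &
    (forall l, l \in L -> exists m : R, A *m l = m *: l)].
  elim: k => [|k IH] kn; first by exists [::].
  have [L [sL oL eL]] := IH (ltnW kn).
  have [|v [v1 vL ev]] := rayleigh_eigenvector sA eL.
    by apply: orthogonal_nonzero; rewrite sL.
  exists (rcons L v); split; first by rewrite size_rcons sL.
    move=> i j; rewrite !ltnS !nth_rcons sL => ik jk.
    have vi m : (m < k)%N -> dotv (nth 0 L m) v = 0.
      by move=> mk; rewrite vL// mem_nth// sL.
    move: ik; rewrite leq_eqVlt => /orP[/eqP ->|ik];
      move: jk; rewrite leq_eqVlt => /orP[/eqP ->|jk]; rewrite ?ltnn ?eqxx ?ik ?jk.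
    - exact: v1.
    - by rewrite dotvC vi// eq_sym (ltn_eqF jk).
    - by rewrite vi// (ltn_eqF ik).
    - exact: oL.
  move=> l; rewrite mem_rcons inE => /orP[/eqP ->//|]; exact: eL.
have [L [sL oL eL]] := step n (leqnn n).
have /choice[l hl] : forall i : 'I_n, exists m : R, A *m nth 0 L i = m *: nth 0 L i.
  by move=> i; apply: eL; rewrite mem_nth// sL.
by exists (fun i => nth 0 L i), l; split=> // i j; rewrite oL.
Qed.

End Spectral.

Section SpectralEstimates.
Variables (R : realType) (n : nat) (A : 'M[R]_n) (v : 'I_n -> 'cV[R]_n) (l : 'I_n -> R).
Hypotheses (sA : A^T = A) (ov : orthonormal v) (ev : forall i, A *m v i = l i *: v i).

Implicit Types x : 'cV[R]_n.

Lemma dotv_sq x : dotv x x = \sum_i dotv (v i) x ^+ 2.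
Proof. by rewrite (orthonormal_dotv _ _ ov); apply: eq_bigr => i _; rewrite expr2. Qed.

Lemma quadform_sum x : dotv x (A *m x) = \sum_i l i * dotv (v i) x ^+ 2.
Proof.
rewrite (orthonormal_dotv _ _ ov); apply: eq_bigr => i _.
by rewrite (eigen_coord x sA (ev i)) mulrCA expr2.
Qed.

Lemma shift_coord (a : R) x i :
  dotv (v i) (A *m x - a *: x) = (l i - a) * dotv (v i) x.
Proof. by rewrite dotvBr dotvZr (eigen_coord x sA (ev i)) mulrBl. Qed.

Lemma shift_quadform (a : R) x :
  dotv x (A *m x - a *: x) = \sum_i (l i - a) * dotv (v i) x ^+ 2.
Proof.
rewrite (orthonormal_dotv _ _ ov); apply: eq_bigr => i _.
by rewrite shift_coord mulrCA expr2.
Qed.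

Lemma shift_norm (a : R) x : dotv (A *m x - a *: x) (A *m x - a *: x) =
  \sum_i (l i - a) ^+ 2 * dotv (v i) x ^+ 2.
Proof.
rewrite dotv_sq; apply: eq_bigr => i _.
by rewrite shift_coord exprMn.
Qed.

(** Both sides are sums over eigencoordinates, of l_i - a and of (l_i - a)^2, and both
    omit the eigenspace of a; only finitely many ratios |l_i - a|^-1 occur. *)
Lemma shift_quadform_le (a : R) : exists2 C : R, 0 < C & forall x,
  `|dotv x (A *m x - a *: x)| <= C * dotv (A *m x - a *: x) (A *m x - a *: x).
Proof.
pose C := \sum_i `|l i - a|^-1 + 1.
have C0 : 0 < C by rewrite ltr_wpDl// sumr_ge0// => i _; rewrite invr_ge0.
exists C => // x; rewrite shift_quadform shift_norm mulr_sumr.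
apply: le_trans (ler_norm_sum _ _ _) _; apply: ler_sum => i _.
rewrite normrM [`|_ ^+ 2|]ger0_norm ?sqr_ge0// mulrA ler_wpM2r ?sqr_ge0//.
case: (eqVneq (l i - a) 0) => [->|d0]; first by rewrite normr0 expr0n mulr0.
rewrite -(real_normK (num_real (l i - a))) expr2 mulrA ler_peMl//.
rewrite -ler_pdivrMr ?normr_gt0// div1r /C (bigD1 i)//= -addrA lerDl.
by rewrite addr_ge0// sumr_ge0// => k _; rewrite invr_ge0.
Qed.

(** Off the one-dimensional eigenspace all (l_i - l_k)^2 are bounded below. *)
Lemma shift_simple_le (k : 'I_n) : (forall i, l i = l k -> i = k) ->
  exists2 b : R, 0 < b & forall x,
    b * (dotv x x - dotv (v k) x ^+ 2) <=
    dotv (A *m x - l k *: x) (A *m x - l k *: x).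
Proof.
move=> simple.
pose b := (\sum_(i | i != k) (l i - l k) ^- 2 + 1)^-1.
have s0 : 0 <= \sum_(i | i != k) (l i - l k) ^- 2.
  by apply: sumr_ge0 => i _; rewrite invr_ge0 sqr_ge0.
have b0 : 0 < b by rewrite invr_gt0 ltr_wpDl.
exists b => // x; rewrite shift_norm dotv_sq (bigD1 k)//= addrAC subrr add0r.
rewrite [leRHS](bigD1 k)//= subrr expr0n mul0r add0r mulr_sumr.
apply: ler_sum => i ik; rewrite ler_wpM2r ?sqr_ge0//.
have d0 : 0 < (l i - l k) ^+ 2.
  by rewrite lt_def sqr_ge0 andbT sqrf_eq0 subr_eq0; apply: contra ik => /eqP/simple ->.
rewrite /b -[leRHS]invrK lef_pV2 ?posrE ?invr_gt0 ?ltr_wpDl//.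
rewrite (bigD1 i)//= -addrA lerDl addr_ge0// sumr_ge0// => j _.
by rewrite invr_ge0 sqr_ge0.
Qed.

Lemma eigenvalue_among (a : R) (x : 'cV[R]_n) : x != 0 -> A *m x = a *: x -> exists i, l i = a.
Proof.
move=> x0 ex; have : 0 < dotv x x by rewrite dotv_gt0.
rewrite dotv_sq => h; have [i hi] : exists i, dotv (v i) x != 0.
  apply/existsP; apply: contraTT h => /existsPn h.
  by rewrite big1 ?ltxx// => i _; have /negPn/eqP -> := h i; rewrite expr0n.
exists i; have := shift_coord a x i; rewrite ex subrr dotv0r => /esym/eqP.
by rewrite mulf_eq0 (negbTE hi) orbF subr_eq0 => /eqP.
Qed.

End SpectralEstimates.

Lemma cross_norm (R : realType) (x y : 'cV[R]_3) :
  dotv (crossmx x *m y) (crossmx x *m y) = dotv x x * dotv y y - dotv x y ^+ 2.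
Proof. by rewrite !dotv3 !mulmx3E !crossE; ring. Qed.

Section WeightedMatrices.
Variables (R : realType) (n : nat) (r : 'I_n -> 'cV[R]_3) (g : 'I_n -> R).
Hypotheses (r_noncollinear : exists i j : 'I_n, ~ collinear (r i) (r j))
  (g_pos : forall i, 0 < g i).

Lemma Wmx_quadform (x : 'cV[R]_3) : dotv x (Wmx r g *m x) =
  \sum_i g i * dotv (crossmx (r i) *m x) (crossmx (r i) *m x).
Proof.
rewrite Wmx_mul dotv_sumr; apply: eq_bigr => i _.
rewrite dotvZr; congr (_ * _).
by rewrite dotv_mulr cross_tr [crossmx x *m _]crossC mulNmx dotvNl dotvNr opprK.
Qed.

Lemma cross_eq0_collinear (x y : 'cV[R]_3) : x != 0 ->
  crossmx y *m x = 0 -> exists a : R, y = a *: x.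
Proof.
move=> x0 h; exists (dotv x y / dotv x x).
have e : dotv x x *: y - dotv x y *: x = crossmx (crossmx x *m y) *m x.
  by mx3.
move: e; rewrite [crossmx x *m y]crossC h oppr0 cross0 mul0mx => /eqP.
rewrite subr_eq0 => /eqP e.
have xx : dotv x x != 0 by rewrite dotv_eq0.
by rewrite mulrC -scalerA -e scalerA mulVf// scale1r.
Qed.

(** The form vanishes at x only if all r_i are parallel to x. *)
Lemma Wmx_posdef : sym_posdef (Wmx r g).
Proof.
split; first exact: Wmx_sym.
move=> x x0; rewrite Wmx_quadform lt_def sumr_ge0 ?andbT => [|i _]; last first.
  by rewrite mulr_ge0 ?dotv_ge0// ltW.
apply/negP => /eqP h0; have h i : g i * dotv (crossmx (r i) *m x) (crossmx (r i) *m x) = 0.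
  by apply: (psumr_eq0P _ h0) => // k _; rewrite mulr_ge0 ?dotv_ge0// ltW.
have c i : exists a : R, r i = a *: x.
  apply: cross_eq0_collinear => //; apply/eqP; rewrite -dotv_eq0.
  by have /eqP := h i; rewrite mulf_eq0 gt_eqF ?g_pos// => /eqP.
have [i [j nc]] := r_noncollinear; apply: nc.
have [a ea] := c i; have [b eb] := c j.
case: (eqVneq a 0) => [a0|a0].
  exists 1, 0; split; first by left; exact: oner_neq0.
  by rewrite ea a0 scale0r scaler0 scale0r addr0.
exists (- b), a; split; first by right.
by rewrite ea eb !scalerA mulNr scaleNr mulrC addNr.
Qed.

(** W is the sum of the g_i (|r_i|^2 - r_i r_i^T), the inertia matrix of point masses:
    an eigenvalue is a sum of squared distances to an axis, hence at most the sum of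
    the other two. *)
Lemma Wmx_triangle (v : 'I_3 -> 'cV[R]_3) (l : 'I_3 -> R) (i j k : 'I_3) :
  orthonormal v -> (forall m, Wmx r g *m v m = l m *: v m) ->
  i != j -> i != k -> j != k -> l k <= l i + l j.
Proof.
move=> ov ev ij ik jk.
have lE m : l m = \sum_a g a * (dotv (r a) (r a) - dotv (v m) (r a) ^+ 2).
  have := Wmx_quadform (v m); rewrite ev dotvZr ov eqxx mulr1 => ->.
  apply: eq_bigr => a _; congr (_ * _).
  by rewrite cross_norm ov eqxx mulr1 [dotv (r a) (v m)]dotvC.
have rr a : dotv (r a) (r a) = dotv (v i) (r a) ^+ 2 + dotv (v j) (r a) ^+ 2 + dotv (v k) (r a) ^+ 2.
  rewrite (dotv_sq ov) sum3.
  by move: i j k ij ik jk; elim/ord3P; elim/ord3P; elim/ord3P => // _ _ _; ring.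
rewrite !lE -big_split/=; apply: ler_sum => a _; rewrite -mulrDr ler_wpM2l ?(ltW (g_pos a))//.
rewrite rr; have := sqr_ge0 (dotv (v k) (r a)); lra.
Qed.

End WeightedMatrices.

Section QuaternionSpectrum.
Variables (R : realType) (n : nat) (r : 'I_n -> 'cV[R]_3) (g : 'I_n -> R).
Hypotheses (r_noncollinear : exists i j : 'I_n, ~ collinear (r i) (r j))
  (g_pos : forall i, 0 < g i).
Let W := Wmx r g.

(** Spectral data of diag (0, W). The eigenvalue 0 belongs to the poles, that is to
    the desired attitude, and is simple. By the triangle inequality a repeated
    eigenvalue is at least a quarter of the trace; this makes the compression of
    volume near its eigenspace integrable. *)
Record quat_spectrum (u : 'I_(1 + 3) -> quat R) (b : 'I_(1 + 3) -> R) : Prop := {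
  qs_on : orthonormal u;
  qs_eig : forall i, Bq W *m u i = b i *: u i;
  qs_u0 : u ord0 = mkquat 1 0;
  qs_b0 : b ord0 = 0;
  qs_vec : forall i, i != ord0 -> qscal (u i) = 0;
  qs_pos : forall i, i != ord0 -> 0 < b i;
  qs_rep : forall i j, i != j -> b i = b j -> \sum_k b k <= 4 * b i
}.

Lemma quat_spectrum_exists : exists u b, quat_spectrum u b.
Proof.
have [sW pW] : sym_posdef W := Wmx_posdef r_noncollinear g_pos.
have [v [l [ov ev]]] := spectral_symmetric sW.
have lpos i : 0 < l i.
  have v0 : v i != 0 by rewrite -dotv_gt0 ov eqxx ltr01.
  by have := pW _ v0; rewrite ev dotvZr ov eqxx mulr1.
pose u (i : 'I_(1 + 3)) := match fintype.split i with
  | inl _ => mkquat 1 0 | inr k => mkquat 0 (v k) end.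
pose b (i : 'I_(1 + 3)) := match fintype.split i with inl _ => 0 | inr k => l k end.
have ul k : u (lshift 3 k) = mkquat 1 0 by rewrite /u (unsplitK (inl k)).
have ur k : u (rshift 1 k) = mkquat 0 (v k) by rewrite /u (unsplitK (inr k)).
have bl k : b (lshift 3 k) = 0 by rewrite /b (unsplitK (inl k)).
have br k : b (rshift 1 k) = l k by rewrite /b (unsplitK (inr k)).
have e0 : ord0 = lshift 3 (ord0 : 'I_1) by apply: val_inj.
have case4 (P : 'I_(1 + 3) -> Prop) : P ord0 -> (forall k, P (rshift 1 k)) -> forall i, P i.
  move=> p0 pr i; case: (split_ordP i) => k -> //.
  by rewrite (ord1 k) -[lshift _ _]e0.
have n0 k : rshift 1 (k : 'I_3) != (ord0 : 'I_(1 + 3)).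
  by apply/eqP => /(congr1 val).
exists u, b; split.
- elim/case4 => [|i]; elim/case4 => [|j].
  + by rewrite e0 ul dotv_quat !qE dotv0l mulr1 addr0 eqxx.
  + by rewrite {1}e0 ul ur dotv_quat !qE dotv0l mulr0 addr0 eq_sym (negbTE (n0 j)).
  + by rewrite {1}e0 ul ur dotv_quat !qE dotv0r mul0r addr0 (negbTE (n0 i)).
  + by rewrite !ur dotv_quat !qE mul0r add0r ov eq_rshift.
- elim/case4 => [|i]; first by rewrite e0 ul bl Bq_mul !qE mulmx0 scale0r;
    apply: quatP; rewrite !qE ?qscal0 ?qvec0.
  by rewrite ur br Bq_mul !qE ev; apply: quatP; rewrite !qE ?mulr0.
- by rewrite e0 ul.
- by rewrite e0 bl.
- by elim/case4 => [|i _]; rewrite ?eqxx// ur qE.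
- by elim/case4 => [|i _]; rewrite ?eqxx// br.
- have sb : \sum_k b k = l 0 + l 1 + l 2%:R.
    rewrite big_split_ord/= big_ord1 bl add0r -(sum3 l).
    by apply: eq_bigr => k _; rewrite br.
  elim/case4 => [|i]; elim/case4 => [|j].
  + by rewrite eqxx.
  + by rewrite e0 bl br => _ /eqP; rewrite lt_eqF.
  + by rewrite e0 bl br => _ /eqP; rewrite gt_eqF.
  rewrite eq_rshift !br sb => ij lij.
  have tri := Wmx_triangle g_pos ov ev.
  have t0 := tri 1 2%:R 0; have t1 := tri 0 2%:R 1; have t2 := tri 0 1 2%:R.
  have {}t0 := t0 isT isT isT; have {}t1 := t1 isT isT isT; have {}t2 := t2 isT isT isT.
  by move: i j ij lij; elim/ord3P; elim/ord3P => // _ lij; lra.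
Qed.

(** The infimum is over the positive eigenvalues of diag (0, W). *)
Lemma lambda_min_pos : 0 < lambda_min W.
Proof.
have [sW pW] : sym_posdef W := Wmx_posdef r_noncollinear g_pos.
have [v [l [ov ev]]] := spectral_symmetric sW.
have lpos i : 0 < l i.
  have v0 : v i != 0 by rewrite -dotv_gt0 ov eqxx ltr01.
  by have := pW _ v0; rewrite ev dotvZr ov eqxx mulr1.
pose m := Num.min (l 0) (Num.min (l 1) (l 2%:R)).
have m0 : 0 < m by rewrite !lt_min !lpos.
apply: lt_le_trans m0 _; apply: lb_le_inf.
  exists (l 0); apply/eigenvalueP; exists (v 0)^T.
    by rewrite -[in LHS]sW -trmx_mul ev linearZ.
  have : v 0 != 0 by rewrite -dotv_gt0 ov eqxx ltr01.
  by apply: contra_neq => e; rewrite -[v 0]trmxK e trmx0.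
move=> a /= /eigenvalueP[x xa x0].
have : W *m x^T = a *: x^T by rewrite -[in LHS]sW -trmx_mul xa linearZ.
move=> /(eigenvalue_among sW ov ev)[|i <-].
  by apply: contra_neq x0 => e; rewrite -[x]trmxK e trmx0.
by move: i; elim/ord3P; rewrite /m !ge_min lexx ?orbT.
Qed.

Lemma lambda_min_le (a : R) (x : 'cV[R]_3) : x != 0 -> W *m x = a *: x -> lambda_min W <= a.
Proof.
move=> x0 ex.
have [sW pW] : sym_posdef W := Wmx_posdef r_noncollinear g_pos.
apply: ge_inf; last first.
  apply/eigenvalueP; exists x^T; first by rewrite -[in LHS]sW -trmx_mul ex linearZ.
  by apply: contra_neq x0 => e; rewrite -[x]trmxK e trmx0.
exists 0 => c /= /eigenvalueP[y yc y0].
have ty0 : y^T != 0 by apply: contra_neq y0 => e; rewrite -[y]trmxK e trmx0.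
have : W *m y^T = c *: y^T by rewrite -[in LHS]sW -trmx_mul yc linearZ.
move=> e; have := pW _ ty0; rewrite e dotvZr pmulr_lgt0 ?dotv_gt0//.
exact: ltW.
Qed.

End QuaternionSpectrum.


(** * The flow of the closed loop *)

Section Coercive.
Variable R : realType.

(** In an eigenbasis the form is a sum of squares with positive weights. *)
Lemma posdef_coercive (J : 'M[R]_3) : sym_posdef J ->
  exists2 j : R, 0 < j & forall x, j * dotv x x <= dotv x (J *m x).
Proof.
move=> [sJ pJ]; have [v [l [ov ev]]] := spectral_symmetric sJ.
have lpos i : 0 < l i.
  have v0 : v i != 0 by rewrite -dotv_gt0 ov eqxx ltr01.
  by have := pJ _ v0; rewrite ev dotvZr ov eqxx mulr1.
exists (Num.min (l 0) (Num.min (l 1) (l 2%:R))); first by rewrite !lt_min !lpos.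
move=> x; rewrite (quadform_sum sJ ov ev) (dotv_sq ov) mulr_sumr.
apply: ler_sum => i _; rewrite ler_wpM2r ?sqr_ge0//.
by move: i; elim/ord3P; rewrite !ge_min lexx ?orbT.
Qed.

(** A continuity argument: the first time at which g reaches r would violate the
    hypothesis. *)
Lemma stays_below (g : R -> R) (N r : R) : continuous g -> g 0 < r ->
  (forall t, 0 <= t <= N -> (forall s, 0 <= s <= t -> g s <= r) -> g t < r) ->
  forall t, 0 <= t <= N -> g t < r.
Proof.
move=> cg g0 step t /andP[t0 tN]; rewrite ltNge; apply/negP => rt.
pose S := [set s | 0 <= s /\ r <= g s].
have St : S t by [].
have lbS : has_lbound S by exists 0 => s [].
have hi : has_inf S by split=> //; exists t.
pose u := inf S.
have ut : u <= t by exact: ge_inf.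
have u0 : 0 <= u by apply: lb_le_inf; [exists t|move=> s []].
have below s : 0 <= s -> s < u -> g s < r.
  move=> s0 su; rewrite ltNge; apply/negP => rs.
  by have : u <= s by [apply: ge_inf]; rewrite leNgt su.
have ru : r <= g u.
  rewrite leNgt; apply/negP => gu.
  have gap : 0 < r - g u by rewrite subr_gt0.
  have [d d0 hd] := continuous_distP (cg u) gap.
  have [s Ss su] : exists2 s, S s & s < u + d.
    by apply: inf_adherent.
  have us : u <= s by exact: ge_inf.
  have := hd s; rewrite distrC ger0_norm ?subr_ge0// ltrBlDr addrC => /(_ su) h.
  have [_ rs] := Ss; have := ler_norm (g s - g u); rewrite distrC in h; lra.
have gu_le : g u <= r.
  rewrite leNgt; apply/negP => gu.
  have u1 : 0 < u by rewrite lt_def u0 andbT; apply/eqP => u00; rewrite u00 in gu; lra.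
  have gap : 0 < g u - r by rewrite subr_gt0.
  have [d d0 hd] := continuous_distP (cg u) gap.
  pose s := Num.max 0 (u - d / 2).
  have s0 : 0 <= s by rewrite le_max lexx.
  have su : s < u by rewrite gt_max u1 ltrBlDr ltrDl divr_gt0.
  have := hd s; rewrite ger0_norm ?subr_ge0 ?(ltW su)//.
  have sd : u - s < d by have : u - d / 2 <= s by [rewrite le_max lexx orbT]; lra.
  move=> /(_ sd) h; have := below s s0 su; have := ler_norm (g u - g s); lra.
have : g u < r.
  apply: step; first by rewrite u0 (le_trans ut).
  move=> s /andP[s0]; rewrite le_eqVlt => /orP[/eqP ->//|su].
  exact/ltW/below.
by rewrite ltNge ru.
Qed.

End Coercive.

Section Flow.
Variables (R : realType) (J Wg Wr : 'M[R]_3).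
Hypotheses (J_spd : sym_posdef J) (Wg_spd : sym_posdef Wg) (Wr_spd : sym_posdef Wr).

Notation E := 'cV[R]_(1 + 3 + (1 + 3) + 3).
Implicit Types x y : E.

Definition xT x : quat R := usubmx (usubmx x).
Definition xQ x : quat R := dsubmx (usubmx x).
Definition xw x : 'cV[R]_3 := dsubmx x.
(** The closed-loop state as one column, so that the general existence theorem
    applies. *)
Definition mkx (T Q : quat R) (w : 'cV[R]_3) : E := col_mx (col_mx T Q) w.

Lemma xT_mk T Q w : xT (mkx T Q w) = T.
Proof. by rewrite /xT /mkx !col_mxKu. Qed.
Lemma xQ_mk T Q w : xQ (mkx T Q w) = Q.
Proof. by rewrite /xQ /mkx col_mxKu col_mxKd. Qed.
Lemma xw_mk T Q w : xw (mkx T Q w) = w.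
Proof. by rewrite /xw /mkx col_mxKd. Qed.
Lemma mkx_eta x : mkx (xT x) (xQ x) (xw x) = x.
Proof. by rewrite /mkx /xT /xQ /xw !vsubmxK. Qed.

Definition xE := (xT_mk, xQ_mk, xw_mk).

Lemma xTZ a x : xT (a *: x) = a *: xT x.
Proof. by rewrite /xT !linearZ. Qed.
Lemma xQZ a x : xQ (a *: x) = a *: xQ x.
Proof. by rewrite /xQ !linearZ. Qed.
Lemma der_xT (F : R -> E) (t : R) dF : is_derive t 1 F dF ->
  is_derive t 1 (fun u => xT (F u)) (xT dF).
Proof. by move=> h; exact: der_usubmx (der_usubmx h). Qed.
Lemma der_xQ (F : R -> E) (t : R) dF : is_derive t 1 F dF ->
  is_derive t 1 (fun u => xQ (F u)) (xQ dF).
Proof. by move=> h; exact: der_dsubmx (der_usubmx h). Qed.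
Lemma der_xw (F : R -> E) (t : R) dF : is_derive t 1 F dF ->
  is_derive t 1 (fun u => xw (F u)) (xw dF).
Proof. by move=> h; exact: der_dsubmx h. Qed.

Definition xunit x := unit_quat (xT x) /\ unit_quat (xQ x).
Definition field x : E := mkx (vT Wg (xT x) (xQ x) (xw x)) (vQ (xQ x) (xw x))
  (vw J Wg Wr (xT x) (xQ x) (xw x)).
Definition en x : R := energy J Wg Wr (xT x) (xQ x) (xw x).

Definition orbit (x : R -> E) (t : R) : Prop :=
  xunit (x t) /\ is_derive t 1 x (field (x t)).

Lemma orbit_solution (x : R -> E) t :
  orbit x t <-> solution J Wg Wr (fun u => (xT (x u), xQ (x u), xw (x u))) t.
Proof.
split=> [[[uT uQ] dx]|[[uT uQ] /= hT hQ hw]].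
  split=> //=.
  - by have := der_usubmx (der_usubmx dx); rewrite !col_mxKu.
  - by have := der_dsubmx (der_usubmx dx); rewrite col_mxKu col_mxKd.
  - by have := der_dsubmx dx; rewrite col_mxKd.
split=> //; apply: is_derive_ext (der_col_mx (der_col_mx hT hQ) hw) => u.
exact: mkx_eta.
Qed.

Lemma solution_orbit s t :
  solution J Wg Wr s t <-> orbit (fun u => mkx (s u).1.1 (s u).1.2 (s u).2) t.
Proof.
rewrite orbit_solution.
have -> // : (fun u => (xT (mkx (s u).1.1 (s u).1.2 (s u).2),
  xQ (mkx (s u).1.1 (s u).1.2 (s u).2), xw (mkx (s u).1.1 (s u).1.2 (s u).2))) = s.
by apply/funext => u; rewrite !xE; case: (s u) => -[].
Qed.

Lemma lip_xT : lipM xT.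
Proof. by apply: lipM_usub; apply: lipM_usub; exact: lipM_id. Qed.
Lemma lip_xQ : lipM xQ.
Proof. by apply: lipM_dsub; apply: lipM_usub; exact: lipM_id. Qed.
Lemma lip_xw : lipM xw.
Proof. by apply: lipM_dsub; exact: lipM_id. Qed.

Lemma lip_Gg : lipM (fun x => Gg Wg (xT x)).
Proof.
apply: lipM_mul; first exact/lipM_tr/lipM_Nq/lip_xT.
by apply: lipM_mul; [exact: lipM_cst|exact: lip_xT].
Qed.

Lemma lip_Gr : lipM (fun x => Gr Wr (xQ x)).
Proof.
apply: lipM_mul; first exact/lipM_tr/lipM_Lq/lip_xQ.
by apply: lipM_mul; [exact: lipM_cst|exact: lip_xQ].
Qed.

Lemma lip_zg : lipM (fun x => zg Wg (xT x) (xQ x)).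
Proof.
apply: lipM_opp; apply: lipM_scale; first exact: lipB_cst.
by apply: lipM_mul; [exact/lipM_tr/lipM_rotmx/lip_xQ|exact: lip_Gg].
Qed.

Lemma lip_field : lipM field.
Proof.
apply: lipM_col_mx; first apply: lipM_col_mx.
- apply: lipM_mul; first exact/lipM_Nq/lip_xT.
  apply: lipM_sub; last exact: lip_Gg.
  apply: lipM_scale; first exact: lipB_cst.
  by apply: lipM_mul; [exact/lipM_rotmx/lip_xQ|exact: lip_xw].
- apply: lipM_scale; first exact: lipB_cst.
  by apply: lipM_mul; [exact/lipM_Lq/lip_xQ|exact: lip_xw].
- apply: lipM_mul; first exact: lipM_cst.
  apply: lipM_add; first apply: lipM_add.
  + apply: lipM_opp; apply: lipM_mul; first exact/lipM_cross/lip_xw.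
    by apply: lipM_mul; [exact: lipM_cst|exact: lip_xw].
  + exact: lip_zg.
  + by apply: lipM_opp; apply: lipM_scale; [exact: lipB_cst|exact: lip_Gr].
Qed.

Lemma lip_en : lipB en.
Proof.
have form m (A : 'M[R]_m) (G : E -> 'cV[R]_m) : lipM G ->
    lipB (fun x => dotv (G x) (A *m G x)).
  by move=> lG; apply: lipB_dotv => //; apply: lipM_mul => //; exact: lipM_cst.
apply: lipB_add; first apply: lipB_add.
- by apply: lipB_mul; [exact: lipB_cst|exact: form lip_xT].
- by apply: lipB_mul; [exact: lipB_cst|exact: form lip_xQ].
- by apply: lipB_mul; [exact: lipB_cst|exact: form lip_xw].
Qed.

(** Entries of a unit quaternion are at most 1. *)
Lemma xunit_norm x : xunit x -> `|x| <= 1 + enorm (xw x).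
Proof.
move=> [/unit_quatE uT /unit_quatE uQ]; apply: mx_norm_le.
  by rewrite addr_ge0 ?enorm_ge0.
have q1 (Q : quat R) i j : dotv Q Q = 1 -> `|Q i j| <= 1 + enorm (xw x).
  move=> h; apply: le_trans (mx_norm_ge Q i j) _; apply: le_trans (mxnorm_le_enorm Q) _.
  by rewrite /enorm h sqrtr1 lerDl sqrtr_ge0.
move=> i j; rewrite -{1}[x]mkx_eta /mkx.
case: (split_ordP i) => k ->.
  rewrite col_mxEu; case: (split_ordP k) => l ->.
    by rewrite col_mxEu; exact: q1.
  by rewrite col_mxEd; exact: q1.
rewrite col_mxEd; apply: le_trans (mx_norm_ge _ k j) _.
by apply: le_trans (mxnorm_le_enorm _) _; rewrite lerDr.
Qed.

Lemma Bq_form (W : 'M[R]_3) (Q : quat R) : dotv Q (Bq W *m Q) = dotv (qvec Q) (W *m qvec Q).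
Proof. by rewrite Bq_mul dotv_quat !qE mulr0 add0r. Qed.

Lemma posdef_ge0 (W : 'M[R]_3) (x : 'cV[R]_3) : sym_posdef W -> 0 <= dotv x (W *m x).
Proof.
move=> [_ h]; have [->|x0] := eqVneq x 0; first by rewrite dotv0l.
exact/ltW/h.
Qed.

(** Kinetic energy controls the angular velocity, and the quaternions are bounded
    anyway. *)
Lemma energy_bound : exists2 j : R, 0 < j &
  forall x, xunit x -> enorm (xw x) ^+ 2 <= j * en x /\ `|x| <= 2 + j * en x.
Proof.
have [j j0 hj] := posdef_coercive J_spd.
exists (2 / j); first by rewrite divr_gt0.
move=> x ux.
have h1 : enorm (xw x) ^+ 2 <= 2 / j * en x.
  rewrite mulrC mulrA ler_pdivlMr// enorm_sqr /en /energy !Bq_form.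
  have := posdef_ge0 (qvec (xT x)) Wg_spd; have := posdef_ge0 (qvec (xQ x)) Wr_spd.
  have := hj (xw x); lra.
split=> //; have := xunit_norm ux; have := sqr_ge0 (enorm (xw x) - 1); nra.
Qed.

Lemma en_ge0 x : 0 <= en x.
Proof.
rewrite /en /energy !Bq_form.
have := posdef_ge0 (qvec (xT x)) Wg_spd; have := posdef_ge0 (qvec (xQ x)) Wr_spd.
have := posdef_ge0 (xw x) J_spd; lra.
Qed.

Lemma orbit_energy (x : R -> E) t : orbit x t ->
  is_derive t 1 (fun u => en (x u)) (- (4 * dotv (Gg Wg (xT (x t))) (Gg Wg (xT (x t))))).
Proof.
move=> /orbit_solution h.
exact: energy_derivative J_spd (proj1 Wg_spd) (proj1 Wr_spd) _ _ h.
Qed.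

Lemma orbit_energy_nincr (x : R -> E) (a b : R) : a <= b ->
  (forall t, a <= t <= b -> orbit x t) -> en (x b) <= en (x a).
Proof.
move=> ab h; apply: (deriv_le0_nincr ab (fun t tab => orbit_energy (h t tab))) => t _.
by rewrite oppr_le0 mulr_ge0// dotv_ge0.
Qed.

(** Both quaternion velocities are images of the tangent maps, hence the flow
    preserves the two spheres. *)
Lemma field_tangent x : dotv (xT x) (xT (field x)) = 0 /\
  dotv (xQ x) (xQ (field x)) = 0.
Proof.
rewrite /field !xE /vT /vQ; split.
  by rewrite dotv_mulr NqTQ dotv0l.
by rewrite dotvZr dotv_mulr LqTQ dotv0l mulr0.
Qed.

(** Runs of the truncated field, forward (s = 1) or backward (s = -1) in time, never
    leave the box: as long as they have not, they are runs of the field itself, keep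
    the quaternions at unit length, and are confined by the energy. *)
Lemma truncated_run (s N r e : R) (y : R -> E) : `|s| = 1 -> 0 <= N ->
  xunit (y 0) -> (forall t : R, is_derive t 1 y (s *: field (clip r (y t)))) ->
  (forall x, xunit x -> en x <= e -> `|x| < r) ->
  en (y 0) <= e ->
  (forall t, 0 <= t <= N -> (forall u, 0 <= u <= t -> xunit (y u)) ->
     (forall u : R, 0 <= u <= t -> is_derive u 1 y (s *: field (y u))) -> en (y t) <= e) ->
  forall t, 0 <= t <= N -> `|y t| < r /\ xunit (y t).
Proof.
move=> s1 N0 u0 dy box e0 econt.
have key t : 0 <= t -> (forall u, 0 <= u <= t -> `|y u| <= r) ->
    (forall u : R, 0 <= u <= t -> is_derive u 1 y (s *: field (y u))) /\ xunit (y t).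
  move=> t0 hb.
  have dyu (u : R) : 0 <= u <= t -> is_derive u 1 y (s *: field (y u)).
    by move=> ut; have := dy u; rewrite clip_id// hb.
  split=> //; have [uT uQ] := u0.
  have cst (G : E -> quat R) (hG : forall (u : R) dF, is_derive u 1 y dF ->
      is_derive u 1 (fun v => G (y v)) (G dF)) (hs : forall a x, G (a *: x) = a *: G x) :
      (forall x, dotv (G x) (G (field x)) = 0) ->
      dotv (G (y t)) (G (y t)) = dotv (G (y 0)) (G (y 0)).
    move=> G0; apply: (deriv_eq0_cst t0 (f := fun v => dotv (G (y v)) (G (y v)))) => u ut.
    have d := hG _ _ (dyu u ut).
    apply: der_eq (der_dotv d d); rewrite hs dotvZl dotvZr G0 [dotv (G (field _)) _]dotvC.
    by rewrite G0 mulr0 addr0.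
  split; apply/unit_quatE.
    rewrite (@cst xT (fun u dF h => der_xT h) xTZ (fun x => proj1 (field_tangent x))).
    exact/unit_quatE.
  rewrite (@cst xQ (fun u dF h => der_xQ h) xQZ (fun x => proj2 (field_tangent x))).
  exact/unit_quatE.
have sub (P : R -> Prop) t : (forall u, 0 <= u <= t -> P u) ->
    forall v, 0 <= v <= t -> forall u, 0 <= u <= v -> P u.
  by move=> h v /andP[_ vt] u /andP[u1 u2]; apply: h; rewrite u1 (le_trans u2).
have cy : continuous (fun t => `|y t|).
  move=> t; apply: (continuous_comp (f := y)); first exact: is_derive_continuous (dy t).
  exact: norm_continuous.
have below : forall t, 0 <= t <= N -> `|y t| < r.
  apply: (stays_below cy); first exact: box.
  move=> t tN hb; have /andP[t0 _] := tN; have [dyt ut] := key t t0 hb.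
  apply: box => //; apply: econt => // u ut'.
  have /andP[u1 _] := ut'.
  by have [] := key u u1 (sub _ _ hb u ut').
move=> t tN; split; first exact: below.
have /andP[t0 tN'] := tN; have [] // := key t t0 _.
by move=> u /andP[u1 u2]; apply/ltW/below; rewrite u1 (le_trans u2).
Qed.

Lemma Gg_bounded : exists2 c : R, 0 <= c & forall T : quat R, unit_quat T ->
  4 * dotv (Gg Wg T) (Gg Wg T) <= c.
Proof.
have [M M0 hM] := lipM_bounded lip_Gg 1.
exists (4 * (3%:R * M ^+ 2)); first by rewrite mulr_ge0// mulr_ge0// sqr_ge0.
move=> T uT; rewrite ler_wpM2l//; apply: le_trans (enorm_le_mxnorm _) _.
rewrite ler_wpM2l// ler_sqr ?nnegrE ?(ltW M0)//.
have ux : xunit (mkx T T 0) by rewrite /xunit !xE.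
have := hM (mkx T T 0); rewrite xE; apply.
by have := xunit_norm ux; rewrite xE enorm0 addr0.
Qed.

(** Backwards in time the energy increases, but only linearly, because its rate
    depends on the error quaternion alone; hence solutions extend arbitrarily far into
    the past. *)
Theorem orbit_exists x0 (N : R) : 0 <= N -> xunit x0 ->
  exists2 x : R -> E, x 0 = x0 & forall t, - N <= t -> orbit x t.
Proof.
move=> N0 u0.
have [j j0 hj] := energy_bound; have [c c0 hc] := Gg_bounded.
pose e := en x0 + c * N; pose r := 3 + j * e.
have e0 : 0 <= e by rewrite addr_ge0 ?en_ge0// mulr_ge0.
have r0 : 0 <= r by rewrite addr_ge0// mulr_ge0// ltW.
have box x : xunit x -> en x <= e -> `|x| < r.
  move=> ux ex; have [_ h] := hj x ux; apply: le_lt_trans h _.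
  have : j * en x <= j * e by rewrite ler_wpM2l// ltW.
  rewrite /r; lra.
have [L L0 hL] := clip_field lip_field r0.
have [x x00 dx] := ode_global L0 hL x0.
have e00 : en x0 <= e by rewrite lerDl mulr_ge0.
have fwd t : 0 <= t -> `|x t| < r /\ xunit (x t).
  move=> t0; apply: (@truncated_run 1 t r e x) => //; rewrite ?normr1 ?x00// ?t0 ?lexx//.
    by move=> u; rewrite scale1r.
  move=> u /andP[u1 ut] uu du; apply: le_trans e00; rewrite -x00.
  apply: orbit_energy_nincr => // v vu; split; first exact: uu.
  by have := du v vu; rewrite scale1r.
have bwd t : 0 <= t <= N -> `|x (- t)| < r /\ xunit (x (- t)).
  have dN (u : R) : is_derive u 1 (fun v => x (- v)) (-1 *: field (clip r (x (- u)))).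
    by rewrite scaleN1r; exact: is_derive_comp_opp.
  apply: (@truncated_run (-1) N r e (fun u => x (- u))) => //;
    rewrite ?normrN1 ?oppr0 ?x00//.
  move=> u /andP[u1 ut] uu du.
  pose h v := en (x (- v)) - c * v.
  have : h u <= h 0.
    apply: (@deriv_le0_nincr _ h
      (fun v => 4 * dotv (Gg Wg (xT (x (- v)))) (Gg Wg (xT (x (- v)))) - c)) => // v vu.
      have ov : orbit x (- v).
        split; first exact: uu.
        have := du v vu; rewrite scaleN1r => dv.
        have := @is_derive_comp_opp _ _ (fun w => x (- w)) (- v) (- field (x (- v))).
        rewrite !opprK => /(_ dv); apply: is_derive_ext => w.
        by rewrite opprK.
      apply: derB.
        apply: der_eq (is_derive_comp_opp (orbit_energy ov)).
        by rewrite opprK.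
      by apply: der_eq (derZ c (is_derive_id v 1)); exact: mulr1.
    by rewrite subr_le0; apply: hc; have [] := uu v vu.
  rewrite /h oppr0 mulr0 x00 /e.
  have : c * u <= c * N by rewrite ler_wpM2l.
  lra.
exists x => // t Nt.
have [bt ut] : `|x t| < r /\ xunit (x t).
  have [t0|t0] := leP 0 t; first exact: fwd.
  have := bwd (- t); rewrite opprK; apply; rewrite lerNl Nt andbT oppr_ge0; exact: ltW.
split=> //; have := dx t; rewrite clip_id//; exact: ltW.
Qed.

(** The bounds hold in both directions of time; the backward one makes the flow open. *)
Lemma orbit_compare (e : R) : exists2 c : R, 0 < c & forall (x y : R -> E) (a b : R),
  a <= b -> (forall t, a <= t <= b -> orbit x t /\ orbit y t) ->
  en (x a) <= e -> en (y a) <= e ->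
  let D t := dotv (x t - y t) (x t - y t) in
  D b <= D a * expR (c * (b - a)) /\ D a <= D b * expR (c * (b - a)).
Proof.
have [j j0 hj] := energy_bound.
have [L L0 hL] := lipM_norm lip_field (2 + j * e).
exists (1 + (1 + 3 + (1 + 3) + 3)%:R * L ^+ 2).
  by rewrite ltr_wpDr// mulr_ge0// sqr_ge0.
move=> x y a b ab h ex ey.
have bnd (z : R -> E) t : a <= t <= b -> (forall u, a <= u <= b -> orbit z u) ->
    en (z a) <= e -> `|z t| <= 2 + j * e.
  move=> /andP[at_ tb] oz ez; have [uz _] := oz t (introT andP (conj at_ tb)).
  have [_ hz] := hj _ uz; apply: le_trans hz _; rewrite lerD2l ler_wpM2l ?(ltW j0)//.
  apply: le_trans ez; apply: orbit_energy_nincr => // u /andP[u1 u2].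
  by apply: oz; rewrite u1 (le_trans u2).
apply: (@gronwall_dotv _ _ x y (fun t => field (x t)) (fun t => field (y t))) => // t tab.
- by have [[]] := h t tab.
- by have [_ []] := h t tab.
- by apply: hL; apply: bnd => // u uab; have [] := h u uab.
Qed.

Lemma orbit_unique (x y : R -> E) (a b : R) : a <= b ->
  (forall t, a <= t <= b -> orbit x t /\ orbit y t) -> x a = y a -> x b = y b.
Proof.
move=> ab h xy; have [c c0 hc] := orbit_compare (en (x a)).
have [] := hc x y a b ab h (lexx _); first by rewrite xy.
rewrite xy subrr dotv0l mul0r => h1 _; apply/eqP; rewrite -subr_eq0 -dotv_eq0.
by rewrite eq_le h1 dotv_ge0.
Qed.

End Flow.


(** * Limits along orbits *)

Section Tends.
Variable R : realType.
Implicit Types f g : R -> R.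

(** Convergence at infinity of functions that are controlled on [0, +oo[ only. *)
Definition tends f (l : R) := forall e : R, 0 < e ->
  exists2 T : R, 0 <= T & forall t, T <= t -> `|f t - l| < e.

Lemma tends_cvg (V : normedModType R) (F : R -> V) (l : V) :
  tends (fun t => `|F t - l|) 0 -> F t @[t --> +oo] --> l.
Proof.
move=> h; apply/cvgrPdist_lt => e e0; have [T T0 hT] := h e e0.
exists T; split; first exact: num_real.
by move=> t /= /ltW Tt; have := hT t Tt; rewrite subr0 normr_id distrC.
Qed.

Lemma tends_le f g : tends g 0 -> (forall t, 0 <= t -> `|f t| <= g t) -> tends f 0.
Proof.
move=> hg fg e e0; have [T T0 hT] := hg e e0; exists T => // t Tt.
rewrite subr0; apply: le_lt_trans (fg t (le_trans T0 Tt)) _.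
by apply: le_lt_trans (hT t Tt); rewrite subr0 ler_norm.
Qed.

Lemma tends_ext f g l : (forall t, 0 <= t -> f t = g t) -> tends f l -> tends g l.
Proof.
move=> fg hf e e0; have [T T0 hT] := hf e e0; exists T => // t Tt.
by rewrite -fg ?hT// (le_trans T0).
Qed.

Lemma tends_cst (a : R) : tends (fun=> a) a.
Proof. by move=> e e0; exists 0 => // t _; rewrite subrr normr0. Qed.

Lemma tends_add f g a b : tends f a -> tends g b -> tends (fun t => f t + g t) (a + b).
Proof.
move=> hf hg e e0; have e2 : 0 < e / 2 by rewrite divr_gt0.
have [T T0 hT] := hf _ e2; have [S S0 hS] := hg _ e2.
exists (Num.max T S) => [|t]; first by rewrite le_max T0.
rewrite ge_max => /andP[Tt St].
have := hT t Tt; have := hS t St => h1 h2.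
rewrite opprD addrACA; apply: le_lt_trans (ler_normD _ _) _; lra.
Qed.

Lemma tends_mul f g a b : tends f a -> tends g b -> tends (fun t => f t * g t) (a * b).
Proof.
move=> hf hg e e0.
pose d := Num.min 1 (e / (1 + `|a| + `|b|)).
have s0 : 0 < 1 + `|a| + `|b| by rewrite -addrA ltr_wpDr// addr_ge0.
have d0 : 0 < d by rewrite lt_min ltr01 divr_gt0.
have d1 : d <= 1 by rewrite ge_min lexx.
have de : d * (1 + `|a| + `|b|) <= e by rewrite -ler_pdivlMr// ge_min lexx orbT.
have [T T0 hT] := hf _ d0; have [S S0 hS] := hg _ d0.
exists (Num.max T S) => [|t]; first by rewrite le_max T0.
rewrite ge_max => /andP[Tt St].
have h1 := hT t Tt; have h2 := hS t St.
have -> : f t * g t - a * b = (f t - a) * (g t - b) + a * (g t - b) + b * (f t - a) by ring.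
apply: le_lt_trans (ler_normD _ _) _.
apply: le_lt_trans (lerD (ler_normD _ _) (lexx _)) _; rewrite !normrM.
have : `|f t - a| * `|g t - b| <= `|f t - a| * 1 by rewrite ler_wpM2l// (le_trans (ltW h2)).
have := normr_ge0 a; have := normr_ge0 b; have := normr_ge0 (f t - a).
have := normr_ge0 (g t - b); nra.
Qed.

Lemma tends_scale k f l : tends f l -> tends (fun t => k * f t) (k * l).
Proof. by move=> h; apply: tends_mul => //; exact: tends_cst. Qed.

Lemma tends_opp f l : tends f l -> tends (fun t => - f t) (- l).
Proof.
move=> h e e0; have [T T0 hT] := h e e0; exists T => // t /hT.
by rewrite -opprD normrN.
Qed.

Lemma tends_sub f g a b : tends f a -> tends g b -> tends (fun t => f t - g t) (a - b).
Proof. by move=> hf hg; apply: tends_add => //; exact: tends_opp. Qed.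

Lemma tends_sum (I : Type) (s : seq I) (F : I -> R -> R) (l : I -> R) :
  (forall i, tends (F i) (l i)) ->
  tends (fun t => \sum_(i <- s) F i t) (\sum_(i <- s) l i).
Proof.
move=> h; elim: s => [|i s IH].
  by rewrite big_nil; apply: tends_ext (tends_cst 0) => t _; rewrite big_nil.
by rewrite big_cons; apply: tends_ext (tends_add (h i) IH) => t _; rewrite big_cons.
Qed.

Lemma tends_sqr0 f : tends f 0 <-> tends (fun t => f t ^+ 2) 0.
Proof.
split=> h.
  by have := tends_mul h h; rewrite mulr0; apply: tends_ext => t _; rewrite expr2.
move=> e e0; have e2 : 0 < e ^+ 2 by rewrite exprn_gt0.
have [T T0 hT] := h _ e2; exists T => // t /hT; rewrite !subr0 normrX => h1.
by rewrite -ltr_sqr ?nnegrE ?(ltW e0).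
Qed.

Lemma nincr_tends f (m : R) : (forall s t, 0 <= s -> s <= t -> f t <= f s) ->
  (forall t, 0 <= t -> m <= f t) -> exists l, tends f l.
Proof.
move=> dec mf; pose S := [set y | exists2 t, 0 <= t & y = f t].
have hi : has_inf S.
  by split; [exists (f 0), 0|exists m => y [t t0 ->]; exact: mf].
exists (inf S) => e e0.
have [_ [T T0 ->] hT] := inf_adherent e0 hi.
exists T => // t Tt; have t0 := le_trans T0 Tt.
have h1 : inf S <= f t by apply: ge_inf; [case: hi|exists t].
have h2 := dec T t T0 Tt.
by rewrite ger0_norm ?subr_ge0// ltrBlDr addrC (le_lt_trans h2).
Qed.

(** A convergent function has vanishing increments over any fixed time; if its
    derivative varies slowly, such an increment is close to the derivative times the
    length. *)
Lemma barbalat f df (l K : R) : tends f l ->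
  (forall t : R, 0 <= t -> is_derive t 1 f (df t)) ->
  (forall s t, 0 <= s -> 0 <= t -> `|df t - df s| <= K * `|t - s|) ->
  tends df 0.
Proof.
move=> hf hd hK e e0.
pose h := e / (2 * (`|K| + 1)).
have K1 : 0 < `|K| + 1 by rewrite ltr_wpDl.
have h0 : 0 < h by rewrite divr_gt0// mulr_gt0.
have hKe : (`|K| + 1) * h = e / 2 by rewrite /h; field; rewrite gt_eqF.
have eh : 0 < h * e / 4 by rewrite divr_gt0// mulr_gt0.
have [T T0 hT] := hf _ eh; exists T => // t Tt; have t0 := le_trans T0 Tt.
have th : t <= t + h by rewrite lerDl ltW.
have [c /andP[tc ch] e1] := @mean_value _ f df t (t + h) th
  (fun u ut => hd u (le_trans t0 (proj1 (andP ut)))).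
have := hT _ Tt; have := hT (t + h) (le_trans Tt th) => h1 h2.
have : `|df c| * h < h * e / 2.
  have -> : `|df c| * h = `|f (t + h) - f t|.
    by rewrite e1 addrAC subrr add0r normrM [`|h|]ger0_norm// ltW.
  have -> : f (t + h) - f t = (f (t + h) - l) - (f t - l) by ring.
  apply: le_lt_trans (ler_normB _ _) _; lra.
rewrite [h * e]mulrC mulrAC ltr_pM2r// => h3.
have h4 : `|df t - df c| <= e / 2.
  apply: le_trans (hK c t (le_trans t0 tc) t0) _; rewrite -hKe.
  apply: le_trans (_ : `|K| * h <= _); last by rewrite ler_wpM2r ?lerDl// ltW.
  have : `|t - c| <= h by rewrite distrC ger0_norm ?subr_ge0//; lra.
  move=> tch; apply: le_trans (_ : `|K| * `|t - c| <= _).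
    by rewrite ler_wpM2r// ler_norm.
  by rewrite ler_wpM2l.
rewrite subr0 -(subrK (df c) (df t)); apply: le_lt_trans (ler_normD _ _) _; lra.
Qed.

(** The function cannot pass from one of the points to another without crossing the
    gap around it. *)
Lemma tends_finite n (b : 'I_n -> R) (u : R -> R) :
  (forall t, 0 <= t -> {for t, continuous u}) ->
  (forall e : R, 0 < e -> exists2 T : R, 0 <= T &
     forall t, T <= t -> exists i, `|u t - b i| < e) ->
  exists i, tends u (b i).
Proof.
move=> cu near.
(* a quarter of the smallest gap *)
have [d d0 hd] : exists2 d : R, 0 < d & forall i j, b i != b j -> 4 * d <= `|b i - b j|.
  pose D (ij : 'I_n * 'I_n) := if b ij.1 != b ij.2 then `|b ij.1 - b ij.2|^-1 else 0.
  have D0 ij : 0 <= D ij by rewrite /D; case: ifP => // _; rewrite invr_ge0.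
  pose s := \sum_ij D ij + 1.
  have s0 : 0 < s by rewrite ltr_wpDl// sumr_ge0.
  exists (s^-1 / 4); first by rewrite divr_gt0// invr_gt0.
  move=> i j ij; rewrite mulrC divfK ?pnatr_eq0//.
  have n0 : 0 < `|b i - b j| by rewrite normr_gt0 subr_eq0.
  rewrite -[leRHS]invrK lef_pV2 ?posrE ?invr_gt0//.
  rewrite /s (bigD1 (i, j))//= -addrA {1}/D /= ij lerDl addr_ge0// sumr_ge0//.
have [T T0 hT] := near d d0.
have [i hi] := hT T (lexx T).
have stay t : T <= t -> `|u t - b i| < d.
  move=> Tt; rewrite ltNge; apply/negP => far.
  have [k hk] := hT t Tt.
  have ik : b i != b k by apply/eqP => e; rewrite e in far; lra.
  pose g s := `|u s - b i|.
  have cg : {within `[T, t], continuous g}.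
    apply: continuous_in_subspaceT => s; rewrite inE/= in_itv/= => /andP[Ts _].
    apply: (continuous_comp (f := fun s => u s - b i)); last exact: norm_continuous.
    apply: (@continuousB _ _ _ u (fun=> b i)); last exact: cvg_cst.
    exact/cu/(le_trans T0).
  have gt : 2 * d <= g t.
    have := hd _ _ ik; have := ler_normB (u t - b k) (u t - b i).
    have -> : u t - b k - (u t - b i) = b i - b k by ring.
    by rewrite /g; lra.
  have [|c] := @IVT _ g T t (2 * d) Tt cg.
    by rewrite ge_min le_max gt orbT andbT /g (le_trans (ltW hi))//; lra.
  rewrite in_itv/= => /andP[Tc _] gc; have [m hm] := hT c Tc.
  have im : b i = b m.
    apply/eqP/negPn/negP => /hd h4.
    have := ler_normB (u c - b m) (u c - b i).
    have -> : u c - b m - (u c - b i) = b i - b m by ring.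
    by move: gc; rewrite /g; lra.
  by move: gc hm; rewrite /g im; lra.
exists i => e e0; have m0 : 0 < Num.min e d by rewrite lt_min e0.
have [S S0 hS] := near _ m0.
exists (Num.max S T) => [|t]; first by rewrite le_max S0.
rewrite ge_max => /andP[St Tt]; have [k] := hS t St.
rewrite lt_min => /andP[ke kd].
have <- // : b k = b i.
apply/eqP/negPn/negP => /hd h4; have h5 := stay t Tt.
have := ler_normB (u t - b i) (u t - b k).
have -> : u t - b i - (u t - b k) = b k - b i by ring.
by lra.
Qed.

End Tends.

Section QuatShift.
Variable R : realType.

(** For unit Q this is Pythagoras: P splits into a radial and a tangential part. With
    P = A Q it measures the distance to the eigenvectors of A. *)
Lemma LqT_norm (Q P : quat R) : unit_quat Q ->
  dotv ((Lq Q)^T *m P) ((Lq Q)^T *m P) = dotv P P - dotv Q P ^+ 2.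
Proof.
move=> /unit_quatE uQ; rewrite dotv_mulr trmxK LqLqT uQ scale1r dotvBl dotvZl.
by rewrite expr2.
Qed.

Lemma NqT_norm (Q P : quat R) : unit_quat Q ->
  dotv ((Nq Q)^T *m P) ((Nq Q)^T *m P) = dotv P P - dotv Q P ^+ 2.
Proof.
move=> /unit_quatE uQ; rewrite dotv_mulr trmxK NqNqT uQ scale1r dotvBl dotvZl.
by rewrite expr2.
Qed.

Lemma rot_norm (Q : quat R) (x : 'cV[R]_3) : unit_quat Q ->
  dotv (rotmx Q *m x) (rotmx Q *m x) = dotv x x.
Proof. by move=> uQ; rewrite dotv_mulr mulmxA rot_trmul// mul1mx. Qed.

Lemma rotT_norm (Q : quat R) (x : 'cV[R]_3) : unit_quat Q ->
  dotv ((rotmx Q)^T *m x) ((rotmx Q)^T *m x) = dotv x x.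
Proof. by move=> uQ; rewrite dotv_mulr trmxK mulmxA rot_multr// mul1mx. Qed.

Lemma Nq_norm (Q : quat R) (x : 'cV[R]_3) : dotv (Nq Q *m x) (Nq Q *m x) = dotv Q Q * dotv x x.
Proof. by rewrite dotv_mulr NqNq dotvZl. Qed.

Lemma Lq_norm (Q : quat R) (x : 'cV[R]_3) : dotv (Lq Q *m x) (Lq Q *m x) = dotv Q Q * dotv x x.
Proof. by rewrite dotv_mulr LqLq dotvZl. Qed.

Lemma tends_dotv_coord m (X : R -> 'cV[R]_m) :
  tends (fun t => dotv (X t) (X t)) 0 <-> forall i, tends (fun t => X t i 0) 0.
Proof.
split=> [h i|h].
  apply/tends_sqr0; apply: tends_le h _ => t _.
  rewrite ger0_norm ?sqr_ge0// dotvE (bigD1 i)//= -expr2 lerDl sumr_ge0// => k _.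
  by rewrite -expr2 sqr_ge0.
have := tends_sum (index_enum 'I_m) (fun i => tends_mul (h i) (h i)).
rewrite mulr0 big1//; apply: tends_ext => t _; by rewrite dotvE.
Qed.

End QuatShift.

Section EigenLimit.
Variables (R : realType) (n : nat) (A : 'M[R]_n) (v : 'I_n -> 'cV[R]_n) (l : 'I_n -> R).
Hypotheses (sA : A^T = A) (ov : orthonormal v) (ev : forall i, A *m v i = l i *: v i).

(** The hypothesis says that the variance of A in the state X vanishes, so that the
    mean value of A approaches the finite spectrum, hence one of its points. *)
Lemma eigenspace_limit (X : R -> 'cV[R]_n) :
  (forall t, 0 <= t -> {for t, continuous X}) ->
  (forall t, 0 <= t -> dotv (X t) (X t) = 1) ->
  tends (fun t => dotv (A *m X t) (A *m X t) - dotv (X t) (A *m X t) ^+ 2) 0 ->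
  exists k, tends (fun t => dotv (A *m X t - l k *: X t) (A *m X t - l k *: X t)) 0.
Proof.
move=> cX uX h.
pose u t := dotv (X t) (A *m X t).
have shift t a : 0 <= t -> dotv (A *m X t - a *: X t) (A *m X t - a *: X t) =
   dotv (A *m X t) (A *m X t) - u t ^+ 2 + (u t - a) ^+ 2.
  move=> t0; rewrite !(dotvBl, dotvBr, dotvZl, dotvZr) uX// -/(u t).
  by rewrite [dotv (A *m X t) (X t)]dotvC -/(u t); ring.
have cu t : 0 <= t -> {for t, continuous u}.
  move=> t0; have lf : lipB (fun x : 'cV[R]_n => dotv x (A *m x)).
    apply: lipB_dotv; first exact: lipM_id.
    by apply: lipM_mul; [exact: lipM_cst|exact: lipM_id].
  apply: (continuous_comp (f := X) (g := fun x : 'cV[R]_n => dotv x (A *m x))).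
    exact: cX.
  exact: lipB_continuous.
have [k hk] : exists k, tends u (l k).
  apply: tends_finite => // e e0; have e2 : 0 < e ^+ 2 by rewrite exprn_gt0.
  have [T T0 hT] := h _ e2; exists T => // t Tt; have t0 := le_trans T0 Tt.
  apply: contrapT => /forallNP far.
  have : e ^+ 2 <= dotv (A *m X t - u t *: X t) (A *m X t - u t *: X t).
    rewrite (shift_norm sA ov ev) -[e ^+ 2]mulr1 -(uX t t0) (dotv_sq ov) mulr_sumr.
    apply: ler_sum => i _; rewrite ler_wpM2r ?sqr_ge0//.
    have /negP := far i; rewrite -leNgt distrC => hi.
    by rewrite -[leRHS]real_normK ?num_real// ler_sqr ?nnegrE// ltW.
  rewrite shift// subrr expr0n addr0.
  have := hT t Tt; rewrite subr0 => h1 h2.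
  by have := le_lt_trans (ler_norm _) h1; rewrite ltNge h2.
exists k; have h2 : tends (fun t => (u t - l k) ^+ 2) 0.
  apply: (proj1 (tends_sqr0 (fun t => u t - l k))).
  by have := tends_sub hk (tends_cst (l k)); rewrite subrr.
have := tends_add h h2; rewrite addr0; apply: tends_ext => t t0.
by rewrite shift.
Qed.

(** The curve approaches a pair of opposite unit vectors and cannot jump between them. *)
Lemma simple_eigenvector_limit (X : R -> 'cV[R]_n) (k : 'I_n) :
  (forall i, l i = l k -> i = k) ->
  (forall t, 0 <= t -> {for t, continuous X}) ->
  (forall t, 0 <= t -> dotv (X t) (X t) = 1) ->
  tends (fun t => dotv (A *m X t - l k *: X t) (A *m X t - l k *: X t)) 0 ->
  exists s : bool, tends (fun t => dotv (X t - (-1) ^+ s *: v k) (X t - (-1) ^+ s *: v k)) 0.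
Proof.
move=> simple cX uX h; have [b b0 hb] := shift_simple_le sA ov ev simple.
pose c t := dotv (v k) (X t).
have hc t : 0 <= t -> 0 <= 1 - c t ^+ 2.
  move=> t0; rewrite subr_ge0; have := dotv_CS (v k) (X t).
  by rewrite ov eqxx uX// mulr1.
have h1 : tends (fun t => 1 - c t ^+ 2) 0.
  apply: tends_le (_ : tends (fun t => b^-1 * _) 0) _; last first.
    move=> t t0; rewrite ger0_norm ?hc// mulrC -ler_pdivrMr ?invr_gt0// invrK.
    rewrite -(uX t t0) mulrC; exact: hb.
  by rewrite -[X in tends _ X](mulr0 b^-1); exact: tends_scale.
have cc t : 0 <= t -> {for t, continuous c}.
  move=> t0; have lf : lipB (fun x : 'cV[R]_n => dotv (v k) x).
    by apply: lipB_dotv; [exact: lipM_cst|exact: lipM_id].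
  apply: (continuous_comp (f := X) (g := fun x : 'cV[R]_n => dotv (v k) x)).
    exact: cX.
  exact: lipB_continuous.
have [i hi] : exists i : 'I_2, tends c ((-1) ^+ i).
  apply: tends_finite => // e e0.
  have m0 : 0 < Num.min e 1 by rewrite lt_min e0 ltr01.
  have [T T0 hT] := h1 _ m0; exists T => // t Tt; have t0 := le_trans T0 Tt.
  have := hT t Tt; rewrite subr0 lt_min => /andP[+ _].
  rewrite ger0_norm ?hc// => he.
  have [c0|c0] := leP 0 (c t).
    exists 0; rewrite expr0 distrC; have := hc t t0 => h2.
    have c1 : c t <= 1 by nra.
    rewrite ger0_norm ?subr_ge0//; nra.
  exists 1; rewrite expr1 opprK; have := hc t t0 => h2.
  have c1 : -1 <= c t by nra.
  rewrite ger0_norm; last by lra.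
  nra.
have [s hs] : exists s : bool, tends c ((-1) ^+ s).
  by exists (val i == 1)%N; move: hi; case: (i) => -[|[|//]] ?.
exists s; have ss : ((-1) ^+ s : R) * (-1) ^+ s = 1 by rewrite -signr_addb addbb.
have := tends_sub (tends_cst 2) (tends_scale (2 * (-1) ^+ s) hs).
rewrite -mulrA ss mulr1 subrr; apply: tends_ext => t t0.
rewrite !(dotvBl, dotvBr, dotvZl, dotvZr) uX// ov eqxx mulr1 ss -/(c t).
by rewrite [dotv (X t) (v k)]dotvC -/(c t); ring.
Qed.

End EigenLimit.

Section OrbitLimits.
Variables (R : realType) (J Wg Wr : 'M[R]_3).
Hypotheses (J_spd : sym_posdef J) (Wg_spd : sym_posdef Wg) (Wr_spd : sym_posdef Wr).
Variables (ug : 'I_(1 + 3) -> quat R) (bg : 'I_(1 + 3) -> R).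
Variables (ur : 'I_(1 + 3) -> quat R) (br : 'I_(1 + 3) -> R).
Hypotheses (og : orthonormal ug) (eg : forall i, Bq Wg *m ug i = bg i *: ug i).
Hypotheses (or : orthonormal ur) (er : forall i, Bq Wr *m ur i = br i *: ur i).

Notation E := 'cV[R]_(1 + 3 + (1 + 3) + 3).
Notation orbit := (orbit J Wg Wr).
Notation field := (field J Wg Wr).
Notation en := (en J Wg Wr).

Variable x : R -> E.
Hypothesis ox : forall t, 0 <= t -> orbit x t.

(** Vanishes exactly on the eigenspace of a; the same for the attitude below. *)
Definition gshift (a : R) (y : E) : R :=
  dotv (Bq Wg *m xT y - a *: xT y) (Bq Wg *m xT y - a *: xT y).
Definition qshift (a : R) (y : E) : R :=
  dotv (Bq Wr *m xQ y - a *: xQ y) (Bq Wr *m xQ y - a *: xQ y).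

Lemma orbit_bounded : exists2 r : R, 0 <= r & forall t, 0 <= t -> `|x t| <= r.
Proof.
have [j j0 hj] := energy_bound J_spd Wg_spd Wr_spd.
exists (2 + j * en (x 0)).
  by rewrite addr_ge0// mulr_ge0 ?(ltW j0)// en_ge0.
move=> t t0; have [ut _] := ox t0; have [_ h] := hj _ ut; apply: le_trans h _.
rewrite lerD2l ler_wpM2l ?(ltW j0)//.
by apply: (orbit_energy_nincr J_spd Wg_spd Wr_spd t0) => u /andP[u0 _]; exact: ox.
Qed.

Lemma orbit_lipschitz : exists2 K : R, 0 <= K &
  forall s t, 0 <= s -> 0 <= t -> `|x t - x s| <= K * `|t - s|.
Proof.
have [r r0 hr] := orbit_bounded.
have [M M0 hM] := lipM_bounded (lip_field J Wg Wr) r.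
exists M; first exact: ltW.
have key s t : 0 <= s -> s <= t -> `|x t - x s| <= M * `|t - s|.
  move=> s0 st; apply: mx_norm_le; first by rewrite mulr_ge0// ltW.
  move=> i j; rewrite !mxE.
  have [|c /andP[sc _] e] := @mean_value _ (fun u => x u i j) (fun u => field (x u) i j) s t st.
    move=> u /andP[su _]; have [_ /is_derive_mxP] := ox (le_trans s0 su); exact.
  rewrite e normrM ler_wpM2r//; apply: le_trans (mx_norm_ge _ i j) _.
  by apply/hM/hr/(le_trans s0).
move=> s t s0 t0; have [st|ts] := leP s t; first exact: key.
by rewrite distrC (distrC t); apply: key => //; exact: ltW.
Qed.

Lemma observable_lipschitz (g : E -> R) : lipB g -> exists K : R,
  forall s t, 0 <= s -> 0 <= t -> `|g (x t) - g (x s)| <= K * `|t - s|.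
Proof.
move=> lg; have [r r0 hr] := orbit_bounded; have [K K0 hK] := orbit_lipschitz.
have [L L0 hL] := lg r; exists (L * K) => s t s0 t0.
apply: le_trans (hL _ _ (hr t t0) (hr s s0)) _.
by rewrite -mulrA ler_wpM2l// hK.
Qed.

(** Barbalat for observables: along a bounded orbit locally Lipschitz functions of the
    state are Lipschitz in time. *)
Lemma coord_derivative_tends0 (F : E -> R) (dF : E -> R) (l : R) : lipB dF ->
  (forall t : R, 0 <= t -> is_derive t 1 (fun u => F (x u)) (dF (x t))) ->
  tends (fun t => F (x t)) l -> tends (fun t => dF (x t)) 0.
Proof.
move=> ldF hd hF; have [K hK] := observable_lipschitz ldF.
exact: barbalat hF hd hK.
Qed.

(** The energy converges, and its derivative is minus four times this quantity. *)
Lemma Gg_tends0 : tends (fun t => dotv (Gg Wg (xT (x t))) (Gg Wg (xT (x t)))) 0.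
Proof.
have [l hl] : exists l, tends (fun t => en (x t)) l.
  apply: (@nincr_tends _ _ 0).
    move=> s t s0 st; apply: (orbit_energy_nincr J_spd Wg_spd Wr_spd st) => u /andP[su _].
    exact/ox/(le_trans s0).
  by move=> t _; exact: en_ge0.
have lG : lipB (fun y : E => - (4 * dotv (Gg Wg (xT y)) (Gg Wg (xT y)))).
  apply: lipB_opp; apply: lipB_mul; first exact: lipB_cst.
  by apply: lipB_dotv; exact: lip_Gg.
have := coord_derivative_tends0 lG (fun t t0 => orbit_energy J_spd Wg_spd Wr_spd (ox t0)) hl.
move=> /tends_opp/(tends_scale 4^-1); rewrite oppr0 mulr0; apply: tends_ext => t _.
by rewrite opprK mulrA mulVf ?pnatr_eq0// mul1r.
Qed.

Lemma xT_continuous t : 0 <= t -> {for t, continuous (fun u => xT (x u))}.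
Proof. by move=> t0; have [_ h] := ox t0; exact: is_derive_continuous (der_xT h). Qed.

Lemma xQ_continuous t : 0 <= t -> {for t, continuous (fun u => xQ (x u))}.
Proof. by move=> t0; have [_ h] := ox t0; exact: is_derive_continuous (der_xQ h). Qed.

Lemma xT_unit t : 0 <= t -> dotv (xT (x t)) (xT (x t)) = 1.
Proof. by move=> t0; have [[/unit_quatE]] := ox t0. Qed.

Lemma xQ_unit t : 0 <= t -> dotv (xQ (x t)) (xQ (x t)) = 1.
Proof. by move=> t0; have [[_ /unit_quatE]] := ox t0. Qed.

(** The tangential part of the gradient vanishes in the limit. *)
Lemma error_eigenspace_limit : exists k, tends (fun t => gshift (bg k) (x t)) 0.
Proof.
apply: (eigenspace_limit (Bq_tr (proj1 Wg_spd)) og eg xT_continuous xT_unit).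
apply: tends_ext Gg_tends0 => t t0; rewrite NqT_norm//; by have [[]] := ox t0.
Qed.

(** Convergence of the error quaternion makes its velocity vanish in the limit, by
    Barbalat; as the gradient part does so too, the angular velocity tends to 0.
    Applied to the angular velocity, the same argument makes the remaining torque
    z_rho vanish, and the attitude approaches an eigenspace. *)
Lemma simple_limit (k : 'I_(1 + 3)) : (forall i, bg i = bg k -> i = k) ->
  tends (fun t => gshift (bg k) (x t)) 0 ->
  [/\ exists s : bool, tends (fun t => dotv (xT (x t) - (-1) ^+ s *: ug k)
         (xT (x t) - (-1) ^+ s *: ug k)) 0,
      tends (fun t => dotv (xw (x t)) (xw (x t))) 0 &
      exists m, tends (fun t => qshift (br m) (x t)) 0].
Proof.
move=> simple hk.
have [s hs] := simple_eigenvector_limit (Bq_tr (proj1 Wg_spd)) og eg simple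
  xT_continuous xT_unit hk.
have lf := lip_field J Wg Wr.
have hT i : tends (fun t => xT (field (x t)) i 0) 0.
  have h1 : tends (fun t => xT (x t) i 0) (((-1) ^+ s *: ug k) i 0).
    have /tends_dotv_coord/(_ i) := hs.
    move=> /tends_add/(_ (tends_cst (((-1) ^+ s *: ug k) i 0))); rewrite add0r.
    by apply: tends_ext => t _; rewrite !mxE subrK.
  apply: (@coord_derivative_tends0 (fun y => xT y i 0)
    (fun y => xT (field y) i 0) _ _ _ h1).
    exact: (lipM_usub (lipM_usub lf)).
  by move=> t t0; have [_ h] := ox t0; have /is_derive_mxP := der_xT h; exact.
have hw : tends (fun t => dotv (xw (x t)) (xw (x t))) 0.
  have /tends_dotv_coord h1 := hT.
  have := tends_add (tends_scale 8 h1) (tends_scale 8 Gg_tends0).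
  rewrite mulr0 addr0 => h2; apply: tends_le h2 _ => t t0.
  rewrite ger0_norm ?dotv_ge0// /field xT_mk /vT Nq_norm xT_unit// mul1r.
  have [[uT uQ] _] := ox t0; rewrite -(rot_norm (xw (x t)) uQ).
  move: (rotmx _ *m _) (Gg _ _) => a b.
  have := dotv_ge0 (2^-1 *: a - 2 *: b).
  rewrite !(dotvBl, dotvBr, dotvZl, dotvZr) [dotv b a]dotvC; lra.
have hdw i : tends (fun t => xw (field (x t)) i 0) 0.
  have h1 : tends (fun t => xw (x t) i 0) 0 by move/tends_dotv_coord: hw.
  apply: (@coord_derivative_tends0 (fun y => xw y i 0)
    (fun y => xw (field y) i 0) _ _ _ h1).
    exact: (lipM_dsub lf).
  by move=> t t0; have [_ h] := ox t0; have /is_derive_mxP := der_xw h; exact.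
have lin (X : R -> 'cV[R]_3) (A : 'M[R]_3) : (forall i, tends (fun t => X t i 0) 0) ->
    forall i, tends (fun t => (A *m X t) i 0) 0.
  move=> hX i; have := tends_sum (index_enum 'I_3) (fun m => tends_scale (A i m) (hX m)).
  rewrite big1 => [|m _]; last by rewrite mulr0.
  by apply: tends_ext => t _; rewrite mxE.
have hcross i : tends (fun t => (crossmx (xw (x t)) *m (J *m xw (x t))) i 0) 0.
  have hwi : forall i, tends (fun t => xw (x t) i 0) 0 by move/tends_dotv_coord: hw.
  have hJ := lin _ J hwi; move: i.
  have p a b c d := tends_sub (tends_mul (hwi a) (hJ b)) (tends_mul (hwi c) (hJ d)).
  move: p; rewrite !mulr0 subr0 => p; elim/ord3P.
  - by apply: tends_ext (p 1 2%:R 2%:R 1) => t _; move: (J *m xw (x t)) => a;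
      move: (xw (x t)) => b; rewrite mulmx3E !crossE; ring.
  - by apply: tends_ext (p 2%:R 0 0 2%:R) => t _; move: (J *m xw (x t)) => a;
      move: (xw (x t)) => b; rewrite mulmx3E !crossE; ring.
  - by apply: tends_ext (p 0 1 1 0) => t _; move: (J *m xw (x t)) => a;
      move: (xw (x t)) => b; rewrite mulmx3E !crossE; ring.
have hzg i : tends (fun t => zg Wg (xT (x t)) (xQ (x t)) i 0) 0.
  move: i; apply/tends_dotv_coord.
  have := tends_scale 4 Gg_tends0; rewrite mulr0; apply: tends_ext => t t0.
  have [[uT uQ] _] := ox t0.
  by rewrite /zg dotvNl dotvNr opprK dotvZl dotvZr rotT_norm//; ring.
have hGr : tends (fun t => dotv (Gr Wr (xQ (x t))) (Gr Wr (xQ (x t)))) 0.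
  apply/tends_dotv_coord => i.
  have := tends_scale (- 2^-1) (tends_sub (tends_add (lin _ J hdw i) (hcross i)) (hzg i)).
  rewrite addr0 subr0 mulr0; apply: tends_ext => t _.
  rewrite /field xw_mk (mulJ_vw _ _ J_spd) /zr !mxE.
  by field.
split; first by exists s.
  exact: hw.
apply: (eigenspace_limit (Bq_tr (proj1 Wr_spd)) or er xQ_continuous xQ_unit).
apply: tends_ext hGr => t t0; rewrite LqT_norm//; by have [[]] := ox t0.
Qed.

End OrbitLimits.


(** * Poincare recurrence for fields made of shears *)

Lemma shift_code_inj (b : nat) (x y : int) : (`|x| <= b)%N -> (`|y| <= b)%N ->
  inord (absz (x + b%:Z)%R) = inord (absz (y + b%:Z)%R) :> 'I_(2 * b).+1 -> x = y.
Proof. by move=> hx hy /(congr1 (@nat_of_ord _)); rewrite !inordK; lia. Qed.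

Lemma box_side (D s : nat) : (0 < s)%N -> ((2 * (D * s)).+1 <= (2 * D + 1) * s)%N.
Proof. by move=> s0; nia. Qed.

Lemma leq_exp2r_weak (a b m : nat) : (a <= b)%N -> (a ^ m <= b ^ m)%N.
Proof. by case: m => [//|m] ab; rewrite leq_exp2r. Qed.

Section LatticeRecurrence.
Variables (R : realType) (m : nat) (F : 'cV[R]_m -> 'cV[R]_m).

(** Such a field is divergence free; moreover the Euler step in one coordinate only is
    a shear, and it remains a bijection after rounding to a lattice. *)
Definition shear_field := forall (i : 'I_m) (x y : 'cV[R]_m),
  (forall j, j != i -> x j 0 = y j 0) -> F x i 0 = F y i 0.

Variables (L M : R).
Hypotheses (L0 : 0 < L) (M0 : 0 < M)
  (F_lip : forall x y, `|F x - F y| <= L * `|x - y|)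
  (F_bound : forall x, `|F x| <= M) (F_shear : shear_field).

Notation Z := {ffun 'I_m -> int}.

Section Step.
Variables (p : 'cV[R]_m) (eta h : R).
Hypotheses (eta0 : 0 < eta) (h0 : 0 < h).

Definition lattice_pt (z : Z) : 'cV[R]_m := \col_i (p i 0 + eta * (z i)%:~R).

Definition shear (z : Z) (i : 'I_m) : Z :=
  [ffun k => if k == i then z k + Num.floor (h * F (lattice_pt z) i 0 / eta) else z k].

Definition shears (s : seq 'I_m) (z : Z) : Z := foldl shear z s.

(** One Euler step in each coordinate in turn, each rounded to the lattice. *)
Definition lattice_step : Z -> Z := shears (enum 'I_m).

(** The displacement is unchanged by the shear, because the component does not depend
    on the coordinate that moves. *)
Lemma shear_inj i : injective (shear^~ i).
Proof.
move=> z y e; have off k : k != i -> z k = y k.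
  by move=> ki; have /ffunP/(_ k) := e; rewrite !ffunE (negbTE ki).
have same : F (lattice_pt z) i 0 = F (lattice_pt y) i 0.
  by apply: F_shear => j ji; rewrite !mxE off.
apply/ffunP => k; case: (eqVneq k i) => [->|]; last exact: off.
have /ffunP/(_ i) := e; rewrite !ffunE eqxx same; exact: addIr.
Qed.

Lemma shears_inj s : injective (shears s).
Proof.
elim: s => [|i s IH] z y //= e; apply: (@shear_inj i); exact: IH.
Qed.

Lemma lattice_step_inj : injective lattice_step.
Proof. exact: shears_inj. Qed.

Lemma floor_scaled (a : R) : `|eta * (Num.floor (a / eta))%:~R - a| <= eta.
Proof.
have /andP[h1 h2] := Num.Theory.floor_itv (a / eta).
rewrite intrD in h2.
have e1 : eta * (a / eta) = a by field; rewrite gt_eqF.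
have h3 : eta * (Num.floor (a / eta))%:~R <= a by rewrite -[leRHS]e1 ler_wpM2l// ltW.
have h4 : a <= eta * (Num.floor (a / eta))%:~R + eta.
  by rewrite -{1}e1 -[X in _ <= _ + X]mulr1 -mulrDr ler_wpM2l// ltW.
by rewrite ler_norml; apply/andP; split; lra.
Qed.

(** Every coordinate moves by at most h M + eta, so evaluating the field at partially
    updated points costs h L (h M + eta). *)
Lemma shears_error (z : Z) (s : seq 'I_m) (y : Z) : uniq s ->
  (forall k, k \in s -> y k = z k) ->
  `|lattice_pt y - lattice_pt z| <= h * M + eta ->
  (forall k, k \notin s -> shears s y k = y k) /\
  (forall k, k \in s -> `|lattice_pt (shears s y) k 0 - lattice_pt z k 0
     - h * F (lattice_pt z) k 0| <= eta + h * L * (h * M + eta)).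
Proof.
elim: s y => [|i s IH] y //= /andP[is_ us] yz near.
set y1 := shear y i.
have y1E k : k != i -> y1 k = y k by move=> ki; rewrite ffunE (negbTE ki).
have rho0 : 0 <= h * M + eta by rewrite addr_ge0 ?mulr_ge0 ?ltW.
have stepi : lattice_pt y1 i 0 - lattice_pt z i 0 =
    eta * (Num.floor (h * F (lattice_pt y) i 0 / eta))%:~R.
  rewrite !mxE ffunE eqxx yz ?mem_head// intrD; ring.
have near1 : `|lattice_pt y1 - lattice_pt z| <= h * M + eta.
  apply: mx_norm_le => // k j; rewrite (ord1 j) mxE [X in _ + X]mxE.
  case: (eqVneq k i) => [->|ki].
    rewrite stepi; have := floor_scaled (h * F (lattice_pt y) i 0).
    have : `|h * F (lattice_pt y) i 0| <= h * M.
      rewrite normrM (gtr0_norm h0) ler_wpM2l ?(ltW h0)//.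
      by apply: le_trans (F_bound (lattice_pt y)); exact: mx_norm_ge.
    set a := eta * _; set b := h * F _ _ _ => hb ha.
    have := ler_normD (a - b) b; rewrite subrK; lra.
  have -> : lattice_pt y1 k 0 = lattice_pt y k 0 by rewrite !mxE y1E.
  by apply: le_trans near; have := mx_norm_ge (lattice_pt y - lattice_pt z) k 0; rewrite mxE [X in _ + X]mxE.
have [|IH1 IH2] := IH y1 us _ near1.
  by move=> k ks; rewrite y1E ?yz ?inE ?ks ?orbT//; apply: contraNneq is_ => <-.
split=> k; first by rewrite inE negb_or => /andP[ki ks]; rewrite IH1// y1E.
rewrite inE => /orP[/eqP ->|ks]; last exact: IH2.
have -> : lattice_pt (shears s y1) i 0 = lattice_pt y1 i 0 by rewrite !mxE IH1.
rewrite stepi.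
have h1 := floor_scaled (h * F (lattice_pt y) i 0).
have h2 : `|h * F (lattice_pt y) i 0 - h * F (lattice_pt z) i 0| <= h * L * (h * M + eta).
  rewrite -mulrBr normrM (gtr0_norm h0) -mulrA ler_wpM2l ?(ltW h0)//.
  apply: le_trans (_ : `|F (lattice_pt y) - F (lattice_pt z)| <= _).
    by have := mx_norm_ge (F (lattice_pt y) - F (lattice_pt z)) i 0; rewrite mxE [X in _ + X]mxE.
  by apply: le_trans (F_lip _ _) _; rewrite ler_wpM2l ?(ltW L0).
move: h1 h2; set a := eta * _; set b := h * F (lattice_pt y) i 0; set c := h * F (lattice_pt z) i 0 => h1 h2.
have -> : a - c = (a - b) + (b - c) by ring.
by apply: le_trans (ler_normD _ _) _; exact: lerD.
Qed.

Lemma lattice_step_error (z : Z) :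
  `|lattice_pt (lattice_step z) - lattice_pt z - h *: F (lattice_pt z)|
  <= eta + h * L * (h * M + eta).
Proof.
have [|||_ e] := @shears_error z (enum 'I_m) z _ _ _; rewrite ?enum_uniq//.
  by rewrite subrr normr0 addr_ge0 ?mulr_ge0 ?ltW.
apply: mx_norm_le.
  by rewrite addr_ge0 ?(ltW eta0)// mulr_ge0 ?addr_ge0 ?mulr_ge0 ?(ltW h0) ?(ltW L0) ?(ltW M0) ?(ltW eta0).
move=> k j; rewrite (ord1 j); have := e k; rewrite mem_enum => /(_ isT).
by rewrite !(mxE _ _ k 0).
Qed.

(** The usual convergence of one-step methods, with the rounding errors included in
    the local error. *)
Lemma lattice_shadow (X : R -> 'cV[R]_m) (z : Z) (c : R) (N : nat) :
  X 0 = lattice_pt z ->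
  (forall t : R, 0 <= t <= h * N%:R -> is_derive t 1 X (F (X t))) ->
  eta + h * L * (h * M + eta) + L * M * h ^+ 2 <= c * (L * h) -> 0 <= c ->
  forall n, (n <= N)%N -> `|X (h * n%:R) - lattice_pt (iter n lattice_step z)|
     <= c * (expR (L * h * n%:R) - 1).
Proof.
move=> X0 dX hc c0.
have lipX s t : 0 <= s -> s <= t -> t <= h * N%:R -> `|X t - X s| <= M * (t - s).
  move=> s0 st tN; apply: mx_norm_le; first by rewrite mulr_ge0 ?(ltW M0)// subr_ge0.
  move=> i j; rewrite !mxE.
  have [|u /andP[su _] e] := @mean_value _ (fun u => X u i j) (fun u => F (X u) i j) s t st.
    move=> u /andP[su ut]; have u1 : 0 <= u <= h * N%:R by rewrite (le_trans s0)//= (le_trans ut).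
    by have /is_derive_mxP := dX u u1; exact.
  rewrite e normrM [`|t - s|]ger0_norm ?subr_ge0// ler_wpM2r ?subr_ge0//.
  exact: le_trans (mx_norm_ge _ i j) (F_bound _).
have euler t : 0 <= t -> t + h <= h * N%:R -> `|X (t + h) - X t - h *: F (X t)| <= L * M * h ^+ 2.
  move=> t0 tN; have th : t <= t + h by rewrite lerDl ltW.
  apply: mx_norm_le.
    by rewrite !mulr_ge0 ?exprn_ge0 ?(ltW L0) ?(ltW M0) ?(ltW h0).
  move=> i j; rewrite !mxE.
  have [|u /andP[tu uh] e] := @mean_value _ (fun u => X u i j) (fun u => F (X u) i j) t (t + h) th.
    move=> u /andP[tu uh]; have u1 : 0 <= u <= h * N%:R by rewrite (le_trans t0)//= (le_trans uh).
    by have /is_derive_mxP := dX u u1; exact.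
  rewrite e addrAC subrr add0r mulrC -mulrBr normrM (gtr0_norm h0).
  have -> : L * M * h ^+ 2 = h * (L * (M * h)) by ring.
  rewrite ler_wpM2l ?(ltW h0)//.
  apply: le_trans (_ : `|F (X u) - F (X t)| <= _).
    by have := mx_norm_ge (F (X u) - F (X t)) i j; rewrite !mxE.
  apply: le_trans (F_lip _ _) _; rewrite ler_wpM2l ?(ltW L0)//.
  by apply: le_trans (lipX t u t0 tu (le_trans uh tN)) _; rewrite ler_wpM2l ?(ltW M0)//; lra.
elim=> [|n IH] nN; first by rewrite !mulr0 expR0 subrr mulr0 X0 subrr normr0.
set y := iter n lattice_step z in IH *; set t := h * n%:R in IH *.
have t0 : 0 <= t by rewrite mulr_ge0 ?(ltW h0).
have eS : h * n.+1%:R = t + h by rewrite -natr1 mulrDr mulr1.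
have tN : t + h <= h * N%:R by rewrite -eS ler_wpM2l ?(ltW h0)// ler_nat.
have {}IH := IH (ltnW nN).
rewrite eS.
rewrite iterS -/y; set y' := lattice_step y.
have e1 := euler t t0 tN; have e2 := lattice_step_error y.
have e3 : `|h *: (F (X t) - F (lattice_pt y))| <= h * (L * `|X t - lattice_pt y|).
  by rewrite normrZ (gtr0_norm h0) ler_wpM2l ?(ltW h0).
have -> : X (t + h) - lattice_pt y' = (X (t + h) - X t - h *: F (X t))
   - (lattice_pt y' - lattice_pt y - h *: F (lattice_pt y))
   + (X t - lattice_pt y) + h *: (F (X t) - F (lattice_pt y)).
  by apply/matrixP => i j; rewrite !mxE; ring.
apply: le_trans (ler_normD _ _) _.
apply: le_trans (lerD (ler_normD _ _) (lexx _)) _.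
apply: le_trans (lerD (lerD (ler_normB _ _) (lexx _)) (lexx _)) _.
have -> : L * h * n.+1%:R = L * h * n%:R + L * h by rewrite -natr1; ring.
rewrite expRD; set E := expR (L * h * n%:R) in IH *.
have E0 : 0 < E by exact: expR_gt0.
have e4 : 1 + L * h <= expR (L * h) by exact: expR_ge1Dx.
have e5 : E * (1 + L * h) <= E * expR (L * h) by rewrite ler_wpM2l ?(ltW E0).
have e6 : c * (E * (1 + L * h) - 1) <= c * (E * expR (L * h) - 1).
  by rewrite ler_wpM2l// lerB.
have e7 : h * (L * `|X t - lattice_pt y|) <= h * (L * (c * (E - 1))).
  by rewrite ler_wpM2l ?(ltW h0)// ler_wpM2l ?(ltW L0).
have e8 : c * (E * (1 + L * h) - 1) = c * (E - 1) + h * (L * (c * (E - 1))) + c * (L * h).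
  by ring.
lra.
Qed.

End Step.

(** The number of images of a cube of side l that cannot be disjoint in a cube of
    half-side C + 1 + |p|: the ratio of the volumes, plus one. *)
Definition recurrence_count (p : 'cV[R]_m) (l C : R) : nat :=
  ((2 * Num.bound ((C + 1 + `|p|) / l) + 1) ^ m).+1.

(** Poincare recurrence without measures. The rounded scheme permutes the lattice.
    Take the s^m lattice points in a cube of side l, with s large; if more than
    recurrence_count of its iterates stay in a bounded region, there are more points
    than places, so that two iterates of points of the cube coincide. Injectivity
    cancels the common part of the iteration: a point of the cube is mapped to another
    one. The solutions shadow the scheme, the mesh l / K^2 being small compared with
    the time step T / K. *)
Theorem lattice_recurrence (p : 'cV[R]_m) (l T C : R) (X : 'cV[R]_m -> R -> 'cV[R]_m) :
  0 < l -> 0 < T ->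
  let H := T * (recurrence_count p l C)%:R in
  (forall z : 'cV[R]_m, (forall i, p i 0 <= z i 0 <= p i 0 + l) ->
     [/\ X z 0 = z, forall t : R, 0 <= t <= H -> is_derive t 1 (X z) (F (X z t)) &
         forall t, 0 <= t <= H -> `|X z t| <= C]) ->
  forall e : R, 0 < e -> exists z z' : 'cV[R]_m, exists k : nat,
    [/\ forall i, p i 0 <= z i 0 <= p i 0 + l,
        forall i, p i 0 <= z' i 0 <= p i 0 + l,
        (0 < k <= recurrence_count p l C)%N &
        `|X z' (T * k%:R) - z| <= e].
Proof.
move=> l0 T0 H hX e e0.
have C0 : 0 <= C.
  have [|_ _ hC] := hX p; first by move=> i; rewrite lexx lerDl ltW.
  by apply: le_trans (normr_ge0 _) (hC 0 _); rewrite lexx mulr_ge0 ?(ltW T0).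
have [D [hD JD]] : exists D : nat, (C + 1 + `|p|) / l <= D%:R /\
    recurrence_count p l C = ((2 * D + 1) ^ m).+1.
  exists (Num.bound ((C + 1 + `|p|) / l)); split=> //; apply/ltW.
  apply: le_lt_trans (ler_norm _) _.
  rewrite ger0_norm; last by rewrite divr_ge0 ?(ltW l0)// addr_ge0// addr_ge0.
  by apply: archi_boundP; rewrite divr_ge0 ?(ltW l0)// addr_ge0// addr_ge0.
pose Jn := ((2 * D + 1) ^ m).+1.
have HE : H = T * Jn%:R by rewrite /H JD.
(* the solutions are bounded by C, hence lattice points that shadow them within
   distance 1 by C + 1 *)
pose d := Num.min e 1.
have d0 : 0 < d by rewrite lt_min e0 ltr01.
(* the local error divided by the square of the step: each of its terms is of
   order 1 / K^2 *)
pose c2 := l + L * T * (M * T + l) + L * M * T ^+ 2.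
have c20 : 0 < c2.
  rewrite /c2 -addrA ltr_wpDr// addr_ge0//.
    by rewrite mulr_ge0 ?addr_ge0 ?mulr_ge0 ?(ltW L0) ?(ltW T0) ?(ltW M0) ?(ltW l0).
  by rewrite mulr_ge0 ?mulr_ge0 ?exprn_ge0 ?(ltW L0) ?(ltW T0) ?(ltW M0).
pose A := c2 / (L * T) * expR (L * T * Jn%:R).
have A0 : 0 < A by rewrite mulr_gt0 ?expR_gt0// divr_gt0// mulr_gt0.
have [K [K0 hK]] : exists K : nat, (0 < K)%N /\ A / K%:R <= d.
  exists (Num.bound (A / d)).+1; split=> //.
  rewrite ler_pdivrMr ?ltr0n// mulrC -ler_pdivrMr//.
  have : A / d < (Num.bound (A / d))%:R by apply: archi_boundP; rewrite divr_ge0 ?(ltW A0) ?(ltW d0).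
  by move=> /ltW/le_trans; apply; rewrite ler_nat.
have K0' : 0 < K%:R :> R by rewrite ltr0n.
have K1 : 1 <= K%:R :> R by rewrite ler1n.
pose s := (K ^ 2)%N.
have s0 : (0 < s)%N by rewrite expn_gt0 K0.
have sK : s%:R = K%:R ^+ 2 :> R by rewrite natrX.
pose eta := l / K%:R ^+ 2; pose h := T / K%:R.
have eta0 : 0 < eta by rewrite divr_gt0// exprn_gt0.
have h0 : 0 < h by rewrite divr_gt0.
pose S := lattice_step p eta h; pose pt := lattice_pt p eta.
have iterS_inj n : injective (iter n S).
  by elim: n => [//|n IH] x y /= /(lattice_step_inj (p := p) (eta := eta) (h := h)) /IH.
pose c := c2 / (L * T) / K%:R.
have c0 : 0 <= c by rewrite !divr_ge0 ?mulr_ge0 ?(ltW c20) ?(ltW L0) ?(ltW T0).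
have hc : eta + h * L * (h * M + eta) + L * M * h ^+ 2 <= c * (L * h).
  have k0 : K%:R != 0 :> R by rewrite gt_eqF.
  have -> : c * (L * h) = c2 / K%:R ^+ 2.
    by rewrite /c /h; field; rewrite k0 !gt_eqF.
  have -> : eta + h * L * (h * M + eta) + L * M * h ^+ 2 =
    (l + L * T * (M * T + l / K%:R) + L * M * T ^+ 2) / K%:R ^+ 2.
    by rewrite /eta /h; field.
  rewrite ler_wpM2r ?invr_ge0 ?exprn_ge0// /c2 lerD2r lerD2l ler_wpM2l//.
    by rewrite mulr_ge0 ?(ltW L0) ?(ltW T0).
  by rewrite lerD2l ler_pdivrMr// ler_peMr ?(ltW l0).
pose z0 (f : {ffun 'I_m -> 'I_s}) : Z := [ffun i => (f i : nat)%:Z].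
have z0cube f i : p i 0 <= pt (z0 f) i 0 <= p i 0 + l.
  rewrite mxE ffunE lerDl mulr_ge0 ?(ltW eta0)//= lerD2l.
  have -> : l = eta * s%:R by rewrite sK /eta divfK// gt_eqF// exprn_gt0.
  by rewrite ler_wpM2l ?(ltW eta0)// -pmulrn ler_nat ltnW.
have shadow f n : (n <= Jn * K)%N ->
    `|X (pt (z0 f)) (h * n%:R) - pt (iter n S (z0 f))| <= d.
  move=> nJ; have [X0 dX _] := hX _ (z0cube f).
  have hN : h * (Jn * K)%:R = H by rewrite HE natrM /h; field; rewrite gt_eqF.
  have dX' t : 0 <= t <= h * (Jn * K)%:R -> is_derive t 1 (X (pt (z0 f))) (F (X (pt (z0 f)) t)).
    by rewrite hN; exact: dX.
  apply: le_trans (lattice_shadow eta0 h0 X0 dX' hc c0 nJ) _.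
  apply: le_trans hK; rewrite /A [leRHS]mulrAC -/c ler_wpM2l//.
  apply: le_trans (_ : expR (L * h * n%:R) <= _); first by rewrite lerBlDr lerDl.
  rewrite ler_expR /h; have -> : L * T * Jn%:R = L * (T / K%:R) * (Jn * K)%:R.
    by rewrite natrM; field; rewrite gt_eqF.
  by rewrite ler_wpM2l ?ler_nat// mulr_ge0 ?(ltW L0)// (ltW h0).
have inbox f n i : (n <= Jn * K)%N -> (`|iter n S (z0 f) i|%N <= D * s)%N.
  move=> nJ; set w := iter n S (z0 f).
  have [_ _ hC] := hX _ (z0cube f).
  have hn : 0 <= h * n%:R <= H.
    rewrite mulr_ge0 ?(ltW h0)//= HE /h.
    have -> : T * Jn%:R = T / K%:R * (Jn * K)%:R by rewrite natrM; field; rewrite gt_eqF.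
    by rewrite ler_wpM2l ?ler_nat// (ltW h0).
  have h1 := hC (h * n%:R) hn; have h2 := shadow f n nJ.
  have h3 : `|pt w i 0| <= C + 1.
    apply: le_trans (mx_norm_ge (pt w) i 0) _.
    have := ler_normB (X (pt (z0 f)) (h * n%:R)) (X (pt (z0 f)) (h * n%:R) - pt w).
    rewrite opprB addrCA subrr addr0; have : d <= 1 by rewrite ge_min lexx orbT.
    by move: h2; rewrite -/w; lra.
  have h4 : `|eta * (w i)%:~R| <= C + 1 + `|p|.
    have -> : eta * (w i)%:~R = pt w i 0 - p i 0 by rewrite mxE; ring.
    by apply: le_trans (ler_normB _ _) _; rewrite lerD// mx_norm_ge.
  rewrite -(ler_nat R) natrM.
  have -> : `|w i|%N%:R = `|(w i)%:~R| :> R by rewrite natr_absz intr_norm.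
  move: h4; rewrite normrM (gtr0_norm eta0) => h4.
  rewrite -(ler_pM2l eta0); apply: le_trans h4 _.
  have -> : eta * (D%:R * s%:R) = D%:R * l.
    by rewrite sK /eta; field; rewrite gt_eqF.
  by rewrite -ler_pdivrMr.
(* all iterates have coordinates between - b and b, so they are coded by a finite
   set; there are more pairs (iterate, initial point) than codes *)
pose b := (D * s)%N.
pose code (z : Z) : {ffun 'I_m -> 'I_(2 * b).+1} :=
  [ffun i => inord (absz (z i + b%:Z)%R)].
pose Phi (jf : 'I_Jn * {ffun 'I_m -> 'I_s}) := code (iter (jf.1 * K) S (z0 jf.2)).
have jK (j : 'I_Jn) : (j * K <= Jn * K)%N by rewrite leq_mul2r ltnW ?orbT.
have code_inj (z y : Z) : (forall i, (`|z i| <= b)%N) -> (forall i, (`|y i| <= b)%N) ->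
    code z = code y -> z = y.
  move=> hz hy /ffunP ezy; apply/ffunP => i; have := ezy i; rewrite !ffunE.
  have hzi := hz i; have hyi := hy i.
  exact: shift_code_inj.
have nPhi : ~ injective Phi.
  move=> /leq_card; rewrite card_prod !card_ffun !card_ord leqNgt => /negP; apply.
  apply: leq_ltn_trans (_ : ((2 * D + 1) ^ m * s ^ m < _)%N).
    by rewrite -expnMn leq_exp2r_weak// box_side.
  by rewrite ltn_mul2r expn_gt0 s0/= /Jn.
have [[j f] [[j' f'] [ne eq]]] : exists a a', a <> a' /\ Phi a = Phi a'.
  apply: contrapT => h1; apply: nPhi => a a' eq; apply: contrapT => ne.
  by apply: h1; exists a, a'.
wlog jj : j f j' f' ne eq / (j <= j')%N.
  move=> W; have [jj|/ltnW jj] := leqP j j'; first exact: (W j f j' f').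
  by apply: (W j' f' j f) => // e1; apply: ne; rewrite e1.
have itereq : iter (j * K) S (z0 f) = iter (j' * K) S (z0 f').
  by apply: code_inj eq => i; exact: inbox.
have : iter (j * K) S (z0 f) = iter (j * K) S (iter ((j' - j) * K) S (z0 f')).
  by rewrite -iterD -mulnDl subnKC.
move=> /iterS_inj zz.
exists (pt (z0 f)), (pt (z0 f')), (j' - j)%N; split.
- exact: z0cube.
- exact: z0cube.
- apply/andP; split; last by rewrite JD (leq_trans (leq_subr _ _))// ltnW.
  rewrite subn_gt0 ltn_neqAle jj andbT; apply/negP => /eqP ejj.
  apply: ne; move: zz; rewrite ejj subnn mul0n /= => zz.
  congr pair; first exact: val_inj.
  apply/ffunP => i; have /ffunP/(_ i) := zz; rewrite !ffunE => -[?]; exact: val_inj.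
- have nJ : ((j' - j) * K <= Jn * K)%N.
    by rewrite leq_mul2r (leq_trans (leq_subr _ _)) ?orbT// ltnW.
  have eT : h * ((j' - j) * K)%:R = T * (j' - j)%:R.
    by rewrite natrM /h; field; rewrite gt_eqF.
  have := shadow f' _ nJ; rewrite -zz eT => /le_trans; apply.
  by rewrite ge_min lexx.
Qed.

End LatticeRecurrence.


(** * A volume-preserving extension of the closed loop, and dependence on initial states *)

Section Frames.
Variable R : realType.

(** The matrix that changes from coordinates in the frame. *)
Definition frame m (v : 'I_m -> 'cV[R]_m) : 'M[R]_m := \matrix_(i, j) v j i 0.

Lemma frame_tr m (v : 'I_m -> 'cV[R]_m) x j : ((frame v)^T *m x) j 0 = dotv (v j) x.
Proof. by rewrite mxE dotvE; apply: eq_bigr => i _; rewrite !mxE. Qed.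

Lemma frame_delta m (v : 'I_m -> 'cV[R]_m) j : frame v *m delta_mx j 0 = v j.
Proof.
by rewrite -colE; apply/matrixP => i k; rewrite !mxE (ord1 k).
Qed.

Lemma frame_orth m (v : 'I_m -> 'cV[R]_m) : orthonormal v -> (frame v)^T *m frame v = 1%:M.
Proof.
move=> ov; apply/matrixP => i j; rewrite mxE mxE -(ov i j) dotvE.
by apply: eq_bigr => k _; rewrite !mxE.
Qed.

Lemma frame_orthr m (v : 'I_m -> 'cV[R]_m) : orthonormal v -> frame v *m (frame v)^T = 1%:M.
Proof. by move=> ov; apply: mulmx1C; exact: frame_orth. Qed.

Lemma frame_norm m (v : 'I_m -> 'cV[R]_m) x : orthonormal v ->
  dotv (frame v *m x) (frame v *m x) = dotv x x.
Proof. by move=> ov; rewrite dotv_mulr mulmxA frame_orth// mul1mx. Qed.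

Lemma frameT_norm m (v : 'I_m -> 'cV[R]_m) x : orthonormal v ->
  dotv ((frame v)^T *m x) ((frame v)^T *m x) = dotv x x.
Proof. by move=> ov; rewrite dotv_mulr trmxK mulmxA frame_orthr// mul1mx. Qed.

Definition hsign (i j : nat) : R :=
  nth 0 (nth [::] [:: [:: 1; 1; 1; 1]; [:: 1; -1; 1; -1];
                      [:: 1; 1; -1; -1]; [:: 1; -1; -1; 1]] i) j.

Lemma hsign_sum (f : nat -> R) : \sum_(k < 1 + 3) f k = f 0%N + f 1%N + f 2%N + f 3%N.
Proof. by rewrite !big_ord_recl big_ord0 addr0 !addrA. Qed.

Lemma hsign_orth (i j : 'I_(1 + 3)) :
  \sum_(k < 1 + 3) hsign i k * hsign j k = 4 * (i == j)%:R.
Proof.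
rewrite (hsign_sum (fun k => hsign i k * hsign j k)).
rewrite -val_eqE.
by case: i => -[|[|[|[|//]]]] ?; case: j => -[|[|[|[|//]]]] ?; rewrite /hsign/=; ring.
Qed.

Lemma hsign_sqr (i k : 'I_(1 + 3)) : hsign i k ^+ 2 = 1.
Proof.
by case: i => -[|[|[|[|//]]]] ?; case: k => -[|[|[|[|//]]]] ?; rewrite /hsign/=; ring.
Qed.

(** All entries of a Hadamard matrix have the same modulus, so in the new orthonormal
    basis each diagonal entry of the form is the mean of its eigenvalues. *)
Definition hadamard (u : 'I_(1 + 3) -> quat R) (j : 'I_(1 + 3)) : quat R :=
  2^-1 *: \sum_(k < 1 + 3) hsign j k *: u k.

Lemma hadamard_coord u i k : orthonormal u -> dotv (u k) (hadamard u i) = 2^-1 * hsign i k.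
Proof.
move=> ou; rewrite /hadamard dotvZr dotv_sumr; congr (_ * _).
rewrite (bigD1 k)//= dotvZr ou eqxx mulr1 big1 ?addr0// => m mk.
by rewrite dotvZr ou eq_sym (negbTE mk) mulr0.
Qed.

Lemma hadamard_on u : orthonormal u -> orthonormal (hadamard u).
Proof.
move=> ou i j; rewrite (orthonormal_dotv _ _ ou).
transitivity (4^-1 * \sum_(k < 1 + 3) hsign i k * hsign j k).
  by rewrite mulr_sumr; apply: eq_bigr => k _; rewrite !hadamard_coord//; field.
by rewrite hsign_orth mulrA mulVf ?pnatr_eq0// mul1r.
Qed.

Lemma hadamard_diag (A : 'M[R]_(1 + 3)) u b i : A^T = A -> orthonormal u ->
  (forall k, A *m u k = b k *: u k) ->
  dotv (hadamard u i) (A *m hadamard u i) = 4^-1 * \sum_k b k.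
Proof.
move=> sA ou eu; rewrite (quadform_sum sA ou eu) mulr_sumr; apply: eq_bigr => k _.
by rewrite hadamard_coord// exprMn hsign_sqr; field.
Qed.

Lemma normalize_near m (x y : 'cV[R]_m) : dotv y y = 1 -> x != 0 ->
  enorm ((enorm x)^-1 *: x - y) <= 2 * enorm (x - y).
Proof.
move=> uy x0; have ey : enorm y = 1 by rewrite /enorm uy sqrtr1.
have ex : 0 < enorm x by rewrite lt_def enorm_ge0 enorm_eq0 x0.
have -> : (enorm x)^-1 *: x - y = ((enorm x)^-1 - 1) *: x + (x - y).
  by rewrite scalerBl scale1r addrA subrK.
apply: le_trans (ler_enormD _ _) _; rewrite mulrDl mul1r lerD2r enormZ.
rewrite -[X in _ * X]ger0_norm ?(ltW ex)// -normrM mulrBl mul1r mulVf ?gt_eqF// -ey.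
rewrite ler_norml; apply/andP; split.
  rewrite lerNl opprB lerBlDr; apply: le_trans (ler_enormD _ _); by rewrite subrK.
rewrite lerBlDr; have := ler_enormD (y - x) x; rewrite subrK.
by rewrite -(enormN (y - x)) opprB.
Qed.

End Frames.

Section ExtendedField.
Variables (R : realType) (J Wg Wr : 'M[R]_3).
Hypotheses (J_spd : sym_posdef J) (Wg_spd : sym_posdef Wg) (Wr_spd : sym_posdef Wr).
Notation E := 'cV[R]_(1 + 3 + (1 + 3) + 3).
Notation orbit := (orbit J Wg Wr).
Notation en := (en J Wg Wr).

Variables (h : 'I_(1 + 3) -> quat R) (v : 'I_3 -> 'cV[R]_3) (l : 'I_3 -> R) (c : R).
Hypotheses (oh : orthonormal h) (hdiag : forall j, dotv (h j) (Bq Wg *m h j) = c).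
Hypotheses (ov : orthonormal v) (ev : forall i, J *m v i = l i *: v i).

Definition from_frame (z : E) : E := mkx (frame h *m xT z) (xQ z) (frame v *m xw z).
Definition to_frame (y : E) : E := mkx ((frame h)^T *m xT y) (xQ y) ((frame v)^T *m xw y).

Lemma to_frameK y : from_frame (to_frame y) = y.
Proof.
rewrite /from_frame /to_frame !xE !mulmxA !frame_orthr// !mul1mx; exact: mkx_eta.
Qed.

Lemma from_frameK z : to_frame (from_frame z) = z.
Proof.
rewrite /from_frame /to_frame !xE !mulmxA !frame_orth// !mul1mx; exact: mkx_eta.
Qed.

Variable kappa : R.
Hypothesis kappa0 : 0 < kappa.

(** The rotation of Q / |Q|, kept Lipschitz near Q = 0. The extended field has to be
    defined and Lipschitz on the whole space, although only quaternions of length at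
    least 1/2 matter. *)
Definition rotn (Q : quat R) : 'M[R]_3 :=
  (Num.max (dotv Q Q) 4^-1)^-1 *: ((Nq Q)^T *m Lq Q).

(** The field of Y = rho T, with rho' / rho = c - T . B T. The cubic term of the
    gradient descent cancels, and for c a quarter of the trace of B the remaining
    linear part c - B is trace free. *)
Definition xfT (Y Q : quat R) (w : 'cV[R]_3) : quat R :=
  2^-1 *: (Nq Y *m (rotn Q *m w)) + (c *: Y - Bq Wg *m Y).
(** The torques are rescaled so that they only depend on the directions of Y and Q. *)
Definition xfw (Y Q : quat R) (w : 'cV[R]_3) : 'cV[R]_3 :=
  invmx J *m (- (crossmx w *m (J *m w))
    - 2 *: ((rotn Q)^T *m ((Num.max (dotv Y Y) kappa)^-1 *: Gg Wg Y))
    - 2 *: ((Num.max (dotv Q Q) 4^-1)^-1 *: Gr Wr Q)).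
Definition xfield (y : E) : E :=
  mkx (xfT (xT y) (xQ y) (xw y)) (vQ (xQ y) (xw y)) (xfw (xT y) (xQ y) (xw y)).

Definition frame_field (z : E) : E := to_frame (xfield (from_frame z)).

Lemma mkx_T (T Q : quat R) (w : 'cV[R]_3) i : mkx T Q w (lshift _ (lshift _ i)) 0 = T i 0.
Proof. by rewrite /mkx !col_mxEu. Qed.
Lemma mkx_Q (T Q : quat R) (w : 'cV[R]_3) i : mkx T Q w (lshift _ (rshift _ i)) 0 = Q i 0.
Proof. by rewrite /mkx col_mxEu col_mxEd. Qed.
Lemma mkx_w (T Q : quat R) (w : 'cV[R]_3) i : mkx T Q w (rshift _ i) 0 = w i 0.
Proof. by rewrite /mkx col_mxEd. Qed.

Lemma to_frame_T y j : to_frame y (lshift _ (lshift _ j)) 0 = dotv (h j) (xT y).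
Proof. by rewrite /to_frame mkx_T frame_tr. Qed.
Lemma to_frame_Q y j : to_frame y (lshift _ (rshift _ j)) 0 = xQ y j 0.
Proof. by rewrite /to_frame mkx_Q. Qed.
Lemma to_frame_w y j : to_frame y (rshift _ j) 0 = dotv (v j) (xw y).
Proof. by rewrite /to_frame mkx_w frame_tr. Qed.

Lemma frame_field_T z j : frame_field z (lshift _ (lshift _ j)) 0 =
  dotv (h j) (xfT (frame h *m xT z) (xQ z) (frame v *m xw z)).
Proof. by rewrite /frame_field to_frame_T /xfield xT_mk /from_frame !xE. Qed.
Lemma frame_field_Q z j : frame_field z (lshift _ (rshift _ j)) 0 =
  vQ (xQ z) (frame v *m xw z) j 0.
Proof. by rewrite /frame_field to_frame_Q /xfield xQ_mk /from_frame !xE. Qed.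
Lemma frame_field_w z j : frame_field z (rshift _ j) 0 =
  dotv (v j) (xfw (frame h *m xT z) (xQ z) (frame v *m xw z)).
Proof. by rewrite /frame_field to_frame_w /xfield xw_mk /from_frame !xE. Qed.

Lemma Nq_lin (P Q : quat R) (x : 'cV[R]_3) : Nq (P + Q) *m x = Nq P *m x + Nq Q *m x.
Proof. by rewrite -!bar_qmul qmulDr. Qed.

Lemma NqZ a (Q : quat R) (x : 'cV[R]_3) : Nq (a *: Q) *m x = a *: (Nq Q *m x).
Proof. by rewrite -!bar_qmul qmulZr. Qed.

Lemma Lq_lin (P Q : quat R) (x : 'cV[R]_3) : Lq (P + Q) *m x = Lq P *m x + Lq Q *m x.
Proof. by rewrite -!qmul_bar qmulDl. Qed.

Lemma LqZ a (Q : quat R) (x : 'cV[R]_3) : Lq (a *: Q) *m x = a *: (Lq Q *m x).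
Proof. by rewrite -!qmul_bar qmulZl. Qed.

Lemma NqTZ a (Q P : quat R) : (Nq (a *: Q))^T *m P = a *: ((Nq Q)^T *m P).
Proof.
rewrite !NqT_mul !qE crossZ -scalemxAl; move: (crossmx _ *m _) => u.
by apply/matrixP => i j; rewrite !mxE; ring.
Qed.

Lemma LqTZ a (Q P : quat R) : (Lq (a *: Q))^T *m P = a *: ((Lq Q)^T *m P).
Proof.
rewrite !LqT_mul !qE crossZ -scalemxAl; move: (crossmx _ *m _) => u.
by apply/matrixP => i j; rewrite !mxE; ring.
Qed.

Lemma dotv_cross_l (x y : 'cV[R]_3) : dotv x (crossmx x *m y) = 0.
Proof. by rewrite dotv_mulr cross_tr mulNmx crossxx oppr0 dotv0l. Qed.

Lemma dotv_cross_r (x y : 'cV[R]_3) : dotv x (crossmx y *m x) = 0.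
Proof. by rewrite crossC dotvNr dotv_cross_l oppr0. Qed.

Lemma dotv_delta m (x : 'cV[R]_m) j : dotv (delta_mx j 0) x = x j 0.
Proof.
rewrite dotvE (bigD1 j)//= big1 => [|k kj]; first by rewrite !mxE !eqxx mul1r addr0.
by rewrite !mxE (negbTE kj) mul0r.
Qed.

Lemma off_delta m (x y : 'cV[R]_m) j : (forall i, i != j -> x i 0 = y i 0) ->
  x = y + (x j 0 - y j 0) *: delta_mx j 0.
Proof.
move=> xy; apply/matrixP => i k; rewrite (ord1 k) !mxE.
case: (eqVneq i j) => [->|ij] /=; first by ring.
by rewrite mulr0 addr0 xy.
Qed.

(** No component involves its own coordinate: in the Hadamard frame the diagonal of B
    - c vanishes, multiplications by pure quaternions are skew, and in the principal
    axes of J the i-th component of the gyroscopic torque is a product of the other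
    two velocities. *)
Lemma frame_field_shear : shear_field frame_field.
Proof.
move=> i x y xy.
case: (split_ordP i) => [k ik|j ij]; last first.
  have eT : xT x = xT y.
    by apply/matrixP => a b; rewrite (ord1 b) !mxE; apply: xy; rewrite ij eq_lrshift.
  have eQ : xQ x = xQ y.
    by apply/matrixP => a b; rewrite (ord1 b) !mxE; apply: xy; rewrite ij eq_lrshift.
  have ew : forall k, k != j -> xw x k 0 = xw y k 0.
    by move=> k kj; rewrite !mxE; apply: xy; rewrite ij (inj_eq (@rshift_inj _ _)).
  rewrite ij; apply: (etrans (frame_field_w x j)); apply: (etrans _ (esym (frame_field_w y j))).
  rewrite eT eQ /xfw.
  set Rw := - (2 *: _); set Rr := - (2 *: _).
  have lv (u : 'cV[R]_3) : dotv (v j) (invmx J *m u) = (l j)^-1 * dotv (v j) u.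
    have lj : l j != 0.
      have v0 : v j != 0 by rewrite -dotv_gt0 ov eqxx ltr01.
      have [_ /(_ _ v0)] := J_spd; rewrite ev dotvZr ov eqxx mulr1 => /lt0r_neq0; exact.
    rewrite dotv_mulr trmx_inv (proj1 J_spd).
    have -> : v j = (l j)^-1 *: (J *m v j) by rewrite ev scalerA mulVf// scale1r.
    rewrite -scalemxAr mulmxA mulVmx ?posdef_unitmx// mul1mx !dotvZl ev dotvZl.
    by rewrite mulrA mulVf// mul1r.
  rewrite !lv; congr (_ * _); rewrite !dotvDr; congr (_ + _ + _); rewrite !dotvNr; congr (- _).
  rewrite (off_delta ew); set s := _ - _; set w := xw y.
  rewrite mulmxDr -scalemxAr frame_delta; set W := frame v *m w.
  rewrite mulmxDr -scalemxAr ev crossD crossZ mulmxDl !mulmxDr -!scalemxAl -!scalemxAr.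
  by rewrite !dotvDr !dotvZr dotv_cross_r !dotv_cross_l; ring.
case: (split_ordP k) => j kj; rewrite ik kj.
  have eQ : xQ x = xQ y.
    by apply/matrixP => a b; rewrite (ord1 b) !mxE; apply: xy; rewrite ik kj ?eq_rlshift ?eq_lshift ?eq_lrshift ?eq_rlshift.
  have ew : xw x = xw y.
    by apply/matrixP => a b; rewrite (ord1 b) !mxE; apply: xy; rewrite ik kj ?eq_rlshift ?eq_lshift ?eq_lrshift ?eq_rlshift.
  have eT : forall m, m != j -> xT x m 0 = xT y m 0.
    by move=> m mj; rewrite !mxE; apply: xy; rewrite ik kj !(inj_eq (@lshift_inj _ _)).
  apply: (etrans (frame_field_T x j)); apply: (etrans _ (esym (frame_field_T y j))).
  rewrite eQ ew /xfT.
  rewrite (off_delta eT); set s := _ - _; set w := rotn _ *m _; set T := xT y.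
  rewrite mulmxDr -scalemxAr frame_delta; set Y := frame h *m T.
  rewrite Nq_lin NqZ mulmxDr -!scalemxAr !scalerDr !dotvDr !dotvNr !dotvDr !dotvZr hdiag oh eqxx /=.
  by rewrite mulr1 [dotv (h j) (Nq (h j) *m _)]dotv_mulr NqTQ dotv0l; ring.
have eT : xT x = xT y.
  by apply/matrixP => a b; rewrite (ord1 b) !mxE; apply: xy; rewrite ik kj ?eq_rlshift ?eq_lshift ?eq_lrshift ?eq_rlshift.
have ew : xw x = xw y.
  by apply/matrixP => a b; rewrite (ord1 b) !mxE; apply: xy; rewrite ik kj ?eq_rlshift ?eq_lshift ?eq_lrshift ?eq_rlshift.
have eQ : forall m, m != j -> xQ x m 0 = xQ y m 0.
  move=> m mj; rewrite !mxE; apply: xy.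
  by rewrite ik kj (inj_eq (@lshift_inj _ _)) (inj_eq (@rshift_inj _ _)).
apply: (etrans (frame_field_Q x j)); apply: (etrans _ (esym (frame_field_Q y j))).
rewrite ew /vQ.
set w := frame v *m _; rewrite (off_delta eQ); set s := _ - _; set Q := xQ y.
rewrite Lq_lin LqZ [LHS]mxE [RHS]mxE; congr (_ * _); rewrite [LHS]mxE.
rewrite [X in _ + X]mxE -[(Lq _ *m w) j 0 in X in _ + X]dotv_delta.
by rewrite dotv_mulr LqTQ dotv0l mulr0 addr0.
Qed.

Lemma lip_frame_field : lipM frame_field.
Proof.
have lT : lipM (fun z => frame h *m xT z).
  by apply: lipM_mul; [exact: lipM_cst|exact: lip_xT].
have lw : lipM (fun z => frame v *m xw z).
  by apply: lipM_mul; [exact: lipM_cst|exact: lip_xw].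
have lQ := @lip_xQ R.
have inv (G : E -> quat R) (k : R) : 0 < k -> lipM G ->
    lipB (fun z => (Num.max (dotv (G z) (G z)) k)^-1).
  move=> k0 lG; apply: (lipB_inv k0); first by move=> z; rewrite le_max lexx orbT.
  by apply: lipB_max; exact: lipB_dotv.
have q0 : 0 < 4^-1 :> R by rewrite invr_gt0.
have lR : lipM (fun z => rotn (xQ z)).
  apply: lipM_scale; first exact: inv.
  by apply: lipM_mul; [exact/lipM_tr/lipM_Nq|exact/lipM_Lq].
have lGg (G : E -> quat R) : lipM G -> lipM (fun z => Gg Wg (G z)).
  move=> lG; apply: lipM_mul; first exact/lipM_tr/lipM_Nq.
  by apply: lipM_mul; [exact: lipM_cst|].
have lGr (G : E -> quat R) : lipM G -> lipM (fun z => Gr Wr (G z)).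
  move=> lG; apply: lipM_mul; first exact/lipM_tr/lipM_Lq.
  by apply: lipM_mul; [exact: lipM_cst|].
have two m (G : E -> 'cV[R]_m) (k : R) : lipM G -> lipM (fun z => k *: G z).
  by move=> lG; apply: lipM_scale; [exact: lipB_cst|].
apply: (@lipM_ext _ _ _ _ (fun z => mkx
    ((frame h)^T *m xfT (frame h *m xT z) (xQ z) (frame v *m xw z))
    (vQ (xQ z) (frame v *m xw z))
    ((frame v)^T *m xfw (frame h *m xT z) (xQ z) (frame v *m xw z)))).
  by move=> z; rewrite /frame_field /to_frame /xfield /from_frame !xE.
apply: lipM_col_mx; first apply: lipM_col_mx.
- apply: lipM_mul; first exact: lipM_cst.
  apply: lipM_add.
    apply: two; apply: lipM_mul; first exact: lipM_Nq.
    exact: lipM_mul.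
  apply: lipM_sub; first exact: two.
  by apply: lipM_mul; [exact: lipM_cst|].
- by apply: two; apply: lipM_mul => //; exact: lipM_Lq.
- apply: lipM_mul; first exact: lipM_cst.
  apply: lipM_mul; first exact: lipM_cst.
  apply: lipM_sub; first apply: lipM_sub.
  + apply: lipM_opp; apply: lipM_mul; first exact: lipM_cross.
    by apply: lipM_mul; [exact: lipM_cst|].
  + apply: two; apply: lipM_mul; first exact: lipM_tr.
    by apply: lipM_scale; [exact: inv|exact: lGg].
  + by apply: two; apply: lipM_scale; [exact: inv|exact: lGr].
Qed.

(** The factor rho absorbs the cubic term of the gradient descent, and the normalised
    torques do not see either scaling. *)
Lemma extended_orbit (x : R -> E) (rho : R -> R) (k t : R) :
  orbit x t -> is_derive t 1 rho (rho t * (c - dotv (xT (x t)) (Bq Wg *m xT (x t)))) ->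
  kappa <= rho t ^+ 2 -> 4^-1 <= k ^+ 2 ->
  let y u := mkx (rho u *: xT (x u)) (k *: xQ (x u)) (xw (x u)) in
  is_derive t 1 y (xfield (y t)).
Proof.
move=> ox drho rk k4 y; have [[uT uQ] dx] := ox.
have k0 : k ^+ 2 != 0 by rewrite gt_eqF// (lt_le_trans _ k4)// invr_gt0.
have r0 : rho t ^+ 2 != 0 by rewrite gt_eqF// (lt_le_trans _ rk).
set T := xT (x t); set Q := xQ (x t); set w := xw (x t).
have rotnE : rotn (k *: Q) = rotmx Q.
  rewrite /rotn dotvZl dotvZr (proj1 (unit_quatE Q) uQ) mulr1 -expr2 (max_idPl k4).
  rewrite (rot_NL uQ); apply/matrixP => i j.
  have lin (u : 'cV[R]_3) : (Nq (k *: Q))^T *m (Lq (k *: Q) *m u) = k ^+ 2 *: ((Nq Q)^T *m (Lq Q *m u)).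
    by rewrite LqZ -scalemxAr NqTZ scalerA -expr2.
  have := lin (delta_mx j 0); rewrite [LHS]mulmxA [in RHS]mulmxA -!colE => /matrixP/(_ i 0).
  rewrite -/Q; move: (_ *m Lq (k *: Q)) (_ *m Lq Q) => A A'; rewrite !mxE => ->.
  by rewrite mulrA mulVf// mul1r.
apply: der_col_mx; first apply: der_col_mx.
- have dT := der_xT dx.
  apply: der_eq (der_scale drho dT); rewrite /field !xE /xfT rotnE -/T -/Q -/w.
  rewrite /vT /Gg mulmxBr NqNqT (proj1 (unit_quatE T) uT) scale1r NqZ -!scalemxAr.
  by rewrite !scalerBr !scalerA -/T; set a := dotv T _; set b := Nq T *m _; set d := Bq Wg *m T;
    apply/matrixP => i j; rewrite !mxE; ring.
- have dQ := derZ k (der_xQ dx).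
  apply: der_eq dQ; rewrite /field !xE /vQ LqZ !scalerA -/Q -/w.
  by rewrite mulrC.
- have dw := der_xw dx.
  apply: der_eq dw; rewrite /field !xE /vw /xfw rotnE -/T -/Q -/w; congr (_ *m _).
  have -> : (Num.max (dotv (rho t *: T) (rho t *: T)) kappa)^-1 *: Gg Wg (rho t *: T) = Gg Wg T.
    rewrite dotvZl dotvZr (proj1 (unit_quatE T) uT) mulr1 -expr2 (max_idPl rk).
    by rewrite /Gg NqTZ -!scalemxAr !scalerA -mulrA -expr2 mulVf ?scale1r.
  have -> : (Num.max (dotv (k *: Q) (k *: Q)) 4^-1)^-1 *: Gr Wr (k *: Q) = Gr Wr Q.
    rewrite dotvZl dotvZr (proj1 (unit_quatE Q) uQ) mulr1 -expr2 (max_idPl k4).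
    by rewrite /Gr LqTZ -!scalemxAr !scalerA -mulrA -expr2 mulVf ?scale1r.
  by [].
Qed.

End ExtendedField.

Section Dependence.
Variables (R : realType) (J Wg Wr : 'M[R]_3).
Hypotheses (J_spd : sym_posdef J) (Wg_spd : sym_posdef Wg) (Wr_spd : sym_posdef Wr).
Notation E := 'cV[R]_(1 + 3 + (1 + 3) + 3).
Notation orbit := (orbit J Wg Wr).
Notation en := (en J Wg Wr).

Definition forward (x : R -> E) := forall t, 0 <= t -> orbit x t.

Lemma is_derive_shift m (x : R -> 'cV[R]_m) (s t : R) dx : is_derive (t + s) 1 x dx ->
  is_derive t 1 (fun u => x (u + s)) dx.
Proof.
move=> /is_derive_mxP h; apply/is_derive_mxP => i j.
have d1 : is_derive t 1 (fun u : R => u + s) 1.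
  by apply: der_eq (derD (is_derive_id t 1) (der_cst t s)); rewrite addr0.
have := @is_derive1_comp R (fun u => x u i j) (fun u => u + s) t _ _ (h i j) d1.
by apply: der_eq; rewrite mulr1.
Qed.

Lemma orbit_time_shift (x : R -> E) (s t : R) : orbit x (t + s) -> orbit (fun u => x (u + s)) t.
Proof. by move=> [ux dx]; split=> //; exact: is_derive_shift. Qed.

Lemma forward_shift (x : R -> E) (s : R) : 0 <= s -> forward x -> forward (fun u => x (u + s)).
Proof. by move=> s0 fx t t0; apply: orbit_time_shift; apply: fx; rewrite addr_ge0. Qed.

Lemma forward_exists y : xunit y -> exists2 x : R -> E, x 0 = y & forward x.
Proof.
move=> uy; have [x x0 ox] := orbit_exists J_spd Wg_spd Wr_spd (lexx 0) uy.
by exists x => // t t0; apply: ox; rewrite oppr0.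
Qed.

(** The energy is lost at a bounded rate. *)
Lemma energy_backward : exists2 c : R, 0 <= c & forall (x : R -> E) (a b : R), a <= b ->
  (forall t, a <= t <= b -> orbit x t) -> en (x a) <= en (x b) + c * (b - a).
Proof.
have [c c0 hc] := Gg_bounded Wg; exists c => // x a b ab ox.
have [|t tab e] := mean_value ab (f := fun u => en (x u))
  (df := fun t => - (4 * dotv (Gg Wg (xT (x t))) (Gg Wg (xT (x t))))).
  by move=> t tab; apply: orbit_energy => //; exact: ox.
have [[uT _] _] := ox t tab; have h := hc _ uT.
have : (4 * dotv (Gg Wg (xT (x t))) (Gg Wg (xT (x t)))) * (b - a) <= c * (b - a).
  by rewrite ler_wpM2r// subr_ge0.
by move: e; rewrite mulNr => e; lra.
Qed.

Lemma en_near y : exists2 d : R, 0 < d & forall z, `|z - y| < d -> en z <= en y + 1.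
Proof.
have cen : continuous en by apply: lipB_continuous; exact: lip_en.
have [d d0 hd] := continuous_distP (cen y) ltr01; exists d => // z zy.
have := hd z; rewrite distrC => /(_ zy); have := ler_norm (en z - en y).
by rewrite distrC; lra.
Qed.

Lemma sqr_dist_lt m (x y : 'cV[R]_m) (r : R) : 0 < r ->
  dotv (x - y) (x - y) < r ^+ 2 -> `|x - y| < r.
Proof.
move=> r0 h; apply: le_lt_trans (mxnorm_le_enorm _) _.
by rewrite -ltr_sqr ?nnegrE ?enorm_ge0 ?(ltW r0)// enorm_sqr.
Qed.

Lemma dist_sqr_small m (s : R) : 0 < s -> exists2 d : R, 0 < d &
  forall x y : 'cV[R]_m, `|x - y| < d -> dotv (x - y) (x - y) < s.
Proof.
move=> s0; exists (Num.min 1 (s / (m%:R + 1))).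
  by rewrite lt_min ltr01 divr_gt0// ltr_wpDl.
move=> x y; rewrite lt_min => /andP[h1 h2]; apply: le_lt_trans (enorm_le_mxnorm _) _.
apply: le_lt_trans (_ : (m%:R + 1) * `|x - y| < s); last first.
  by rewrite mulrC -ltr_pdivlMr ?ltr_wpDl.
have m0 : (0 : R) <= m%:R by [].
have n0 := normr_ge0 (x - y); have := mulr_ge0 m0 (mulr_ge0 n0 (_ : 0 <= 1 - `|x - y|)).
by rewrite subr_ge0 (ltW h1) => /(_ isT); lra.
Qed.

Lemma forward_close y0 (T e : R) : 0 <= T -> 0 < e -> exists2 d : R, 0 < d &
  forall x z : R -> E, (forall t, 0 <= t <= T -> orbit x t /\ orbit z t) -> x 0 = y0 ->
    `|z 0 - y0| < d -> forall t, 0 <= t <= T -> `|z t - x t| < e.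
Proof.
move=> T0 e0; have [c c0 hc] := orbit_compare J_spd Wg_spd Wr_spd (en y0 + 1).
have [d1 d10 hd1] := en_near y0.
have s0 : 0 < e ^+ 2 / expR (c * T) by rewrite divr_gt0 ?expR_gt0// exprn_gt0.
have [d2 d20 hd2] := @dist_sqr_small (1 + 3 + (1 + 3) + 3) _ s0.
exists (Num.min d1 d2) => [|x z oxz x0]; first by rewrite lt_min d10.
rewrite lt_min => /andP[h1 h2] t /andP[t0 tT].
apply: sqr_dist_lt => //.
have [|||+ _] := hc z x 0 t t0.
- by move=> u /andP[u0 ut]; have [] := oxz u; rewrite ?u0 ?(le_trans ut)//; split.
- exact: hd1.
- by rewrite x0 lerDl.
move=> /le_lt_trans; apply; rewrite subr0.
apply: le_lt_trans (_ : dotv (z 0 - x 0) (z 0 - x 0) * expR (c * T) < _).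
  by rewrite ler_wpM2l ?dotv_ge0// ler_expR ler_wpM2l// ltW.
by rewrite -ltr_pdivlMr ?expR_gt0// x0; exact: hd2.
Qed.

Lemma backward_close y1 (T e : R) : 0 <= T -> 0 < e -> exists2 d : R, 0 < d &
  forall x z : R -> E, (forall t, 0 <= t <= T -> orbit x t /\ orbit z t) -> x T = y1 ->
    `|z T - y1| < d -> `|z 0 - x 0| < e.
Proof.
move=> T0 e0; have [k k0 hk] := energy_backward.
have [c c0 hc] := orbit_compare J_spd Wg_spd Wr_spd (en y1 + 1 + k * T).
have [d1 d10 hd1] := en_near y1.
have s0 : 0 < e ^+ 2 / expR (c * T) by rewrite divr_gt0 ?expR_gt0// exprn_gt0.
have [d2 d20 hd2] := @dist_sqr_small (1 + 3 + (1 + 3) + 3) _ s0.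
exists (Num.min d1 d2) => [|x z oxz x0]; first by rewrite lt_min d10.
rewrite lt_min => /andP[h1 h2]; apply: sqr_dist_lt => //.
have [|||_] := hc z x 0 T T0.
- by move=> u uT; have [] := oxz u uT; split.
- apply: le_trans (hk z 0 T T0 (fun u uT => proj2 (oxz u uT))) _.
  by rewrite subr0 lerD2r; exact: hd1.
- apply: le_trans (hk x 0 T T0 (fun u uT => proj1 (oxz u uT))) _.
  by rewrite subr0 lerD2r x0 lerDl.
move=> /le_lt_trans; apply; rewrite subr0.
by rewrite -ltr_pdivlMr ?expR_gt0// x0; exact: hd2.
Qed.

(** What holds from time T on along all orbits from an open set holds from the start
    along all orbits from another open set, since the time T map of the flow is open. *)
Lemma persistent_shift (P : E -> Prop) y0 (T d : R) : 0 <= T -> 0 < d -> xunit y0 ->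
  (forall x, forward x -> `|x 0 - y0| < d -> forall t, T <= t -> P (x t)) ->
  exists y1 d1, [/\ xunit y1, 0 < d1 & forall x, forward x -> `|x 0 - y1| < d1 ->
    forall t, 0 <= t -> P (x t)].
Proof.
move=> T0 d0 u0 hP; have [x x0 fx] := forward_exists u0.
have [d1 d10 hd1] := backward_close (x T) T0 d0.
exists (x T), d1; split=> //; first by have [] := fx T T0.
move=> z fz zx t t0.
have uz : xunit (z 0) by have [] := fz 0 (lexx 0).
have [b b0 ob] := orbit_exists J_spd Wg_spd Wr_spd T0 uz.
have obT u : 0 <= u -> orbit (fun v => b (v + - T)) u.
  by move=> u0'; apply: orbit_time_shift; apply: ob; rewrite lerDr.
have bz u : 0 <= u -> b u = z u.
  move=> u0'; apply: (orbit_unique J_spd Wg_spd Wr_spd u0'); last exact: b0.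
  move=> v /andP[v0 _]; split; last exact: fz.
  by apply: ob; rewrite (le_trans _ v0)// oppr_le0.
have := hP _ obT _ (t + T); rewrite addrK -bz//; apply; last by rewrite lerDr.
rewrite -x0; apply: (hd1 x (fun v => b (v + - T))) => //.
  by move=> v /andP[v0 _]; split; [exact: fx|exact: obT].
by rewrite subrr b0.
Qed.

(** A rational parametrisation of the great circle from a towards b. *)
Definition circle m (a b : 'cV[R]_m) (s : R) : 'cV[R]_m :=
  ((1 - s ^+ 2) / (1 + s ^+ 2)) *: a + (2 * s / (1 + s ^+ 2)) *: b.

Lemma circle_den (s : R) : 1 + s ^+ 2 != 0.
Proof. by rewrite gt_eqF// ltr_pwDl// sqr_ge0. Qed.

Lemma circle_unit m (a b : 'cV[R]_m) s : dotv a a = 1 -> dotv b b = 1 -> dotv a b = 0 ->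
  dotv (circle a b s) (circle a b s) = 1.
Proof.
move=> ha hb hab; rewrite /circle !(dotvDl, dotvDr, dotvZl, dotvZr) ha hb [dotv b a]dotvC hab.
by field; rewrite circle_den.
Qed.

Lemma circle_near m (a b : 'cV[R]_m) s : dotv a a = 1 -> dotv b b = 1 -> 0 <= s <= 1 ->
  `|circle a b s - a| <= 4 * s.
Proof.
move=> ha hb /andP[s0 s1]; have -> : circle a b s - a =
   (- (2 * s ^+ 2 / (1 + s ^+ 2))) *: a + (2 * s / (1 + s ^+ 2)) *: b.
  by apply/matrixP => i j; rewrite !mxE; field; rewrite circle_den.
have le1 (c : 'cV[R]_m) : dotv c c = 1 -> `|c| <= 1.
  by move=> h; apply: le_trans (mxnorm_le_enorm _) _; rewrite /enorm h sqrtr1.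
have p : 0 < 1 + s ^+ 2 by rewrite ltr_pwDl// sqr_ge0.
apply: le_trans (ler_normD _ _) _; rewrite (normrZ _ a) (normrZ _ b) normrN.
have q1 : 0 <= 2 * s ^+ 2 / (1 + s ^+ 2) <= 2 * s.
  rewrite divr_ge0 ?mulr_ge0 ?sqr_ge0 ?(ltW p)//= ler_pdivrMr//; nra.
have q2 : 0 <= 2 * s / (1 + s ^+ 2) <= 2 * s.
  rewrite divr_ge0 ?mulr_ge0 ?(ltW p)//= ler_pdivrMr//; nra.
have /andP[q1a q1b] := q1; have /andP[q2a q2b] := q2.
rewrite (ger0_norm q1a) (ger0_norm q2a).
have := ler_wpM2l q1a (le1 a ha); have := ler_wpM2l q2a (le1 b hb); lra.
Qed.

End Dependence.


(** * No open set of motions stays near a repeated eigenvalue *)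

Section RepeatedEigenvalue.
Variables (R : realType) (J Wg Wr : 'M[R]_3).
Hypotheses (J_spd : sym_posdef J) (Wg_spd : sym_posdef Wg) (Wr_spd : sym_posdef Wr).
Notation E := 'cV[R]_(1 + 3 + (1 + 3) + 3).
Notation orbit := (orbit J Wg Wr).
Notation forward := (forward J Wg Wr).
Notation en := (en J Wg Wr).
Notation B := (Bq Wg).
Variables (ug : 'I_(1 + 3) -> quat R) (bg : 'I_(1 + 3) -> R).
Hypotheses (og : orthonormal ug) (eg : forall i, B *m ug i = bg i *: ug i).
Hypothesis bg_ne : exists i j, bg i != bg j.

Lemma Gg_sqr (T : quat R) : unit_quat T ->
  dotv (Gg Wg T) (Gg Wg T) = dotv (B *m T) (B *m T) - dotv T (B *m T) ^+ 2.
Proof. exact: NqT_norm. Qed.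

Lemma Gg_eq0 (T : quat R) : unit_quat T -> Gg Wg T = 0 -> B *m T = dotv T (B *m T) *: T.
Proof.
move=> uT g0; have := NqNqT T (B *m T); rewrite -/(Gg Wg T) g0 mulmx0.
by rewrite (proj1 (unit_quatE T) uT) scale1r => /esym/eqP; rewrite subr_eq0 => /eqP.
Qed.

(** Unless B is scalar, an eigenvector can be moved a little towards one of another
    eigenvalue, and stops being an eigenvector. *)
Lemma perturb_Gg y (d : R) : xunit y -> 0 < d ->
  exists y1, [/\ xunit y1, `|y1 - y| < d & Gg Wg (xT y1) != 0].
Proof.
move=> [uT uQ] d0; have [g0|g0] := eqVneq (Gg Wg (xT y)) 0; last first.
  by exists y; split=> //; rewrite subrr normr0.
set T := xT y in uT g0; have eT := Gg_eq0 uT g0; set mu := dotv T _ in eT.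
have T1 : dotv T T = 1 by exact/unit_quatE.
have [i imu] : exists i, bg i != mu.
  have [i [j ij]] := bg_ne; have [e|] := eqVneq (bg i) mu; last by exists i.
  by exists j; rewrite -e eq_sym.
have iT : dotv T (ug i) = 0.
  have := eigen_coord T (Bq_tr (proj1 Wg_spd)) (eg i); rewrite eT dotvZr => /eqP.
  rewrite -subr_eq0 -mulrBl mulf_eq0 subr_eq0 [mu == _]eq_sym (negbTE imu)/=.
  by rewrite dotvC => /eqP.
have i1 : dotv (ug i) (ug i) = 1 by rewrite og eqxx.
pose s := Num.min 2^-1 (d / 8).
have s0 : 0 < s by rewrite lt_min invr_gt0 ltr0n divr_gt0.
have s2 : s <= 2^-1 by rewrite ge_min lexx.
have sd : 4 * s < d by have : s <= d / 8 by [rewrite ge_min lexx orbT]; lra.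
have s1 : 0 <= s <= 1 by rewrite (ltW s0) /=; lra.
have uc := circle_unit s T1 i1 iT.
exists (mkx (circle T (ug i) s) (xQ y) (xw y)); split.
- by rewrite /xunit !xE; split=> //; exact/unit_quatE.
- apply: le_lt_trans sd; apply: mx_norm_le => [|a b]; first by rewrite mulr_ge0 ?(ltW s0).
  rewrite (ord1 b) mxE [X in _ + X]mxE.
  have -> : y a 0 = mkx T (xQ y) (xw y) a 0 by rewrite mkx_eta.
  case: (split_ordP a) => a' ->; last by rewrite !mkx_w subrr normr0 mulr_ge0 ?(ltW s0).
  case: (split_ordP a') => a'' ->; last by rewrite !mkx_Q subrr normr0 mulr_ge0 ?(ltW s0).
  rewrite !mkx_T; apply: le_trans (circle_near T1 i1 s1).
  by have := mx_norm_ge (circle T (ug i) s - T) a'' 0; rewrite mxE [X in _ + X]mxE.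
- rewrite xT_mk -dotv_gt0 Gg_sqr; last exact/unit_quatE.
  set p := (1 - s ^+ 2) / (1 + s ^+ 2); set q := 2 * s / (1 + s ^+ 2).
  have pq : p ^+ 2 + q ^+ 2 = 1 by rewrite /p /q; field; rewrite circle_den.
  have den : 0 < 1 + s ^+ 2 by rewrite ltr_pwDl// sqr_ge0.
  have p0 : 0 < p by rewrite divr_gt0// subr_gt0 exprn_ilt1//; lra.
  have q0 : 0 < q by rewrite divr_gt0// mulr_gt0.
  have -> : B *m circle T (ug i) s = (p * mu) *: T + (q * bg i) *: ug i.
    by rewrite mulmxDr -!scalemxAr eT eg !scalerA.
  rewrite /circle -/p -/q !(dotvDl, dotvDr, dotvZl, dotvZr) T1 i1 [dotv (ug i) T]dotvC iT.
  rewrite (_ : 0 < _ = (0 < (p * q * (bg i - mu)) ^+ 2)).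
    rewrite exprn_even_gt0//= mulf_eq0 mulf_eq0 !negb_or (gt_eqF p0) (gt_eqF q0)/=.
    by rewrite subr_eq0.
  congr (_ < _); have e4 : p ^+ 2 = 1 - q ^+ 2 by rewrite -pq; ring.
  have e5 : (p * q * (bg i - mu)) ^+ 2 = p ^+ 2 * q ^+ 2 * (bg i - mu) ^+ 2 by ring.
  rewrite e5 e4; set m := mu; rewrite (_ : _ - _ ^+ 2 = p ^+ 2 * m ^+ 2 + q ^+ 2 * bg i ^+ 2 -
    (p ^+ 2 * m + q ^+ 2 * bg i) ^+ 2); last by ring.
  by rewrite e4; ring.
Qed.

(** The dissipation is positive at y. By continuity the loss of energy during a short
    time h exceeds the variation of the energy near y. *)
Lemma energy_drop y : xunit y -> Gg Wg (xT y) != 0 ->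
  exists h lev d : R, [/\ 0 < h, 0 < d & forall x, forward x -> `|x 0 - y| < d ->
    lev < en (x 0) /\ forall t, h <= t -> en (x t) <= lev].
Proof.
move=> uy g0; have [x x0 fx] := forward_exists J_spd Wg_spd Wr_spd uy.
pose g t := dotv (Gg Wg (xT (x t))) (Gg Wg (xT (x t))).
have gpos : 0 < g 0 by rewrite /g x0 dotv_gt0.
have cg : {for 0, continuous g}.
  have [_ dx] := fx 0 (lexx 0).
  apply: (continuous_comp (f := x)
    (g := fun z => dotv (Gg Wg (xT z)) (Gg Wg (xT z)))); first exact: is_derive_continuous dx.
  by apply: lipB_continuous; apply: lipB_dotv; exact: lip_Gg.
have [h0 h00 hh0] := continuous_distP cg gpos.
pose h := h0 / 2; have h_gt0 : 0 < h by rewrite divr_gt0.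
pose D := en (x 0) - en (x h).
have D0 : 0 < D.
  have [|c /andP[c0 ch] e] := mean_value (ltW h_gt0) (f := fun u => en (x u))
    (df := fun t => - (4 * g t)).
    by move=> t /andP[t0 _]; apply: orbit_energy => //; exact: fx.
  have gc : 0 < g c.
    have := hh0 c; rewrite sub0r normrN ger0_norm// => /(_ _); have -> : c < h0 by rewrite /h in ch; lra.
    by move=> /(_ isT); have := ler_norm (g 0 - g c); lra.
  have : 0 < 4 * g c * h by rewrite !mulr_gt0.
  by move: e; rewrite subr0 mulNr /D; lra.
have cen : continuous en by apply: lipB_continuous; exact: lip_en.
have D2 : 0 < D / 2 by rewrite divr_gt0.
have [d1 d10 hd1] := continuous_distP (cen y) D2.
have [d2 d20 hd2] := continuous_distP (cen (x h)) D2.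
have [d3 d30 hd3] := forward_close J_spd Wg_spd Wr_spd y (ltW h_gt0) d20.
exists h, (en y - D / 2), (Num.min d1 d3); split=> //; first by rewrite lt_min d10.
move=> z fz; rewrite lt_min => /andP[z1 z3]; split.
  have := hd1 (z 0); rewrite distrC => /(_ z1); have := ler_norm (en y - en (z 0)); lra.
move=> t ht.
have := hd3 x z _ x0 z3 h; rewrite lexx (ltW h_gt0) => /(_ _ isT) zh.
have {zh}zh : `|z h - x h| < d2 by apply: zh => u /andP[u0 _]; split; [exact: fx|exact: fz].
have := hd2 (z h); rewrite distrC => /(_ zh); have := ler_norm (en (z h) - en (x h)).
rewrite distrC.
have : en (z t) <= en (z h).
  apply: (orbit_energy_nincr J_spd Wg_spd Wr_spd ht) => u /andP[hu _].
  by apply: fz; rewrite (le_trans _ hu)// ltW.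
by move: D0; rewrite /D x0; lra.
Qed.

Variable lam : R.
Hypothesis lam_ge : \sum_i bg i <= 4 * lam.
Let c := 4^-1 * \sum_i bg i.

(** With s the squared distance of the error from the eigenspace, T . B T - lam is of
    order s while the dissipation is s up to order s^2; and c <= lam, because the
    repeated eigenvalue is at least a quarter of the trace. So the compression of
    volume is paid for by the dissipation of energy. *)
Lemma compression_le : exists e0 k : R, [/\ 0 < e0, 0 < k & forall y, xunit y ->
  gshift Wg lam y <= e0 ->
  c - dotv (xT y) (B *m xT y) <= k * dotv (Gg Wg (xT y)) (Gg Wg (xT y))].
Proof.
have [C C0 hC] := shift_quadform_le (Bq_tr (proj1 Wg_spd)) og eg lam.
exists (2 * C ^+ 2)^-1, (2 * C); split; rewrite ?invr_gt0 ?mulr_gt0 ?exprn_gt0//.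
move=> y [uT _]; rewrite Gg_sqr// /gshift; set T := xT y in uT *.
have := hC T; have T1 : dotv T T = 1 by exact/unit_quatE.
set s := dotv (B *m T - _) _; rewrite dotvBr dotvZr T1 mulr1 => hs ss.
have es : s = dotv (B *m T) (B *m T) - 2 * lam * dotv T (B *m T) + lam ^+ 2.
  by rewrite /s !(dotvBl, dotvBr, dotvZl, dotvZr) T1 [dotv (B *m T) T]dotvC; ring.
have s0 : 0 <= s by exact: dotv_ge0.
set u := dotv T (B *m T) in hs es *; set b := dotv (B *m T) _ in es *.
have e1 : b - u ^+ 2 = s - (u - lam) ^+ 2 by rewrite es; ring.
rewrite e1.
have h1 : (u - lam) ^+ 2 <= s / 2.
  have : (u - lam) ^+ 2 <= (C * s) ^+ 2.
    rewrite -(real_normK (num_real (u - lam))) ler_sqr ?nnegrE ?mulr_ge0 ?(ltW C0)//.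
  move/le_trans; apply; have -> : (C * s) ^+ 2 = C ^+ 2 * s * s by ring.
  rewrite mulrC ler_wpM2l//.
  have : 2 * C ^+ 2 * s <= 1.
    by rewrite mulrC -ler_pdivlMr ?div1r// mulr_gt0 ?exprn_gt0.
  lra.
have h2 : c <= lam by rewrite /c mulrC ler_pdivrMr// mulrC.
have h3 := ler_norm (lam - u); rewrite distrC in h3.
have h4 : C * (2 * (u - lam) ^+ 2) <= C * s by rewrite ler_wpM2l ?(ltW C0)//; lra.
rewrite mulrBr; lra.
Qed.

Let h := hadamard ug.

Lemma normalize_unit m (x : 'cV[R]_m) : x != 0 ->
  dotv ((enorm x)^-1 *: x) ((enorm x)^-1 *: x) = 1.
Proof.
move=> x0; by rewrite dotvZl dotvZr -enorm_sqr; field; rewrite enorm_eq0.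
Qed.

(** The logarithm of the factor rho that undoes the compression of volume along an
    orbit. *)
Lemma log_scale (x : R -> E) : forward x -> exists2 G : R -> R, G 0 = 0 &
  forall t : R, 0 <= t -> is_derive t 1 G (c - dotv (xT (x t)) (B *m xT (x t))).
Proof.
move=> fx; pose f z := c - dotv (xT z) (B *m xT z).
have cf : continuous (fun t : R => f (x `|t|)).
  move=> t; have [_ dx] := fx `|t| (normr_ge0 t).
  apply: (continuous_comp (f := fun t : R => x `|t|) (g := f)).
    apply: (continuous_comp (f := fun t : R => `|t|)); first exact: norm_continuous.
    exact: is_derive_continuous dx.
  apply: lipB_continuous; apply: lipB_sub; first exact: lipB_cst.
  apply: lipB_dotv; first exact: lip_xT.
  by apply: lipM_mul; [exact: lipM_cst|exact: lip_xT].
have [G G0 dG] := antiderivative_exists cf; exists G => // t t0.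
by apply: der_eq (dG t); rewrite ger0_norm.
Qed.

(** Near the eigenspace the dissipation, whose integral is at most the initial energy,
    dominates the growth. *)
Lemma log_scale_upper (x : R -> E) (G : R -> R) (e0 k : R) : forward x -> G 0 = 0 ->
  (forall t : R, 0 <= t -> is_derive t 1 G (c - dotv (xT (x t)) (B *m xT (x t)))) ->
  (forall y, xunit y -> gshift Wg lam y <= e0 ->
     c - dotv (xT y) (B *m xT y) <= k * dotv (Gg Wg (xT y)) (Gg Wg (xT y))) -> 0 < k ->
  (forall t, 0 <= t -> gshift Wg lam (x t) <= e0) ->
  forall t, 0 <= t -> G t <= k / 4 * en (x 0).
Proof.
move=> fx G0 dG hk k0 hx t t0.
pose F u := G u + k / 4 * en (x u).
have : F t <= F 0.
  apply: (deriv_le0_nincr t0 (df := fun u => c - dotv (xT (x u)) (B *m xT (x u)) +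
    k / 4 * - (4 * dotv (Gg Wg (xT (x u))) (Gg Wg (xT (x u)))))) => u /andP[u0 _].
    apply: derD; first exact: dG.
    by apply: derZ; apply: orbit_energy => //; exact: fx.
  have [uu _] := fx u u0; have := hk _ uu (hx u u0); lra.
rewrite /F G0 add0r.
have : 0 <= k / 4 * en (x t) by rewrite mulr_ge0 ?divr_ge0 ?(ltW k0)// en_ge0.
lra.
Qed.

Lemma log_scale_lower (x : R -> E) (G : R -> R) : forward x -> G 0 = 0 ->
  (forall t : R, 0 <= t -> is_derive t 1 G (c - dotv (xT (x t)) (B *m xT (x t)))) ->
  forall t, 0 <= t -> - ((`|c| + en (x 0)) * t) <= G t.
Proof.
move=> fx G0 dG t t0.
have [|s /andP[s0 st] e] := mean_value t0 (f := G)
    (df := fun t => c - dotv (xT (x t)) (B *m xT (x t))).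
  by move=> u /andP[u0 _]; exact: dG.
have h1 : en (x s) <= en (x 0).
  by apply: (orbit_energy_nincr J_spd Wg_spd Wr_spd s0) => u /andP[u0 _]; exact: fx.
have h2 : dotv (xT (x s)) (B *m xT (x s)) <= en (x s).
  rewrite /en /energy !Bq_form.
  have := posdef_ge0 (qvec (xT (x s))) Wg_spd; have := posdef_ge0 (qvec (xQ (x s))) Wr_spd.
  have := posdef_ge0 (xw (x s)) J_spd; lra.
move: e; rewrite G0 !subr0 => ->; rewrite -mulNr ler_wpM2r//.
have := ler_norm (- c); rewrite normrN; lra.
Qed.

Lemma mkxB (T T' Q Q' : quat R) (w w' : 'cV[R]_3) :
  mkx T Q w - mkx T' Q' w' = mkx (T - T') (Q - Q') (w - w').
Proof. by rewrite /mkx opp_col_mx opp_col_mx add_col_mx add_col_mx. Qed.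

Lemma mkx_norm_le (T Q : quat R) (w : 'cV[R]_3) (r : R) : 0 <= r ->
  `|T| <= r -> `|Q| <= r -> `|w| <= r -> `|mkx T Q w| <= r.
Proof.
move=> r0 hT hQ hw; apply: mx_norm_le => // i j; rewrite (ord1 j).
case: (split_ordP i) => k ->; last by rewrite mkx_w; apply: le_trans (mx_norm_ge _ _ _) hw.
case: (split_ordP k) => m ->; first by rewrite mkx_T; apply: le_trans (mx_norm_ge _ _ _) hT.
by rewrite mkx_Q; apply: le_trans (mx_norm_ge _ _ _) hQ.
Qed.

Lemma mkx_norm_ge (T Q : quat R) (w : 'cV[R]_3) :
  [/\ `|T| <= `|mkx T Q w|, `|Q| <= `|mkx T Q w| & `|w| <= `|mkx T Q w|].
Proof.
split; apply: mx_norm_le => // i j; rewrite (ord1 j).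
- by rewrite -(mkx_T T Q w); exact: mx_norm_ge.
- by rewrite -(mkx_Q T Q w); exact: mx_norm_ge.
- by rewrite -(mkx_w T Q w); exact: mx_norm_ge.
Qed.

Lemma enorm_le2 m (u : 'cV[R]_m) : (m <= 4)%N -> enorm u <= 2 * `|u|.
Proof.
move=> m4; rewrite -ler_sqr ?nnegrE ?enorm_ge0 ?mulr_ge0//.
rewrite enorm_sqr exprMn; apply: le_trans (enorm_le_mxnorm _) _.
by rewrite ler_wpM2r ?sqr_ge0// -natrX ler_nat.
Qed.

(** The state of the original system represented by a point z of the extended space,
    in the frame coordinates. *)
Definition to_units (v : 'I_3 -> 'cV[R]_3) (z : E) : E :=
  let Y := frame h *m xT z in
  mkx ((enorm Y)^-1 *: Y) ((enorm (xQ z))^-1 *: xQ z) (frame v *m xw z).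

Lemma to_units_near (v : 'I_3 -> 'cV[R]_3) y (r : R) z : orthonormal v -> xunit y ->
  r <= 4^-1 -> `|z - to_frame h v y| <= r ->
  [/\ 2^-1 <= enorm (frame h *m xT z) <= 2, 2^-1 <= enorm (xQ z) <= 2,
      xunit (to_units v z) & `|to_units v z - y| <= 4 * r].
Proof.
move=> ov [uT uQ] r4 zr; have oh := hadamard_on og.
have r0 : 0 <= r by apply: le_trans zr.
have T1 : dotv (xT y) (xT y) = 1 by exact/unit_quatE.
have Q1 : dotv (xQ y) (xQ y) = 1 by exact/unit_quatE.
move: zr; rewrite -{1}[z]mkx_eta /to_frame mkxB => zr.
have [h1 h2 h3] := mkx_norm_ge (xT z - (frame h)^T *m xT y) (xQ z - xQ y)
  (xw z - (frame v)^T *m xw y).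
have iso m (f : 'I_m -> 'cV[R]_m) a b : orthonormal f -> (m <= 4)%N ->
    `|a - (frame f)^T *m b| <= r -> enorm (frame f *m a - b) <= 2 * r.
  move=> of_ m4 abr.
  have -> : frame f *m a - b = frame f *m (a - (frame f)^T *m b).
    by rewrite mulmxBr mulmxA frame_orthr// mul1mx.
  rewrite {1}/enorm frame_norm// -/(enorm _); apply: le_trans (enorm_le2 _ m4) _.
  by rewrite ler_wpM2l.
have gT := iso _ h _ _ oh isT (le_trans h1 zr).
have gw := iso _ v _ _ ov isT (le_trans h3 zr).
have gQ : enorm (xQ z - xQ y) <= 2 * r.
  apply: le_trans (enorm_le2 (m := 1 + 3) _ isT) _; rewrite ler_wpM2l//; exact: le_trans h2 zr.
have len m (a b : 'cV[R]_m) : dotv b b = 1 -> enorm (a - b) <= 2 * r -> 2^-1 <= enorm a <= 2.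
  move=> b1 ab; have eb : enorm b = 1 by rewrite /enorm b1 sqrtr1.
  have := ler_enormD (a - b) b; have := ler_enormD (b - a) a; rewrite !subrK eb.
  rewrite -(enormN (b - a)) opprB => g1 g2; apply/andP; split; lra.
have lT := len _ _ _ T1 gT; have lQ := len _ _ _ Q1 gQ.
have nz m (a : 'cV[R]_m) : 2^-1 <= enorm a <= 2 -> a != 0.
  by move=> /andP[g _]; rewrite -enorm_eq0 gt_eqF// (lt_le_trans _ g)// invr_gt0.
split=> //.
  by rewrite /xunit !xE; split; apply/unit_quatE; apply: normalize_unit; exact: nz.
rewrite /to_units -{1}[y]mkx_eta mkxB; apply: mkx_norm_le; first by rewrite mulr_ge0.
- apply: le_trans (mxnorm_le_enorm _) _.
  by apply: le_trans (normalize_near T1 (nz _ _ lT)) _; lra.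
- apply: le_trans (mxnorm_le_enorm _) _.
  by apply: le_trans (normalize_near Q1 (nz _ _ lQ)) _; lra.
- by apply: le_trans (mxnorm_le_enorm _) _; lra.
Qed.

(** Assume that all motions from an open set stay near the eigenspace of lam. The
    factor rho is bounded on them, so the extended motions form a bounded divergence-
    free flow and recur: some motion returns, up to scaling of the quaternions, close
    to its initial state. Near a state with positive dissipation this is incompatible
    with the loss of energy. *)
Theorem no_persistent_repeated : exists2 e0 : R, 0 < e0 & forall y (d : R),
  xunit y -> 0 < d ->
  ~ (forall x, forward x -> `|x 0 - y| < d -> forall t, 0 <= t -> gshift Wg lam (x t) <= e0).
Proof.
have [e0 [k [e00 k0 hk]]] := compression_le; exists e0 => // y0 d uy0 d0 hP.
have d2 : 0 < d / 2 by rewrite divr_gt0.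
have [y [uy yy0 Gy]] := perturb_Gg uy0 d2.
have [tau [lev [d1 [tau0 d10 drop]]]] := energy_drop uy Gy.
have [d3 d30 hd3] := en_near J Wg Wr y.
have [v [l [ov ev]]] := spectral_symmetric (proj1 J_spd).
have oh := hadamard_on og.
have hdiag j : dotv (h j) (B *m h j) = c := hadamard_diag j (Bq_tr (proj1 Wg_spd)) og eg.
set p := to_frame h v y.
pose dd := Num.min (d / 2) (Num.min d1 d3).
have dd0 : 0 < dd by rewrite !lt_min d2 d10.
pose r := Num.min 4^-1 (dd / 8).
have r0 : 0 < r by rewrite lt_min invr_gt0 ltr0n divr_gt0.
have r4 : r <= 4^-1 by rewrite ge_min lexx.
have rd : 4 * r < dd by have : r <= dd / 8 by [rewrite ge_min lexx orbT]; lra.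
pose e := en y + 1; have e1 : 0 <= e by rewrite addr_ge0// en_ge0.
pose good z (xG : (R -> E) * (R -> R)) := `|z - p| <= r -> [/\ forward xG.1, xG.1 0 = to_units v z,
  xG.2 0 = 0 & forall t : R, 0 <= t ->
    is_derive t 1 xG.2 (c - dotv (xT (xG.1 t)) (B *m xT (xG.1 t)))].
have /choice[f hf] : forall z, exists xG, good z xG.
  move=> z; have [zr|zr] := pselect (`|z - p| <= r); last first.
    by exists (fun=> 0, fun=> 0) => /zr.
  have [_ _ uz _] := to_units_near ov uy r4 zr.
  have [x x0 fx] := forward_exists J_spd Wg_spd Wr_spd uz.
  by have [G G0 dG] := log_scale fx; exists (x, G).
have near z : `|z - p| <= r -> [/\ `|(f z).1 0 - y0| < d, `|(f z).1 0 - y| < d1 &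
    en ((f z).1 0) <= e].
  move=> zr; have [_ -> _ _] := hf z zr; have [_ _ _ h1] := to_units_near ov uy r4 zr.
  have := le_lt_trans h1 rd; rewrite !lt_min => /and3P[g1 g2 g3]; split=> //; last exact: hd3.
  rewrite -(subrK y (to_units v z)) -addrA; apply: le_lt_trans (ler_normD _ _) _; lra.
have upper z t : `|z - p| <= r -> 0 <= t -> (f z).2 t <= k / 4 * e.
  move=> zr t0; have [fx _ G0 dG] := hf z zr; have [n1 _ n3] := near z zr.
  apply: le_trans (log_scale_upper fx G0 dG hk k0 (hP _ fx n1) t0) _.
  by rewrite ler_wpM2l// divr_ge0 ?(ltW k0).
have lower z t : `|z - p| <= r -> 0 <= t -> - ((`|c| + e) * t) <= (f z).2 t.
  move=> zr t0; have [fx _ G0 dG] := hf z zr; have [_ _ n3] := near z zr.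
  apply: le_trans (log_scale_lower fx G0 dG t0); rewrite lerN2 ler_wpM2r//.
  by rewrite lerD2l.
have [j j0 hj] := energy_bound J_spd Wg_spd Wr_spd.
pose C := 2 * expR (k / 4 * e) + 2 + (1 + j * e).
have je : 0 <= j * e by rewrite mulr_ge0 ?(ltW j0).
have C0 : 0 <= C by have := expR_ge0 (k / 4 * e); rewrite /C; lra.
(* the time until recurrence; kappa bounds rho^2 from below up to that time *)
pose H := tau * (recurrence_count p (r / 2) C)%:R.
pose kappa := (2^-1 * expR (- ((`|c| + e) * H))) ^+ 2.
have kappa0 : 0 < kappa by rewrite exprn_gt0// mulr_gt0 ?invr_gt0 ?expR_gt0.
pose sY (z : E) := enorm (frame h *m xT z); pose sQ (z : E) := enorm (xQ z).
(* the motions from the states represented by z, scaled so as to start at z *)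
pose W z (t : R) := mkx ((sY z * expR ((f z).2 t)) *: xT ((f z).1 t)) (sQ z *: xQ ((f z).1 t))
  (xw ((f z).1 t)).
pose X z t := to_frame h v (W z t).
pose F z := frame_field J Wg Wr h v c kappa (clip C z).
have lF := @lip_frame_field R J Wg Wr h v c kappa kappa0.
have [L L0 hL] := clip_field lF C0.
have [M M0 hM] := lipM_bounded lF C.
have F_bound z : `|F z| <= M by apply: hM; exact: clip_norm.
have F_shear : shear_field F.
  move=> i a b ab; apply: (frame_field_shear Wr J_spd oh hdiag ov ev kappa) => q qi.
  by rewrite !mxE ab.
have Xbound z t : `|z - p| <= r -> 0 <= t -> `|X z t| <= C.
  move=> zr t0; have [fx _ _ _] := hf z zr; have [_ _ n3] := near z zr.
  have [/andP[_ s2] /andP[_ q2] _ _] := to_units_near ov uy r4 zr.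
  have [[/unit_quatE uT /unit_quatE uQ] _] := fx t t0.
  have Ee : en ((f z).1 t) <= e.
    apply: le_trans n3; apply: (orbit_energy_nincr J_spd Wg_spd Wr_spd t0) => u /andP[u0 _].
    exact: fx.
  have E0 : 0 < expR (k / 4 * e) by exact: expR_gt0.
  rewrite /X /to_frame /W !xE; apply: mkx_norm_le => //.
  + apply: le_trans (mxnorm_le_enorm _) _; rewrite {1}/enorm frameT_norm// -/(enorm _) enormZ.
    rewrite [X in _ * X](_ : _ = 1) ?mulr1; last by rewrite /enorm uT sqrtr1.
    rewrite ger0_norm ?mulr_ge0 ?enorm_ge0 ?expR_ge0//.
    apply: le_trans (_ : 2 * expR (k / 4 * e) <= _); last by rewrite /C; lra.
    by apply: ler_pM; rewrite ?enorm_ge0 ?expR_ge0 ?ler_expR ?upper.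
  + apply: le_trans (mxnorm_le_enorm _) _; rewrite enormZ.
    rewrite [X in _ * X](_ : _ = 1) ?mulr1; last by rewrite /enorm uQ sqrtr1.
    by rewrite ger0_norm ?enorm_ge0//; apply: le_trans q2 _; rewrite /C; lra.
  + apply: le_trans (mxnorm_le_enorm _) _; rewrite {1}/enorm frameT_norm// -/(enorm _).
    have ut : xunit ((f z).1 t) by split; exact/unit_quatE.
    have [g1 _] := hj _ ut; have g2 : j * en ((f z).1 t) <= j * e by rewrite ler_wpM2l// ltW.
    have := sqr_ge0 (enorm (xw ((f z).1 t)) - 1); rewrite /C; nra.
have Xder z (t : R) : `|z - p| <= r -> 0 <= t <= H -> is_derive t 1 (X z) (F (X z t)).
  move=> zr /andP[t0 tH]; have [fx _ _ dG] := hf z zr.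
  have [/andP[s2 _] /andP[q2 _] _ _] := to_units_near ov uy r4 zr.
  rewrite /F clip_id; last exact: Xbound.
  have -> : frame_field J Wg Wr h v c kappa (X z t) =
      to_frame h v (xfield J Wg Wr c kappa (W z t)).
    by rewrite /frame_field /X to_frameK.
  have drho : is_derive t 1 (fun u => sY z * expR ((f z).2 u))
      (sY z * expR ((f z).2 t) * (c - dotv (xT ((f z).1 t)) (B *m xT ((f z).1 t)))).
    have := derZ (sY z) (@is_derive1_comp R expR (f z).2 t _ _ (is_derive_expR _) (dG t t0)).
    by apply: der_eq; rewrite /GRing.scale/=; ring.
  have dW := @extended_orbit R J Wg Wr c kappa kappa0 (f z).1 _ (sQ z) t (fx t t0) drho.
  have {}dW : is_derive t 1 (W z) (xfield J Wg Wr c kappa (W z t)).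
    apply: dW.
      rewrite /kappa ler_sqr ?nnegrE ?mulr_ge0 ?invr_ge0 ?expR_ge0 ?enorm_ge0//.
      apply: ler_pM; rewrite ?invr_ge0 ?expR_ge0// ler_expR.
      apply: le_trans (lower z t zr t0); rewrite lerN2 ler_wpM2l// addr_ge0//.
    by rewrite (_ : 4^-1 = 2^-1 ^+ 2) ?ler_sqr ?nnegrE ?invr_ge0 ?enorm_ge0//; field.
  apply: der_col_mx; first apply: der_col_mx.
  - exact/der_mulmxl/der_xT.
  - exact/der_xQ.
  - exact/der_mulmxl/der_xw.
have X0 z : `|z - p| <= r -> X z 0 = z.
  move=> zr; have [_ x0 G0 _] := hf z zr.
  have [/andP[s2 _] /andP[q2 _] _ _] := to_units_near ov uy r4 zr.
  have nz (a : R) : 2^-1 <= a -> a != 0.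
    by move=> g; rewrite gt_eqF// (lt_le_trans _ g)// invr_gt0.
  rewrite /X /W x0 G0 expR0 mulr1 /to_units !xE !scalerA /sY /sQ !mulfV ?nz// !scale1r.
  exact: (from_frameK oh ov z).
have r2 : 0 < r / 2 by rewrite divr_gt0.
have cube (z : E) : (forall i, p i 0 <= z i 0 <= p i 0 + r / 2) -> `|z - p| <= r / 2.
  move=> hz; apply: mx_norm_le (ltW r2) _ => i m; rewrite (ord1 m) mxE [X in _ + X]mxE.
  by have /andP[g1 g2] := hz i; rewrite ger0_norm ?subr_ge0// lerBlDl.
have half a : a <= r / 2 -> a <= r by move=> /le_trans; apply; lra.
have [|z [z' [n [hz hz' /andP[n0 nN] hX]]]] :=
  @lattice_recurrence _ _ F L M L0 M0 hL F_bound F_shear p (r / 2) tau C X r2 tau0 _ (r / 2) r2.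
  move=> z /cube/half zr; split; first exact: X0.
    by move=> t; exact: Xder.
  by move=> t /andP[t0 _]; exact: Xbound.
have zp := cube _ hz; have z'p := half _ (cube _ hz').
set t := tau * n%:R in hX; have tt : tau <= t by rewrite ler_peMr ?(ltW tau0)// ler1n.
have t0 : 0 <= t by rewrite (le_trans _ tt)// ltW.
have Xp : `|X z' t - p| <= r.
  rewrite -(subrK z (X z' t)) -addrA; apply: le_trans (ler_normD _ _) _; lra.
have [_ _ _ near'] := to_units_near ov uy r4 Xp.
have [fx' x'0 _ _] := hf z' z'p; have [_ n2 _] := near z' z'p.
(* the returning point represents the original motion at time t *)
have uX : to_units v (X z' t) = (f z').1 t.
  have [[/unit_quatE uT /unit_quatE uQ] _] := fx' t t0.
  have [/andP[s2 _] /andP[q2 _] _ _] := to_units_near ov uy r4 z'p.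
  have unscale m (a : R) (b : 'cV[R]_m) : 0 < a -> dotv b b = 1 -> (enorm (a *: b))^-1 *: (a *: b) = b.
    move=> a0 b1; rewrite enormZ [enorm b](_ : _ = 1) ?mulr1; last by rewrite /enorm b1 sqrtr1.
    by rewrite gtr0_norm// scalerA mulVf ?scale1r// gt_eqF.
  rewrite /to_units /X /to_frame /W !xE !mulmxA !frame_orthr// !mul1mx.
  rewrite !unscale ?mkx_eta// ?mulr_gt0 ?expR_gt0//.
    by rewrite (lt_le_trans _ q2)// invr_gt0.
  by rewrite (lt_le_trans _ s2)// invr_gt0.
have [_ /(_ t tt) low] := drop _ fx' n2.
have [|high _] := drop _ (forward_shift t0 fx').
  rewrite add0r -uX; apply: le_lt_trans near' _; apply: lt_le_trans rd _.
  by rewrite !ge_min lexx orbT.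
by move: high; rewrite add0r ltNge low.
Qed.

End RepeatedEigenvalue.


(** * Euclidean bounds for the quaternion matrices *)

Section EuclideanBounds.
Variable R : realType.
Implicit Types (T Q P : quat R) (x y : 'cV[R]_3).

Lemma dotv_le m (x y : 'cV[R]_m) (a b : R) : enorm x <= a -> enorm y <= b -> `|dotv x y| <= a * b.
Proof. by move=> xa yb; apply: le_trans (dotv_enorm x y) _; rewrite ler_pM ?enorm_ge0. Qed.

Lemma enorm_addle m (x y : 'cV[R]_m) (a b : R) : enorm x <= a -> enorm y <= b ->
  enorm (x + y) <= a + b.
Proof. by move=> xa yb; apply: le_trans (ler_enormD x y) _; rewrite lerD. Qed.

Lemma enorm_unit Q : unit_quat Q -> enorm Q = 1.
Proof. by move=> /unit_quatE uQ; rewrite /enorm uQ sqrtr1. Qed.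

Lemma enorm_Lq Q x : enorm (Lq Q *m x) = enorm Q * enorm x.
Proof. by rewrite /enorm Lq_norm sqrtrM ?dotv_ge0. Qed.

Lemma enorm_Nq Q x : enorm (Nq Q *m x) = enorm Q * enorm x.
Proof. by rewrite /enorm Nq_norm sqrtrM ?dotv_ge0. Qed.

Lemma enorm_LqT Q P : enorm ((Lq Q)^T *m P) <= enorm Q * enorm P.
Proof.
rewrite /enorm -sqrtrM ?dotv_ge0// ler_wsqrtr// dotv_mulr trmxK LqLqT dotvBl !dotvZl.
by rewrite lerBlDr lerDl -expr2 sqr_ge0.
Qed.

Lemma enorm_NqT Q P : enorm ((Nq Q)^T *m P) <= enorm Q * enorm P.
Proof.
rewrite /enorm -sqrtrM ?dotv_ge0// ler_wsqrtr// dotv_mulr trmxK NqNqT dotvBl !dotvZl.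
by rewrite lerBlDr lerDl -expr2 sqr_ge0.
Qed.

Lemma enorm_rot Q x : unit_quat Q -> enorm (rotmx Q *m x) = enorm x.
Proof. by move=> uQ; rewrite /enorm rot_norm. Qed.

Lemma enorm_rotT Q x : unit_quat Q -> enorm ((rotmx Q)^T *m x) = enorm x.
Proof. by move=> uQ; rewrite /enorm rotT_norm. Qed.

Lemma enorm_cross x y : enorm (crossmx x *m y) <= enorm x * enorm y.
Proof.
rewrite /enorm -sqrtrM ?dotv_ge0// ler_wsqrtr// cross_norm.
by rewrite lerBlDr lerDl sqr_ge0.
Qed.

Lemma Lq_sub P Q x : Lq (P - Q) *m x = Lq P *m x - Lq Q *m x.
Proof. by rewrite Lq_lin -scaleN1r LqZ scaleN1r. Qed.

Lemma Nq_sub P Q x : Nq (P - Q) *m x = Nq P *m x - Nq Q *m x.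
Proof. by rewrite Nq_lin -scaleN1r NqZ scaleN1r. Qed.

Lemma LqT_sub P Q T : (Lq (P - Q))^T *m T = (Lq P)^T *m T - (Lq Q)^T *m T.
Proof.
rewrite !LqT_mul !qE crossD crossN mulmxDl mulNmx.
move: (crossmx _ *m _) (crossmx (qvec Q) *m _) => u v.
by apply/matrixP => i j; rewrite !mxE; ring.
Qed.

Lemma NqT_sub P Q T : (Nq (P - Q))^T *m T = (Nq P)^T *m T - (Nq Q)^T *m T.
Proof.
rewrite !NqT_mul !qE crossD crossN mulmxDl mulNmx.
move: (crossmx _ *m _) (crossmx (qvec Q) *m _) => u v.
by apply/matrixP => i j; rewrite !mxE; ring.
Qed.

Lemma rot_NLv Q x : unit_quat Q -> rotmx Q *m x = (Nq Q)^T *m (Lq Q *m x).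
Proof. by move=> uQ; rewrite (rot_NL uQ) mulmxA. Qed.

Lemma rotT_LNv Q x : unit_quat Q -> (rotmx Q)^T *m x = (Lq Q)^T *m (Nq Q *m x).
Proof. by move=> uQ; rewrite (rot_NL uQ) trmx_mul trmxK mulmxA. Qed.

Lemma rot_sub P Q x : unit_quat P -> unit_quat Q ->
  enorm (rotmx P *m x - rotmx Q *m x) <= 2 * (enorm (P - Q) * enorm x).
Proof.
move=> uP uQ; rewrite !rot_NLv//.
have -> : (Nq P)^T *m (Lq P *m x) - (Nq Q)^T *m (Lq Q *m x) =
    (Nq P)^T *m (Lq (P - Q) *m x) + (Nq (P - Q))^T *m (Lq Q *m x).
  by rewrite NqT_sub Lq_sub mulmxBr addrA subrK.
rewrite mulr_natl mulr2n; apply: enorm_addle.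
  by apply: le_trans (enorm_NqT _ _) _; rewrite enorm_unit// mul1r enorm_Lq.
by apply: le_trans (enorm_NqT _ _) _; rewrite enorm_Lq (enorm_unit uQ) mul1r.
Qed.

Lemma rotT_sub P Q x : unit_quat P -> unit_quat Q ->
  enorm ((rotmx P)^T *m x - (rotmx Q)^T *m x) <= 2 * (enorm (P - Q) * enorm x).
Proof.
move=> uP uQ; rewrite !rotT_LNv//.
have -> : (Lq P)^T *m (Nq P *m x) - (Lq Q)^T *m (Nq Q *m x) =
    (Lq P)^T *m (Nq (P - Q) *m x) + (Lq (P - Q))^T *m (Nq Q *m x).
  by rewrite LqT_sub Nq_sub mulmxBr addrA subrK.
rewrite mulr_natl mulr2n; apply: enorm_addle.
  by apply: le_trans (enorm_LqT _ _) _; rewrite enorm_unit// mul1r enorm_Nq.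
by apply: le_trans (enorm_LqT _ _) _; rewrite enorm_Nq (enorm_unit uQ) mul1r.
Qed.

Lemma mulmx_bound m (A : 'M[R]_m) : exists2 K : R, 0 <= K & forall x : 'cV[R]_m,
  enorm (A *m x) <= K * enorm x.
Proof.
pose K2 := \sum_i dotv (row i A)^T (row i A)^T.
have K0 : 0 <= K2 by apply: sumr_ge0 => i _; exact: dotv_ge0.
exists (Num.sqrt K2) => [|x]; first exact: sqrtr_ge0.
rewrite /enorm -sqrtrM// ler_wsqrtr// [leLHS]dotvE /K2 mulr_suml; apply: ler_sum => i _.
have -> : (A *m x) i 0 = dotv (row i A)^T x.
  by rewrite dotvE mxE; apply: eq_bigr => k _; rewrite !mxE.
rewrite -expr2; exact: dotv_CS.
Qed.

(** The transpose maps P to the vector part of P times the conjugate of Q, and the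
    conjugate of Q (0, w) is - (0, w) times that of Q. *)
Lemma NqT_qmul (Q P : quat R) (w : 'cV[R]_3) :
  (Nq (Lq Q *m w))^T *m P = - ((Nq Q)^T *m qmul P (qbar w)).
Proof.
rewrite !NqT_mul Lq_mul /qmul /qbar !qE mulr0 sub0r scale0r addr0.
by move: (qvec Q) (qscal Q) (qvec P) (qscal P) => q q0 p p0; mx3.
Qed.

(** R' = R S(w): pure quaternions commute up to twice their cross product. Written
    with the two multiplication matrices, the identity holds for all lengths of Q. *)
Lemma rot_kinematics Q (w x : 'cV[R]_3) :
  (Nq (2^-1 *: (Lq Q *m w)))^T *m (Lq Q *m x) + (Nq Q)^T *m (Lq (2^-1 *: (Lq Q *m w)) *m x)
  = (Nq Q)^T *m (Lq Q *m (crossmx w *m x)).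
Proof.
have comm : qmul (qbar w) (qbar x) - qmul (qbar x) (qbar w) = 2 *: qbar (crossmx w *m x).
  apply: quatP; rewrite /qmul /qbar !qE; first by rewrite [dotv x w]dotvC; ring.
  by rewrite !scale0r !add0r (crossC x w) opprK scaler_nat.
rewrite NqTZ LqZ -scalemxAr -scalerDr NqT_qmul -!qmul_bar -!qmulA -mulmxN -mulmxDr addrC.
rewrite -scaleN1r -qmulZr -qmulDr scaleN1r comm qmulZr -scalemxAr scalerA.
by rewrite mulVf ?pnatr_eq0// scale1r.
Qed.
End EuclideanBounds.


(** * Comparing two motions near a set of rest points *)

Section PairField.
Variables (R : realType) (J : 'M[R]_3) (Bl Al : 'M[R]_(1 + 3)).
Implicit Types (T Q : quat R) (w : 'cV[R]_3).
#[local] Opaque Lq Nq rotmx crossmx.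

(** Near an eigenspace the potentials may be shifted by multiples of the identity,
    since these are constant on the sphere. The shifted forms Bl and Al are small
    there, and so are all the terms below: the velocities of error and attitude, the
    torque, the momentum in inertial coordinates and its rate of change. *)
Definition cT T Q w : quat R := Nq T *m (2^-1 *: (rotmx Q *m w) - (Nq T)^T *m (Bl *m T)).
Definition cQ Q w : quat R := 2^-1 *: (Lq Q *m w).
Definition ctau T Q w : 'cV[R]_3 := - (crossmx w *m (J *m w))
  - 2 *: ((rotmx Q)^T *m ((Nq T)^T *m (Bl *m T))) - 2 *: ((Lq Q)^T *m (Al *m Q)).
Definition cPi Q w : 'cV[R]_3 := rotmx Q *m (J *m w).
Definition cforce T Q : 'cV[R]_3 :=
  - (2 *: ((Nq T)^T *m (Bl *m T))) - 2 *: ((Nq Q)^T *m (Al *m Q)).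

Variables (T T2 Q Q2 : quat R) (w w2 : 'cV[R]_3) (e M : R).
Hypotheses (uT : unit_quat T) (uT2 : unit_quat T2) (uQ : unit_quat Q) (uQ2 : unit_quat Q2).
Hypotheses (e0 : 0 <= e) (e1 : e <= 1) (M1 : 1 <= M).
Hypotheses (sB : Bl^T = Bl) (sA : Al^T = Al).
Hypotheses (JM : forall x, enorm (J *m x) <= M * enorm x)
  (AM : forall x, enorm (Al *m x) <= M * enorm x).
Hypotheses (hT : enorm (Bl *m T) <= e) (hT2 : enorm (Bl *m T2) <= e)
  (hQ : enorm (Al *m Q) <= e) (hQ2 : enorm (Al *m Q2) <= e)
  (hw : enorm w <= e) (hw2 : enorm w2 <= e).

Let D := T - T2. Let q := Q - Q2. Let om := w - w2.
Hypothesis DM : enorm D <= M * enorm (Bl *m D).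
Let S := enorm (Bl *m D) + enorm om + enorm q.

Lemma mulBr2 a b c d (A : 'M[R]_(a, b)) (B : 'M[R]_(b, c)) (x y : 'M[R]_(c, d)) :
  A *m (B *m (x - y)) = A *m (B *m x) - A *m (B *m y).
Proof. by rewrite !mulmxBr. Qed.

Lemma S_ge0 : 0 <= S. Proof. by rewrite !addr_ge0 ?enorm_ge0. Qed.
Lemma omS : enorm om <= S. Proof. by rewrite /S -addrA addrCA lerDl addr_ge0 ?enorm_ge0. Qed.
Lemma qS : enorm q <= S. Proof. by rewrite lerDr addr_ge0 ?enorm_ge0. Qed.
Lemma bS : enorm (Bl *m D) <= S. Proof. by rewrite /S -addrA lerDl addr_ge0 ?enorm_ge0. Qed.
Lemma DS : enorm D <= M * S.
Proof. by apply: le_trans DM _; rewrite ler_wpM2l ?bS// (le_trans _ M1). Qed.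

Lemma prod_le (a b c d : R) : 0 <= a -> 0 <= b -> a <= c -> b <= d -> a * b <= c * d.
Proof. by move=> *; exact: ler_pM. Qed.

Lemma enormN_le m (x : 'cV[R]_m) a : enorm x <= a -> enorm (- x) <= a.
Proof. by rewrite enormN. Qed.

Lemma enorm2_le m (x : 'cV[R]_m) a : enorm x <= a -> enorm (2 *: x) <= 2 * a.
Proof. by move=> xa; rewrite enormZ normr_nat ler_wpM2l. Qed.

Let X := e * S.
Lemma X_ge0 : 0 <= X. Proof. by rewrite mulr_ge0 ?S_ge0. Qed.
Lemma XM : X <= M * X. Proof. by rewrite ler_peMl ?X_ge0. Qed.
Lemma qe : enorm q * e <= X. Proof. by rewrite mulrC ler_wpM2l ?qS. Qed.
Lemma De : enorm D * e <= M * X. Proof. by rewrite mulrC mulrCA ler_wpM2l ?DS. Qed.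
Lemma oe : enorm om * e <= X. Proof. by rewrite mulrC ler_wpM2l ?omS. Qed.

Lemma NTB_le (P P2 : quat R) (A : 'M[R]_(1 + 3)) : enorm (A *m P2) <= e ->
  enorm ((Nq P)^T *m (A *m P2)) <= enorm P * e.
Proof. by move=> h; apply: le_trans (enorm_NqT _ _) _; rewrite ler_wpM2l ?enorm_ge0. Qed.
Lemma LTB_le (P P2 : quat R) (A : 'M[R]_(1 + 3)) : enorm (A *m P2) <= e ->
  enorm ((Lq P)^T *m (A *m P2)) <= enorm P * e.
Proof. by move=> h; apply: le_trans (enorm_LqT _ _) _; rewrite ler_wpM2l ?enorm_ge0. Qed.

(** In this and the following differences of two motions, the linear part in the
    differences D, q, om is separated; as the shifted gradients and velocities
    themselves are at most e, what is left is of order e times the size S of the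
    difference. *)
Lemma rem_Q : enorm (cQ Q w - cQ Q2 w2 - 2^-1 *: (Lq Q *m om)) <= 10 * M * X.
Proof.
have -> : cQ Q w - cQ Q2 w2 - 2^-1 *: (Lq Q *m om) = 2^-1 *: (Lq q *m w2).
  have h1 := Lq_sub Q Q2 w2; have h2 := mulmxBr (Lq Q) w w2.
  rewrite /cQ -!scalerBr h2 h1; congr (_ *: _).
  by apply/matrixP => i j; rewrite !mxE; ring.
rewrite enormZ ger0_norm ?invr_ge0// enorm_Lq.
have h : enorm q * enorm w2 <= X by apply: le_trans qe; rewrite ler_wpM2l ?enorm_ge0.
have := XM; have := X_ge0; lra.
Qed.

Lemma rem_Pi : enorm (cPi Q w - cPi Q2 w2 - rotmx Q *m (J *m om)) <= 10 * M * X.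
Proof.
have -> : cPi Q w - cPi Q2 w2 - rotmx Q *m (J *m om) =
    rotmx Q *m (J *m w2) - rotmx Q2 *m (J *m w2).
  rewrite /cPi (mulBr2 (rotmx Q) J w w2).
  by apply/matrixP => i j; rewrite ?(mxE _ _ i j); ring.
apply: le_trans (rot_sub _ uQ uQ2) _.
have h : enorm q * enorm (J *m w2) <= M * X.
  apply: le_trans (_ : enorm q * (M * e) <= _); last first.
    by rewrite mulrCA ler_wpM2l ?qe// (le_trans _ M1).
  rewrite ler_wpM2l ?enorm_ge0//; apply: le_trans (JM _) _.
  by rewrite ler_wpM2l// (le_trans _ M1).
have := XM; have := X_ge0; rewrite -/q; lra.
Qed.

Lemma rem_force : enorm (cforce T Q - cforce T2 Q2 -
   (- (2 *: ((Nq T)^T *m (Bl *m D))) - 2 *: ((Nq Q)^T *m (Al *m q)))) <= 10 * M * X.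
Proof.
have -> : cforce T Q - cforce T2 Q2 -
   (- (2 *: ((Nq T)^T *m (Bl *m D))) - 2 *: ((Nq Q)^T *m (Al *m q))) =
   - (2 *: ((Nq D)^T *m (Bl *m T2))) - 2 *: ((Nq q)^T *m (Al *m Q2)).
  rewrite /cforce (NqT_sub T T2 (Bl *m T2)) (NqT_sub Q Q2 (Al *m Q2)).
  rewrite (mulBr2 (Nq T)^T Bl T T2) (mulBr2 (Nq Q)^T Al Q Q2).
  move: ((Nq T)^T *m (Bl *m T)) ((Nq T)^T *m (Bl *m T2)) ((Nq T2)^T *m (Bl *m T2)) => a b c.
  move: ((Nq Q)^T *m (Al *m Q)) ((Nq Q)^T *m (Al *m Q2)) ((Nq Q2)^T *m (Al *m Q2)) => a' b' c'.
  by apply/matrixP => i j; rewrite !mxE; ring.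
apply: le_trans (_ : 2 * (M * X) + 2 * X <= _); last by have := XM; have := X_ge0; lra.
apply: enorm_addle; apply: enormN_le; apply: enorm2_le.
  exact: le_trans (NTB_le _ hT2) De.
exact: le_trans (NTB_le _ hQ2) qe.
Qed.

Lemma rem_tau : enorm (ctau T Q w - ctau T2 Q2 w2 -
   (- (2 *: ((rotmx Q)^T *m ((Nq T)^T *m (Bl *m D)))) - 2 *: ((Lq Q)^T *m (Al *m q))))
   <= 20 * M * X.
Proof.
have -> : ctau T Q w - ctau T2 Q2 w2 -
   (- (2 *: ((rotmx Q)^T *m ((Nq T)^T *m (Bl *m D)))) - 2 *: ((Lq Q)^T *m (Al *m q))) =
   (- (crossmx om *m (J *m w)) - crossmx w2 *m (J *m om)) +
   ((- (2 *: ((rotmx Q)^T *m ((Nq D)^T *m (Bl *m T2))))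
     - 2 *: ((rotmx Q)^T *m ((Nq T2)^T *m (Bl *m T2)) - (rotmx Q2)^T *m ((Nq T2)^T *m (Bl *m T2))))
   - 2 *: ((Lq q)^T *m (Al *m Q2))).
  have c1 : crossmx om *m (J *m w) = crossmx w *m (J *m w) - crossmx w2 *m (J *m w).
    by rewrite /om crossD crossN mulmxBl.
  rewrite /ctau c1 (NqT_sub T T2 (Bl *m T2)) (LqT_sub Q Q2 (Al *m Q2)).
  rewrite (mulBr2 (Nq T)^T Bl T T2) (mulBr2 (Lq Q)^T Al Q Q2) (mulBr2 (crossmx w2) J w w2).
  rewrite (mulmxBr (rotmx Q)^T ((Nq T)^T *m (Bl *m T)) ((Nq T)^T *m (Bl *m T2))).
  rewrite (mulmxBr (rotmx Q)^T ((Nq T)^T *m (Bl *m T2)) ((Nq T2)^T *m (Bl *m T2))).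
  move: (crossmx w *m (J *m w)) (crossmx w2 *m (J *m w)) (crossmx w2 *m (J *m w2)) => a b c.
  by apply/matrixP => i j; rewrite ?(mxE _ _ i j); ring.
apply: le_trans (_ : (M * X + M * X) + ((2 * (M * X) + 2 * (2 * X)) + 2 * X) <= _); last first.
  by have := XM; have := X_ge0; lra.
have M0 : 0 <= M by apply: le_trans M1.
apply: enorm_addle; last apply: enorm_addle; try apply: enorm_addle; apply: enormN_le.
- apply: le_trans (enorm_cross _ _) _.
  apply: le_trans (_ : enorm om * (M * e) <= _); last by rewrite mulrCA ler_wpM2l ?oe.
  rewrite ler_wpM2l ?enorm_ge0//; apply: le_trans (JM _) _; by rewrite ler_wpM2l.
- apply: le_trans (enorm_cross _ _) _.
  apply: le_trans (_ : e * (M * enorm om) <= _).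
    by rewrite ler_pM ?enorm_ge0.
  by rewrite mulrCA ler_wpM2l// mulrC oe.
- apply: enorm2_le; rewrite enorm_rotT//; exact: le_trans (NTB_le _ hT2) De.
- apply: enorm2_le; apply: le_trans (rotT_sub _ uQ uQ2) _; rewrite ler_wpM2l//.
  apply: le_trans qe; rewrite ler_wpM2l ?enorm_ge0//.
  by apply: le_trans (NTB_le _ hT2) _; rewrite enorm_unit// mul1r.
- by apply: enorm2_le; exact: le_trans (LTB_le _ hQ2) qe.
Qed.

Lemma rem_T : enorm (cT T Q w - cT T2 Q2 w2 -
   (2^-1 *: (Nq T *m (rotmx Q *m om)) - Bl *m D)) <= 10 * M * X.
Proof.
have T1 : dotv T T = 1 by exact/unit_quatE.
have T21 : dotv T2 T2 = 1 by exact/unit_quatE.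
pose u := dotv T (Bl *m T); pose u2 := dotv T2 (Bl *m T2).
have -> : cT T Q w - cT T2 Q2 w2 - (2^-1 *: (Nq T *m (rotmx Q *m om)) - Bl *m D) =
   2^-1 *: (Nq T *m (rotmx Q *m w2 - rotmx Q2 *m w2) + Nq D *m (rotmx Q2 *m w2)) +
   (u *: D + (u - u2) *: T2).
  have c1 : cT T Q w = 2^-1 *: (Nq T *m (rotmx Q *m w)) - (Bl *m T - u *: T).
    by rewrite /cT mulmxBr (NqNqT T (Bl *m T)) T1 scale1r -/u -scalemxAr.
  have c2 : cT T2 Q2 w2 = 2^-1 *: (Nq T2 *m (rotmx Q2 *m w2)) - (Bl *m T2 - u2 *: T2).
    by rewrite /cT mulmxBr (NqNqT T2 (Bl *m T2)) T21 scale1r -/u2 -scalemxAr.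
  rewrite c1 c2 (Nq_sub T T2 (rotmx Q2 *m w2)) (mulBr2 (Nq T) (rotmx Q) w w2) (mulmxBr Bl T T2).
  rewrite (mulmxBr (Nq T) (rotmx Q *m w2) (rotmx Q2 *m w2)) /D.
  move: (Nq T *m (rotmx Q *m w)) (Nq T *m (rotmx Q *m w2)) => a1 a2.
  move: (Nq T *m (rotmx Q2 *m w2)) (Nq T2 *m (rotmx Q2 *m w2)) => a3 a4.
  by apply/matrixP => i j; rewrite ?(mxE _ _ i j); ring.
have hu : `|u| <= e.
  by apply: le_trans (dotv_le (lexx _) hT) _; rewrite enorm_unit// mul1r.
have huu : `|u - u2| <= 2 * (M * X).
  have -> : u - u2 = dotv D (Bl *m T) + dotv (Bl *m T2) D.
    by rewrite /u /u2 /D dotvBl dotvBr [dotv (Bl *m T2) T]dotv_mull sB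
       [dotv (Bl *m T2) T2]dotv_mull sB; ring.
  apply: le_trans (ler_normD _ _) _; rewrite mulr_natl mulr2n; apply: lerD.
    by apply: le_trans (dotv_le (lexx _) hT) _; exact: De.
  by rewrite dotvC; apply: le_trans (dotv_le (lexx _) hT2) _; exact: De.
apply: le_trans (_ : 2^-1 * (2 * X + M * X) + (M * X + 2 * (M * X)) <= _); last first.
  by have := XM; have := X_ge0; lra.
apply: enorm_addle.
  rewrite enormZ ger0_norm ?invr_ge0// ler_wpM2l ?invr_ge0//; apply: enorm_addle.
    rewrite enorm_Nq enorm_unit// mul1r; apply: le_trans (rot_sub _ uQ uQ2) _.
    rewrite ler_wpM2l//; apply: le_trans qe; by rewrite ler_wpM2l ?enorm_ge0.
  rewrite enorm_Nq enorm_rot//; apply: le_trans De; by rewrite ler_wpM2l ?enorm_ge0.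
apply: enorm_addle; rewrite enormZ; last by rewrite enorm_unit// mulr1.
by apply: le_trans De; rewrite mulrC ler_wpM2l ?enorm_ge0.
Qed.

Lemma cT_small : enorm (cT T Q w) <= 2 * e.
Proof.
rewrite /cT enorm_Nq enorm_unit// mul1r; apply: le_trans (_ : 2^-1 * e + e <= _); last by have := e0; lra.
apply: enorm_addle; last first.
  by apply: enormN_le; apply: le_trans (NTB_le _ hT) _; rewrite enorm_unit// mul1r.
by rewrite enormZ ger0_norm ?invr_ge0// enorm_rot// ler_wpM2l ?invr_ge0.
Qed.

Lemma cQ_small : enorm (cQ Q w) <= e.
Proof.
rewrite /cQ enormZ ger0_norm ?invr_ge0// enorm_Lq enorm_unit// mul1r.
have := hw; have := enorm_ge0 w; lra.
Qed.

Hypothesis AqM : `|dotv q (Al *m q)| <= M * dotv (Al *m q) (Al *m q).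
Hypothesis BDM : `|dotv D (Bl *m D)| <= M * dotv (Bl *m D) (Bl *m D).
Hypothesis sJ : J^T = J.
Variable j : R.
Hypotheses (j0 : 0 <= j) (Jj : forall x, j * dotv x x <= dotv x (J *m x)).

Let dT := cT T Q w - cT T2 Q2 w2.
Let dQ := cQ Q w - cQ Q2 w2.
Let dW := ctau T Q w - ctau T2 Q2 w2.
Let dP := cPi Q w - cPi Q2 w2.
Let dF := cforce T Q - cforce T2 Q2.
Let be := enorm (Bl *m D).
Let al := enorm (Al *m q).
Let o := enorm om.
Let p := enorm q.

Let M0 : 0 <= M. Proof. exact: le_trans M1. Qed.
Let X0 := X_ge0.
Let be0 : 0 <= be := enorm_ge0 _.
Let al0 : 0 <= al := enorm_ge0 _.
Let o0 : 0 <= o := enorm_ge0 _.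
Let p0 : 0 <= p := enorm_ge0 _.
Let XS : X <= S. Proof. by rewrite /X ler_piMl ?S_ge0. Qed.
Let alp : al <= M * p. Proof. exact: AM. Qed.
Let alS : al <= M * S. Proof. by apply: le_trans alp _; rewrite ler_wpM2l ?qS. Qed.
Let JoS : enorm (J *m om) <= M * o. Proof. exact: JM. Qed.

Lemma scale1_le (a b : R) : 0 <= b -> a <= 1 -> a * b <= b.
Proof. by move=> b0 a1; rewrite -[leRHS]mul1r ler_wpM2r. Qed.

Lemma split_rem m (x y g : 'cV[R]_m) (a b c : R) : enorm (x - g) <= a -> enorm y <= b ->
  dotv g y <= c -> dotv x y <= c + a * b.
Proof.
move=> h1 h2 h3; rewrite -(subrK g x) dotvDl addrC lerD//.
exact: le_trans (ler_norm _) (dotv_le h1 h2).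
Qed.

Lemma split_remN m (x y g : 'cV[R]_m) (a b c : R) : enorm (x - g) <= a -> enorm y <= b ->
  c <= dotv g y -> c - a * b <= dotv x y.
Proof.
move=> h1 h2 h3; rewrite -(subrK g x) dotvDl addrC lerD//.
by rewrite lerNl; apply: le_trans (dotv_le h1 h2); rewrite -normrN ler_norm.
Qed.

Let T1 : dotv T T = 1. Proof. exact/unit_quatE. Qed.
Let Q1 : dotv Q Q = 1. Proof. exact/unit_quatE. Qed.
Let gT := 2^-1 *: (Nq T *m (rotmx Q *m om)) - Bl *m D.
Let gW := - (2 *: ((rotmx Q)^T *m ((Nq T)^T *m (Bl *m D)))) - 2 *: ((Lq Q)^T *m (Al *m q)).

(** The rate of change of the energy of the difference: to first order the
    conservative parts cancel and only the dissipation of the error remains. *)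
Lemma est1 : dotv om dW + 4 * dotv dQ (Al *m q) + 4 * dotv dT (Bl *m D)
  <= - 4 * be ^+ 2 + 180 * (M ^+ 2 * (X * S)).
Proof.
have hW : dotv om dW <= dotv gW om + 20 * M * X * S.
  by rewrite dotvC; apply: split_rem (lexx _); [exact: rem_tau|exact: omS].
have hQ' : dotv dQ (Al *m q) <= dotv (2^-1 *: (Lq Q *m om)) (Al *m q) + 10 * M * X * (M * S).
  by apply: split_rem (lexx _); [exact: rem_Q|exact: alS].
have hT' : dotv dT (Bl *m D) <= dotv gT (Bl *m D) + 10 * M * X * S.
  by apply: split_rem (lexx _); [exact: rem_T|exact: bS].
have e2 : dotv gW om + 4 * dotv (2^-1 *: (Lq Q *m om)) (Al *m q) + 4 * dotv gT (Bl *m D)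
    = - 4 * be ^+ 2.
  rewrite /gW /gT /be enorm_sqr !dotvBl !dotvNl !dotvZl.
  rewrite [dotv ((rotmx Q)^T *m _) om]dotv_mull trmxK [dotv ((Nq T)^T *m _) _]dotv_mull trmxK.
  rewrite [dotv ((Lq Q)^T *m _) om]dotv_mull trmxK.
  by rewrite [dotv (Bl *m D) (Nq T *m _)]dotvC [dotv (Al *m q) (Lq Q *m _)]dotvC; field.
have XS0 : 0 <= X * S by rewrite mulr_ge0 ?S_ge0.
have m1 : M * (X * S) <= M ^+ 2 * (X * S) by rewrite ler_wpM2r// expr2 ler_peMl.
have m2 : 0 <= M ^+ 2 * (X * S) by rewrite mulr_ge0 ?sqr_ge0.
lra.
Qed.

Lemma est2 : - (2 * M * (be + al) * be) - 20 * (M ^+ 2 * (X * S)) <= dotv dF ((Nq T)^T *m D).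
Proof.
have hN : enorm ((Nq T)^T *m D) <= M * be.
  by apply: le_trans (enorm_NqT _ _) _; rewrite enorm_unit// mul1r.
set g := - (2 *: ((Nq T)^T *m (Bl *m D))) - 2 *: ((Nq Q)^T *m (Al *m q)).
have hg : enorm g <= 2 * be + 2 * al.
  apply: enorm_addle; apply: enormN_le; apply: enorm2_le.
    by apply: le_trans (enorm_NqT _ _) _; rewrite enorm_unit// mul1r.
  by apply: le_trans (enorm_NqT _ _) _; rewrite enorm_unit// mul1r.
have h1 := dotv_le hg hN.
have h2 : - ((2 * be + 2 * al) * (M * be)) <= dotv g ((Nq T)^T *m D).
  by rewrite lerNl; apply: le_trans h1; rewrite -normrN ler_norm.
have := split_remN rem_force hN h2; apply: le_trans.
have : 10 * M * X * (M * be) <= 10 * (M ^+ 2 * (X * S)).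
  have -> : 10 * M * X * (M * be) = 10 * (M ^+ 2 * (X * be)) by ring.
  by rewrite ler_wpM2l// ler_wpM2l ?sqr_ge0// ler_wpM2l ?bS.
have : 0 <= M ^+ 2 * (X * S) by rewrite mulr_ge0 ?sqr_ge0// mulr_ge0 ?S_ge0.
lra.
Qed.

Lemma dP_le : enorm dP <= M * o + 10 * M * X.
Proof.
rewrite -(subrK (rotmx Q *m (J *m om)) dP) addrC; apply: enorm_addle; last exact: rem_Pi.
by rewrite enorm_rot.
Qed.

Lemma dT_le : enorm dT <= 2^-1 * o + be + 10 * M * X.
Proof.
rewrite -(subrK gT dT) addrC; apply: enorm_addle; last exact: rem_T.
apply: enorm_addle; last by rewrite enormN.
by rewrite enormZ ger0_norm ?invr_ge0// enorm_Nq enorm_unit// mul1r enorm_rot.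
Qed.

Lemma dQ_le : enorm dQ <= 2^-1 * o + 10 * M * X.
Proof.
rewrite -(subrK (2^-1 *: (Lq Q *m om)) dQ) addrC; apply: enorm_addle; last exact: rem_Q.
by rewrite enormZ ger0_norm ?invr_ge0// enorm_Lq enorm_unit// mul1r.
Qed.

Lemma est3 : - (42 * (M ^+ 2 * (X * S))) <= dotv dP ((Nq (cT T Q w))^T *m D).
Proof.
have h : enorm ((Nq (cT T Q w))^T *m D) <= 2 * (M * X).
  apply: le_trans (enorm_NqT _ _) _; apply: le_trans (_ : 2 * e * (M * S) <= _).
    by apply: prod_le; rewrite ?enorm_ge0 ?cT_small ?DS.
  by have -> : 2 * e * (M * S) = 2 * (M * X) by rewrite /X; ring.
have := dotv_le dP_le h; rewrite ler_norml => /andP[+ _]; apply: le_trans.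
rewrite lerN2; apply: le_trans (_ : (21 * (M * S)) * (2 * (M * X)) <= _).
  apply: (ler_wpM2r (mulr_ge0 (ler0n R 2) (mulr_ge0 M0 X0))).
  have : M * o <= M * S by rewrite ler_wpM2l ?omS.
  have : M * X <= M * S by rewrite ler_wpM2l.
  have := mulr_ge0 M0 S_ge0; lra.
by have -> : 21 * (M * S) * (2 * (M * X)) = 42 * (M ^+ 2 * (X * S)) by ring.
Qed.

(** The term that detects the angular velocity: D moves with half of the rotated om,
    which is paired with the momentum J om. *)
Lemma est4 : 2^-1 * j * o ^+ 2 - M * o * be - 460 * (M ^+ 2 * (X * S))
  <= dotv dP ((Nq T)^T *m dT).
Proof.
have MS0 : 0 <= M * S by rewrite mulr_ge0 ?S_ge0.
have XS0 : 0 <= X * S by rewrite mulr_ge0 ?S_ge0.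
have hN : enorm ((Nq T)^T *m dT) <= 22 * (M * S).
  apply: le_trans (enorm_NqT _ _) _; rewrite enorm_unit// mul1r; apply: le_trans dT_le _.
  have : M * X <= M * S by rewrite ler_wpM2l.
  have := omS; have := bS; have := S_ge0; have : S <= M * S by rewrite ler_peMl ?S_ge0.
  by rewrite -/o -/be; lra.
set g := rotmx Q *m (J *m om).
have h1 : - (M * o * be) + 2^-1 * j * o ^+ 2 - M * o * (10 * M * X) <= dotv g ((Nq T)^T *m dT).
  have hr : enorm ((Nq T)^T *m (dT - gT)) <= 10 * M * X.
    by apply: le_trans (enorm_NqT _ _) _; rewrite enorm_unit// mul1r; exact: rem_T.
  have hgM : enorm g <= M * o by rewrite enorm_rot.
  have -> : (Nq T)^T *m dT = (Nq T)^T *m (dT - gT) + (Nq T)^T *m gT.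
    by rewrite -mulmxDr subrK.
  have -> : (Nq T)^T *m gT = 2^-1 *: (rotmx Q *m om) - (Nq T)^T *m (Bl *m D).
    rewrite /gT (mulmxBr (Nq T)^T) -scalemxAr (NqNq T (rotmx Q *m om)) T1 scale1r.
    by [].
  rewrite dotvDr dotvBr dotvZr.
  have -> : dotv g (rotmx Q *m om) = dotv om (J *m om).
    by rewrite /g dotv_mulr mulmxA rot_trmul// mul1mx dotvC.
  have a1 := dotv_le hgM hr.
  have a2 : `|dotv g ((Nq T)^T *m (Bl *m D))| <= M * o * be.
    apply: dotv_le => //; apply: le_trans (enorm_NqT _ _) _; by rewrite enorm_unit// mul1r.
  have a3 := Jj om; rewrite -enorm_sqr -/o in a3.
  move: a1 a2; rewrite !ler_norml => /andP[a1 _] /andP[_ a2].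
  lra.
have := split_remN rem_Pi hN h1; apply: le_trans.
have : M * o * (10 * M * X) <= 10 * (M ^+ 2 * (X * S)).
  have -> : M * o * (10 * M * X) = 10 * (M ^+ 2 * (X * o)) by ring.
  by rewrite ler_wpM2l// ler_wpM2l ?sqr_ge0// ler_wpM2l ?omS.
have : 0 <= M ^+ 2 * (X * S) by rewrite mulr_ge0 ?sqr_ge0.
lra.
Qed.

(** The term that detects the shifted attitude: the torque contains -2 times the
    gradient. *)
Lemma est5 : dotv dW ((Lq Q)^T *m (Al *m q)) <=
  - (2 * al ^+ 2) + 2 * be * al + 22 * (M ^+ 2 * (X * S)).
Proof.
have XS0 : 0 <= X * S by rewrite mulr_ge0 ?S_ge0.
have hL : enorm ((Lq Q)^T *m (Al *m q)) <= al.
  by apply: le_trans (enorm_LqT _ _) _; rewrite enorm_unit// mul1r.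
have h1 : dotv gW ((Lq Q)^T *m (Al *m q)) <= - (2 * al ^+ 2) + 2 * be * al + 2 * (X * S).
  rewrite /gW dotvBl dotvNl !dotvZl LqT_norm// -enorm_sqr -/al.
  have a1 : `|dotv Q (Al *m q)| <= e * p.
    by rewrite dotv_mulr sA; apply: dotv_le.
  have a2 : dotv Q (Al *m q) ^+ 2 <= X * S.
    rewrite -(real_normK (num_real _)); apply: le_trans (_ : (e * p) ^+ 2 <= _).
      by rewrite ler_sqr ?nnegrE ?mulr_ge0.
    rewrite expr2; apply: prod_le; rewrite ?mulr_ge0//.
      by rewrite ler_wpM2l ?qS.
    by apply: le_trans XS; rewrite ler_wpM2l ?qS.
  have a3 : `|dotv ((rotmx Q)^T *m ((Nq T)^T *m (Bl *m D))) ((Lq Q)^T *m (Al *m q))| <= be * al.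
    apply: dotv_le hL; rewrite enorm_rotT//; apply: le_trans (enorm_NqT _ _) _.
    by rewrite enorm_unit// mul1r.
  by move: a3; rewrite ler_norml => /andP[a3 _]; lra.
have h2 := split_rem rem_tau hL h1; apply: le_trans h2 _.
have : 20 * M * X * al <= 20 * (M ^+ 2 * (X * S)).
  apply: le_trans (_ : 20 * M * X * (M * S) <= _).
    exact: ler_wpM2l (mulr_ge0 (mulr_ge0 (ler0n R 20) M0) X0) _ _ alS.
  by have -> : 20 * M * X * (M * S) = 20 * (M ^+ 2 * (X * S)) by ring.
have : 1 * (X * S) <= M ^+ 2 * (X * S) by rewrite ler_wpM2r// exprn_ege1.
lra.
Qed.

Lemma est6 : dotv (J *m om) ((Lq (cQ Q w))^T *m (Al *m q)) <= M ^+ 2 * (X * S).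
Proof.
have h : enorm ((Lq (cQ Q w))^T *m (Al *m q)) <= e * (M * S).
  by apply: le_trans (enorm_LqT _ _) _; apply: prod_le; rewrite ?enorm_ge0 ?cQ_small ?alS.
apply: le_trans (ler_norm _) _; apply: le_trans (dotv_le JoS h) _.
apply: le_trans (_ : M * S * (e * (M * S)) <= _).
  by rewrite ler_wpM2r ?mulr_ge0 ?S_ge0// ler_wpM2l ?omS.
by have -> : M * S * (e * (M * S)) = M ^+ 2 * (X * S) by rewrite /X; ring.
Qed.

Lemma est7 : dotv (J *m om) ((Lq Q)^T *m (Al *m dQ)) <= M ^+ 2 * o ^+ 2 + 10 * (M ^+ 3 * (X * S)).
Proof.
have h : enorm ((Lq Q)^T *m (Al *m dQ)) <= M * (2^-1 * o + 10 * M * X).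
  apply: le_trans (enorm_LqT _ _) _; rewrite enorm_unit// mul1r; apply: le_trans (AM _) _.
  by rewrite ler_wpM2l ?dQ_le.
apply: le_trans (ler_norm _) _; apply: le_trans (dotv_le JoS h) _.
have : M ^+ 3 * (X * o) <= M ^+ 3 * (X * S).
  by rewrite ler_wpM2l ?exprn_ge0// ler_wpM2l ?omS.
have : 0 <= M ^+ 2 * o ^+ 2 by rewrite mulr_ge0 ?sqr_ge0.
have -> : M * o * (M * (2^-1 * o + 10 * M * X)) = 2^-1 * (M ^+ 2 * o ^+ 2) + 10 * (M ^+ 3 * (X * o)).
  by ring.
lra.
Qed.

Lemma est8 : 2 * dotv dQ q <= o * p + 20 * (M * (X * S)).
Proof.
have h1 : dotv (2^-1 *: (Lq Q *m om)) q <= 2^-1 * (o * p).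
  apply: le_trans (ler_norm _) _; rewrite dotvZl normrM ger0_norm ?invr_ge0// ler_wpM2l ?invr_ge0//.
  by apply: dotv_le => //; rewrite enorm_Lq enorm_unit// mul1r.
have h2 := split_rem rem_Q qS h1.
lra.
Qed.

Variables (delta eps nu : R).
Hypotheses (d01 : 0 <= delta <= 1) (ep01 : 0 <= eps <= 1) (nu01 : 0 <= nu <= 1).

(** The eight estimates together: up to errors of order e the derivative of the cone
    form is bounded below by a form in the sizes be, o, al, p. *)
Lemma cone_derivative :
  4 * be ^+ 2 + delta * (2^-1 * j * o ^+ 2 - 2 * M * (be + al) * be - M * o * be)
  + eps * (2 * al ^+ 2 - 2 * be * al - M ^+ 2 * o ^+ 2) - nu * (o * p) - 1000 * (M ^+ 3 * (X * S))
  <= - (dotv om dW + 4 * dotv dQ (Al *m q) + 4 * dotv dT (Bl *m D))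
   + delta * (dotv dF ((Nq T)^T *m D) + dotv dP ((Nq (cT T Q w))^T *m D + (Nq T)^T *m dT))
   - eps * (dotv dW ((Lq Q)^T *m (Al *m q))
       + dotv (J *m om) ((Lq (cQ Q w))^T *m (Al *m q) + (Lq Q)^T *m (Al *m dQ)))
   - nu * (2 * dotv dQ q).
Proof.
have XS0 : 0 <= X * S by rewrite mulr_ge0 ?S_ge0.
have m1 : M * (X * S) <= M ^+ 3 * (X * S).
  by rewrite ler_wpM2r// [leRHS]exprS ler_peMr// exprn_ege1.
have m2 : M ^+ 2 * (X * S) <= M ^+ 3 * (X * S).
  by rewrite ler_wpM2r// exprS ler_peMl// sqr_ge0.
have m0 : 0 <= M ^+ 3 * (X * S) by rewrite mulr_ge0 ?exprn_ge0.
have m600 := mulr_ge0 (ler0n R 600) m0.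
have m100 := mulr_ge0 (ler0n R 100) m0.
have m20 := mulr_ge0 (ler0n R 20) m0.
have [/andP[dd0 dd1] /andP[ep0 ep1] /andP[nu0 nu1]] := And3 d01 ep01 nu01.
rewrite (dotvDr ((Nq _)^T *m D)) (dotvDr ((Lq (cQ Q w))^T *m _)).
have E1 := est1.
have E2 : delta * (2^-1 * j * o ^+ 2 - 2 * M * (be + al) * be - M * o * be - 600 * (M ^+ 3 * (X * S)))
    <= delta * (dotv dF ((Nq T)^T *m D) + (dotv dP ((Nq (cT T Q w))^T *m D) + dotv dP ((Nq T)^T *m dT))).
  by rewrite ler_wpM2l//; have := est2; have := est3; have := est4; lra.
have E3 : eps * (dotv dW ((Lq Q)^T *m (Al *m q)) + (dotv (J *m om) ((Lq (cQ Q w))^T *m (Al *m q)) +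
     dotv (J *m om) ((Lq Q)^T *m (Al *m dQ)))) <=
     eps * (- (2 * al ^+ 2) + 2 * be * al + M ^+ 2 * o ^+ 2 + 100 * (M ^+ 3 * (X * S))).
  by rewrite ler_wpM2l//; have := est5; have := est6; have := est7; lra.
have E4 : nu * (2 * dotv dQ q) <= nu * (o * p + 20 * (M ^+ 3 * (X * S))).
  by rewrite ler_wpM2l//; have := est8; lra.
have F1 : delta * (600 * (M ^+ 3 * (X * S))) <= 600 * (M ^+ 3 * (X * S)).
  exact: scale1_le m600 dd1.
have F2 : eps * (100 * (M ^+ 3 * (X * S))) <= 100 * (M ^+ 3 * (X * S)).
  exact: scale1_le m100 ep1.
have F3 : nu * (20 * (M ^+ 3 * (X * S))) <= 20 * (M ^+ 3 * (X * S)).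
  exact: scale1_le m20 nu1.
lra.
Qed.

(** The cone form itself is bounded above by the same quantities, except for -nu
    |q|^2, which is what makes the bound useful: q may be large along the set of rest
    points, where al vanishes. *)
Lemma cone_upper :
  - (2^-1 * dotv om (J *m om) + 2 * dotv q (Al *m q) + 2 * dotv D (Bl *m D))
   + delta * dotv dP ((Nq T)^T *m D) - eps * dotv (J *m om) ((Lq Q)^T *m (Al *m q))
   - nu * dotv q q
  <= 3 * M ^+ 2 * (be ^+ 2 + o ^+ 2 + al ^+ 2) + 10 * (M ^+ 2 * (X * S)) - nu * p ^+ 2.
Proof.
have XS0 : 0 <= X * S by rewrite mulr_ge0 ?S_ge0.
have [/andP[dd0 dd1] /andP[ep0 ep1] /andP[nu0 nu1]] := And3 d01 ep01 nu01.
have h1 : 0 <= dotv om (J *m om) by apply: le_trans (Jj om); rewrite mulr_ge0 ?dotv_ge0.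
have h2 := AqM; rewrite ler_norml -enorm_sqr -/al in h2; have /andP[h2' _] := h2.
have h3 := BDM; rewrite ler_norml -enorm_sqr -/be in h3; have /andP[h3' _] := h3.
have hN : enorm ((Nq T)^T *m D) <= M * be.
  by apply: le_trans (enorm_NqT _ _) _; rewrite enorm_unit// mul1r.
have hL : enorm ((Lq Q)^T *m (Al *m q)) <= al.
  by apply: le_trans (enorm_LqT _ _) _; rewrite enorm_unit// mul1r.
have h4 : delta * dotv dP ((Nq T)^T *m D) <= M ^+ 2 * (o * be) + 10 * (M ^+ 2 * (X * S)).
  apply: le_trans (ler_norm _) _; rewrite normrM (ger0_norm dd0).
  apply: le_trans (_ : 1 * `|dotv dP ((Nq T)^T *m D)| <= _); first by rewrite ler_wpM2r.
  rewrite mul1r; apply: le_trans (dotv_le dP_le hN) _.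
  have : M ^+ 2 * (X * be) <= M ^+ 2 * (X * S).
    by rewrite ler_wpM2l ?sqr_ge0// ler_wpM2l ?bS.
  have -> : (M * o + 10 * M * X) * (M * be) = M ^+ 2 * (o * be) + 10 * (M ^+ 2 * (X * be)) by ring.
  lra.
have h5 : - (M * (o * al)) <= eps * dotv (J *m om) ((Lq Q)^T *m (Al *m q)).
  rewrite lerNl; apply: le_trans (ler_norm _) _; rewrite normrN normrM (ger0_norm ep0).
  apply: le_trans (_ : 1 * `|dotv (J *m om) ((Lq Q)^T *m (Al *m q))| <= _); first by rewrite ler_wpM2r.
  by rewrite mul1r; apply: le_trans (dotv_le JoS hL) _; rewrite mulrA.
have m2 : M <= M ^+ 2 by rewrite expr2 ler_peMl.
have g1 : M ^+ 2 * (o * be) <= M ^+ 2 * (2^-1 * (o ^+ 2 + be ^+ 2)).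
  by rewrite ler_wpM2l ?sqr_ge0//; have := sqr_ge0 (o - be); rewrite sqrrB; lra.
have g2 : M * (o * al) <= M ^+ 2 * (2^-1 * (o ^+ 2 + al ^+ 2)).
  apply: prod_le; rewrite ?mulr_ge0//.
  by have := sqr_ge0 (o - al); rewrite sqrrB; lra.
have g3 : M * al ^+ 2 <= M ^+ 2 * al ^+ 2 by rewrite ler_wpM2r ?sqr_ge0.
have g4 : M * be ^+ 2 <= M ^+ 2 * be ^+ 2 by rewrite ler_wpM2r ?sqr_ge0.
have g5 : 0 <= M ^+ 2 * o ^+ 2 by rewrite mulr_ge0 ?sqr_ge0.
have g6 : 0 <= M ^+ 2 * al ^+ 2 by rewrite mulr_ge0 ?sqr_ge0.
have g7 : 0 <= M ^+ 2 * be ^+ 2 by rewrite mulr_ge0 ?sqr_ge0.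
rewrite -(enorm_sqr q) -/p; lra.
Qed.

End PairField.


(** * The weights of the cone and the way into it *)

Section ConeParameters.
Variable R : realType.

(** The weights are chosen in the order delta, eps, mu, nu, each small compared with
    the preceding ones, and the size e of the neighbourhood last. The dangerous term
    nu o p is absorbed by o^2 and by mu nu p^2, which comes from -nu p^2 in the upper
    bound; this needs nu small against mu. *)
Lemma cone_parameters (M j nu0 : R) : 1 <= M -> 0 < j -> 0 < nu0 ->
  exists delta eps nu mu e0 : R,
  [/\ (0 <= delta <= 1) && (0 <= eps <= 1), 0 < nu <= 1 /\ nu <= nu0, 0 < mu, 0 < e0 &
  forall e be al o p : R, 0 <= e <= e0 -> 0 <= be -> 0 <= al -> 0 <= o -> 0 <= p ->
  2 * mu * (3 * M ^+ 2 * (be ^+ 2 + o ^+ 2 + al ^+ 2)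
     + 10 * (M ^+ 2 * (e * (be + o + p) * (be + o + p))) - nu * p ^+ 2) <=
  4 * be ^+ 2 + delta * (2^-1 * j * o ^+ 2 - 2 * M * (be + al) * be - M * o * be)
  + eps * (2 * al ^+ 2 - 2 * be * al - M ^+ 2 * o ^+ 2) - nu * (o * p)
  - 1000 * (M ^+ 3 * (e * (be + o + p) * (be + o + p)))].
Proof.
move=> M1 j0 nu00; have M0 : 0 < M by apply: lt_le_trans M1.
have MM0 : 0 < M ^+ 2 by rewrite exprn_gt0.
pose ka := Num.min 1 (j / (8 * M ^+ 2)).
have ka0 : 0 < ka by rewrite lt_min ltr01 divr_gt0// mulr_gt0.
have ka1 : ka <= 1 by rewrite ge_min lexx.
have kaj : ka * M ^+ 2 <= j / 8.
  have : ka <= j / (8 * M ^+ 2) by rewrite ge_min lexx orbT.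
  rewrite ler_pdivlMr ?mulr_gt0//; lra.
pose G := 2 * M + 2 * M ^+ 2 / j + 4 * M ^+ 2 / ka.
have g2 : 0 < 2 * M ^+ 2 / j by rewrite divr_gt0// mulr_gt0.
have g4 : 0 < 4 * M ^+ 2 / ka by rewrite divr_gt0// mulr_gt0.
have G0 : 0 < G by rewrite /G !addr_gt0// mulr_gt0.
pose de := Num.min 1 G^-1.
have de0 : 0 < de by rewrite lt_min ltr01 invr_gt0.
have de1 : de <= 1 by rewrite ge_min lexx.
have deG : de * G <= 1 by rewrite -ler_pdivlMr// div1r ge_min lexx orbT.
pose c1 := Num.min 1 (Num.min (de * j / 4) (ka * de)).
have c10 : 0 < c1 by rewrite !lt_min ltr01 !divr_gt0 ?mulr_gt0.
have c11 : c1 <= 1 by rewrite ge_min lexx.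
have c1j : c1 <= de * j / 4 by rewrite !ge_min lexx orbT.
have c1k : c1 <= ka * de by rewrite !ge_min lexx !orbT.
pose mu := c1 / (24 * M ^+ 2).
have mu0 : 0 < mu by rewrite divr_gt0// mulr_gt0.
have muM : mu * M ^+ 2 = c1 / 24 by rewrite /mu; field; rewrite gt_eqF.
have mu1 : mu <= 1.
  rewrite ler_pdivrMr ?mulr_gt0// mul1r; have : 1 <= M ^+ 2 by rewrite exprn_ege1.
  lra.
pose nu := Num.min nu0 (mu * c1).
have nu_0 : 0 < nu by rewrite lt_min nu00 mulr_gt0.
have nuc : nu <= mu * c1 by rewrite ge_min lexx orbT.
have nu1 : nu <= 1 by apply: le_trans nuc _; rewrite mulr_ile1// ltW.
pose K := 3000 * M ^+ 3.
have K0 : 0 < K by exact: mulr_gt0 (ltr0Sn R _) (exprn_gt0 _ M0).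
(* K bounds the constants of the error terms; they are to be smaller than what is
   left of the definite terms *)
pose e0 := Num.min (c1 / 8) (mu * nu / 2) / K.
have e00 : 0 < e0 by rewrite divr_gt0// lt_min !divr_gt0// mulr_gt0.
exists de, (ka * de), nu, mu, e0; split=> //.
- rewrite (ltW de0) de1 mulr_ge0 ?(ltW ka0) ?(ltW de0)//=; apply: mulr_ile1 => //; exact: ltW.
- by rewrite nu_0 nu1; split=> //; rewrite ge_min lexx.
move=> e be al o p /andP[ee ee0] be0 al0 o0 p0.
have Ke : K * e <= Num.min (c1 / 8) (mu * nu / 2).
  by rewrite mulrC -ler_pdivlMr.
have Ke1 : K * e <= c1 / 8 by apply: le_trans Ke _; rewrite ge_min lexx.
have Ke2 : K * e <= mu * nu / 2 by apply: le_trans Ke _; rewrite ge_min lexx orbT.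
set S2 := e * (be + o + p) * (be + o + p).
pose N := be ^+ 2 + o ^+ 2 + p ^+ 2.
have N0 : 0 <= N by rewrite !addr_ge0 ?sqr_ge0.
have S3 : S2 <= 3 * (e * N).
  have -> : S2 = e * (be + o + p) ^+ 2 by rewrite /S2; ring.
  have -> : 3 * (e * N) = e * (3 * N) by ring.
  rewrite ler_wpM2l// /N; have := sqr_ge0 (be - o); have := sqr_ge0 (be - p).
  have := sqr_ge0 (o - p); rewrite !sqrrB; lra.
have S20 : 0 <= S2 by rewrite /S2 !mulr_ge0 ?addr_ge0.
have err : 1000 * (M ^+ 3 * S2) <= K * e * N.
  have -> : K * e * N = 1000 * (M ^+ 3 * (3 * (e * N))) by rewrite /K; ring.
  by apply: (ler_wpM2l (ler0n R 1000)); rewrite ler_wpM2l ?exprn_ge0 ?(ltW M0).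
have M3 : 1 <= M ^+ 3 by rewrite exprn_ege1.
have err2 : 2 * mu * (10 * (M ^+ 2 * S2)) <= K * e * N.
  have -> : 2 * mu * (10 * (M ^+ 2 * S2)) = 20 * (mu * M ^+ 2 * S2) by ring.
  rewrite muM; apply: le_trans err.
  have a1 : c1 / 24 * S2 <= 1 * S2 by rewrite ler_wpM2r//; lra.
  have a2 : 1 * S2 <= M ^+ 3 * S2 by rewrite ler_wpM2r.
  lra.
have KN : 2 * (K * e * N) <= c1 / 4 * (be ^+ 2 + o ^+ 2) + mu * nu * p ^+ 2.
  have b1 : K * e * (be ^+ 2 + o ^+ 2) <= c1 / 8 * (be ^+ 2 + o ^+ 2).
    by rewrite ler_wpM2r// addr_ge0 ?sqr_ge0.
  have b2 : K * e * p ^+ 2 <= mu * nu / 2 * p ^+ 2 by rewrite ler_wpM2r ?sqr_ge0.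
  rewrite /N; lra.
(* Young inequalities for the mixed terms *)
have y1 : de * (M * o * be) <= de * (j / 8 * o ^+ 2 + 2 * M ^+ 2 / j * be ^+ 2).
  rewrite ler_wpM2l ?(ltW de0)//.
  have -> : j / 8 * o ^+ 2 + 2 * M ^+ 2 / j * be ^+ 2 =
    M * o * be + 2 / j * (j / 4 * o - M * be) ^+ 2 by field; rewrite gt_eqF.
  by rewrite lerDl mulr_ge0 ?sqr_ge0// divr_ge0// ltW.
have y2 : de * (4 * M * al * be) <= de * (ka * al ^+ 2 + 4 * M ^+ 2 / ka * be ^+ 2).
  rewrite ler_wpM2l ?(ltW de0)//.
  have -> : ka * al ^+ 2 + 4 * M ^+ 2 / ka * be ^+ 2 =
    4 * M * al * be + ka^-1 * (ka * al - 2 * M * be) ^+ 2 by field; rewrite gt_eqF.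
  by rewrite lerDl mulr_ge0 ?sqr_ge0// invr_ge0 ltW.
have y3 : ka * de * (2 * be * al) <= de * (2 * M * (al * be)).
  have -> : ka * de * (2 * be * al) = ka * (2 * de * (al * be)) by ring.
  have -> : de * (2 * M * (al * be)) = M * (2 * de * (al * be)) by ring.
  by rewrite ler_wpM2r ?(le_trans ka1)// !mulr_ge0// ltW.
have y4 : de * G * be ^+ 2 <= 1 * be ^+ 2 by rewrite ler_wpM2r ?sqr_ge0.
have y5 : ka * de * (M ^+ 2 * o ^+ 2) <= de * (j / 8 * o ^+ 2).
  have -> : ka * de * (M ^+ 2 * o ^+ 2) = de * (ka * M ^+ 2 * o ^+ 2) by ring.
  by rewrite ler_wpM2l ?(ltW de0)// ler_wpM2r ?sqr_ge0.
have y6 : nu * (o * p) <= c1 / 4 * o ^+ 2 + mu * nu * p ^+ 2.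
  have t1 : nu * (o * p) <= c1 / 4 * o ^+ 2 + nu * (nu / c1) * p ^+ 2.
    have -> : c1 / 4 * o ^+ 2 + nu * (nu / c1) * p ^+ 2 =
      nu * (o * p) + c1^-1 * (c1 / 2 * o - nu * p) ^+ 2 by field; rewrite gt_eqF.
    by rewrite lerDl mulr_ge0 ?sqr_ge0// invr_ge0 ltW.
  apply: le_trans t1 _; rewrite lerD2l ler_wpM2r ?sqr_ge0// mulrC ler_wpM2r ?(ltW nu_0)//.
  by rewrite ler_pdivrMr.
have z1 : c1 * be ^+ 2 <= 1 * be ^+ 2 by rewrite ler_wpM2r ?sqr_ge0.
have z2 : c1 * o ^+ 2 <= de * j / 4 * o ^+ 2 by rewrite ler_wpM2r ?sqr_ge0.
have z3 : c1 * al ^+ 2 <= ka * de * al ^+ 2 by rewrite ler_wpM2r ?sqr_ge0.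
have w1 : 2 * mu * (3 * M ^+ 2 * (be ^+ 2 + o ^+ 2 + al ^+ 2)) = c1 / 4 * (be ^+ 2 + o ^+ 2 + al ^+ 2).
  have -> : 2 * mu * (3 * M ^+ 2 * (be ^+ 2 + o ^+ 2 + al ^+ 2)) =
    6 * (mu * M ^+ 2) * (be ^+ 2 + o ^+ 2 + al ^+ 2) by ring.
  by rewrite muM; field.
have al20 := mulr_ge0 (ltW c10) (sqr_ge0 al).
have be20 := mulr_ge0 (ltW c10) (sqr_ge0 be).
have o20 := mulr_ge0 (ltW c10) (sqr_ge0 o).
have eG : de * G * be ^+ 2 = de * (2 * M * be ^+ 2) + de * (2 * M ^+ 2 / j * be ^+ 2)
  + de * (4 * M ^+ 2 / ka * be ^+ 2) by rewrite /G; ring.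
have eL : 2 * mu * (3 * M ^+ 2 * (be ^+ 2 + o ^+ 2 + al ^+ 2) + 10 * (M ^+ 2 * S2) - nu * p ^+ 2) =
  2 * mu * (3 * M ^+ 2 * (be ^+ 2 + o ^+ 2 + al ^+ 2)) + 2 * mu * (10 * (M ^+ 2 * S2))
   - 2 * (mu * nu * p ^+ 2) by ring.
have eR : 4 * be ^+ 2 + de * (2^-1 * j * o ^+ 2 - 2 * M * (be + al) * be - M * o * be) +
   ka * de * (2 * al ^+ 2 - 2 * be * al - M ^+ 2 * o ^+ 2) - nu * (o * p) - 1000 * (M ^+ 3 * S2) =
  4 * be ^+ 2 + 2 * (de * j / 4 * o ^+ 2) - de * (2 * M * be ^+ 2) - de * (2 * M * (al * be))
   - de * (M * o * be) + 2 * (ka * de * al ^+ 2) - ka * de * (2 * be * al)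
   - ka * de * (M ^+ 2 * o ^+ 2) - nu * (o * p) - 1000 * (M ^+ 3 * S2) by field.
rewrite eL eR w1.
have y2' : 2 * (de * (2 * M * (al * be))) <= ka * de * al ^+ 2 + de * (4 * M ^+ 2 / ka * be ^+ 2).
  by apply: le_trans (le_trans _ y2) _; rewrite le_eqVlt; apply/orP; left; apply/eqP; ring.
have y1' : de * (M * o * be) <= 2^-1 * (de * j / 4 * o ^+ 2) + de * (2 * M ^+ 2 / j * be ^+ 2).
  by apply: le_trans y1 _; rewrite le_eqVlt; apply/orP; left; apply/eqP; field; rewrite gt_eqF.
have y5' : ka * de * (M ^+ 2 * o ^+ 2) <= 2^-1 * (de * j / 4 * o ^+ 2).
  by apply: le_trans y5 _; rewrite le_eqVlt; apply/orP; left; apply/eqP; field.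
move: y1' y2' y3 y4 y5' y6 z1 z2 z3 err err2 KN al20 be20 o20; rewrite eG /N.
move: (de * (M * o * be)) (de * (2 * M ^+ 2 / j * be ^+ 2)) => x1 x2.
move: (de * (2 * M * (al * be))) (de * (4 * M ^+ 2 / ka * be ^+ 2)) => x3 x4.
move: (ka * de * (2 * be * al)) (de * (2 * M * be ^+ 2)) => x5 x6.
move: (ka * de * (M ^+ 2 * o ^+ 2)) (de * j / 4 * o ^+ 2) (ka * de * al ^+ 2) => x7 x8 x9.
move: (1000 * (M ^+ 3 * S2)) (2 * mu * (10 * (M ^+ 2 * S2))) (nu * (o * p)) => x10 x11 x12.
move: (mu * nu * p ^+ 2) (be ^+ 2) (o ^+ 2) (al ^+ 2) => x13 b2 o2 a2.
lra.
Qed.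

(** In the direction of u, the kernel of A, the shifted form A - lam takes the value
    -lam. Differences along the great circle from X to u are nearly in this direction. *)
Lemma escape_direction (A : 'M[R]_(1 + 3)) (u X : quat R) (lam d : R) : A^T = A ->
  dotv u u = 1 -> A *m u = 0 -> 0 < lam -> dotv X X = 1 -> 0 < d ->
  enorm (A *m X - lam *: X) <= lam / 8 ->
  exists X2 : quat R, [/\ dotv X2 X2 = 1, `|X2 - X| < d &
    let z := X - X2 in
    2 * dotv z (A *m z - lam *: z) + lam / 2 * dotv z z < 0].
Proof.
move=> sA u1 Au l0 X1 d0 hX.
pose c := dotv u X; set Y := A *m X - lam *: X in hX.
have enX : enorm X = 1 by rewrite /enorm X1 sqrtr1.
have enu : enorm u = 1 by rewrite /enorm u1 sqrtr1.
have uY : dotv u Y = - lam * c.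
  by rewrite dotvBr dotvZr dotv_mulr sA Au dotv0l -/c; ring.
have hc : `|c| <= 8^-1.
  have : `|dotv u Y| <= 1 * (lam / 8) by apply: dotv_le; rewrite ?enu.
  by rewrite uY normrM normrN (gtr0_norm l0) mul1r ler_pM2l.
have hXY : `|dotv X Y| <= lam / 8.
  by have := dotv_le (lexx (enorm X)) hX; rewrite enX mul1r.
have c2 : c ^+ 2 <= 64^-1.
  have -> : 64^-1 = 8^-1 ^+ 2 :> R by field.
  by rewrite -(real_normK (num_real c)) ler_sqr ?nnegrE ?invr_ge0.
pose g := u - c *: X.
have gX : dotv X g = 0 by rewrite dotvBr dotvZr X1 [dotv X u]dotvC -/c; ring.
have gg : dotv g g = 1 - c ^+ 2.
  by rewrite /g !(dotvBl, dotvBr, dotvZl, dotvZr) u1 X1 [dotv X u]dotvC -/c; ring.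
have g0 : g != 0 by rewrite -dotv_gt0 gg; lra.
pose n := enorm g; have n0 : 0 < n by rewrite lt_def enorm_ge0 enorm_eq0 g0.
have n2 : n ^+ 2 = 1 - c ^+ 2 by rewrite enorm_sqr.
pose f := n^-1 *: g.
have f1 : dotv f f = 1 by exact: normalize_unit.
have fX : dotv X f = 0 by rewrite dotvZr gX mulr0.
pose s := Num.min 8^-1 (d / 8).
have s0 : 0 < s by rewrite lt_min invr_gt0 ltr0n divr_gt0.
have s8 : s <= 8^-1 by rewrite ge_min lexx.
have sd : s <= d / 8 by rewrite ge_min lexx orbT.
have s01 : 0 <= s <= 1 by rewrite (ltW s0)/=; lra.
exists (circle X f s); split; first exact: circle_unit.
  by apply: le_lt_trans (circle_near X1 f1 s01) _; lra.
set k := 2 * s / (1 + s ^+ 2).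
have den : 0 < 1 + s ^+ 2 by rewrite ltr_pwDl// sqr_ge0.
have k0 : 0 < k by rewrite divr_gt0// mulr_gt0.
have -> : X - circle X f s = (- k) *: (f - s *: X).
  rewrite /circle -/k; apply/matrixP => i j; rewrite !mxE /k; field.
  by rewrite !gt_eqF.
set v := f - s *: X.
move=> z; rewrite {}/z.
have -> : A *m (- k *: v) - lam *: (- k *: v) = - k *: (A *m v - lam *: v).
  rewrite -scalemxAr; move: (A *m v) => a1; set a2 := v; clearbody a2.
  by apply/matrixP => i m; rewrite !mxE; ring.
rewrite !(dotvZl, dotvZr).
have fY : dotv f Y = n^-1 * (- lam * c - c * dotv X Y) by rewrite dotvZl dotvBl dotvZl uY.
have AlX : A *m v - lam *: v = (A *m f - lam *: f) - s *: Y.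
  rewrite /v /Y (mulmxBr A f (s *: X)) -(scalemxAr s A X).
  move: (A *m f) (A *m X) => a1 a2; set a3 := f; clearbody a3.
  by apply/matrixP => i j; rewrite !mxE; ring.
have XAf : dotv X (A *m f - lam *: f) = dotv f Y.
  by rewrite dotvBr dotvZr dotv_mulr sA [dotv (A *m X) f]dotvC dotvBr dotvZr [dotv f X]dotvC.
have Alf : A *m f - lam *: f = n^-1 *: (- lam *: u - c *: Y).
  rewrite /f /Y -scalemxAr mulmxBr Au -scalemxAr; apply/matrixP => i j.
  by move: (A *m X) => a1; rewrite !mxE; ring.
have ff : dotv f (A *m f - lam *: f) = (n ^+ 2)^-1 * (- lam * (1 - 2 * c ^+ 2) + c ^+ 2 * dotv X Y).
  rewrite Alf dotvZr dotvBr !dotvZr fY /f dotvZl dotvBl u1 dotvZl [dotv X u]dotvC -/c.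
  by field; rewrite gt_eqF.
have bil (a b p y : quat R) : dotv (a - s *: b) (p - s *: y) =
    dotv a p - s * dotv a y - s * dotv b p + s ^+ 2 * dotv b y.
  by rewrite !(dotvBl, dotvBr, dotvZl, dotvZr); ring.
have qf : dotv v (A *m v - lam *: v) = dotv f (A *m f - lam *: f) - 2 * s * dotv f Y + s ^+ 2 * dotv X Y.
  by rewrite AlX /v bil XAf; ring.
have vv : dotv v v = 1 + s ^+ 2.
  by rewrite /v bil f1 X1 [dotv f X]dotvC fX; ring.
have hf : dotv f (A *m f - lam *: f) <= - (9 / 10 * lam).
  rewrite ff n2 mulrC ler_pdivrMr; last by lra.
  have t1 : c ^+ 2 * dotv X Y <= 64^-1 * (lam / 8).
    apply: le_trans (ler_norm _) _; rewrite normrM (ger0_norm (sqr_ge0 c)).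
    by apply: ler_pM; rewrite ?sqr_ge0.
  have t2 : lam * c ^+ 2 <= lam * 64^-1 by rewrite ler_wpM2l// ltW.
  have t3 : 0 <= lam * c ^+ 2 by rewrite mulr_ge0 ?sqr_ge0// ltW.
  lra.
have hfY : `|dotv f Y| <= lam / 8.
  by have := dotv_le (lexx (enorm f)) hX; rewrite [enorm f](_ : _ = 1) ?mul1r// /enorm f1 sqrtr1.
have t4 : `|2 * s * dotv f Y| <= 2 * 8^-1 * (lam / 8).
  by rewrite normrM ger0_norm ?mulr_ge0 ?(ltW s0)//; apply: ler_pM; rewrite ?mulr_ge0 ?(ltW s0) ?ler_wpM2l.
have s2 : s ^+ 2 <= 64^-1.
  have -> : 64^-1 = 8^-1 ^+ 2 :> R by field.
  by rewrite ler_sqr ?nnegrE ?invr_ge0// ltW.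
have t5 : `|s ^+ 2 * dotv X Y| <= 64^-1 * (lam / 8).
  by rewrite normrM (ger0_norm (sqr_ge0 s)); apply: ler_pM; rewrite ?sqr_ge0.
have t6 : lam * s ^+ 2 <= lam * 64^-1 by rewrite ler_wpM2l// ltW.
have hv : 2 * dotv v (A *m v - lam *: v) + lam / 2 * dotv v v < 0.
  rewrite qf vv; move: t4 t5; rewrite !ler_norml => /andP[t4 _] /andP[_ t5]; lra.
have -> : 2 * (- k * (- k * dotv v (A *m v - lam *: v))) + lam / 2 * (- k * (- k * dotv v v)) =
  k ^+ 2 * (2 * dotv v (A *m v - lam *: v) + lam / 2 * dotv v v) by ring.
by rewrite pmulr_rlt0// exprn_gt0.
Qed.

End ConeParameters.


(** * No open set of motions stays near the other rest points *)

Section OrbitPair.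
Variables (R : realType) (J Wg Wr : 'M[R]_3).
Hypotheses (J_spd : sym_posdef J) (Wg_spd : sym_posdef Wg) (Wr_spd : sym_posdef Wr).
Notation E := 'cV[R]_(1 + 3 + (1 + 3) + 3).
Notation orbit := (orbit J Wg Wr).
Notation forward := (forward J Wg Wr).
Variables (lg lr : R).

Definition shiftmx (A : 'M[R]_(1 + 3)) (a : R) : 'M[R]_(1 + 3) := A - a%:M.
Notation Bl := (shiftmx (Bq Wg) lg).
Notation Al := (shiftmx (Bq Wr) lr).
#[local] Opaque Lq Nq rotmx crossmx.

Lemma shiftmx_mul A a (P : quat R) : shiftmx A a *m P = A *m P - a *: P.
Proof. by rewrite /shiftmx mulmxBl mul_scalar_mx. Qed.

Lemma shiftmx_tr A a : A^T = A -> (shiftmx A a)^T = shiftmx A a.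
Proof. by move=> sA; rewrite /shiftmx raddfB/= sA tr_scalar_mx. Qed.

Lemma NqT_shift (T : quat R) : (Nq T)^T *m (Bl *m T) = Gg Wg T.
Proof. by rewrite shiftmx_mul mulmxBr -scalemxAr NqTQ scaler0 subr0. Qed.

Lemma LqT_shift (Q : quat R) : (Lq Q)^T *m (Al *m Q) = Gr Wr Q.
Proof. by rewrite shiftmx_mul mulmxBr -scalemxAr LqTQ scaler0 subr0. Qed.

Lemma vT_shift T Q w : vT Wg T Q w = cT Bl T Q w.
Proof. by rewrite /vT /cT NqT_shift. Qed.

Lemma vw_shift T Q w : J *m vw J Wg Wr T Q w = ctau J Bl Al T Q w.
Proof. by rewrite (mulJ_vw _ _ J_spd) /ctau NqT_shift LqT_shift. Qed.

Definition momentum (Q : quat R) (w : 'cV[R]_3) : 'cV[R]_3 := (Nq Q)^T *m (Lq Q *m (J *m w)).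

Lemma momentumE Q w : unit_quat Q -> momentum Q w = cPi J Q w.
Proof. by move=> uQ; rewrite /cPi rot_NLv. Qed.

(** In inertial coordinates the momentum changes only by the torques; the gyroscopic
    term is due to the rotating coordinates. *)
Lemma der_momentum (x : R -> E) t : orbit x t ->
  is_derive t 1 (fun u => momentum (xQ (x u)) (xw (x u))) (cforce Bl Al (xT (x t)) (xQ (x t))).
Proof.
move=> [[uT uQ] dx]; have dQ := der_xQ dx; have dw := der_xw dx.
have := der_mulmx (der_trmx (der_Nq dQ)) (der_mulmx (der_Lq dQ) (der_mulmxl J dw)).
apply: der_eq; rewrite /field !xE; set T := xT _ in uT *; set Q := xQ _ in uQ *; set w := xw _.
rewrite vw_shift /vQ mulmxDr addrA rot_kinematics.
set g := crossmx w *m (J *m w).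
have -> : ctau J Bl Al T Q w = - g + (- (2 *: ((rotmx Q)^T *m Gg Wg T)) - 2 *: Gr Wr Q).
  by rewrite /ctau NqT_shift LqT_shift addrA.
rewrite (mulmxDr (Lq Q) (- g)) (mulmxDr (Nq Q)^T (Lq Q *m (- g))) addrA.
rewrite [Lq Q *m (- g)]mulmxN [_ *m (- (Lq Q *m g))]mulmxN subrr add0r.
rewrite -(rot_NLv _ uQ) mulmxBr mulmxN -!scalemxAr (mulmxA (rotmx Q)) (rot_multr uQ) mul1mx.
rewrite /Gr (mulmxA (rotmx Q)) (rot_LqT uQ) /cforce NqT_shift shiftmx_mul mulmxBr.
by rewrite -scalemxAr NqTQ scaler0 subr0.
Qed.

Variables (delta eps nu : R).

(** Minus the energy of the difference of two motions, with the shifted potentials,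
    which decreases only through the error; the terms with delta and eps make the
    derivative positive in the directions that the dissipation does not see, in the
    manner of a Lyapunov function with cross terms. The last term takes care of the
    directions along a continuum of rest points. *)
Definition cone (x y : E) : R :=
  let D := xT x - xT y in let q := xQ x - xQ y in let om := xw x - xw y in
  - (2^-1 * dotv om (J *m om) + 2 * dotv q (Al *m q) + 2 * dotv D (Bl *m D))
  + delta * dotv (momentum (xQ x) (xw x) - momentum (xQ y) (xw y)) ((Nq (xT x))^T *m D)
  - eps * dotv (J *m om) ((Lq (xQ x))^T *m (Al *m q)) - nu * dotv q q.

Lemma der_cone (x y : R -> E) t : orbit x t -> orbit y t ->
  let T := xT (x t) in let T2 := xT (y t) in let Q := xQ (x t) in let Q2 := xQ (y t) in
  let w := xw (x t) in let w2 := xw (y t) in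
  let D := T - T2 in let q := Q - Q2 in let om := w - w2 in
  let dT := cT Bl T Q w - cT Bl T2 Q2 w2 in let dQ := cQ Q w - cQ Q2 w2 in
  let dW := ctau J Bl Al T Q w - ctau J Bl Al T2 Q2 w2 in
  is_derive t 1 (fun u => cone (x u) (y u))
   (- (dotv om dW + 4 * dotv dQ (Al *m q) + 4 * dotv dT (Bl *m D))
    + delta * (dotv (cforce Bl Al T Q - cforce Bl Al T2 Q2) ((Nq T)^T *m D)
        + dotv (cPi J Q w - cPi J Q2 w2) ((Nq (cT Bl T Q w))^T *m D + (Nq T)^T *m dT))
    - eps * (dotv dW ((Lq Q)^T *m (Al *m q))
        + dotv (J *m om) ((Lq (cQ Q w))^T *m (Al *m q) + (Lq Q)^T *m (Al *m dQ)))
    - nu * (2 * dotv dQ q)).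
Proof.
move=> ox oy T T2 Q Q2 w w2 D q om dT dQ dW.
have [[uT uQ] dx] := ox; have [[uT2 uQ2] dy] := oy.
have hT1 : is_derive t 1 (fun u => xT (x u)) (cT Bl T Q w).
  by apply: der_eq (der_xT dx); rewrite /field xE vT_shift.
have hD : is_derive t 1 (fun u => xT (x u) - xT (y u)) dT.
  by apply: derB hT1 _; apply: der_eq (der_xT dy); rewrite /field xE vT_shift.
have hQ1 : is_derive t 1 (fun u => xQ (x u)) (cQ Q w).
  by apply: der_eq (der_xQ dx); rewrite /field xE.
have hq : is_derive t 1 (fun u => xQ (x u) - xQ (y u)) dQ.
  by apply: derB hQ1 _; apply: der_eq (der_xQ dy); rewrite /field xE.
pose dom := vw J Wg Wr T Q w - vw J Wg Wr T2 Q2 w2.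
have hom : is_derive t 1 (fun u => xw (x u) - xw (y u)) dom.
  by apply: derB; [apply: der_eq (der_xw dx)|apply: der_eq (der_xw dy)]; rewrite /field xE.
have Jdom : J *m dom = dW by rewrite /dom mulmxBr !vw_shift.
have hP := derB (der_momentum ox) (der_momentum oy).
have hN := der_mulmx (der_trmx (der_Nq hT1)) hD.
have hL := der_mulmx (der_trmx (der_Lq hQ1)) (der_mulmxl Al hq).
have hJ := der_mulmxl J hom.
have sB := shiftmx_tr lg (Bq_tr (proj1 Wg_spd)); have sA := shiftmx_tr lr (Bq_tr (proj1 Wr_spd)).
have kin := der_quadform (proj1 J_spd) hom.
have pq := der_quadform sA hq; have pD := der_quadform sB hD.
have := derB (derB (derD (derN (derD (derD (derZ 2^-1 kin) (derZ 2 pq)) (derZ 2 pD)))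
  (derZ delta (der_dotv hP hN))) (derZ eps (der_dotv hJ hL))) (derZ nu (der_dotv hq hq)).
apply: der_eq; rewrite Jdom -/T -/T2 -/Q -/Q2 -/w -/w2 -/D -/q -/om.
rewrite !momentumE//.
have -> : dotv dom (J *m om) = dotv om dW.
  by rewrite dotv_mulr (proj1 J_spd) Jdom dotvC.
rewrite [dotv q dQ]dotvC /GRing.scale/=.
have -> : 2^-1 * (2 * dotv om dW) = dotv om dW by field.
ring.
Qed.

End OrbitPair.

Section ConePersistence.
Variables (R : realType) (J Wg Wr : 'M[R]_3).
Hypotheses (J_spd : sym_posdef J) (Wg_spd : sym_posdef Wg) (Wr_spd : sym_posdef Wr).
Variables (ug : 'I_(1 + 3) -> quat R) (bg : 'I_(1 + 3) -> R).
Variables (ur : 'I_(1 + 3) -> quat R) (br : 'I_(1 + 3) -> R).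
Hypotheses (og : orthonormal ug) (eg : forall i, Bq Wg *m ug i = bg i *: ug i).
Hypotheses (or : orthonormal ur) (er : forall i, Bq Wr *m ur i = br i *: ur i).
Variables (k m : 'I_(1 + 3)).
Hypothesis simple : forall i, bg i = bg k -> i = k.
Notation E := 'cV[R]_(1 + 3 + (1 + 3) + 3).
Notation orbit := (orbit J Wg Wr).
Notation forward := (forward J Wg Wr).
Notation Bl := (shiftmx (Bq Wg) (bg k)).
Notation Al := (shiftmx (Bq Wr) (br m)).

(** If br m is a repeated eigenvalue, this is a neighbourhood of a continuum of rest
    points. *)
Definition near_rest (s : bool) (e : R) (x : E) : Prop :=
  [/\ enorm (Bl *m xT x) <= e, enorm (Al *m xQ x) <= e, enorm (xw x) <= e &
      enorm (xT x - (-1) ^+ s *: ug k) <= e].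

(** Two unit vectors close to each other differ by a nearly tangential vector: their
    difference is orthogonal to their sum, which is close to twice the eigenvector. *)
Lemma simple_difference : exists2 M : R, 1 <= M & forall s e (x y : E), e <= 2^-1 ->
  xunit x -> xunit y -> near_rest s e x -> near_rest s e y ->
  enorm (xT x - xT y) <= M * enorm (Bl *m (xT x - xT y)).
Proof.
have [b b0 hb] := shift_simple_le (Bq_tr (proj1 Wg_spd)) og eg simple.
exists (1 + 2 / b); first by rewrite lerDl divr_ge0// ltW.
move=> s e x y e2 [/unit_quatE uTx _] [/unit_quatE uTy _] [_ _ _ hx] [_ _ _ hy].
set T := xT x in uTx hx *; set T2 := xT y in uTy hy *; set D := T - T2.
set sg : R := (-1) ^+ s in hx hy.
have ss : sg * sg = 1 by rewrite /sg -signr_addb addbb.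
have e0 : 0 <= e by apply: le_trans (enorm_ge0 _) hx.
have orth : dotv (T + T2) D = 0.
  by rewrite /D !(dotvDl, dotvBr) uTx uTy [dotv T2 T]dotvC; ring.
have ud : `|dotv (ug k) D| <= e * enorm D.
  have -> : dotv (ug k) D = - (sg / 2 * dotv (T - sg *: ug k + (T2 - sg *: ug k)) D).
    have -> : T - sg *: ug k + (T2 - sg *: ug k) = T + T2 - (2 * sg) *: ug k.
      by apply/matrixP => i j; rewrite !mxE; ring.
    rewrite dotvBl orth dotvZl.
    have -> : - (sg / 2 * (0 - 2 * sg * dotv (ug k) D)) = sg * sg * dotv (ug k) D by field.
    by rewrite ss mul1r.
  rewrite normrN normrM normrM normfV normr_nat.
  have -> : `|sg| = 1 by rewrite /sg normr_sign.
  have := dotv_le (enorm_addle hx hy) (lexx (enorm D)); lra.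
have u2 : dotv (ug k) D ^+ 2 <= 4^-1 * dotv D D.
  rewrite -enorm_sqr -(real_normK (num_real (dotv _ _))).
  have -> : 4^-1 * enorm D ^+ 2 = (2^-1 * enorm D) ^+ 2 by field.
  rewrite ler_sqr ?nnegrE ?mulr_ge0 ?invr_ge0 ?enorm_ge0//.
  by apply: le_trans ud _; rewrite ler_wpM2r ?enorm_ge0.
have := hb D; rewrite -shiftmx_mul -!enorm_sqr => h.
have h2 : 2^-1 * b * enorm D ^+ 2 <= enorm (Bl *m D) ^+ 2.
  apply: le_trans h; have := u2; rewrite -enorm_sqr => u3.
  have : b * (2^-1 * enorm D ^+ 2) <= b * (enorm D ^+ 2 - dotv (ug k) D ^+ 2).
    rewrite ler_wpM2l ?(ltW b0)//; have := sqr_ge0 (enorm D); lra.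
  lra.
rewrite -ler_sqr ?nnegrE ?mulr_ge0 ?enorm_ge0 ?addr_ge0 ?divr_ge0 ?(ltW b0)//.
rewrite exprMn; apply: le_trans (_ : 2 / b * enorm (Bl *m D) ^+ 2 <= _).
  rewrite mulrAC ler_pdivlMr//; lra.
rewrite ler_wpM2r ?sqr_ge0//; have : 0 <= 2 / b by rewrite divr_ge0// ltW.
have := sqr_ge0 (2 / b); nra.
Qed.

(** The form H of the two motions satisfies H' >= 2 mu H and is bounded, hence H <= 0
    from the start. For equal angular velocities and equal error or attitude, the
    cross terms vanish in H(0). *)
Lemma persistent_pair (nu0 : R) : 0 < nu0 -> exists2 e0 : R, 0 < e0 &
  forall s x y, forward x -> forward y -> (forall t, 0 <= t -> near_rest s e0 (x t)) ->
    (forall t, 0 <= t -> near_rest s e0 (y t)) -> xw (x 0) = xw (y 0) ->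
    (xT (x 0) = xT (y 0) \/ xQ (x 0) = xQ (y 0)) ->
    let q := xQ (x 0) - xQ (y 0) in let D := xT (x 0) - xT (y 0) in
    0 <= 2 * dotv q (Al *m q) + 2 * dotv D (Bl *m D) + nu0 * dotv q q.
Proof.
move=> nu00.
have [M1 M11 hM1] := simple_difference.
have [M2 M20 hM2] := mulmx_bound J; have [M3 M30 hM3] := mulmx_bound Al.
have [M4 M40 hM4] := shift_quadform_le (Bq_tr (proj1 Wr_spd)) or er (br m).
have [M5 M50 hM5] := shift_quadform_le (Bq_tr (proj1 Wg_spd)) og eg (bg k).
pose M := M1 + M2 + M3 + M4 + M5.
have M1M : M1 <= M by rewrite /M; lra.
have M2M : M2 <= M by rewrite /M; lra.
have M3M : M3 <= M by rewrite /M; lra.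
have M4M : M4 <= M by rewrite /M; lra.
have M5M : M5 <= M by rewrite /M; lra.
have M_1 : 1 <= M by apply: le_trans M1M.
have M0 : 0 <= M by apply: le_trans M_1.
have [j j0 hj] := posdef_coercive J_spd.
have [de [ep [nu [mu [e1 [/andP[de01 ep01] [/andP[nu_0 nu1] nunu0] mu0 e10 hpar]]]]]] :=
  cone_parameters M_1 j0 nu00.
have nu01 : 0 <= nu <= 1 by rewrite (ltW nu_0).
pose e0 := Num.min 2^-1 e1.
have e00 : 0 < e0 by rewrite lt_min invr_gt0 ltr0n.
have e02 : e0 <= 2^-1 by rewrite ge_min lexx.
have e0_1 : e0 <= 1 by lra.
have e0e1 : e0 <= e1 by rewrite ge_min lexx orbT.
exists e0 => // s x y fx fy nx ny ew eTQ.
pose q0 := xQ (x 0) - xQ (y 0); pose D0 := xT (x 0) - xT (y 0).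
suff : 0 <= 2 * dotv q0 (Al *m q0) + 2 * dotv D0 (Bl *m D0) + nu0 * dotv q0 q0 by [].
pose H t := cone J Wg Wr (bg k) (br m) de ep nu (x t) (y t).
have JM z : enorm (J *m z) <= M * enorm z.
  by apply: le_trans (hM2 z) _; rewrite ler_wpM2r ?enorm_ge0.
have AM z : enorm (Al *m z) <= M * enorm z.
  by apply: le_trans (hM3 z) _; rewrite ler_wpM2r ?enorm_ge0.
have sB := shiftmx_tr (bg k) (Bq_tr (proj1 Wg_spd)); have sA := shiftmx_tr (br m) (Bq_tr (proj1 Wr_spd)).
have AqM q : `|dotv q (Al *m q)| <= M * dotv (Al *m q) (Al *m q).
  by rewrite shiftmx_mul; apply: le_trans (hM4 q) _; rewrite ler_wpM2r ?dotv_ge0.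
have BDM D : `|dotv D (Bl *m D)| <= M * dotv (Bl *m D) (Bl *m D).
  by rewrite shiftmx_mul; apply: le_trans (hM5 D) _; rewrite ler_wpM2r ?dotv_ge0.
have DM t : 0 <= t -> enorm (xT (x t) - xT (y t)) <= M * enorm (Bl *m (xT (x t) - xT (y t))).
  move=> t0; have [ux _] := fx t t0; have [uy _] := fy t t0.
  apply: le_trans (hM1 s e0 _ _ e02 ux uy (nx t t0) (ny t t0)) _.
  by rewrite ler_wpM2r ?enorm_ge0.
pose up t := 3 * M ^+ 2 * (enorm (Bl *m (xT (x t) - xT (y t))) ^+ 2 +
    enorm (xw (x t) - xw (y t)) ^+ 2 + enorm (Al *m (xQ (x t) - xQ (y t))) ^+ 2) +
  10 * (M ^+ 2 * (e0 * (enorm (Bl *m (xT (x t) - xT (y t))) + enorm (xw (x t) - xw (y t))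
     + enorm (xQ (x t) - xQ (y t))) * (enorm (Bl *m (xT (x t) - xT (y t))) +
     enorm (xw (x t) - xw (y t)) + enorm (xQ (x t) - xQ (y t))))) -
  nu * enorm (xQ (x t) - xQ (y t)) ^+ 2.
have Hup t : 0 <= t -> H t <= up t.
  move=> t0; have [[uT uQ] _] := fx t t0; have [[uT2 uQ2] _] := fy t t0.
  have [_ _ _ _] := nx t t0; have [_ _ hw2 _] := ny t t0.
  rewrite /H /cone !momentumE//.
  exact: (cone_upper _ uT uQ uQ2 (ltW e00) M_1 JM hw2 (DM t t0) (AqM _) (BDM _) (ltW j0) hj de01 ep01 nu01).
have grow (t : R) : 0 <= t -> exists2 dH : R, is_derive t 1 H dH & 2 * mu * H t <= dH.
  move=> t0; have ox := fx t t0; have oy := fy t t0.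
  have [[uT uQ] _] := ox; have [[uT2 uQ2] _] := oy.
  have [hT hQ hw _] := nx t t0; have [hT2 hQ2 hw2 _] := ny t t0.
  have := der_cone J_spd Wg_spd Wr_spd (bg k) (br m) de ep nu ox oy; move=> /= dH.
  eexists; first exact: dH.
  apply: le_trans (cone_derivative uT uT2 uQ uQ2 (ltW e00) e0_1 M_1 sB sA JM AM hT hT2 hQ hQ2 hw hw2
    (DM t t0) hj de01 ep01 nu01).
  have := hpar e0 (enorm (Bl *m (xT (x t) - xT (y t)))) (enorm (Al *m (xQ (x t) - xQ (y t))))
    (enorm (xw (x t) - xw (y t))) (enorm (xQ (x t) - xQ (y t))).
  rewrite (ltW e00) e0e1 !enorm_ge0 => /(_ isT isT isT isT isT); apply: le_trans.
  by rewrite ler_wpM2l ?mulr_ge0 ?(ltW mu0)//; exact: Hup.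
(* a positive value would grow beyond the bound C by the time C / (2 mu H 0) *)
have H0 : H 0 <= 0.
  rewrite leNgt; apply/negP => Hpos.
  have [C hC] : exists C, forall t, 0 <= t -> H t <= C.
    exists (3 * M ^+ 2 * (2 ^+ 2 + 2 ^+ 2 + 2 ^+ 2) + 10 * (M ^+ 2 * (1 * (2 + 2 + 2) * (2 + 2 + 2)))) => t t0.
    apply: le_trans (Hup t t0) _.
    have [hT hQ hw _] := nx t t0; have [hT2 hQ2 hw2 _] := ny t t0.
    have [[uT uQ] _] := fx t t0; have [[uT2 uQ2] _] := fy t t0.
    have two n (a b : 'cV[R]_n) : enorm a <= e0 -> enorm b <= e0 -> enorm (a - b) <= 2.
      by move=> ha hb; apply: le_trans (ler_enormB a b) _; lra.
    have b1 : enorm (Bl *m (xT (x t) - xT (y t))) <= 2 by rewrite mulmxBr; exact: two.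
    have b2 : enorm (Al *m (xQ (x t) - xQ (y t))) <= 2 by rewrite mulmxBr; exact: two.
    have b3 : enorm (xw (x t) - xw (y t)) <= 2 by exact: two.
    have b4 : enorm (xQ (x t) - xQ (y t)) <= 2.
      by apply: le_trans (ler_enormB _ _) _; rewrite !enorm_unit.
    rewrite /up; apply: le_trans (_ : 3 * M ^+ 2 * (2 ^+ 2 + 2 ^+ 2 + 2 ^+ 2) +
      10 * (M ^+ 2 * (1 * (2 + 2 + 2) * (2 + 2 + 2))) - 0 <= _); last by rewrite subr0.
    apply: lerB; last by rewrite mulr_ge0 ?sqr_ge0// ltW.
    apply: lerD.
      rewrite ler_wpM2l ?mulr_ge0 ?sqr_ge0//.
      by rewrite !lerD// ler_sqr ?nnegrE ?enorm_ge0.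
    rewrite ler_wpM2l// ler_wpM2l ?sqr_ge0//.
    by apply: ler_pM; rewrite ?mulr_ge0 ?addr_ge0 ?enorm_ge0 ?(ltW e00)// ?lerD//;
      apply: ler_pM; rewrite ?addr_ge0 ?enorm_ge0 ?(ltW e00)// ?lerD.
  have C0 : 0 < C by apply: lt_le_trans Hpos (hC 0 (lexx 0)).
  pose t := C / (H 0 * (2 * mu)).
  have t0 : 0 <= t by rewrite divr_ge0 ?mulr_ge0 ?(ltW C0) ?(ltW Hpos) ?(ltW mu0).
  have [dH hdH] : exists dH : R -> R, forall u : R, 0 <= u -> is_derive u 1 H (dH u) /\ 2 * mu * H u <= dH u.
    have /choice[dH hdH] : forall u : R, exists d : R, 0 <= u -> is_derive u 1 H d /\ 2 * mu * H u <= d.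
      move=> u; have [u0|u0] := leP 0 u; last by exists 0.
      by have [d d1 d2] := grow u u0; exists d.
    by exists dH.
  have := @exp_growth_lower R H dH (2 * mu) 0 t t0
    (fun u ut => proj1 (hdH u (proj1 (andP ut)))) (fun u ut => proj2 (hdH u (proj1 (andP ut)))).
  rewrite subr0; apply/negP; rewrite -ltNge; apply: le_lt_trans (hC t t0) _.
  have h1 := expR_ge1Dx (2 * mu * t).
  have h2 : H 0 * (1 + 2 * mu * t) <= H 0 * expR (2 * mu * t) by rewrite ler_wpM2l// ltW.
  apply: lt_le_trans h2.
  have -> : H 0 * (1 + 2 * mu * t) = H 0 + C.
    by rewrite /t; field; rewrite !gt_eqF.
  by rewrite ltrDr.
move: H0; rewrite /H /cone ew subrr mulmx0 !dotv0l !mulr0 add0r subr0 -/q0 -/D0.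
have -> : dotv (momentum J (xQ (x 0)) (xw (y 0)) - momentum J (xQ (y 0)) (xw (y 0)))
    ((Nq (xT (x 0)))^T *m D0) = 0.
  by have [e|e] := eTQ; [rewrite /D0 e subrr mulmx0 dotv0r|rewrite e subrr dotv0l].
have : nu * dotv q0 q0 <= nu0 * dotv q0 q0 by rewrite ler_wpM2r ?dotv_ge0.
rewrite mulr0 addr0; lra.
Qed.

Lemma near_rest_le s (e e' : R) x : e <= e' -> near_rest s e x -> near_rest s e' x.
Proof. by move=> ee [h1 h2 h3 h4]; split; apply: le_trans ee. Qed.

Lemma Bq_one (W : 'M[R]_3) : Bq W *m (mkquat 1 0 : quat R) = 0.
Proof. by rewrite Bq_mul qvec_mk mulmx0 /mkquat raddf0 col_mx0. Qed.

Lemma dotv_one : dotv (mkquat 1 0 : quat R) (mkquat 1 0) = 1.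
Proof. by rewrite dotv_quat qscal_mk qvec_mk dotv0l addr0 mulr1. Qed.

(** Compare a motion with the one obtained by moving its attitude, or else its error,
    a little towards the pole, which lowers the shifted potential: this pair violates
    the inequality for persistent pairs. *)
Theorem no_persistent_near : 0 < br m \/ 0 < bg k -> exists2 e0 : R, 0 < e0 &
  forall s y (d : R), xunit y -> 0 < d ->
  ~ (forall x, forward x -> `|x 0 - y| < d -> forall t, 0 <= t -> near_rest s e0 (x t)).
Proof.
have near0 (y y2 : E) : `|y2 - y| <= Num.max `|xT y2 - xT y| (Num.max `|xQ y2 - xQ y| `|xw y2 - xw y|).
  rewrite -{1}[y2]mkx_eta -{1}[y]mkx_eta mkxB; apply: mkx_norm_le.
  - by rewrite le_max normr_ge0.
  - by rewrite le_max lexx.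
  - by rewrite !le_max lexx !orbT.
  - by rewrite !le_max lexx !orbT.
have max3 (a d : R) : 0 < d -> a < d -> Num.max 0 (Num.max a 0) < d /\ Num.max a (Num.max 0 0) < d.
  by move=> d0 ad; rewrite !gt_max ad d0.
case=> [l0|l0].
- have n0 : 0 < br m / 2 by rewrite divr_gt0.
  have [e1 e10 he] := persistent_pair n0.
  pose e0 := Num.min e1 (br m / 8).
  exists e0 => [|s y d uy d0 hP]; first by rewrite lt_min e10 divr_gt0.
  have e01 : e0 <= e1 by rewrite ge_min lexx.
  have [x x0 fx] := forward_exists J_spd Wg_spd Wr_spd uy.
  have nx t : 0 <= t -> near_rest s e0 (x t).
    by move=> t0; apply: hP => //; rewrite x0 subrr normr0.
  have [uT uQ] := uy; have X1 := proj1 (unit_quatE _) uQ.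
  have hX : enorm (Bq Wr *m xQ y - br m *: xQ y) <= br m / 8.
    have [_ h _ _] := nx 0 (lexx 0); rewrite x0 shiftmx_mul in h.
    by apply: le_trans h _; rewrite ge_min lexx orbT.
  have [X2 [X21 X2d neg]] := escape_direction (Bq_tr (proj1 Wr_spd)) dotv_one (Bq_one Wr) l0 X1 d0 hX.
  pose y2 := mkx (xT y) X2 (xw y).
  have uy2 : xunit y2 by rewrite /xunit !xE; split=> //; exact/unit_quatE.
  have [z z0 fz] := forward_exists J_spd Wg_spd Wr_spd uy2.
  have nz t : 0 <= t -> near_rest s e0 (z t).
    move=> t0; apply: hP => //; rewrite z0; apply: le_lt_trans (near0 _ _) _.
    by rewrite !xE !subrr !normr0; have [] := max3 _ _ d0 X2d.
  have := he s x z fx fz (fun t t0 => near_rest_le e01 (nx t t0)) (fun t t0 => near_rest_le e01 (nz t t0)).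
  rewrite x0 z0 !xE => /(_ erefl (or_introl erefl)); cbv zeta.
  rewrite (subrr (xT y)) dotv0l mulr0 addr0 shiftmx_mul.
  by rewrite leNgt neg.
- have n0 : 0 < bg k / 2 by rewrite divr_gt0.
  have [e1 e10 he] := persistent_pair n0.
  pose e0 := Num.min e1 (bg k / 8).
  exists e0 => [|s y d uy d0 hP]; first by rewrite lt_min e10 divr_gt0.
  have e01 : e0 <= e1 by rewrite ge_min lexx.
  have [x x0 fx] := forward_exists J_spd Wg_spd Wr_spd uy.
  have nx t : 0 <= t -> near_rest s e0 (x t).
    by move=> t0; apply: hP => //; rewrite x0 subrr normr0.
  have [uT uQ] := uy; have X1 := proj1 (unit_quatE _) uT.
  have hX : enorm (Bq Wg *m xT y - bg k *: xT y) <= bg k / 8.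
    have [h _ _ _] := nx 0 (lexx 0); rewrite x0 shiftmx_mul in h.
    by apply: le_trans h _; rewrite ge_min lexx orbT.
  have [X2 [X21 X2d neg]] := escape_direction (Bq_tr (proj1 Wg_spd)) dotv_one (Bq_one Wg) l0 X1 d0 hX.
  pose y2 := mkx X2 (xQ y) (xw y).
  have uy2 : xunit y2 by rewrite /xunit !xE; split=> //; exact/unit_quatE.
  have [z z0 fz] := forward_exists J_spd Wg_spd Wr_spd uy2.
  have nz t : 0 <= t -> near_rest s e0 (z t).
    move=> t0; apply: hP => //; rewrite z0; apply: le_lt_trans (near0 _ _) _.
    by rewrite !xE !subrr !normr0; have [] := max3 _ _ d0 X2d.
  have := he s x z fx fz (fun t t0 => near_rest_le e01 (nx t t0)) (fun t t0 => near_rest_le e01 (nz t t0)).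
  rewrite x0 z0 !xE => /(_ erefl (or_intror erefl)); cbv zeta.
  rewrite (subrr (xQ y)) !dotv0l !mulr0 addr0 add0r shiftmx_mul.
  have := neg; set D := xT y - X2; have : 0 <= bg k / 2 * dotv D D.
    by rewrite mulr_ge0 ?dotv_ge0 ?(ltW n0).
  by move=> /=; lra.
Qed.

End ConePersistence.


(** * Attraction and stability of the origin *)

Section LocalStability.
Variables (R : realType) (n : nat) (r : 'I_n -> 'cV[R]_3) (J : 'M[R]_3).
Hypotheses (r_noncollinear : exists i j : 'I_n, ~ collinear (r i) (r j))
  (J_spd : sym_posdef J).
Variables (gamma rho : 'I_n -> R).
Hypotheses (gamma_pos : forall i, 0 < gamma i) (rho_pos : forall i, 0 < rho i).
Notation Wg := (Wmx r gamma).
Notation Wr := (Wmx r rho).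
Notation E := 'cV[R]_(1 + 3 + (1 + 3) + 3).
Notation orbit := (orbit J Wg Wr).
Notation forward := (forward J Wg Wr).
Notation en := (en J Wg Wr).
Let Wg_spd : sym_posdef Wg := Wmx_posdef r_noncollinear gamma_pos.
Let Wr_spd : sym_posdef Wr := Wmx_posdef r_noncollinear rho_pos.

Definition chix (x : E) : 'cV[R]_(3 + 3 + 3) := col_mx (col_mx (qvec (xT x)) (qvec (xQ x))) (xw x).

Lemma dotv_col_mx m1 m2 (a c : 'cV[R]_m1) (b d : 'cV[R]_m2) :
  dotv (col_mx a b) (col_mx c d) = dotv a c + dotv b d.
Proof. by rewrite /dotv tr_col_mx mul_row_col mxE. Qed.

Lemma dotv_chix x : dotv (chix x) (chix x) =
  dotv (qvec (xT x)) (qvec (xT x)) + dotv (qvec (xQ x)) (qvec (xQ x)) + dotv (xw x) (xw x).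
Proof. by rewrite /chix !dotv_col_mx. Qed.

Lemma energy_chix x : en x = dotv (chix x) (Pmx J Wg Wr *m chix x).
Proof.
rewrite /en /energy !Bq_form /Pmx /chix !mul_block_col !mul0mx !addr0 !add0r.
by rewrite !dotv_col_mx -!scalemxAl !dotvZr.
Qed.

Lemma qvec_le1 (Q : quat R) : unit_quat Q -> dotv (qvec Q) (qvec Q) <= 1.
Proof. by move=> /unit_quatE; rewrite dotv_quat -expr2 => <-; rewrite lerDr sqr_ge0. Qed.

(** W q small forces q small; on the unit ball a fourth power suffices. *)
Lemma posdef_image_small (W : 'M[R]_3) : sym_posdef W -> exists2 c : R, 0 < c &
  forall Q : quat R, unit_quat Q ->
  dotv (qvec Q) (qvec Q) ^+ 2 <= c * dotv (Bq W *m Q) (Bq W *m Q).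
Proof.
move=> W_spd; have [j j0 hj] := posdef_coercive W_spd; exists (j ^+ 2)^-1.
  by rewrite invr_gt0 exprn_gt0.
move=> Q uQ; rewrite Bq_mul dotv_quat !qE mul0r add0r; set q := qvec Q.
rewrite mulrC ler_pdivlMr ?exprn_gt0// mulrC -exprMn.
apply: le_trans (_ : dotv q (W *m q) ^+ 2 <= _).
  by rewrite ler_sqr ?nnegrE ?mulr_ge0 ?dotv_ge0 ?(ltW j0)// (le_trans _ (hj q))// mulr_ge0 ?dotv_ge0 ?(ltW j0).
apply: le_trans (dotv_CS _ _) _; rewrite -[leRHS]mul1r ler_wpM2r ?dotv_ge0//; exact: qvec_le1.
Qed.

Definition good (y : E) : Prop := forall x, forward x -> x 0 = y ->
  tends (fun t => dotv (chix (x t)) (chix (x t))) 0.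

Lemma vector_part_tends0 (W : 'M[R]_3) (P : R -> quat R) : sym_posdef W ->
  (forall t, 0 <= t -> unit_quat (P t)) ->
  tends (fun t => dotv (Bq W *m P t) (Bq W *m P t)) 0 ->
  tends (fun t => dotv (qvec (P t)) (qvec (P t))) 0.
Proof.
move=> W_spd uP hP; have [c c0 hc] := posdef_image_small W_spd.
apply/tends_sqr0; have := tends_scale c hP; rewrite mulr0 => h; apply: tends_le h _ => t t0.
by rewrite ger0_norm ?sqr_ge0// hc//; exact: uP.
Qed.

(** The eigenvalue 0 is attained at the poles only. *)
Lemma rest_limit (x : R -> E) : forward x -> tends (fun t => gshift Wg 0 (x t)) 0 ->
  tends (fun t => dotv (xw (x t)) (xw (x t))) 0 -> tends (fun t => qshift Wr 0 (x t)) 0 ->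
  tends (fun t => dotv (chix (x t)) (chix (x t))) 0.
Proof.
move=> fx hT hw hQ.
have aT : tends (fun t => dotv (qvec (xT (x t))) (qvec (xT (x t)))) 0.
  apply: (vector_part_tends0 Wg_spd); first by move=> t t0; have [[]] := fx t t0.
  by apply: tends_ext hT => t _; rewrite /gshift scale0r subr0.
have aQ : tends (fun t => dotv (qvec (xQ (x t))) (qvec (xQ (x t)))) 0.
  apply: (vector_part_tends0 Wr_spd); first by move=> t t0; have [[]] := fx t t0.
  by apply: tends_ext hQ => t _; rewrite /qshift scale0r subr0.
have := tends_add (tends_add aT aQ) hw; rewrite !addr0; apply: tends_ext => t _.
by rewrite dotv_chix.
Qed.

Lemma shift_value (A : 'M[R]_(1 + 3)) (P : quat R) (a : R) : dotv P P = 1 ->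
  (dotv P (A *m P) - a) ^+ 2 <= dotv (A *m P - a *: P) (A *m P - a *: P).
Proof.
move=> P1; have -> : dotv P (A *m P) - a = dotv P (A *m P - a *: P).
  by rewrite dotvBr dotvZr P1 mulr1.
by apply: le_trans (dotv_CS _ _) _; rewrite P1 mul1r.
Qed.

Lemma small_shift_bound (A : 'M[R]_(1 + 3)) (P : R -> quat R) (a c : R) :
  (forall t, 0 <= t -> dotv (P t) (P t) = 1) ->
  tends (fun t => dotv (A *m P t - a *: P t) (A *m P t - a *: P t)) 0 ->
  (forall t, 0 <= t -> dotv (P t) (A *m P t) <= c) -> a <= c.
Proof.
move=> uP h hc; rewrite leNgt; apply/negP => ca.
have e0 : 0 < (a - c) ^+ 2 by rewrite exprn_gt0// subr_gt0.
have [T T0 hT] := h _ e0; have := hT T (lexx T); rewrite subr0 => h1.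
have := le_lt_trans (le_trans (shift_value A a (uP T T0)) (ler_norm _)) h1.
have := hc T T0 => h2; rewrite -[X in X < _]sqrrN opprB => h3.
by move: h3; rewrite ltNge ler_sqr ?nnegrE ?subr_ge0 ?(ltW ca) ?(le_trans h2 (ltW ca))// lerD2l lerN2 h2.
Qed.

Lemma spectrum_lambda_min (g : 'I_n -> R) u b i : (forall i, 0 < g i) ->
  quat_spectrum r g u b -> i != ord0 -> lambda_min (Wmx r g) <= b i.
Proof.
move=> g_pos hs i0; have [ou eu _ _ hv _ _] := hs.
have s0 := hv i i0.
apply: (lambda_min_le r_noncollinear g_pos (x := qvec (u i))).
  rewrite -dotv_gt0; have := ou i i; rewrite eqxx dotv_quat s0 mul0r add0r => ->.
  exact: ltr01.
by have := eu i; rewrite Bq_mul => /(congr1 (@qvec R)); rewrite !qE.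
Qed.

(** In the limit the error is in an eigenspace of B and the attitude in one of A. A
    positive eigenvalue would contribute more potential energy than there is, being at
    least the smallest eigenvalue of W; so both eigenvalues are 0, and 0 is simple. *)
Lemma low_energy_good y : xunit y -> en y < 2 * Num.min (lambda_min Wg) (lambda_min Wr) -> good y.
Proof.
move=> uy; rewrite mulrC -ltr_pdivrMr// lt_min => /andP[eg er] x fx x0.
have [ug [bg hsg]] := quat_spectrum_exists r_noncollinear gamma_pos.
have [ur [br hsr]] := quat_spectrum_exists r_noncollinear rho_pos.
have [og eig _ b0 _ bpos _] := hsg; have [or eir _ c0 _ cpos _] := hsr.
have en_le t : 0 <= t -> en (x t) <= en y.
  move=> t0; rewrite -x0.
  by apply: (orbit_energy_nincr J_spd Wg_spd Wr_spd t0) => u /andP[u0 _]; exact: fx.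
have parts z : dotv (xT z) (Bq Wg *m xT z) <= en z / 2 /\ dotv (xQ z) (Bq Wr *m xQ z) <= en z / 2.
  rewrite /en /energy !Bq_form.
  have := posdef_ge0 (qvec (xT z)) Wg_spd; have := posdef_ge0 (qvec (xQ z)) Wr_spd.
  have := posdef_ge0 (xw z) J_spd; split; lra.
have [k hk] := error_eigenspace_limit J_spd Wg_spd Wr_spd og eig fx.
have k0 : k = ord0.
  apply/eqP/negPn/negP => k0; have h1 := spectrum_lambda_min gamma_pos hsg k0.
  have : bg k <= en y / 2.
    apply: (small_shift_bound (A := Bq Wg) (P := fun t => xT (x t))) => //.
      by move=> t t0; have [[/unit_quatE]] := fx t t0.
    by move=> t t0; apply: le_trans (proj1 (parts _)) _; rewrite ler_wpM2r ?invr_ge0// en_le.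
  by rewrite leNgt (lt_le_trans eg h1).
have simple i : bg i = bg k -> i = k.
  by rewrite k0 b0 => bi; apply/eqP/negPn/negP => /bpos; rewrite bi ltxx.
have [_ hw [m hm]] := simple_limit J_spd Wg_spd Wr_spd og eig or eir fx simple hk.
have m0 : m = ord0.
  apply/eqP/negPn/negP => m0; have h1 := spectrum_lambda_min rho_pos hsr m0.
  have : br m <= en y / 2.
    apply: (small_shift_bound (A := Bq Wr) (P := fun t => xQ (x t))) => //.
      by move=> t t0; have [[_ /unit_quatE]] := fx t t0.
    by move=> t t0; apply: le_trans (proj2 (parts _)) _; rewrite ler_wpM2r ?invr_ge0// en_le.
  by rewrite leNgt (lt_le_trans er h1).
by move: hk hm; rewrite k0 m0 b0 c0 => hk hm; exact: rest_limit.
Qed.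

(** The matrix P is positive definite. *)
Lemma energy_equivalent : exists a b : R, [/\ 0 < a, 0 < b & forall x,
  a * dotv (chix x) (chix x) <= en x <= b * dotv (chix x) (chix x)].
Proof.
have [jg jg0 hg] := posdef_coercive Wg_spd; have [jr jr0 hr] := posdef_coercive Wr_spd.
have [jj jj0 hj] := posdef_coercive J_spd.
have up (W : 'M[R]_3) : exists2 K : R, 0 <= K & forall z, dotv z (W *m z) <= K * dotv z z.
  have [K K0 hK] := mulmx_bound W; exists K => // z.
  apply: le_trans (ler_norm _) _; apply: le_trans (dotv_le (lexx _) (hK z)) _.
  by rewrite -enorm_sqr expr2 mulrCA.
have [Kg Kg0 ug] := up Wg; have [Kr Kr0 ur] := up Wr; have [Kj Kj0 uj] := up J.
pose a := Num.min (2 * jg) (Num.min (2 * jr) (2^-1 * jj)).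
exists a, (2 * Kg + 2 * Kr + 2^-1 * Kj + 1); split.
- by rewrite !lt_min !mulr_gt0 ?invr_gt0.
- by rewrite ltr_wpDl// !addr_ge0 ?mulr_ge0 ?invr_ge0.
move=> x; rewrite dotv_chix /en /energy !Bq_form.
set q1 := qvec (xT x); set q2 := qvec (xQ x); set w := xw x.
have d1 := dotv_ge0 q1; have d2 := dotv_ge0 q2; have d3 := dotv_ge0 w.
apply/andP; split.
  have a1 : a * dotv q1 q1 <= 2 * jg * dotv q1 q1 by rewrite ler_wpM2r// ge_min lexx.
  have a2 : a * dotv q2 q2 <= 2 * jr * dotv q2 q2 by rewrite ler_wpM2r// !ge_min lexx orbT.
  have a3 : a * dotv w w <= 2^-1 * jj * dotv w w by rewrite ler_wpM2r// !ge_min lexx !orbT.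
  have := hg q1; have := hr q2; have := hj w; lra.
have := ug q1; have := ur q2; have := uj w.
have p1 := mulr_ge0 Kg0 d1; have p2 := mulr_ge0 Kg0 d2; have p3 := mulr_ge0 Kg0 d3.
have p4 := mulr_ge0 Kr0 d1; have p5 := mulr_ge0 Kr0 d2; have p6 := mulr_ge0 Kr0 d3.
have p7 := mulr_ge0 Kj0 d1; have p8 := mulr_ge0 Kj0 d2; have p9 := mulr_ge0 Kj0 d3.
lra.
Qed.

Lemma chix_near0_good : exists2 d : R, 0 < d & forall y, xunit y -> dotv (chix y) (chix y) < d -> good y.
Proof.
have [a [b [_ b0 hab]]] := energy_equivalent.
have l0 : 0 < Num.min (lambda_min Wg) (lambda_min Wr).
  by rewrite lt_min !(lambda_min_pos r_noncollinear).
exists (2 * Num.min (lambda_min Wg) (lambda_min Wr) / b); first by rewrite divr_gt0// mulr_gt0.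
move=> y uy; rewrite ltr_pdivlMr// mulrC => h; apply: low_energy_good => //.
by apply: le_lt_trans h; have /andP[] := hab y.
Qed.

(** Sublevel sets of the energy. *)
Lemma chix_stable (e : R) : 0 < e -> exists2 d : R, 0 < d & forall x, forward x ->
  dotv (chix (x 0)) (chix (x 0)) < d -> forall t, 0 <= t -> dotv (chix (x t)) (chix (x t)) < e.
Proof.
move=> e0; have [a [b [a0 b0 hab]]] := energy_equivalent.
exists (a * e / b); first by rewrite divr_gt0// mulr_gt0.
move=> x fx; rewrite ltr_pdivlMr// mulrC => h t t0.
rewrite -(ltr_pM2l a0); apply: le_lt_trans (proj1 (andP (hab (x t)))) _.
apply: le_lt_trans h; apply: le_trans (proj2 (andP (hab (x 0)))).
by apply: (orbit_energy_nincr J_spd Wg_spd Wr_spd t0) => u /andP[u0 _]; exact: fx.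
Qed.

End LocalStability.


(** * From vector parts to unit quaternions *)

Section Basin.
Variables (R : realType) (n : nat) (r : 'I_n -> 'cV[R]_3) (J : 'M[R]_3).
Hypotheses (r_noncollinear : exists i j : 'I_n, ~ collinear (r i) (r j))
  (J_spd : sym_posdef J).
Variables (gamma rho : 'I_n -> R).
Hypotheses (gamma_pos : forall i, 0 < gamma i) (rho_pos : forall i, 0 < rho i).
Notation Wg := (Wmx r gamma).
Notation Wr := (Wmx r rho).
Notation E := 'cV[R]_(1 + 3 + (1 + 3) + 3).
Notation X9 := 'cV[R]_(3 + 3 + 3).
Notation orbit := (orbit J Wg Wr).
Notation forward := (forward J Wg Wr).
Notation good := (good r J gamma rho).
Let Wg_spd : sym_posdef Wg := Wmx_posdef r_noncollinear gamma_pos.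
Let Wr_spd : sym_posdef Wr := Wmx_posdef r_noncollinear rho_pos.

Lemma tends_shift (f : R -> R) (l s : R) : 0 <= s -> tends (fun t => f (t + s)) l -> tends f l.
Proof.
move=> s0 h e e0; have [T T0 hT] := h e e0; exists (T + s); first by rewrite addr_ge0.
by move=> t; rewrite -lerBrDr => /hT; rewrite subrK.
Qed.

Lemma lip_chix : lipM (@chix R).
Proof.
apply: lipM_col_mx; first apply: lipM_col_mx.
- exact: lipM_qvec (@lip_xT R).
- exact: lipM_qvec (@lip_xQ R).
- exact: lip_xw.
Qed.

(** After some time the motion is in the region of low energy, which is open; by
    continuous dependence nearby motions reach it too. *)
Lemma good_open y : xunit y -> good y -> exists2 d : R, 0 < d &
  forall z, xunit z -> `|z - y| < d -> good z.
Proof.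
move=> uy gy; have [x x0 fx] := forward_exists J_spd Wg_spd Wr_spd uy.
have [d0 d00 hd0] := chix_near0_good r_noncollinear J_spd gamma_pos rho_pos.
have [t t0 ht] := gy x fx x0 d0 d00.
have := ht t (lexx t); rewrite subr0 ger0_norm ?dotv_ge0// => small.
have cont : continuous (fun z : E => dotv (chix z) (chix z)).
  by apply: lipB_continuous; apply: lipB_dotv; exact: lip_chix.
have gap : 0 < d0 - dotv (chix (x t)) (chix (x t)) by rewrite subr_gt0.
have [d1 d10 hd1] := continuous_distP (cont (x t)) gap.
have [d d_0 hd] := forward_close J_spd Wg_spd Wr_spd y t0 d10.
exists d => // z uz zy u fu u0.
have ut : `|u t - x t| < d1.
  apply: (hd x u) => //; rewrite ?u0 ?t0 ?lexx//.
  by move=> v /andP[v0 _]; split; [exact: fx|exact: fu].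
have gu : good (u t).
  apply: hd0; first by have [] := fu t t0.
  have := hd1 (u t); rewrite distrC => /(_ ut); rewrite distrC.
  have := ler_norm (dotv (chix (u t)) (chix (u t)) - dotv (chix (x t)) (chix (x t))); lra.
have := gu _ (forward_shift t0 fu); rewrite add0r => /(_ erefl) h.
exact: tends_shift t0 h.
Qed.

Definition vecT (x : X9) : 'cV[R]_3 := usubmx (usubmx x).
Definition vecQ (x : X9) : 'cV[R]_3 := dsubmx (usubmx x).
(** The unit quaternions over given vector parts, with chosen signs of the scalar
    parts. *)
Definition signed (s : bool * bool) (x : X9) : E :=
  mkx (mkquat ((-1) ^+ s.1 * Num.sqrt (1 - dotv (vecT x) (vecT x))) (vecT x))
      (mkquat ((-1) ^+ s.2 * Num.sqrt (1 - dotv (vecQ x) (vecQ x))) (vecQ x))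
      (dsubmx x).

Lemma chix_signed s x : chix (signed s x) = x.
Proof. by rewrite /chix /signed !xE !qvec_mk !vsubmxK. Qed.

Lemma signed_sqrt_sqr (s : bool) (a : R) : 0 <= a -> ((-1) ^+ s * Num.sqrt a) ^+ 2 = a.
Proof. by move=> a0; rewrite exprMn sqr_sqrtr// sqrr_sign mul1r. Qed.

Lemma signed_unit s x : Upsilon x -> xunit (signed s x).
Proof.
move=> [h1 h2]; rewrite /xunit /signed !xE; split; rewrite /unit_quat/= qscal_mk qvec_mk.
  by rewrite signed_sqrt_sqr ?subr_ge0// subrK.
by rewrite signed_sqrt_sqr ?subr_ge0// subrK.
Qed.

Lemma mkxD (T T' Q Q' : quat R) (w w' : 'cV[R]_3) :
  mkx T Q w + mkx T' Q' w' = mkx (T + T') (Q + Q') (w + w').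
Proof. by rewrite /mkx add_col_mx add_col_mx. Qed.

Lemma mkxZ (a : R) (T Q : quat R) (w : 'cV[R]_3) :
  a *: mkx T Q w = mkx (a *: T) (a *: Q) (a *: w).
Proof. by rewrite /mkx scale_col_mx scale_col_mx. Qed.

Lemma signed_continuous s : continuous (signed s).
Proof.
pose eT : E := mkx (mkquat 1 0) 0 0; pose eQ : E := mkx 0 (mkquat 1 0) 0.
pose L (x : X9) : E := mkx (mkquat 0 (vecT x)) (mkquat 0 (vecQ x)) (dsubmx x).
pose f (x : X9) : R := (-1) ^+ s.1 * Num.sqrt (1 - dotv (vecT x) (vecT x)).
pose g (x : X9) : R := (-1) ^+ s.2 * Num.sqrt (1 - dotv (vecQ x) (vecQ x)).
have mk (a : R) (v : 'cV[R]_3) : mkquat a v = mkquat 0 v + a *: mkquat 1 0.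
  by apply: quatP; rewrite !qE ?mulr1 ?add0r ?scaler0 ?addr0.
have -> : signed s = fun x => L x + f x *: eT + g x *: eQ.
  apply/funext => x; rewrite /signed -/(f x) -/(g x) (mk (f x)) (mk (g x)).
  by rewrite /L /eT /eQ !mkxZ !mkxD !scaler0 !addr0.
have lT : lipM vecT by apply: lipM_usub; apply: lipM_usub; exact: lipM_id.
have lQ : lipM vecQ by apply: lipM_dsub; apply: lipM_usub; exact: lipM_id.
have cL : continuous L.
  apply: lipM_continuous; apply: lipM_col_mx; first apply: lipM_col_mx.
  - by apply: lipM_mkquat => //; exact: lipB_cst.
  - by apply: lipM_mkquat => //; exact: lipB_cst.
  - by apply: lipM_dsub; exact: lipM_id.
have cs (b : bool) (G : X9 -> 'cV[R]_3) : lipM G ->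
    continuous (fun x => (-1) ^+ b * Num.sqrt (1 - dotv (G x) (G x)) : R).
  move=> lG x; apply: (@continuousM R _ (fun=> (-1) ^+ b) (fun x => Num.sqrt (1 - dotv (G x) (G x)))).
    by apply: lipB_continuous; exact: lipB_cst.
  apply: (continuous_comp (f := fun x => 1 - dotv (G x) (G x)) (g := Num.sqrt)).
    by apply: lipB_continuous; apply: lipB_sub; [exact: lipB_cst|exact: lipB_dotv].
  exact: sqrt_continuous.
move=> x; apply: (@continuousD _ _ _ (fun x => L x + f x *: eT) (fun x => g x *: eQ)).
  apply: (@continuousD _ _ _ L (fun x => f x *: eT)); first exact: cL.
  by apply: continuousZr_tmp; exact: (cs s.1 vecT).
by apply: continuousZr_tmp; exact: (cs s.2 vecQ).
Qed.

Lemma scalar_from_sign (s : bool) (c a : R) : 0 <= a -> c ^+ 2 = a -> 0 <= (-1) ^+ s * c ->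
  c = (-1) ^+ s * Num.sqrt a.
Proof.
move=> a0 ca sc; have -> : Num.sqrt a = (-1) ^+ s * c.
  apply/eqP; rewrite -(@eqrXn2 _ 2)// ?sqrtr_ge0// sqr_sqrtr//.
  by rewrite exprMn sqrr_sign mul1r ca.
by rewrite mulrA -signr_addb addbb mul1r.
Qed.

(** Where neither scalar part vanishes, the lifts are local homeomorphisms. *)
Definition inner (x : X9) : Prop := dotv (vecT x) (vecT x) < 1 /\ dotv (vecQ x) (vecQ x) < 1.

Lemma inner_Upsilon x : inner x -> Upsilon x.
Proof. by move=> [/ltW h1 /ltW h2]; split. Qed.

(** A scalar part close to a nonzero one has the same sign. *)
Lemma signed_surj_near s x : inner x -> exists2 d : R, 0 < d & forall y, xunit y ->
  `|y - signed s x| < d -> y = signed s (chix y).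
Proof.
move=> [i1 i2].
pose c1 := Num.sqrt (1 - dotv (vecT x) (vecT x)).
pose c2 := Num.sqrt (1 - dotv (vecQ x) (vecQ x)).
have c10 : 0 < c1 by rewrite sqrtr_gt0 subr_gt0.
have c20 : 0 < c2 by rewrite sqrtr_gt0 subr_gt0.
exists (Num.min c1 c2); first by rewrite lt_min c10.
have sgn (b : bool) (c : R) (P P0 : quat R) : unit_quat P -> qscal P0 = (-1) ^+ b * c ->
    `|P - P0| < c -> P = mkquat ((-1) ^+ b * Num.sqrt (1 - dotv (qvec P) (qvec P))) (qvec P).
  move=> uP p0 near; apply: quatP; rewrite !qE//; apply: scalar_from_sign.
  - by rewrite subr_ge0; exact: qvec_le1.
  - by move: uP => /= <-; rewrite addrK.
  have h : `|(-1) ^+ b * qscal P - c| < c.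
    have -> : (-1) ^+ b * qscal P - c = (-1) ^+ b * (qscal P - qscal P0).
      by rewrite p0 mulrBr mulrA -signr_addb addbb mul1r.
    rewrite normrM normr_sign mul1r; apply: le_lt_trans near.
    by have := mx_norm_ge (P - P0) (lshift 3 0) 0; rewrite /qscal !mxE.
  by move: h; rewrite ltr_norml => /andP[h _]; lra.
have hB y : y - signed s x = mkx (xT y - mkquat ((-1) ^+ s.1 * c1) (vecT x))
    (xQ y - mkquat ((-1) ^+ s.2 * c2) (vecQ x)) (xw y - dsubmx x).
  by rewrite -{1}[y]mkx_eta /signed mkxB.
move=> y [uT uQ]; rewrite lt_min hB => /andP[d1 d2].
have [n1 _ _] := mkx_norm_ge (xT y - mkquat ((-1) ^+ s.1 * c1) (vecT x))
  (xQ y - mkquat ((-1) ^+ s.2 * c2) (vecQ x)) (xw y - dsubmx x).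
have [_ n2 _] := mkx_norm_ge (xT y - mkquat ((-1) ^+ s.1 * c1) (vecT x))
  (xQ y - mkquat ((-1) ^+ s.2 * c2) (vecQ x)) (xw y - dsubmx x).
have e1 := sgn s.1 c1 _ _ uT (qscal_mk _ _) (le_lt_trans n1 d1).
have e2 := sgn s.2 c2 _ _ uQ (qscal_mk _ _) (le_lt_trans n2 d2).
rewrite /signed /vecT /vecQ /chix !col_mxKu !col_mxKd -[LHS]mkx_eta.
by rewrite -e1 -e2.
Qed.

Lemma chix_dist (x y : E) : `|chix x - chix y| <= `|x - y|.
Proof.
rewrite -{2}[x]mkx_eta -{2}[y]mkx_eta mkxB.
have [h1 h2 h3] := mkx_norm_ge (xT x - xT y) (xQ x - xQ y) (xw x - xw y).
rewrite /chix !opp_col_mx !add_col_mx; apply: mx_norm_le => // i j; rewrite (ord1 j).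
have qv (P P' : quat R) k : `|(qvec P - qvec P') k 0| <= `|P - P'|.
  by have := mx_norm_ge (P - P') (rshift 1 k) 0; rewrite /qvec !mxE.
case: (split_ordP i) => k ->; last first.
  by rewrite col_mxEd; apply: le_trans h3; exact: mx_norm_ge.
rewrite col_mxEu; case: (split_ordP k) => l ->.
  by rewrite col_mxEu; apply: le_trans h1; exact: qv.
by rewrite col_mxEd; apply: le_trans h2; exact: qv.
Qed.

End Basin.


(** * Density of the basin of the origin *)

Section Density.
Variables (R : realType) (n : nat) (r : 'I_n -> 'cV[R]_3) (J : 'M[R]_3).
Hypotheses (r_noncollinear : exists i j : 'I_n, ~ collinear (r i) (r j))
  (J_spd : sym_posdef J).
Variables (gamma rho : 'I_n -> R).
Hypotheses (gamma_pos : forall i, 0 < gamma i) (rho_pos : forall i, 0 < rho i).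
Notation Wg := (Wmx r gamma).
Notation Wr := (Wmx r rho).
Notation E := 'cV[R]_(1 + 3 + (1 + 3) + 3).
Notation X9 := 'cV[R]_(3 + 3 + 3).
Notation orbit := (orbit J Wg Wr).
Notation forward := (forward J Wg Wr).
Notation good := (good r J gamma rho).
Let Wg_spd : sym_posdef Wg := Wmx_posdef r_noncollinear gamma_pos.
Let Wr_spd : sym_posdef Wr := Wmx_posdef r_noncollinear rho_pos.
Notation index := ('I_(1 + 3) * 'I_(1 + 3) * bool)%type.

(** Closedness, in the form in which it is used. *)
Definition open_failure (P : E -> Prop) := forall x, ~ P x -> exists2 d : R, 0 < d &
  forall y, `|x - y| < d -> ~ P y.

Lemma open_failure_le (f : E -> R) (e : R) : continuous f -> open_failure (fun x => f x <= e).
Proof.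
move=> cf x /negP; rewrite -ltNge => fx; have gap : 0 < f x - e by rewrite subr_gt0.
have [d d0 hd] := continuous_distP (cf x) gap; exists d => // y /hd h; apply/negP.
by rewrite -ltNge; have := ler_norm (f x - f y); lra.
Qed.

Lemma open_failure_and (P Q : E -> Prop) : open_failure P -> open_failure Q ->
  open_failure (fun x => P x /\ Q x).
Proof.
move=> hP hQ x nPQ; have [px|/hP[d d0 hd]] := pselect (P x); last first.
  by exists d => // y /hd np [].
have [|d d0 hd] := hQ x; first by move=> qx; apply: nPQ.
by exists d => // y /hd nq [].
Qed.

Definition nonpersistent (P : E -> Prop) := forall y (d : R), xunit y -> 0 < d ->
  ~ (forall x, forward x -> `|x 0 - y| < d -> forall t, 0 <= t -> P (x t)).

Lemma eventually_le (f : R -> R) (e : R) : 0 < e -> tends f 0 ->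
  exists2 T, 0 <= T & forall t, T <= t -> f t <= e.
Proof.
move=> e0 h; have [T T0 hT] := h e e0; exists T => // t /hT; rewrite subr0 => /ltW.
by apply: le_trans; exact: ler_norm.
Qed.

Lemma eventually_enorm m (f : R -> 'cV[R]_m) (e : R) : 0 < e ->
  tends (fun t => dotv (f t) (f t)) 0 -> exists2 T, 0 <= T & forall t, T <= t -> enorm (f t) <= e.
Proof.
move=> e0 h; have e2 : 0 < e ^+ 2 by rewrite exprn_gt0.
have [T T0 hT] := eventually_le e2 h; exists T => // t /hT.
by rewrite -enorm_sqr ler_sqr ?nnegrE ?enorm_ge0 ?(ltW e0).
Qed.

(** A motion that does not converge to the origin eventually satisfies one of finitely
    many closed conditions, none of which persists on an open set: being near the
    eigenspace of a repeated eigenvalue, or near rest points with an isolated error.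
    There is one condition for each choice of eigenvalues and of the sign of the error
    quaternion. *)
Lemma bad_classes : exists P : index -> E -> Prop,
  [/\ forall i, open_failure (P i), forall i, nonpersistent (P i) &
  forall x, forward x -> ~ tends (fun t => dotv (chix (x t)) (chix (x t))) 0 ->
    exists i, exists2 T : R, 0 <= T & forall t, T <= t -> P i (x t)].
Proof.
have [ug [bg hsg]] := quat_spectrum_exists r_noncollinear gamma_pos.
have [ur [br hsr]] := quat_spectrum_exists r_noncollinear rho_pos.
have [og eig _ b0 _ bpos brep] := hsg; have [or eir _ c0 _ cpos _] := hsr.
have bge i : 0 <= bg i.
  by have [->|/bpos/ltW//] := eqVneq i ord0; rewrite b0.
have cge i : 0 <= br i.
  by have [->|/cpos/ltW//] := eqVneq i ord0; rewrite c0.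
(* the condition for the index i catches the motions whose error approaches the
   eigenspace of bg i.1.1; if it is a line, the limit of the error and the
   eigenspace of the attitude are known as well *)
pose caught (i : index) (Pi : E -> Prop) := forall x, forward x ->
  tends (fun t => gshift Wg (bg i.1.1) (x t)) 0 ->
  ((forall j, bg j = bg i.1.1 -> j = i.1.1) ->
    [/\ tends (fun t => dotv (xT (x t) - (-1) ^+ i.2 *: ug i.1.1) (xT (x t) - (-1) ^+ i.2 *: ug i.1.1)) 0,
        tends (fun t => dotv (xw (x t)) (xw (x t))) 0,
        tends (fun t => qshift Wr (br i.1.2) (x t)) 0 & ~ (bg i.1.1 = 0 /\ br i.1.2 = 0)]) ->
  exists2 T : R, 0 <= T & forall t, T <= t -> Pi (x t).
have cE m (A : 'M[R]_m) (G : E -> 'cV[R]_m) (v : 'cV[R]_m) : lipM G ->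
    continuous (fun x => enorm (A *m G x - v)).
  move=> lG x; apply: (continuous_comp (f := fun x => dotv (A *m G x - v) (A *m G x - v))
    (g := Num.sqrt)); last exact: sqrt_continuous.
  have lH : lipM (fun x => A *m G x - v).
    by apply: lipM_sub; [apply: lipM_mul => //|]; exact: lipM_cst.
  by apply: lipB_continuous; exact: lipB_dotv.
have /choice[P hP] : forall i, exists Pi, [/\ open_failure Pi, nonpersistent Pi & caught i Pi].
  move=> [[k m] s]; have [simple|rep] := pselect (forall j, bg j = bg k -> j = k); last first.
    have [j [jk jk']] : exists j, bg j = bg k /\ j != k.
      by apply: contrapT => h; apply: rep => j jk; apply/eqP/negPn/negP => jk'; apply: h; exists j.
    have ne : exists i j, bg i != bg j.
      by exists ord0, (lift ord0 ord0); rewrite b0 eq_sym gt_eqF ?bpos.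
    have lam : \sum_i bg i <= 4 * bg k by apply: (brep k j) => //; rewrite eq_sym.
    have [e0 e00 he] := no_persistent_repeated J_spd Wg_spd Wr_spd og eig ne lam.
    exists (fun x => gshift Wg (bg k) x <= e0); split.
    - apply: open_failure_le; apply: lipB_continuous.
      have lG : lipM (fun x : E => Bq Wg *m xT x - bg k *: xT x).
        apply: lipM_sub; first by apply: lipM_mul; [exact: lipM_cst|exact: lip_xT].
        by apply: lipM_scale; [exact: lipB_cst|exact: lip_xT].
      exact: lipB_dotv.
    - by move=> y d uy d0; exact: he.
    - by move=> x fx h _; exact: eventually_le h.
  have [pos|npos] := pselect (0 < br m \/ 0 < bg k); last first.
    exists (fun=> False); split.
    - by move=> x _; exists 1; [exact: ltr01|move=> y _ []].
    - move=> y d uy d0 h; have [x x0 fx] := forward_exists J_spd Wg_spd Wr_spd uy.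
      by apply: (h x fx _ 0 (lexx 0)); rewrite x0 subrr normr0.
    - move=> x fx _ /(_ simple)[_ _ _ []]; split; apply/eqP; rewrite eq_le.
        by rewrite bge andbT leNgt; apply/negP => h; apply: npos; right.
      by rewrite cge andbT leNgt; apply/negP => h; apply: npos; left.
  have [e0 e00 he] := no_persistent_near J_spd Wg_spd Wr_spd og eig or eir simple pos.
  exists (near_rest Wg Wr ug bg br k m s e0); split.
  - have f1 := open_failure_le (e := e0) (cE _ (shiftmx (Bq Wg) (bg k)) _ 0 (@lip_xT R)).
    have f2 := open_failure_le (e := e0) (cE _ (shiftmx (Bq Wr) (br m)) _ 0 (@lip_xQ R)).
    have f3 := open_failure_le (e := e0) (cE _ 1%:M _ 0 (@lip_xw R)).
    have f4 := open_failure_le (e := e0) (cE _ 1%:M _ ((-1) ^+ s *: ug k) (@lip_xT R)).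
    have := open_failure_and (open_failure_and f1 f2) (open_failure_and f3 f4).
    move=> h x nx; have [|d d0 hd] := h x.
      by move=> [[]]; rewrite !subr0 !mul1mx => h1 h2 [h3 h4]; apply: nx.
    exists d => // y /hd ny [h1 h2 h3 h4]; apply: ny.
    by rewrite !subr0 !mul1mx.
  - by move=> y d uy d0; exact: he.
  - move=> x fx h1 /(_ simple)[h4 h3 h2 _].
    have {}h1 : tends (fun t => dotv (shiftmx (Bq Wg) (bg k) *m xT (x t)) (shiftmx (Bq Wg) (bg k) *m xT (x t))) 0.
      by apply: tends_ext h1 => t _; rewrite shiftmx_mul.
    have {}h2 : tends (fun t => dotv (shiftmx (Bq Wr) (br m) *m xQ (x t)) (shiftmx (Bq Wr) (br m) *m xQ (x t))) 0.
      by apply: tends_ext h2 => t _; rewrite shiftmx_mul.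
    have [T1 T10 hT1] := eventually_enorm e00 h1; have [T2 T20 hT2] := eventually_enorm e00 h2.
    have [T3 T30 hT3] := eventually_enorm e00 h3; have [T4 T40 hT4] := eventually_enorm e00 h4.
    exists (Num.max (Num.max T1 T2) (Num.max T3 T4)) => [|t].
      by rewrite !le_max T10.
    by rewrite !ge_max => /andP[/andP[t1 t2] /andP[t3 t4]]; split; auto.
exists P; split; [by move=> i; have [] := hP i|by move=> i; have [] := hP i|].
move=> x fx nx; have [k hk] := error_eigenspace_limit J_spd Wg_spd Wr_spd og eig fx.
have [simple|nsimple] := pselect (forall j, bg j = bg k -> j = k); last first.
  have [_ _ hc] := hP (k, ord0, false); exists (k, ord0, false).
  by apply: hc => // simple; case: nsimple.
have [[s hs] hw [m hm]] := simple_limit J_spd Wg_spd Wr_spd og eig or eir fx simple hk.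
have [_ _ hc] := hP (k, m, s); exists (k, m, s); apply: hc => // _; split=> //= -[bk cm].
move: hk hm; rewrite bk cm => hk hm; apply: nx.
exact: (rest_limit r_noncollinear gamma_pos rho_pos fx hk hw hm).
Qed.

Lemma open_near (V : set X9) : open V -> forall x, V x -> exists2 d : R, 0 < d &
  forall y, `|y - x| < d -> V y.
Proof.
move=> oV x Vx; have /nbhs_normP[d d0 hd] := open_nbhs_nbhs (conj oV Vx).
by exists d => // y yx; apply: hd; rewrite /= distrC.
Qed.

Lemma near_open (V : set X9) : (forall x, V x -> exists2 d : R, 0 < d &
  forall y, `|y - x| < d -> V y) -> open V.
Proof.
move=> h; rewrite openE => x Vx; have [d d0 hd] := h x Vx; rewrite /interior.
apply/(@nbhs_normP _ X9 x V); exists d => // y /= yx; apply: hd; rewrite distrC; exact: yx.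
Qed.

Lemma forward_unique (x y : R -> E) : forward x -> forward y -> x 0 = y 0 ->
  forall t, 0 <= t -> x t = y t.
Proof.
move=> fx fy xy t t0; apply: (orbit_unique J_spd Wg_spd Wr_spd t0) xy => u /andP[u0 _].
by split; [exact: fx|exact: fy].
Qed.

Definition captured (s : bool * bool) (P : E -> Prop) (T : nat) : set X9 :=
  [set x | Upsilon x /\ forall u, forward u -> u 0 = signed s x ->
     forall t, T%:R <= t -> P (u t)].

Lemma Upsilon_open_failure (x : X9) : ~ Upsilon x -> exists2 d : R, 0 < d &
  forall y, `|y - x| < d -> ~ Upsilon y.
Proof.
have key (G : X9 -> 'cV[R]_3) : lipM G -> ~ (dotv (G x) (G x) <= 1) -> exists2 d : R, 0 < d &
    forall y, `|y - x| < d -> ~ (dotv (G y) (G y) <= 1).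
  move=> lG /negP; rewrite -ltNge => gx.
  have gap : 0 < dotv (G x) (G x) - 1 by rewrite subr_gt0.
  have cG : continuous (fun x => dotv (G x) (G x)) by apply: lipB_continuous; exact: lipB_dotv.
  have [d d0 hd] := continuous_distP (cG x) gap; exists d => // y; rewrite distrC => /hd h.
  apply/negP; rewrite -ltNge; have := ler_norm (dotv (G x) (G x) - dotv (G y) (G y)); lra.
have lT : lipM (@vecT R) by apply: lipM_usub; apply: lipM_usub; exact: lipM_id.
have lQ : lipM (@vecQ R) by apply: lipM_dsub; apply: lipM_usub; exact: lipM_id.
move=> nx; have [h1|h1] := pselect (dotv (vecT x) (vecT x) <= 1); last first.
  by have [d d0 hd] := key _ lT h1; exists d => // y /hd ny [].
have [|d d0 hd] := key _ lQ; first by move=> h2; apply: nx.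
by exists d => // y /hd ny [].
Qed.

Lemma captured_open (s : bool * bool) (P : E -> Prop) T : open_failure P ->
  open (~` captured s P T).
Proof.
move=> oP; apply: near_open => x nx; have [ux|/Upsilon_open_failure[d d0 hd]] := pselect (Upsilon x); last first.
  by exists d => // y /hd ny [].
have [u [fu [u0 [t [tT nP]]]]] : exists u, forward u /\ u 0 = signed s x /\ exists t, T%:R <= t /\ ~ P (u t).
  apply: contrapT => h; apply: nx; split=> // u fu u0 t tT; apply: contrapT => nP.
  by apply: h; exists u; split=> //; split=> //; exists t.
have t0 : 0 <= t by apply: le_trans tT.
have [d1 d10 hd1] := oP _ nP.
have [d2 d20 hd2] := forward_close J_spd Wg_spd Wr_spd (signed s x) t0 d10.
have [d d0 hd] := continuous_distP (@signed_continuous R s x) d20.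
exists d => // y yx [uy hy].
have [z z0 fz] := forward_exists J_spd Wg_spd Wr_spd (signed_unit s uy).
apply: (hd1 (z t)); last exact: hy fz z0 t tT.
rewrite distrC; apply: (hd2 u z) => //; rewrite ?t0 ?lexx//.
  by move=> v /andP[v0 _]; split; [exact: fu|exact: fz].
by rewrite z0 distrC; apply: hd; rewrite distrC.
Qed.

(** An open set has no point on a sphere: moving radially outwards would leave the
    ball. *)
Lemma open_inner (V : set X9) : open V -> V `<=` @Upsilon R -> forall x, V x -> inner x.
Proof.
move=> oV VU x Vx; have [d d0 hd] := open_near oV Vx.
pose e := d / (2 * (`|x| + 1)).
have n0 : 0 < `|x| + 1 by rewrite ltr_wpDl.
have e0 : 0 < e by rewrite divr_gt0// mulr_gt0.
have Vy : V ((1 + e) *: x).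
  apply: hd; rewrite scalerDl scale1r addrAC subrr add0r normrZ gtr0_norm//.
  rewrite /e mulrAC ltr_pdivrMr ?mulr_gt0//; have := normr_ge0 x; nra.
have key (v : 'cV[R]_3) : dotv v v <= 1 -> dotv ((1 + e) *: v) ((1 + e) *: v) <= 1 -> dotv v v < 1.
  move=> v1; rewrite dotvZl dotvZr => h; rewrite lt_neqAle v1 andbT; apply/eqP => e1.
  by move: h; rewrite e1 mulr1; nra.
have [a1 a2] := VU _ Vx; have [b1 b2] := VU _ Vy.
by split; apply: key => //; [move: b1|move: b2]; rewrite /unit_ball3/= !linearZ.
Qed.

(** An open set of captured points, lifted and moved by the flow for the time T, would
    be an open set of motions on which P persists. *)
Lemma captured_interior (s : bool * bool) (P : E -> Prop) T (V : set X9) : nonpersistent P ->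
  open V -> V `<=` captured s P T -> V = set0.
Proof.
move=> nP oV hV; rewrite -subset0 => x Vx.
have VU : V `<=` @Upsilon R by move=> y /hV[].
have ix := open_inner oV VU Vx; have [d1 d10 hd1] := open_near oV Vx.
have [d2 d20 hd2] := signed_surj_near s ix.
have u0 := signed_unit s (inner_Upsilon ix).
have d0 : 0 < Num.min d1 d2 by rewrite lt_min d10.
have T0 : (0 : R) <= T%:R by [].
have [|y [d [uy dd0 hy]]] := persistent_shift (P := P) J_spd Wg_spd Wr_spd T0 d0 u0.
  move=> u fu; rewrite lt_min => /andP[h1 h2] t tT.
  have uu : xunit (u 0) by have [] := fu 0 (lexx 0).
  have e0 := hd2 _ uu h2.
  have Vu : V (chix (u 0)).
    apply: hd1; apply: le_lt_trans h1; have := chix_dist (u 0) (signed s x).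
    by rewrite chix_signed.
  by have [_] := hV _ Vu; apply.
exact: nP uy dd0 hy.
Qed.

(** The Baire theorem: the points to avoid, for given signs, form a countable union of
    closed sets without interior, indexed by the condition and by an integer time. *)
Lemma good_dense s (V : set X9) : open V -> V !=set0 -> V `<=` @Upsilon R ->
  exists2 x, V x & good (signed s x).
Proof.
move=> oV V0 VU; have [P [oP nP cP]] := bad_classes.
pose F (i : nat) : set X9 := if unpickle i is Some (j, T) then ~` captured s (P j) T else setT.
have hF i : open (F i) /\ dense (F i).
  rewrite /F; case: (unpickle i : option (index * nat)) => [[j T]|]; last first.
    by split; [exact: openT|move=> O O0 _; rewrite setIT].
  split; first exact: captured_open.
  move=> O [x Ox] oO; apply: contrapT => h.
  have O0 : O = set0.
    apply: (captured_interior (s := s) (T := T) (nP j) oO) => y Oy; apply: contrapT => ny.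
    by apply: h; exists y.
  by rewrite O0 in Ox.
have [x [Vx Fx]] := Baire hF V0 oV.
exists x => // u fu u0; apply: contrapT => nu.
have [j [T T0 hT]] := cP u fu nu.
have [N hN] : exists N : nat, T <= N%:R.
  exists (Num.bound T); apply/ltW; apply: le_lt_trans (ler_norm _) _.
  by rewrite ger0_norm//; exact: archi_boundP.
have := Fx (pickle (j, N)) I; rewrite /F pickleK; apply; split; first exact: VU.
move=> z fz z0 t Nt; rewrite (forward_unique fz fu) ?z0 ?u0//; last by apply: le_trans Nt.
by apply: hT; apply: le_trans Nt.
Qed.

(** For a vector part of length less than 1 all four choices of signs are possible,
    and convergence is required for each. *)
Definition basin : set X9 := [set x | inner x /\ forall s, good (signed s x)].

Lemma inner_open : open (@inner R : set X9).
Proof.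
have key (G : X9 -> 'cV[R]_3) (x : X9) : lipM G -> dotv (G x) (G x) < 1 -> exists2 d : R, 0 < d &
    forall y, `|y - x| < d -> dotv (G y) (G y) < 1.
  move=> lG gx; have gap : 0 < 1 - dotv (G x) (G x) by rewrite subr_gt0.
  have cG : continuous (fun x => dotv (G x) (G x)) by apply: lipB_continuous; exact: lipB_dotv.
  have [d d0 hd] := continuous_distP (cG x) gap; exists d => // y; rewrite distrC => /hd h.
  have := ler_norm (dotv (G y) (G y) - dotv (G x) (G x)); rewrite distrC; lra.
have lT : lipM (@vecT R) by apply: lipM_usub; apply: lipM_usub; exact: lipM_id.
have lQ : lipM (@vecQ R) by apply: lipM_dsub; apply: lipM_usub; exact: lipM_id.
apply: near_open => x [h1 h2]; have [d1 d10 hd1] := key _ x lT h1.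
have [d2 d20 hd2] := key _ x lQ h2; exists (Num.min d1 d2); first by rewrite lt_min d10.
by move=> y; rewrite lt_min => /andP[/hd1 a1 /hd2 a2]; split.
Qed.

Lemma good_signed_open s : open [set x : X9 | inner x /\ good (signed s x)].
Proof.
apply: near_open => x [ix gx].
have [d1 d10 hd1] := good_open r_noncollinear J_spd gamma_pos rho_pos
  (signed_unit s (inner_Upsilon ix)) gx.
have [d2 d20 hd2] := continuous_distP (@signed_continuous R s x) d10.
have [d3 d30 hd3] := open_near inner_open ix.
exists (Num.min d2 d3) => [|y]; first by rewrite lt_min d20.
rewrite lt_min => /andP[h2 h3]; have iy := hd3 y h3; split=> //.
apply: hd1; first exact/signed_unit/inner_Upsilon.
by rewrite distrC; apply: hd2; rewrite distrC.
Qed.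

(** The good set of each choice of signs is open and dense in the interior, so the
    four of them have a dense intersection. *)
Lemma basin_near x (d : R) : inner x -> 0 < d -> exists y, [/\ basin y & `|y - x| < d].
Proof.
move=> ix d0.
have [y [[iy yd] gy]] : exists y, (inner y /\ `|y - x| < d) /\
    {in enum {: bool * bool}, forall s, good (signed s y)}.
  elim: (enum _) => [|s L [y [[iy yd] gy]]]; first by exists x; rewrite subrr normr0.
  pose V := [set z : X9 | inner z /\ (`|z - x| < d /\ forall s, s \in L -> good (signed s z))].
  have oV : open V.
    have -> : V = ([set z | inner z] `&` [set z | `|z - x| < d]) `&`
        [set z | forall s, s \in L -> inner z /\ good (signed s z)].
      apply/seteqP; split=> [z [iz [zx gz]]|z [[iz zx] gz]].
        by split=> [//|s' sL]; split=> //; exact: gz.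
      by split=> //; split=> // s' sL; have [] := gz s' sL.
    apply: openI; first apply: openI; first exact: inner_open.
      apply: near_open => z /= zx; exists (d - `|z - x|); first by rewrite subr_gt0.
      move=> w wz; rewrite -(subrK z w) -addrA; apply: le_lt_trans (ler_normD _ _) _; lra.
    elim: L {gy V} => [|s' L IH].
      rewrite (_ : [set _ | _] = setT); first exact: openT.
      by apply/seteqP; split=> z // _ s'; rewrite in_nil.
    rewrite (_ : [set _ | _] = [set z | inner z /\ good (signed s' z)] `&`
      [set z | forall s0, s0 \in L -> inner z /\ good (signed s0 z)]).
      by apply: openI; [exact: good_signed_open|exact: IH].
    apply/seteqP; split=> [z h|z [h1 h2] s0].
      by split=> [|s0 s0L]; apply: h; rewrite inE ?eqxx ?s0L ?orbT.
    by rewrite inE => /orP[/eqP ->|/h2].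
  have [||z [iz [zx gz]] gs] := good_dense s oV.
  - by exists y; split.
  - by move=> z [iz _]; exact: inner_Upsilon.
  exists z; split=> // s'; rewrite inE => /orP[/eqP ->//|]; exact: gz.
by exists y; split=> //; split=> // s; apply: gy; rewrite mem_enum.
Qed.

Lemma basin_open : open basin.
Proof.
have -> : basin = [set x | inner x /\ good (signed (true, true) x)] `&`
   [set x | inner x /\ good (signed (true, false) x)] `&`
   ([set x | inner x /\ good (signed (false, true) x)] `&`
   [set x | inner x /\ good (signed (false, false) x)]).
  apply/seteqP; split=> [x [ix gx]|x [[[ix g1] [_ g2]] [[_ g3] [_ g4]]]].
    by do 2!split.
  by split=> // -[[] []].
by do 2!apply: openI; exact: good_signed_open.
Qed.

(** The interior is dense in Upsilon by radial contraction. *)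
Lemma basin_dense : @Upsilon R `<=` closure basin.
Proof.
move=> x [h1 h2] B /nbhs_normP[d d0 hB].
pose e := Num.min 2^-1 (d / (2 * (`|x| + 1))).
have n0 : 0 < `|x| + 1 by rewrite ltr_wpDl.
have e0 : 0 < e by rewrite lt_min invr_gt0 ltr0n divr_gt0// mulr_gt0.
have e2 : e <= 2^-1 by rewrite ge_min lexx.
have ed : e * (2 * (`|x| + 1)) <= d by rewrite -ler_pdivlMr ?mulr_gt0// ge_min lexx orbT.
have ix : inner ((1 - e) *: x).
  have key (v : 'cV[R]_3) : dotv v v <= 1 -> dotv ((1 - e) *: v) ((1 - e) *: v) < 1.
    move=> v1; rewrite dotvZl dotvZr; have := dotv_ge0 v; nra.
  by split; rewrite /vecT /vecQ !linearZ /=; exact: key.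
have d2 : 0 < d / 2 by rewrite divr_gt0.
have [y [by_ yx]] := basin_near ix d2.
exists y; split=> //; apply: hB; rewrite /= distrC -(subrK ((1 - e) *: x) y) -addrA.
apply: le_lt_trans (ler_normD _ _) _.
have -> : (1 - e) *: x - x = - e *: x by rewrite scalerBl scale1r scaleNr addrAC subrr add0r.
by rewrite normrZ normrN gtr0_norm//; lra.
Qed.

End Density.


(** * Equilibria, attraction and instability for the closed loop *)

Section RestPoints.
Variable R : realType.

(** In components: 0 = a s and W q = a q with a = q . W q. If q is nonzero then a > 0,
    hence s = 0. *)
Lemma critical_quatP (W : 'M[R]_3) (P : quat R) : sym_posdef W -> unit_quat P ->
  Bq W *m P = dotv P (Bq W *m P) *: P <-> qvec P = 0 \/ unit_eigenvectors W (qvec P).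
Proof.
move=> [_ W_pos] uP; rewrite Bq_form Bq_mul; split=> [h|[q0|[q1 [l ql]]]].
- have [q0|q0] := eqVneq (qvec P) 0; first by left.
  right; split; last first.
    by exists (dotv (qvec P) (W *m qvec P)); have := congr1 (@qvec R) h; rewrite !qE.
  have /esym/eqP := congr1 (@qscal R) h; rewrite !qE mulf_eq0 gt_eqF ?W_pos//= => /eqP s0.
  by move: uP; rewrite /unit_quat/= s0 expr0n add0r.
- by rewrite q0 mulmx0 dotv0l scale0r /mkquat raddf0 col_mx0.
have s0 : qscal P = 0.
  by apply/eqP; rewrite -sqrf_eq0 -(addrK (dotv (qvec P) (qvec P)) (_ ^+ 2)) uP q1 subrr.
by rewrite ql dotvZr q1 mulr1; apply: quatP; rewrite !qE// s0 mulr0.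
Qed.

Lemma Gr_eq0P (W : 'M[R]_3) (Q : quat R) : unit_quat Q ->
  Gr W Q = 0 <-> Bq W *m Q = dotv Q (Bq W *m Q) *: Q.
Proof.
move=> uQ; split=> [g0|h]; last by rewrite /Gr h -scalemxAr LqTQ scaler0.
have := LqLqT Q (Bq W *m Q); rewrite -/(Gr W Q) g0 mulmx0 (proj1 (unit_quatE Q) uQ) scale1r.
by move=> /esym/eqP; rewrite subr_eq0 => /eqP.
Qed.

Lemma Gg_eq0P (W : 'M[R]_3) (T : quat R) : unit_quat T ->
  Gg W T = 0 <-> Bq W *m T = dotv T (Bq W *m T) *: T.
Proof.
move=> uT; split=> [|h]; first exact: Gg_eq0.
by rewrite /Gg h -scalemxAr NqTQ scaler0.
Qed.

(** Reading the equations from the attitude upwards: no rotation, then no gradient of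
    the error, then no torque. *)
Lemma equilibriumP (J Wg Wr : 'M[R]_3) (s : cl_state R) : sym_posdef J -> admissible s ->
  equilibrium (closed_loop J Wg Wr) s <-> [/\ s.2 = 0, Gg Wg s.1.1 = 0 & Gr Wr s.1.2 = 0].
Proof.
move=> J_spd as_; have [uT uQ] := as_.
have T1 := proj1 (unit_quatE _) uT; have Q1 := proj1 (unit_quatE _) uQ.
have const0 (V : normedModType R) (c d : V) : is_derive (0 : R) (1 : R) (fun=> c) d -> d = 0.
  by move=> h; rewrite -(@derive_val _ _ _ _ _ _ _ h) (@derive_val _ _ _ _ _ _ _ (der_cst (0 : R) c)).
rewrite /equilibrium closed_loopP//; split.
  move=> /(_ 0 (lexx 0))[_ /const0 hT /const0 hQ /const0 hw] /=.
  have w0 : s.2 = 0.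
    have := congr1 (fun x => (Lq s.1.2)^T *m x) hQ; rewrite /vQ mulmx0 -scalemxAr LqLq Q1 scale1r.
    by move=> /eqP; rewrite scaler_eq0 invr_eq0 pnatr_eq0 => /eqP.
  have g0 : Gg Wg s.1.1 = 0.
    have := congr1 (fun x => (Nq s.1.1)^T *m x) hT; rewrite /vT w0 mulmx0 scaler0 sub0r mulmx0 NqNq T1 scale1r.
    by move=> /eqP; rewrite oppr_eq0 => /eqP.
  split=> //; have := mulJ_vw Wg Wr J_spd s.1.1 s.1.2 s.2.
  rewrite hw mulmx0 w0 !mulmx0 oppr0 add0r /zg g0 mulmx0 scaler0 oppr0 add0r /zr.
  by move=> /esym/eqP; rewrite oppr_eq0 scaler_eq0 pnatr_eq0 => /eqP.
move=> [w0 g0 r0] t t0; split=> //.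
- by rewrite /vT w0 g0 mulmx0 scaler0 subr0 mulmx0; exact: der_cst.
- by rewrite /vQ w0 mulmx0 scaler0; exact: der_cst.
by rewrite /vw w0 /zg /zr g0 r0 !mulmx0 !scaler0 oppr0 !addr0 mulmx0; exact: der_cst.
Qed.

(** Both quaternions are critical for their potentials, and independently of each
    other a pole or an eigenvector. *)
Lemma equilibrium_classes (J Wg Wr : 'M[R]_3) (s : cl_state R) :
  sym_posdef J -> sym_posdef Wg -> sym_posdef Wr -> admissible s ->
  equilibrium (closed_loop J Wg Wr) s <->
  [\/ chi s = Omega1 R, Omega2 Wg (chi s), Omega3 Wg Wr (chi s) | Omega4 Wr (chi s)].
Proof.
move=> J_spd Wg_spd Wr_spd as_; have [uT uQ] := as_.
have eT := iff_trans (Gg_eq0P Wg uT) (critical_quatP Wg_spd uT).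
have eQ := iff_trans (Gr_eq0P Wr uQ) (critical_quatP Wr_spd uQ).
rewrite equilibriumP//; split.
  move=> [w0 /eT[t0|tv] /eQ[q0|qv]].
  - by apply: Or41; rewrite /chi w0 t0 q0 !col_mx0.
  - by apply: Or44; exists (qvec s.1.2) => //; rewrite /chi w0 t0.
  - by apply: Or42; exists (qvec s.1.1) => //; rewrite /chi w0 q0.
  - by apply: Or43; exists (qvec s.1.1), (qvec s.1.2); split=> //; rewrite /chi w0.
have split3 (a b c : 'cV[R]_3) : chi s = col_mx (col_mx a b) c ->
    [/\ qvec s.1.1 = a, qvec s.1.2 = b & s.2 = c].
  by rewrite /chi => /eq_col_mx[/eq_col_mx[-> ->] ->].
case=> [h|[v hv h]|[v [u [hv hu h]]]|[v hv h]].
- have [|t0 q0 w0] := split3 0 0 0; first by rewrite h /Omega1 !col_mx0.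
  by split=> //; [apply/eT|apply/eQ]; left.
- have [t0 q0 w0] := split3 _ _ _ (esym h); rewrite -t0 in hv.
  by split=> //; [apply/eT; right|apply/eQ; left].
- have [t0 q0 w0] := split3 _ _ _ h; rewrite -t0 in hv; rewrite -q0 in hu.
  by split=> //; [apply/eT|apply/eQ]; right.
- have [t0 q0 w0] := split3 _ _ _ (esym h); rewrite -q0 in hv.
  by split=> //; [apply/eT; left|apply/eQ; right].
Qed.

End RestPoints.

Section ClosedLoop.
Variables (R : realType) (n : nat) (r : 'I_n -> 'cV[R]_3) (J : 'M[R]_3).
Hypotheses (r_noncollinear : exists i j : 'I_n, ~ collinear (r i) (r j))
  (J_spd : sym_posdef J).
Variables (gamma rho : 'I_n -> R).
Hypotheses (gamma_pos : forall i, 0 < gamma i) (rho_pos : forall i, 0 < rho i).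
Notation Wg := (Wmx r gamma).
Notation Wr := (Wmx r rho).
Notation E := 'cV[R]_(1 + 3 + (1 + 3) + 3).
Notation X9 := 'cV[R]_(3 + 3 + 3).
Notation forward := (forward J Wg Wr).
Notation good := (good r J gamma rho).
Notation CL := (closed_loop J Wg Wr).
Let Wg_spd : sym_posdef Wg := Wmx_posdef r_noncollinear gamma_pos.
Let Wr_spd : sym_posdef Wr := Wmx_posdef r_noncollinear rho_pos.

Definition pack (s : cl_state R) : E := mkx s.1.1 s.1.2 s.2.
Definition unpack (x : E) : cl_state R := (xT x, xQ x, xw x).

Lemma packK s : unpack (pack s) = s.
Proof. by rewrite /unpack /pack !xE; case: s => -[]. Qed.

Lemma chix_pack s : chix (pack s) = chi s.
Proof. by rewrite /chix /pack !xE. Qed.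

Lemma closed_loop_forward s : CL s -> forward (fun t => pack (s t)).
Proof. by move=> /(closed_loopP _ _ J_spd) h t t0; exact/solution_orbit/h. Qed.

Lemma forward_closed_loop x : forward x -> CL (fun t => unpack (x t)).
Proof. by move=> h; apply/(closed_loopP _ _ J_spd) => t t0; exact/orbit_solution/h. Qed.

Lemma admissible_xunit s : admissible s -> xunit (pack s).
Proof. by move=> [h1 h2]; split; rewrite /pack xE. Qed.

(** Every lift of x0 converges; the solutions exist because the flow does. *)
Lemma good_attracted x0 : Upsilon x0 ->
  (forall s0, admissible s0 -> chi s0 = x0 -> good (pack s0)) ->
  attraction_domain CL (Omega1 R) x0.
Proof.
move=> ux0 gx0; split=> // s0 as0 cs0; split.
  have [x x0E fx] := forward_exists J_spd Wg_spd Wr_spd (admissible_xunit as0).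
  by exists (fun t => unpack (x t)); [exact: forward_closed_loop|rewrite x0E packK].
move=> s /closed_loop_forward fs s0E; apply: tends_cvg.
have h : tends (fun t => dotv (chix (pack (s t))) (chix (pack (s t)))) 0.
  by apply: gx0 as0 cs0 _ fs _; rewrite s0E.
apply/tends_sqr0; apply: tends_le h _ => t t0; rewrite ger0_norm ?sqr_ge0//.
rewrite /Omega1 subr0 chix_pack -enorm_sqr ler_sqr ?nnegrE ?enorm_ge0//.
exact: mxnorm_le_enorm.
Qed.

Lemma chi_small (d : R) : 0 < d -> exists2 e : R, 0 < e & forall x : X9, `|x| < e -> dotv x x < d.
Proof.
move=> d0; have p : 0 < d / (3 + 3 + 3)%:R by rewrite divr_gt0.
exists (Num.sqrt (d / (3 + 3 + 3)%:R)); first by rewrite sqrtr_gt0.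
move=> x hx; apply: le_lt_trans (enorm_le_mxnorm x) _.
rewrite mulrC -ltr_pdivlMr// -[ltRHS]sqr_sqrtr ?(ltW p)//.
by rewrite ltr_sqr ?nnegrE ?sqrtr_ge0.
Qed.

Lemma origin_stable : lyapunov_stable CL (Omega1 R).
Proof.
move=> e e0; have e2 : 0 < e ^+ 2 by rewrite exprn_gt0.
have [d d0 hd] := chix_stable r_noncollinear J_spd gamma_pos rho_pos e2.
have [d' d'0 hd'] := chi_small d0; exists d' => // s /closed_loop_forward fs.
rewrite /Omega1 subr0 => /hd'; rewrite -chix_pack => h t t0.
rewrite subr0 -chix_pack; apply: le_lt_trans (mxnorm_le_enorm _) _.
by rewrite -ltr_sqr ?nnegrE ?enorm_ge0 ?(ltW e0)// enorm_sqr; exact: hd fs h t t0.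
Qed.

Lemma origin_asymptotically_stable : asymptotically_stable CL (Omega1 R).
Proof.
split; first exact: origin_stable.
have [d d0 hd] := chix_near0_good r_noncollinear J_spd gamma_pos rho_pos.
have [d' d'0 hd'] := chi_small d0; exists d' => // x0 ux0; rewrite /Omega1 subr0 => /hd' h.
apply: good_attracted => // s0 as0 cs0; apply: hd; first exact: admissible_xunit.
by rewrite chix_pack cs0.
Qed.

(** The quadratic form of P is the energy. *)
Lemma sublevel_attracted (c : R) : c < 2 * Num.min (lambda_min Wg) (lambda_min Wr) ->
  Phi1 J Wg Wr c `<=` attraction_domain CL (Omega1 R).
Proof.
move=> hc x0 [ux0 px0]; apply: good_attracted => // s0 as0 cs0.
apply: low_energy_good => //; first exact: admissible_xunit.
by rewrite energy_chix chix_pack cs0; exact: le_lt_trans hc.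
Qed.

Lemma signed_pack s0 : admissible s0 -> exists s, pack s0 = signed s (chi s0).
Proof.
move=> [uT uQ].
have sgn (P : quat R) : unit_quat P -> exists s : bool,
    P = mkquat ((-1) ^+ s * Num.sqrt (1 - dotv (qvec P) (qvec P))) (qvec P).
  move=> uP; exists (qscal P < 0); apply: quatP; rewrite !qE//; apply: scalar_from_sign.
  - by rewrite subr_ge0; exact: qvec_le1.
  - by move: uP => /= <-; rewrite addrK.
  by case: ltP => h; rewrite ?expr1 ?mulN1r ?expr0 ?mul1r// oppr_ge0 ltW.
have [s1 h1] := sgn _ uT; have [s2 h2] := sgn _ uQ; exists (s1, s2).
by rewrite /signed /pack /vecT /vecQ /chi !col_mxKu !col_mxKd -h1 -h2.
Qed.

Lemma basin_attracted : basin r J gamma rho `<=` attraction_domain CL (Omega1 R).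
Proof.
move=> x [ix gx]; apply: good_attracted; first exact: inner_Upsilon.
by move=> s0 as0 cs0; have [s ->] := signed_pack as0; rewrite cs0.
Qed.

Lemma origin_almost_global : almost_globally_asymptotically_stable CL (Omega1 R).
Proof.
split; first exact: origin_stable.
exists (basin r J gamma rho); last exact: basin_attracted.
split; last by move=> x; exact: basin_dense.
exists (basin r J gamma rho); first exact: basin_open.
by apply/seteqP; split=> [x bx|x []//]; split=> //; have [/inner_Upsilon] := bx.
Qed.

(** Arbitrarily close to xe there are points of the basin, and their motions end far
    away from xe. *)
Lemma other_unstable xe : Upsilon xe -> xe != 0 -> lyapunov_unstable CL xe.
Proof.
move=> uxe xe0 st; have e0 : 0 < `|xe| / 2 by rewrite divr_gt0// normr_gt0.
have [d d0 hd] := st _ e0.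
have [x [bx /= hx]] := basin_dense r_noncollinear J_spd gamma_pos rho_pos uxe
  (nbhsx_ballx xe d d0).
have [ux ax] := basin_attracted bx.
have as0 : admissible (unpack (signed (false, false) x)).
  exact: signed_unit.
have cs0 : chi (unpack (signed (false, false) x)) = x.
  by rewrite -chix_pack /pack mkx_eta chix_signed.
have [[s cs s0] /(_ s)] := ax _ as0 cs0; move=> /(_ cs s0) /cvgrPdist_lt /(_ _ e0)[M [_ hM]].
pose t := Num.max M 0 + 1.
have t0 : 0 <= t by rewrite addr_ge0// le_max lexx orbT.
have Mt : M < t by rewrite ltr_pwDr// le_max lexx.
have := hM t Mt; rewrite /Omega1 sub0r normrN => h1.
have h2 : `|chi (s t) - xe| < `|xe| / 2.
  apply: hd => //; rewrite s0 cs0 distrC.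
  by move: hx; rewrite -ball_normE.
have := ler_normB (chi (s t)) (chi (s t) - xe).
rewrite opprB addrC subrK; lra.
Qed.

Lemma unit_eigenvectors_ne0 (W : 'M[R]_3) v : unit_eigenvectors W v -> v != 0.
Proof. by move=> [v1 _]; rewrite -dotv_gt0 v1. Qed.

Lemma Omega_unstable x : Omega2 Wg x \/ Omega3 Wg Wr x \/ Omega4 Wr x -> lyapunov_unstable CL x.
Proof.
have ups (a b : 'cV[R]_3) : dotv a a <= 1 -> dotv b b <= 1 -> Upsilon (col_mx (col_mx a b) 0).
  by rewrite /Upsilon/= /unit_ball3/= !col_mxKu col_mxKd.
have ne (a b : 'cV[R]_3) : a != 0 \/ b != 0 -> col_mx (col_mx a b) (0 : 'cV[R]_3) != 0.
  by rewrite !col_mx_eq0 !negb_and => -[->|->]; rewrite ?orbT.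
have one (W : 'M[R]_3) v : unit_eigenvectors W v -> dotv v v <= 1 by move=> [->].
have zero : dotv (0 : 'cV[R]_3) 0 <= 1 by rewrite dotv0l.
move=> [[v hv <-]|[[v [u [hv hu ->]]]|[v hv <-]]]; apply: other_unstable.
- by apply: ups; [exact: one hv|].
- by apply: ne; left; exact: unit_eigenvectors_ne0 hv.
- by apply: ups; [exact: one hv|exact: one hu].
- by apply: ne; left; exact: unit_eigenvectors_ne0 hv.
- by apply: ups; [|exact: one hv].
- by apply: ne; right; exact: unit_eigenvectors_ne0 hv.
Qed.

End ClosedLoop.


Theorem theorem1 (R : realType) (n : nat) (r : 'I_n -> 'cV[R]_3) (J : 'M[R]_3)
    (n_ge2 : (2 <= n)%N)
    (r_noncollinear : exists i j : 'I_n, ~ collinear (r i) (r j))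
    (J_spd : sym_posdef J) :
  (forall gamma rho : 'I_n -> R,
    (forall i, 0 < gamma i) -> (forall i, 0 < rho i) ->
    let Wg := Wmx r gamma in
    let Wr := Wmx r rho in
    let CL := closed_loop J Wg Wr in
    [/\ (* the controlled system results in the closed-loop system *)
        (forall (Q Qhat : R -> quat R) (omega : R -> 'cV[R]_3),
           attitude_system r J gamma rho Q Qhat omega ->
           CL (fun t => (qmul (Q t) (qinv (Qhat t)), Q t, omega t))) /\
        (forall s : R -> cl_state R, CL s ->
           attitude_system r J gamma rho (fun t => (s t).1.2)
             (fun t => qmul (qinv (s t).1.1) (s t).1.2) (fun t => (s t).2)),
        (* 1) *)
        (forall s : cl_state R, admissible s ->
           (equilibrium CL s <->
            [\/ chi s = Omega1 R, Omega2 Wg (chi s),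
                Omega3 Wg Wr (chi s) | Omega4 Wr (chi s)])) &
        (* 2) *)
        asymptotically_stable CL (Omega1 R) /\
        (forall c : R, c < 2%:R * Num.min (lambda_min Wg) (lambda_min Wr) ->
           Phi1 J Wg Wr c `<=` attraction_domain CL (Omega1 R))]) /\
  (* 3) *)
  (exists krho kgamma : R, [/\ 0 < krho, 0 < kgamma &
    forall gamma rho : 'I_n -> R,
      (forall i, 0 < gamma i) -> (forall i, 0 < rho i) ->
      let Wg := Wmx r gamma in
      let Wr := Wmx r rho in
      let CL := closed_loop J Wg Wr in
      krho < lambda_min Wr -> kgamma < lambda_min Wg ->
      (forall x, Omega2 Wg x \/ Omega3 Wg Wr x \/ Omega4 Wr x ->
         lyapunov_unstable CL x) /\
      almost_globally_asymptotically_stable CL (Omega1 R)]).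
Proof.
split=> [gamma rho g0 r0 Wg Wr CL|].
  have Wg_spd : sym_posdef Wg := Wmx_posdef r_noncollinear g0.
  have Wr_spd : sym_posdef Wr := Wmx_posdef r_noncollinear r0.
  split; first split.
  - exact: attitude_to_closed_loop.
  - exact: closed_loop_to_attitude.
  - by move=> s; exact: equilibrium_classes.
  split; first exact: origin_asymptotically_stable.
  exact: sublevel_attracted.
exists 1, 1; split=> // gamma rho g0 r0 Wg Wr CL _ _.
split; first exact: Omega_unstable.
exact: origin_almost_global.
Qed.
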